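(* Fix $\lambda\in(0,e/2)$, $\eta>0$, $m>1$. Let $\Psi:\mathbb{R}^d\to[0,\infty)$ be in $C^2(\mathbb{R}^d)$ with $(\Delta\Psi)^+\in L^\infty(\mathbb{R}^d)$, and assume: there is $K>0$ with $|\nabla\Psi(y)|\le K(1+|y|)$ for all $y\in\mathbb{R}^d$; and there is $R>0$ with $\Psi(ky)\ge\Psi(y)$ for all $k\ge1$ and $|y|\ge R$. For any $\rho_0\in\mathcal{D}_2(\mathbb{R}^d)$ with $J_{\lambda,\eta}(\rho_0)<\infty$, let $\rho:[0,\infty)\to\mathcal{D}_2(\mathbb{R}^d)$ be a minimizing-movement solution (as defined in the context) of the Fokker-Planck equation $$\partial_tu-\operatorname{div}\big(u\nabla\Psi+\nabla(\lambda u+\eta u^m)\big)=0,\qquad u(0,\cdot)=\rho_0.$$ Then $\rho(t)\in L^m(\mathbb{R}^d)$ for all $t\ge0$. Moreover, $$\|\rho(t)\|_{L^m(\mathbb{R}^d)}\le e^{\frac{m-1}{m}At}\|\rho_0\|_{L^m(\mathbb{R}^d)}\quad\forall t\ge0,\qquad A:=\|(\Delta\Psi)^+\|_{L^\infty(\mathbb{R}^d)}.$$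
   Context: Notation. $\mathcal{L}^d$ is Lebesgue measure on $\mathbb{R}^d$. $\mathcal{D}(\mathbb{R}^d)$ is the set of probability density functions on $\mathbb{R}^d$, and $\mathcal{D}_2(\mathbb{R}^d)$ the subset with $\int|y|^2\rho(y)dy<\infty$. $\mathcal{P}(\mathbb{R}^d)$ is the set of Borel probability measures; $\mathcal{P}_2(\mathbb{R}^d)$ is the subset with finite second moment, equipped with the Wasserstein-2 metric $\mathcal{W}_2$. $\rho\mathcal{L}^d$ is the measure with density $\rho$. $H(s)=\lambda s\ln s$ for $s>0$, $H(0)=0$; $F(s)=H(s)+\frac{\eta}{m-1}s^m$; $L_F(s):=sF'(s)-F(s)=\lambda s+\eta s^m$. For $\rho\in\mathcal{D}_2(\mathbb{R}^d)$, $J_{\lambda,\eta}(\rho)=\int\Psi\rho\,dy+\int H^+(\rho)\,dy-\int H^-(\rho)\,dy+\int\frac{\eta}{m-1}\rho^m\,dy\in(-\infty,\infty]$ ($H^-(\rho)$ is integrable). For $\mu\in\mathcal{P}_2(\mathbb{R}^d)$, $\mathcal{J}_{\lambda,\eta}(\mu)=J_{\lambda,\eta}(\rho)$ if $\mu=\rho\mathcal{L}^d$, and $=\infty$ otherwise. Solution of the Fokker-Planck equation. $\rho:[0,\infty)\to\mathcal{D}(\mathbb{R}^d)$ is a solution if: (i) $t\mapsto\rho(t)$ is continuous on $[0,\infty)$ under the weak-$*$ topology in $L^1(\mathbb{R}^d)$ (i.e. $t\mapsto\rho(t)\mathcal{L}^d$ is weakly continuous in $\mathcal{P}(\mathbb{R}^d)$),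 with $\rho(0)=\rho_0$; (ii) $L_F(\rho(t))\in W^{1,1}_{\mathrm{loc}}(\mathbb{R}^d)$ for all $t>0$; (iii) for all $\varphi\in C_c^\infty((0,\infty)\times\mathbb{R}^d)$, $\int_0^\infty\int\{\rho\,\partial_t\varphi-(\rho\nabla\Psi+\nabla(\lambda\rho+\eta\rho^m))\cdot\nabla\varphi\}\,dy\,dt=0$. Minimizing-movement solution. For $\tau>0$ set $M_\tau^0=\rho_0\mathcal{L}^d$ and choose recursively $M_\tau^n\in\operatorname{argmin}\{\frac1{2\tau}\mathcal{W}_2^2(\nu,M_\tau^{n-1})+\mathcal{J}_{\lambda,\eta}(\nu):\nu\in\mathcal{P}_2(\mathbb{R}^d)\}$, $n\in\mathbb{N}$. Let $\overline M_\tau(0)=\rho_0\mathcal{L}^d$ and $\overline M_\tau(t)=M_\tau^n$ for $t\in((n-1)\tau,n\tau]$. A minimizing-movement solution is a solution $\rho:[0,\infty)\to\mathcal{D}_2(\mathbb{R}^d)$ of the Fokker-Planck equation such that: for some $\tau_k\downarrow0$, $\overline M_{\tau_k}(t)\to\rho(t)\mathcal{L}^d$ weakly in $\mathcal{P}(\mathbb{R}^d)$ for all $t\ge0$; $t\mapsto\rho(t)\mathcal{L}^d$ is locally absolutely continuous of order 2 in $\mathcal{P}_2(\mathbb{R}^d)$ (there is $g\in L^2_{\mathrm{loc}}([0,\infty))$ with $\mathcal{W}_2(\rho(t)\mathcal{L}^d,\rho(s)\mathcal{L}^d)\le\int_s^tg(z)\,dz$ for $0\le s\le t$); and $v_\rho:=-(\nabla\Psi+\lambda\nabla\rho/\rho+\eta\nabla\rho^m/\rho)$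 satisfies $\int_0^T\int|v_\rho|^2\rho\,dy\,dt<\infty$ for all $T>0$. Such a $\rho$ exists for every $\rho_0\in\mathcal{D}_2(\mathbb{R}^d)$ with $J_{\lambda,\eta}(\rho_0)<\infty$. *)

(* Defs.v *)
From HB Require Import structures.
From mathcomp Require Import all_boot all_order all_algebra.
From mathcomp Require Import all_classical all_reals all_analysis.
From mathcomp Require Import measurable_realfun giry.
Set Implicit Arguments.
Unset Strict Implicit.
Unset Printing Implicit Defensive.
Import Order.TTheory GRing.Theory Num.Theory.
Import numFieldNormedType.Exports.
Local Open Scope classical_set_scope.
Local Open Scope ring_scope.

(** The Borel sigma-algebra of R^d. *)
HB.instance Definition _ (R : realType) (d : nat) :=
  @isMeasurable.Build default_measure_display 'rV[R]_d <<s @open 'rV[R]_d >>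
    (@sigma_algebra0 _ setT _) (@sigma_algebraC _ _)
    (@sigma_algebra_bigcup _ setT _).

Section borel_rV.
Context {R : realType} {d : nat}.

Lemma open_measurable_rV (U : set 'rV[R]_d) : open U -> measurable U.
Proof. exact: sub_sigma_algebra. Qed.

Lemma measurable_coord (i : 'I_d) :
  measurable_fun [set: 'rV[R]_d] (fun x => x 0 i).
Proof.
apply: (measurability _ (RGenOpens.measurableE R)).
move=> _ [_ [a [b ->] <-]]; rewrite setTI; apply: open_measurable_rV.
apply: open_comp; last exact: interval_open.
by move=> x _; exact: coord_continuous.
Qed.

Lemma measurable_fun_rV d0 (T : measurableType d0) (f : T -> 'rV[R]_d) :
  (forall i, measurable_fun [set: T] (fun t => f t 0 i)) ->
  measurable_fun [set: T] f.
Proof.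
move=> mf; apply: (@measurability _ _ _ _ _ _ (@open 'rV[R]_d)) => //.
move=> _ [U oU <-]; rewrite setTI.
pose c (p : 'rV[rat]_d * rat) : 'rV[R]_d := \row_j ratr (p.1 0 j).
pose F p := if `[< 0 < ratr p.2 :> R /\ ball (c p) (ratr p.2 : R) `<=` U >]
            then f @^-1` ball (c p) (ratr p.2 : R) else set0.
have -> : f @^-1` U = \bigcup_p F p.
  apply/seteqP; split => [t Ut|t [p _]]; last first.
    by rewrite /F; case: asboolP => // -[_ sub]; exact: sub.
  move: oU; rewrite openE => /(_ _ Ut) /nbhs_ballP[e /= e0 eU].
  have e20 : 0 < e / 2 by rewrite divr_gt0.
  have [r /[!in_itv]/= /andP[r0 re]] := rat_in_itvoo e20.
  have /choice[q qE] : forall j, exists q : rat,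
      ratr q \in `]f t 0 j - ratr r, f t 0 j + ratr r[.
    by move=> j; apply: rat_in_itvoo; rewrite ltrD2l gt0_cp.
  have ct : ball (c (\row_j q j, r)) (ratr r : R) (f t).
    split=> // i j; rewrite ord1 /ball/= /c !mxE/= distrC.
    by have /[!in_itv]/= := qE j; rewrite ltr_distl ltrBlDr => /andP[? ?]; rewrite ltrBlDr; apply/andP.
  exists (\row_j q j, r) => //; rewrite /F asboolT//; split => // z zr.
  apply: eU; rewrite [e]splitr.
  apply: (@ball_triangle _ _ (c (\row_j q j, r))); last exact: le_ball (ltW re) _ zr.
  by apply/ball_sym/(le_ball (ltW re)).
apply: countable_bigcupT_measurable => // p.
rewrite /F; case: asboolP => // -[r0 _].
have -> : f @^-1` ball (c p) (ratr p.2 : R) =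
    \bigcap_(i in [set: 'I_d]) ((fun t => f t 0 i) @^-1` ball (c p 0 i) (ratr p.2 : R)).
  apply/seteqP; split => [t [_ tp] i _|t tp]; first exact: tp.
  by split => // i j; rewrite ord1; exact: tp.
apply: fin_bigcap_measurable => // i _.
rewrite -[X in measurable X]setTI; apply: mf => //.
apply: open_measurable; exact: ball_open.
Qed.

End borel_rV.

Section lebesgue_rV.
Context {R : realType}.
Local Open Scope ereal_scope.

Section cons.
Variable d : nat.

Definition rVcons (p : R * 'rV[R]_d) : 'rV[R]_d.+1 :=
  \row_i (if unlift ord0 i is Some j then p.2 0%R j else p.1).

Definition rVuncons (x : 'rV[R]_d.+1) : R * 'rV[R]_d :=
  (x 0%R ord0, \row_j x 0%R (lift ord0 j)).

Lemma rVconsK : cancel rVcons rVuncons.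
Proof.
case=> a x; rewrite /rVuncons /rVcons; congr (_, _); first by rewrite mxE unlift_none.
by apply/rowP => j; rewrite !mxE liftK.
Qed.

Lemma measurable_rVcons : measurable_fun setT rVcons.
Proof.
apply: measurable_fun_rV => i; rewrite /rVcons.
case: (unliftP ord0 i) => [j|] ->.
  under eq_fun do rewrite mxE liftK.
  exact: (measurableT_comp (measurable_coord j) measurable_snd).
by under eq_fun do rewrite mxE unlift_none; exact: measurable_fst.
Qed.

Lemma measurable_rVuncons : measurable_fun setT rVuncons.
Proof.
apply/measurable_fun_pairP; split; first exact: measurable_coord.
apply: measurable_fun_rV => i /=.
by under eq_fun do rewrite mxE; exact: measurable_coord.
Qed.

End cons.

Section step.
Variable d : nat.
Variable mu : {sigma_finite_measure set 'rV[R]_d -> \bar R}.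

Definition lebesgue_rV_step : set 'rV[R]_d.+1 -> \bar R :=
  pushforward (lebesgue_measure \x mu) (@rVcons d).

Let step0 : lebesgue_rV_step set0 = 0.
Proof. by rewrite /lebesgue_rV_step /pushforward preimage_set0 measure0. Qed.

Let step_ge0 A : 0 <= lebesgue_rV_step A.
Proof. exact: (measure_ge0 (lebesgue_measure \x mu)). Qed.

Let step_sigma_additive : semi_sigma_additive lebesgue_rV_step.
Proof.
have mcons := @measurable_rVcons d.
exact: (@measure_semi_sigma_additive _ _ _
  (pushforward (lebesgue_measure \x mu) (@rVcons d) : {measure set _ -> \bar R})).
Qed.

HB.instance Definition _ := isMeasure.Build _ _ _ lebesgue_rV_step
  step0 step_ge0 step_sigma_additive.

Let step_sigma_finite : sigma_finite setT lebesgue_rV_step.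
Proof.
have /sigma_finiteP[F [TF ndF Foo]] := sigma_finiteT (@lebesgue_measure R).
have /sigma_finiteP[G [TG ndG Goo]] := sigma_finiteT mu.
exists (fun n => @rVuncons d @^-1` (F n `*` G n)).
  rewrite -preimage_bigcup -(preimage_setT (@rVuncons d)); congr preimage.
  apply/esym; rewrite -subTset => -[x y] _.
  have [n _ Fnx] : (\bigcup_i F i) x by rewrite -TF.
  have [k _ Gky] : (\bigcup_i G i) y by rewrite -TG.
  exists (maxn n k) => //; split => /=.
  - by move: x Fnx; exact/subsetPset/ndF/leq_maxl.
  - by move: y Gky; exact/subsetPset/ndG/leq_maxr.
move=> n; have [? ?] := Foo n; have [? ?] := Goo n.
have mFG : measurable (F n `*` G n) by exact: measurableX.
split; first by rewrite -[X in measurable X]setTI; exact: measurable_rVuncons.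
rewrite /lebesgue_rV_step /pushforward -comp_preimage.
rewrite (_ : _ \o _ = id); last by apply/funext => p; exact: rVconsK.
by rewrite preimage_id product_measure1E// lte_mul_pinfty// ge0_fin_numE.
Qed.

HB.instance Definition _ := Measure_isSigmaFinite.Build _ _ _ lebesgue_rV_step
  step_sigma_finite.

End step.

(** Lebesgue measure on R^d, through R^(d+1) = R * R^d; see [lebesgue_rV_box]. *)
Fixpoint lebesgue_rV (d : nat) : {sigma_finite_measure set 'rV[R]_d -> \bar R} :=
  match d with
  | 0 => @dirac _ 'rV[R]_0 0%R R
  | d'.+1 => lebesgue_rV_step (lebesgue_rV d')
  end.

Lemma lebesgue_rV_box (d : nat) (A : 'I_d -> set R) :
  (forall i, measurable (A i)) ->
  lebesgue_rV d [set x | forall i, A i (x 0%R i)] =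
  \prod_(i < d) lebesgue_measure (A i).
Proof.
elim: d A => [|d ih] A mA.
  by rewrite big_ord0 /= diracE mem_set// => -[].
rewrite big_ord_recl -ih// /lebesgue_rV_step /pushforward /=.
rewrite /lebesgue_rV_step /pushforward -product_measure1E//.
  congr (_ _); apply/seteqP; split => [p Ap|[a x] [/= Aa Ax] i].
  - split => [|j].
    + by have := Ap ord0; rewrite mxE unlift_none.
    + by have := Ap (lift ord0 j); rewrite mxE liftK.
  - by rewrite mxE; case: (unliftP ord0 i) => [j|] ->.
  exact: mA.
rewrite (_ : (fun _ => _) = \bigcap_(i in [set: 'I_d])
  ((fun x : 'rV[R]_d => x 0%R i) @^-1` A (lift ord0 i))); last first.
  by apply/seteqP; split => x Ax i *; exact: Ax.
apply: fin_bigcap_measurable => // i _.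
by rewrite -[X in measurable X]setTI; exact: measurable_coord.
Qed.

End lebesgue_rV.

Section calculus.
Context {R : realType}.

(** [`|x|] on ['rV[R]_d] is the maximum norm; [dot] and [enorm] are the Euclidean
    scalar product and norm. *)
Definition dot {d : nat} (x y : 'rV[R]_d) : R := \sum_i x 0 i * y 0 i.
Definition enorm {d : nat} (x : 'rV[R]_d) : R := Num.sqrt (dot x x).

Definition partial {d : nat} (i : 'I_d) (f : 'rV[R]_d -> R) : 'rV[R]_d -> R :=
  'D_(delta_mx 0 i) f.
Definition grad {d : nat} (f : 'rV[R]_d -> R) (x : 'rV[R]_d) : 'rV[R]_d :=
  \row_i partial i f x.
Definition laplacian {d : nat} (f : 'rV[R]_d -> R) (x : 'rV[R]_d) : R :=
  \sum_i partial i (partial i f) x.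

(** The class C^k: all directional derivatives of order at most [k] exist and are
    continuous. *)
Fixpoint is_Ck {V : normedModType R} (k : nat) (f : V -> R) : Prop :=
  continuous f /\
  if k is k'.+1
  then forall v, (forall x, derivable f x v) /\ is_Ck k' ('D_v f)
  else True.

(** C_c^oo(U) for an open set [U]; its elements are extended by zero to [V]. *)
Definition test_function {V : normedModType R} (U : set V) (phi : V -> R) : Prop :=
  (forall k, is_Ck k phi) /\
  exists K, [/\ compact K, K `<=` U & forall x, ~ K x -> phi x = 0].

Section weak_gradient.
Variable d : nat.
Implicit Types (f : 'rV[R]_d -> R) (G : 'rV[R]_d -> 'rV[R]_d).

Definition L1loc f : Prop := measurable_fun setT f /\
  forall K, compact K -> (lebesgue_rV d).-integrable K (EFin \o f).

Definition is_weak_grad f G : Prop :=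
  [/\ L1loc f, forall i, L1loc (fun y => G y 0 i) &
    forall phi, test_function setT phi -> forall i,
      \int[lebesgue_rV d]_y (f y * partial i phi y) =
      - \int[lebesgue_rV d]_y (G y 0 i * phi y)].

Definition W11loc f : Prop := exists G, is_weak_grad f G.

(** A representative of the weak gradient; [0] if [f] is not in W^{1,1}_loc. *)
Definition weak_grad f : 'rV[R]_d -> 'rV[R]_d := xget (fun=> 0) (is_weak_grad f).

End weak_gradient.
End calculus.

Section densities.
Context {R : realType}.
Local Open Scope ereal_scope.

(** Representatives of the elements of D(R^d). *)
Record density (d : nat) := Density {
  density_fun :> 'rV[R]_d -> R ;
  measurable_density : measurable_fun setT density_fun ;
  density_ge0 : forall y, (0 <= density_fun y)%R ;
  integral_density : \int[lebesgue_rV d]_y (density_fun y)%:E = 1 }.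

Definition D2 {d : nat} (rho : density d) : Prop :=
  \int[lebesgue_rV d]_y (enorm y ^+ 2 * rho y)%:E < +oo.

Definition density_measure {d : nat} (rho : density d) (A : set 'rV[R]_d) :=
  \int[lebesgue_rV d]_(y in A) (rho y)%:E.

Section density_measure_probability.
Variables (d : nat) (rho : density d).

Let density_measure0 : density_measure rho set0 = 0.
Proof. exact: integral_set0. Qed.

Let density_measure_ge0 A : 0 <= density_measure rho A.
Proof. by apply: integral_ge0 => y _; rewrite lee_fin density_ge0. Qed.

Let density_measure_sigma_additive : semi_sigma_additive (density_measure rho).
Proof.
apply: semi_sigma_additive_nng_induced => [|y].
  by apply/measurable_EFinP; exact: measurable_density.
by rewrite lee_fin density_ge0.
Qed.

HB.instance Definition _ := isMeasure.Build _ _ _ (density_measure rho)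
  density_measure0 density_measure_ge0 density_measure_sigma_additive.

HB.instance Definition _ := Measure_isProbability.Build _ _ _
  (density_measure rho) (integral_density rho).

End density_measure_probability.

Section spaces_of_probabilities.
Variable d : nat.
Implicit Types mu nu : probability 'rV[R]_d R.

Definition P2 mu : Prop := \int[mu]_y (enorm y ^+ 2)%:E < +oo.

Definition coupling mu nu (g : probability ('rV[R]_d * 'rV[R]_d)%type R) : Prop :=
  forall A, measurable A -> g (A `*` setT) = mu A /\ g (setT `*` A) = nu A.

Definition W2 mu nu : \bar R :=
  (ereal_inf [set \int[g]_p (enorm (p.1 - p.2) ^+ 2)%:E | g in coupling mu nu])
    `^ 2^-1.

(** Weak convergence of [M s] to [mu] along the filter [F]. *)
Definition weak_cvg {S : Type} (F : set_system S)
    (M : S -> probability 'rV[R]_d R) mu : Prop :=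
  forall f : 'rV[R]_d -> R, continuous f ->
    (exists C : R, forall y, `|f y| <= C)%R ->
    (\int[M s]_y f y)%R @[s --> F] --> (\int[mu]_y f y)%R.

End spaces_of_probabilities.
End densities.

Section fokker_planck.
Context {R : realType} {d : nat}.
Variables (lam eta m : R) (Psi : 'rV[R]_d -> R).
Local Open Scope ereal_scope.

(** [ln 0 = 0], so that [H 0 = 0]. *)
Definition H (s : R) : R := (lam * s * ln s)%R.

(** L_F(s) = s F'(s) - F(s) for F(s) = H(s) + eta / (m - 1) s^m. *)
Definition LF (s : R) : R := (lam * s + eta * s `^ m)%R.

Definition energy (rho : density d) : \bar R :=
  \int[lebesgue_rV d]_y (Psi y * rho y)%:E
  + \int[lebesgue_rV d]_y ((H \o rho)^\+%R y)%:E
  - \int[lebesgue_rV d]_y ((H \o rho)^\-%R y)%:E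
  + \int[lebesgue_rV d]_y (eta / (m - 1) * rho y `^ m)%:E.

(** [energy rho] only depends on the a.e. class of [rho], hence not on the chosen
    density. *)
Definition energy_measure (mu : probability 'rV[R]_d R) : \bar R :=
  if pselect (exists rho : density d, mu ≡μ density_measure rho) is left ex
  then energy (projT1 (cid ex)) else +oo.

Definition FP_solution (rho0 : density d) (rho : R -> density d) : Prop :=
  [/\ forall t : R, (0 <= t)%R ->
        weak_cvg (within `[0%R, +oo[ (nbhs t))
          (fun s => density_measure (rho s)) (density_measure (rho t)),
      rho 0%R = rho0 %[ae lebesgue_rV d],
      forall t : R, (0 < t)%R -> W11loc (LF \o rho t) &
      forall phi : R * 'rV[R]_d -> R, test_function [set p : R * 'rV[R]_d | (0 < p.1)%R] phi ->
        \int[lebesgue_measure]_(t in `]0%R, +oo[) \int[lebesgue_rV d]_y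
          (rho t y * (fun s => phi (s, y))^`()%classic t
           - dot (rho t y *: grad Psi y + weak_grad (LF \o rho t) y)
                 (grad (fun z => phi (t, z)) y))%:E = 0].

(** [M n] is the n-th iterate of the minimizing-movement scheme of step [tau]. *)
Definition MM_scheme (rho0 : density d) (tau : R)
    (M : nat -> probability 'rV[R]_d R) : Prop :=
  M 0%N ≡μ density_measure rho0 /\
  forall n,
    let cost nu := ((2 * tau)^-1)%:E * W2 nu (M n) ^+ 2 + energy_measure nu in
    P2 (M n.+1) /\ forall nu, P2 nu -> cost (M n.+1) <= cost nu.

(** For [t >= 0], the index [Num.ceil (t / tau)] is the [n] such that
    (n - 1) tau < t <= n tau. *)
Definition MM_interpolation (tau : R) (M : nat -> probability 'rV[R]_d R) (t : R) :=
  M `|Num.ceil (t / tau)|%N.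

Definition locally_AC2 (mu : R -> probability 'rV[R]_d R) : Prop :=
  exists g : R -> R, [/\ measurable_fun (`[0%R, +oo[ : set R) g,
    forall T : R, (0 < T)%R -> \int[lebesgue_measure]_(z in `[0%R, T]) (g z ^+ 2)%:E < +oo &
    forall s t : R, (0 <= s <= t)%R ->
      W2 (mu t) (mu s) <= \int[lebesgue_measure]_(z in `[s, t]) (g z)%:E].

Definition velocity (rho : 'rV[R]_d -> R) (y : 'rV[R]_d) : 'rV[R]_d :=
  (- (grad Psi y + (lam / rho y) *: weak_grad rho y
      + (eta / rho y) *: weak_grad (fun z => rho z `^ m) y))%R.

Definition MM_solution (rho0 : density d) (rho : R -> density d) : Prop :=
  [/\ FP_solution rho0 rho,
      forall t : R, (0 <= t)%R -> D2 (rho t),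
      exists M : R -> nat -> probability 'rV[R]_d R,
        (forall tau : R, (0 < tau)%R -> MM_scheme rho0 tau (M tau)) /\
        exists tau : nat -> R,
          [/\ forall k, (0 < tau k)%R,
              {homo tau : i j / (i <= j)%N >-> (j <= i)%R},
              tau k @[k --> \oo] --> 0%R &
              forall t : R, (0 <= t)%R ->
                weak_cvg \oo (fun k => MM_interpolation (tau k) (M (tau k)) t)
                  (density_measure (rho t))],
      locally_AC2 (fun t => density_measure (rho t)) &
      forall T : R, (0 < T)%R ->
        \int[lebesgue_measure]_(t in `]0%R, T]) \int[lebesgue_rV d]_y
          (enorm (velocity (rho t) y) ^+ 2 * rho t y)%:E < +oo].

End fokker_planck.

(* Main.v *)
Require Import Defs.
From mathcomp Require Import all_boot all_order all_algebra.
From mathcomp Require Import all_classical all_reals all_analysis.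
From mathcomp Require Import measurable_realfun ring lra.
Set Implicit Arguments.
Unset Strict Implicit.
Unset Printing Implicit Defensive.
Import Order.TTheory GRing.Theory Num.Theory.
Import numFieldNormedType.Exports.
Local Open Scope classical_set_scope.
Local Open Scope ring_scope.

(** An energy estimate for the continuity equation [d/dt rho + div (rho v) = 0] with finite
    dissipation [int int |v|^2 rho]. Inverting the increasing function [LF] shows that
    [rho] inherits a weak gradient [W] from [LF rho], and that
    [rho v = - (rho grad Psi + LF' (rho) W)].
    Let [G] be convex with bounded [G'] and bounded [s G'' s], and mollify [rho] in space.
    By convexity the increments in time of [int zeta G (rho_n)] are at most those of the
    mass tested against the mollification of [zeta G' (rho_n)], hence at most a time
    integral of the flux; Riemann sums over finer and finer partitions give a differential
    inequality. Removing the mollification and then the cutoff [zeta], the diffusion term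
    has a sign, and with [P s = s G' s - G s] one is left with
    [d/dt int G (rho) <= int P (rho) (laplacian Psi) <= A int P (rho)].
    For regularizations [G] of [s^m] with [P <= (m - 1) G + eps s], Gronwall's lemma gives
    [int rho(t)^m <= exp ((m - 1) A t) int rho0^m]. The right-hand side is finite because
    the Gaussian bound [- s ln s <= s |y|^2 + exp (- |y|^2)] and the second moment control
    the negative part of the entropy in the energy of [rho0]. *)

(** * Real-valued integrals *)

(** In time, [rho] is only known to be weakly continuous, and joint measurability in [(t, y)] is not
    given. Measurable functions of time are therefore built from quantities continuous in [t],
    namely masses and point values of mollified densities. The bounds imposed on [G] come from the
    limit in the mollification. [G'] meets the flux [J = rho v], which is integrable because
    [|rho v| <= rho + rho |v|^2]; so [G'] has to be bounded. [G''] meets the product of the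
    mollified flux with the gradient of [rho_n]. Since [W = - rho (v + grad Psi) / LF'] and
    [LF' >= lam], both factors mollify some [rho w] with [rho w^2] integrable on balls, and
    Cauchy-Schwarz bounds their product by [rho_n] times a sequence converging in L^1. This is what
    a bound on [s G'' s] absorbs. As [grad Psi] may grow linearly, [grad zeta . grad Psi] stays
    bounded without becoming small; only the vanishing mass at infinity removes it. The factor
    [m - 1] is [P s / s^m] for [G s = s^m], and the m-th root turns it into [(m - 1) / m]. *)

Section real_integrals.
Context d0 (T : measurableType d0) (R : realType).
Variables (mu : {measure set T -> \bar R}) (D : set T).
Hypothesis mD : measurable D.
Implicit Types f g h : T -> R.

Definition rint f : Prop := mu.-integrable D (EFin \o f).

Lemma rint_meas f : rint f -> measurable_fun D f.
Proof. by move=> /measurable_int /measurable_EFinP. Qed.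

Lemma rint_le f g : measurable_fun D f -> rint g ->
  (forall x, D x -> `|f x| <= g x) -> rint f.
Proof.
move=> mf ig fg; apply: (le_integrable mD _ _ ig) => //.
  exact/measurable_EFinP.
move=> x Dx /=; rewrite lee_fin; apply: (le_trans (fg _ Dx)); exact: ler_norm.
Qed.

Lemma rintD f g : rint f -> rint g -> rint (fun x => f x + g x).
Proof. by move=> fi gi; exact: (integrableD mD fi gi). Qed.

Lemma rintB f g : rint f -> rint g -> rint (fun x => f x - g x).
Proof. by move=> fi gi; exact: (integrableB mD fi gi). Qed.

Lemma rintZ c f : rint f -> rint (fun x => c * f x).
Proof. by move=> fi; exact: (integrableZl mD c fi). Qed.

Lemma rintZr c f : rint f -> rint (fun x => f x * c).
Proof. by move=> /(rintZ c); under [X in rint X]eq_fun do rewrite mulrC. Qed.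

Lemma rintN f : rint f -> rint (fun x => - f x).
Proof. by move=> fi; exact: (integrableN fi). Qed.

Lemma rint_abs f : rint f -> rint (fun x => `|f x|).
Proof. by move=> fi; exact: (integrable_abse fi). Qed.

Lemma rint_sum (I : Type) (s : seq I) (F : I -> T -> R) :
  (forall i, rint (F i)) -> rint (fun x => \sum_(i <- s) F i x).
Proof.
move=> Fi; elim: s => [|a s ih].
  under [X in rint X]eq_fun do rewrite big_nil.
  exact: (integrable0 mu D).
by under [X in rint X]eq_fun do rewrite big_cons; exact: rintD.
Qed.

Lemma rint0 : rint (fun=> 0).
Proof. exact: (integrable0 mu D). Qed.

Lemma rint_cst c : (mu D < +oo)%E -> rint (fun=> c).
Proof.
move=> Doo; apply/integrableP; split; first exact: measurable_cst.
by rewrite (integral_cst mu mD (`|c|%:E)) lte_mul_pinfty// lee_fin.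
Qed.

Lemma rintM_bdd f g (C : R) : measurable_fun D g -> rint f ->
  (forall x, D x -> `|g x| <= C) -> rint (fun x => f x * g x).
Proof.
move=> mg fi gC; apply: (@rint_le _ (fun x => C * `|f x|)).
- by apply: measurable_funM => //; exact: rint_meas.
- exact/rintZ/rint_abs.
- by move=> x Dx; rewrite normrM mulrC ler_wpM2r// gC.
Qed.

Lemma rint_ge0P f : measurable_fun D f -> (forall x, D x -> 0 <= f x) ->
  rint f <-> (\int[mu]_(x in D) (f x)%:E < +oo)%E.
Proof.
move=> mf f0.
have e : (\int[mu]_(x in D) `|(EFin \o f) x| = \int[mu]_(x in D) (f x)%:E)%E.
  by apply: eq_integral => x /set_mem Dx /=; rewrite ger0_norm// f0.
split=> [/integrableP[_]|h]; rewrite ?e//.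
by apply/integrableP; split; [exact/measurable_EFinP|rewrite e].
Qed.

Lemma rint_indic (A : set T) : measurable A -> (mu A < +oo)%E ->
  mu.-integrable setT (EFin \o (fun x => \1_A x : R)).
Proof.
move=> mA Aoo; apply/integrableP; split.
  by apply/measurable_EFinP; exact: measurable_indic.
under eq_integral => x _ do rewrite /= ger0_norm//.
by rewrite integral_indic// setIT.
Qed.

Lemma rint_EFin f : rint f -> (\int[mu]_(x in D) f x)%R%:E = (\int[mu]_(x in D) (f x)%:E)%E.
Proof. by move=> fi; rewrite /Rintegral fineK//; exact: integrable_fin_num fi. Qed.

Lemma RintegralN f : rint f ->
  \int[mu]_(x in D) (- f x) = - \int[mu]_(x in D) f x.
Proof.
move=> fi; have := RintegralZl (-1) mD fi; rewrite mulN1r => <-.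
by apply: eq_Rintegral => x _; rewrite mulN1r.
Qed.

Lemma Rintegral_sum (I : Type) (s : seq I) (F : I -> T -> R) :
  (forall i, rint (F i)) ->
  \int[mu]_(x in D) (\sum_(i <- s) F i x) = \sum_(i <- s) \int[mu]_(x in D) F i x.
Proof.
move=> Fi; elim: s => [|a s ih].
  rewrite big_nil /Rintegral.
  by under eq_integral do rewrite big_nil; rewrite integral0.
rewrite big_cons -ih -RintegralD//; [|exact: Fi|exact: rint_sum].
by apply: eq_Rintegral => x _; rewrite big_cons.
Qed.

Lemma Rintegral_abs_le f g : rint f -> rint g ->
  (forall x, D x -> `|f x| <= g x) -> `|\int[mu]_(x in D) f x| <= \int[mu]_(x in D) g x.
Proof.
move=> fi gi fg; apply: (le_trans (le_normr_Rintegral mD fi)).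
by apply: le_Rintegral => //; exact: rint_abs.
Qed.

Lemma ae_eq_Rintegral f g : measurable_fun D f -> measurable_fun D g ->
  {ae mu, forall x, D x -> f x = g x} ->
  \int[mu]_(x in D) f x = \int[mu]_(x in D) g x.
Proof.
move=> mf mg fg; congr fine; apply: ae_eq_integral => //.
- exact/measurable_EFinP.
- exact/measurable_EFinP.
- by move: fg; apply: filterS => x /= h Dx; rewrite h.
Qed.

Lemma ae_eq_rint f g : measurable_fun D g -> rint f ->
  {ae mu, forall x, D x -> f x = g x} -> rint g.
Proof.
move=> mg /[dup] fi /integrableP[mf foo] fg; apply/integrableP; split.
  exact/measurable_EFinP.
have <- : (\int[mu]_(x in D) `|(EFin \o f) x| = \int[mu]_(x in D) `|(EFin \o g) x|)%E; last exact: foo.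
apply: ae_eq_integral => //.
- exact: measurableT_comp.
- by apply: measurableT_comp => //; exact/measurable_EFinP.
- by move: fg; apply: filterS => x /= h Dx; rewrite h.
Qed.

Lemma ae_le_Rintegral f g : rint f -> rint g ->
  {ae mu, forall x, D x -> f x <= g x} ->
  \int[mu]_(x in D) f x <= \int[mu]_(x in D) g x.
Proof.
move=> fi gi fg.
have mf := rint_meas fi; have mg := rint_meas gi.
(* [g] equals [max f g] almost everywhere, and [f] is below [max f g] everywhere, so pointwise
   monotonicity applies. *)
rewrite (@ae_eq_Rintegral g (fun x => Num.max (f x) (g x)))//.
- apply: le_Rintegral => //.
  + apply: (@rint_le _ (fun x => `|f x| + `|g x|)).
    * exact: measurable_maxr.
    * by apply: rintD; exact: rint_abs.
    * move=> x _; rewrite /Order.max; case: ifPn => _.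
        by rewrite lerDr.
      by rewrite lerDl.
  + by move=> x _; rewrite le_max lexx.
- exact: measurable_maxr.
- by move: fg; apply: filterS => x /= h /h ?; rewrite max_r.
Qed.

Lemma Rintegral_dct (F : nat -> T -> R) f h :
  (forall n, measurable_fun D (F n)) -> measurable_fun D f -> rint h ->
  {ae mu, forall x, D x -> F n x @[n --> \oo] --> f x} ->
  {ae mu, forall x, D x -> forall n, `|F n x| <= h x} ->
  rint f /\ \int[mu]_(x in D) F n x @[n --> \oo] --> \int[mu]_(x in D) f x.
Proof.
move=> mF mf hi Ff Fh.
have mF' n : measurable_fun D (EFin \o F n) by exact/measurable_EFinP.
have mf' : measurable_fun D (EFin \o f) by exact/measurable_EFinP.
have Ff' : {ae mu, forall x, D x -> (EFin \o F n) x @[n --> \oo] --> (EFin \o f) x}.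
  move: Ff; apply: filterS => x H Dx; apply: cvg_EFin; first exact: nearW.
  exact: H.
have Fh' : {ae mu, forall x n, D x -> (`|(EFin \o F n) x| <= (EFin \o h) x)%E}.
  by move: Fh; apply: filterS => x H n Dx; rewrite lee_fin; exact: H.
have [fi _ cv] := dominated_convergence mD mF' mf' Ff' hi Fh'.
split => //; apply: fine_cvg.
by rewrite rint_EFin.
Qed.

Lemma Rintegral_dctT (F : nat -> T -> R) f h :
  (forall n, measurable_fun D (F n)) -> measurable_fun D f -> rint h ->
  (forall x, D x -> F n x @[n --> \oo] --> f x) ->
  (forall x, D x -> forall n, `|F n x| <= h x) ->
  rint f /\ \int[mu]_(x in D) F n x @[n --> \oo] --> \int[mu]_(x in D) f x.
Proof.
by move=> mF mf hi Ff Fh; apply: (Rintegral_dct mF mf hi); exact: aeW.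
Qed.

End real_integrals.

(** * Lebesgue measure on R^d *)

Section lebesgue_rV_integral.
Context {R : realType}.
Local Open Scope ereal_scope.

(** The boolean treats the reflection [h - x] and the translation [h + x] at once: the change of
    variables in a convolution needs the first, continuity of translations the second. By uniqueness
    of Lebesgue measure it suffices to look at half-open intervals, whose preimages under the
    reflection are closed on the other side. *)
Lemma lebesgue_measure_affine (e : bool) (h : R) (A : set (measurableTypeR R)) :
  measurable A ->
  lebesgue_measure ((fun x : R => if e then h - x else h + x)%R @^-1` A) = lebesgue_measure A.
Proof.
have mT : measurable_fun [set: measurableTypeR R]
    (fun x : measurableTypeR R => (if e then h - x else h + x)%R : measurableTypeR R).
  by case: e; [apply: measurable_funB|apply: measurable_funD].
pose mu' := pushforward (@lebesgue_measure R)
  (fun x : measurableTypeR R => (if e then h - x else h + x)%R : measurableTypeR R).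
move=> mA; apply/esym.
apply: (@lebesgue_measure_unique R (mu' : {measure set _ -> \bar R})) => //= _ [[a b]] _ <-.
rewrite /mu' /pushforward.
case: e {mu' mT}.
- rewrite (_ : _ @^-1` _ = `[(h - b)%R, (h - a)%R[%classic).
    rewrite !lebesgue_measure_itv/= !lte_fin.
    rewrite ltrD2l ltrN2; case: ifPn => // _.
    by congr _%:E; ring.
  by apply/seteqP; split => x /=; rewrite !in_itv/=; lra.
- rewrite (_ : _ @^-1` _ = `](a - h)%R, (b - h)%R]%classic).
    rewrite !lebesgue_measure_itv/= !lte_fin.
    rewrite ltrD2r; case: ifPn => // _.
    by congr _%:E; ring.
  by apply/seteqP; split => x /=; rewrite !in_itv/=; lra.
Qed.

Lemma ge0_integral_affine1 (e : bool) (h : R) (f : R -> \bar R) :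
  measurable_fun setT f -> (forall x, 0 <= f x) ->
  \int[lebesgue_measure]_x f (if e then h - x else h + x)%R = \int[lebesgue_measure]_x f x.
Proof.
move=> mf f0.
have mT : measurable_fun [set: measurableTypeR R]
    (fun x : measurableTypeR R => (if e then h - x else h + x)%R : measurableTypeR R).
  by case: e; [apply: measurable_funB|apply: measurable_funD].
have := ge0_integral_pushforward mT lebesgue_measure measurableT mf (fun y _ => f0 y).
rewrite preimage_setT => /= <-.
by apply: eq_measure_integral => //= A mA _; exact: lebesgue_measure_affine.
Qed.

Lemma integral_lebesgue_rVS d (f : 'rV[R]_d.+1 -> \bar R) :
  measurable_fun setT f -> (forall x, 0 <= f x) ->
  \int[lebesgue_rV d.+1]_x f x =
  \int[lebesgue_measure]_a \int[lebesgue_rV d]_x f (rVcons (a, x)).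
Proof.
move=> mf f0.
have mc : measurable_fun [set: (measurableTypeR R * 'rV[R]_d)%type] (@rVcons R d).
  exact: measurable_rVcons.
have := ge0_integral_pushforward mc (lebesgue_measure \x lebesgue_rV d)
  measurableT mf (fun y _ => f0 y).
rewrite preimage_setT => /=.
rewrite /lebesgue_rV_step => ->.
rewrite fubini_tonelli1//.
by apply: measurableT_comp => //; exact: measurable_rVcons.
Qed.

Lemma measurable_affine_rV d (e : bool) (h : 'rV[R]_d) :
  measurable_fun setT (fun x : 'rV[R]_d => if e then h - x else h + x)%R.
Proof.
apply: measurable_fun_rV => i.
case: e.
- under eq_fun do rewrite !mxE.
  by apply: measurable_funB => //; exact: measurable_coord.
- under eq_fun do rewrite !mxE.
  by apply: measurable_funD => //; exact: measurable_coord.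
Qed.

(** Induction on the dimension: through [rVcons], Tonelli's theorem splits off the first coordinate,
    which the one-dimensional case moves, while the others are moved by [h']. *)
Lemma ge0_integral_affine d (e : bool) (h : 'rV[R]_d) (f : 'rV[R]_d -> \bar R) :
  measurable_fun setT f -> (forall x, 0 <= f x) ->
  \int[lebesgue_rV d]_x f (if e then h - x else h + x)%R = \int[lebesgue_rV d]_x f x.
Proof.
elim: d => [|d ih] in h f *.
  by move=> _ _; apply: eq_integral => x _; congr f; apply/rowP => -[].
move=> mf f0.
rewrite integral_lebesgue_rVS//; last first.
  by apply: measurableT_comp => //; exact: measurable_affine_rV.
rewrite [in RHS](integral_lebesgue_rVS mf f0).
have mfc : measurable_fun setT (f \o @rVcons R d).
  by apply: measurableT_comp => //; exact: measurable_rVcons.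
have mfc' : measurable_fun [set: (measurableTypeR R * 'rV[R]_d)%type] (f \o @rVcons R d) by [].
pose h' : 'rV[R]_d := (\row_j h 0 (lift ord0 j))%R.
pose F a := \int[lebesgue_rV d]_x f (rVcons (a, x)).
have F0 a : 0 <= F a by apply: integral_ge0.
have mF : measurable_fun setT F.
  have F'0 x : 0 <= (f \o @rVcons R d) x by exact: f0.
  have := @measurable_fun_fubini_tonelli_F _ _ _ _ R (lebesgue_rV d) _ mfc' F'0.
  exact.
transitivity (\int[lebesgue_measure]_a F (if e then h 0 ord0 - a else h 0 ord0 + a)%R); last first.
  exact: ge0_integral_affine1.
apply: eq_integral => a _.
rewrite /F -[RHS](ih h')//; last exact: (measurableT_comp mfc (measurable_pair1 _)).
apply: eq_integral => x _; congr f.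
clear ih mF; case: e; apply/rowP => i; rewrite /rVcons !mxE;
  by case: (unliftP ord0 i) => [j|] -> /=; rewrite ?liftK ?unlift_none ?mxE.
Qed.

End lebesgue_rV_integral.

Section lebesgue_rV_basics.
Context {R : realType} {d : nat}.
Local Notation V := 'rV[R]_d.
Local Notation leb := (lebesgue_rV d : {measure set V -> \bar R}).
Implicit Types (f g : V -> R) (x y z h : V).

Lemma continuous_measurable_rV f : continuous f -> measurable_fun setT f.
Proof.
move=> cf; apply: (measurability _ (RGenOpens.measurableE R)).
move=> _ [_ [a [b ->] <-]]; rewrite setTI; apply: open_measurable_rV.
by apply: open_comp; [move=> x _; exact: cf|exact: interval_open].
Qed.

Lemma rV_normP (x : V) (r : R) : 0 <= r ->
  (`|x| <= r) <-> (forall i, `|x 0 i| <= r).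
Proof.
move=> r0; rewrite (_ : `|x| = mx_norm x)// mx_normrE; split => [/bigmax_leP[_ h] i|h].
  exact: (h (0, i)).
by apply/bigmax_leP; split => // -[i j] _ /=; rewrite ord1.
Qed.

Lemma rV_coord_le (x : V) i : `|x 0 i| <= `|x|.
Proof. exact: (rV_normP x (normr_ge0 x)).1. Qed.

Lemma closed_ball_rV_compact (r : R) : compact [set x : V | `|x| <= r].
Proof.
apply: bounded_closed_compact.
  by exists r; split; rewrite ?num_real// => s rs x /= /le_trans; apply; exact: ltW.
by apply: (preimage_closed (f := fun x : V => `|x|) (D := [set s | s <= r]));
  [move=> x _; exact: norm_continuous|exact: closed_le].
Qed.

Lemma measurable_norm_rV : measurable_fun setT (fun x : V => `|x|).
Proof. by apply: continuous_measurable_rV; exact: norm_continuous. Qed.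

Lemma measurable_ball_rV (r : R) : measurable [set x : V | `|x| <= r].
Proof.
rewrite -[X in measurable X]setTI.
by apply: (measurable_norm_rV measurableT (Y := [set s | s <= r])) => //; by rewrite (_ : [set s | s <= r] = `]-oo, r]%classic)//; apply/seteqP; split => s /=; rewrite in_itv.
Qed.

Lemma measure_ball_rV (r : R) : (leb [set x : V | (`|x| <= r)%R] < +oo)%E.
Proof.
have [r0|r0] := ltP r 0.
  rewrite (_ : [set x : V | _] = set0) ?measure0//.
  by apply/seteqP; split => // x /= /le_lt_trans => /(_ _ r0); rewrite normr_lt0.
have mA (i : 'I_d) : measurable (`[- r, r]%classic : set R) by exact: measurable_itv.
have -> : leb [set x : V | `|x| <= r] = (\prod_(i < d) lebesgue_measure (`[(- r)%R, r]%classic : set R))%E.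
  rewrite -(lebesgue_rV_box mA); congr (lebesgue_rV d _).
  apply/seteqP; split => x /=.
    by move=> /(rV_normP x r0) h i; rewrite in_itv/= -ler_norml.
  by move=> h; apply/(rV_normP x r0) => i; have := h i; rewrite in_itv/= -ler_norml.
rewrite ltey_eq; apply/orP; left; elim/big_ind : _ => //.
- by move=> x y; exact: fin_numM.
- by move=> i _; rewrite lebesgue_measure_itv/=; case: ifPn.
Qed.

Lemma integral_affine (e : bool) h f : measurable_fun setT f ->
  (\int[leb]_x (f (if e then h - x else h + x))%:E = \int[leb]_x (f x)%:E)%E.
Proof.
move=> mf; rewrite [LHS]integralE [RHS]integralE.
have mf' : measurable_fun setT (EFin \o f) by exact/measurable_EFinP.
congr (_ - _)%E.
  rewrite -[RHS](ge0_integral_affine e h) => [|//|//]; last exact: measurable_funepos.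
  by apply: eq_integral => x _; rewrite !funeposE.
rewrite -[RHS](ge0_integral_affine e h) => [|//|//]; last exact: measurable_funeneg.
by apply: eq_integral => x _; rewrite !funenegE.
Qed.

Lemma Rintegral_affine (e : bool) h f : measurable_fun setT f ->
  \int[leb]_x f (if e then h - x else h + x) = \int[leb]_x f x.
Proof. by move=> mf; rewrite /Rintegral integral_affine. Qed.

Lemma rint_affine (e : bool) h f : rint leb setT f ->
  rint leb setT (fun x => f (if e then h - x else h + x)).
Proof.
move=> fi; have mf := rint_meas fi.
apply/integrableP; split.
  apply/measurable_EFinP; apply: measurableT_comp => //; exact: measurable_affine_rV.
have /integrableP[_] := fi; rewrite -(ge0_integral_affine e h)//.
by do 2 apply: measurableT_comp => //.
Qed.

End lebesgue_rV_basics.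

(** * Limits along sequences *)

Section sequential_limits.
Context {R : realType} {W : pseudoMetricType R}.

(** Dominated convergence speaks of sequences, so limits along neighbourhood filters are reduced to
    them. If the limit fails, the balls of radius [1 / (n + 1)] supply a sequence whose values stay
    at distance [e] from [l]. *)
Lemma cvg_withinP_seq (D : set W) (f : W -> R) (p : W) (l : R) :
  (forall u : nat -> W, (forall n, D (u n)) -> u n @[n --> \oo] --> p ->
     f (u n) @[n --> \oo] --> l) ->
  f x @[x --> within D (nbhs p)] --> l.
Proof.
move=> H; apply: contrapT => fpl.
have [e e0 He] : exists2 e : R, 0 < e & forall n : nat,
    exists x, [/\ D x, ball p n.+1%:R^-1 x & e <= `|l - f x|].
  apply: contrapT => /forall2NP h; apply: fpl; apply/cvgrPdist_lt => e e0.
  have [//|/existsNP[n /forallNP hn]] := h e.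
  rewrite near_withinE; near=> x => Dx.
  rewrite ltNge; apply/negP => ex; apply: (hn x); split => //.
  by near: x; apply: nbhsx_ballx; rewrite invr_gt0.
have [u hu] := choice He.
have up : u n @[n --> \oo] --> p.
  apply/cvg_ballP => r r0; near=> n.
  have [_ + _] := hu n; apply: le_ball.
  by apply/ltW; near: n; exact: (near_infty_natSinv_lt (PosNum r0)).
have /cvgrPdist_lt/(_ e e0)[n _ /(_ n (leqnn n))] := H u (fun n => let: And3 a _ _ := hu n in a) up.
by have [_ _] := hu n; rewrite leNgt => /negP.
Unshelve. all: by end_near. Qed.

Lemma cvg_nbhsP_seq (f : W -> R) (p : W) (l : R) :
  (forall u : nat -> W, u n @[n --> \oo] --> p -> f (u n) @[n --> \oo] --> l) ->
  f x @[x --> p] --> l.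
Proof.
move=> H; have := @cvg_withinP_seq setT f p l (fun u _ => H u).
move=> cv A lA; have h : \forall x \near p, setT x -> A (f x) := cv A lA.
by move: h; apply: filterS => x; exact.
Qed.

End sequential_limits.

(** * Continuity of translations in L^1 *)

Section translation_continuity.
Context {R : realType} {d : nat}.
Local Notation V := 'rV[R]_d.
Local Notation leb := (lebesgue_rV d : {measure set V -> \bar R}).
Implicit Types (f g : V -> R) (x y z : V).

Definition L1_translation_continuous f := rint leb setT f /\
  forall e : R, 0 < e -> \forall z \near (0 : V), \int[leb]_x `|f (z + x) - f x| <= e.
Local Notation tcont := L1_translation_continuous.

Let rint_diff f z : rint leb setT f -> rint leb setT (fun x => `|f (z + x) - f x|).
Proof. by move=> fi; apply: rint_abs; apply: rintB => //; exact: (rint_affine false z fi). Qed.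

Lemma tcontD f g : tcont f -> tcont g -> tcont (fun x => f x + g x).
Proof.
move=> [fi fc] [gi gc]; split; first exact: rintD.
move=> e e0; have e20 : 0 < e / 2 by rewrite divr_gt0.
near=> z; rewrite [e]splitr.
apply: (@le_trans _ _ (\int[leb]_x (`|f (z + x) - f x| + `|g (z + x) - g x|))).
  apply: le_Rintegral => //.
  - apply: (rint_diff (f := fun x => f x + g x)); exact: rintD.
  - by apply: rintD => //; exact: rint_diff.
  - by move=> x _; rewrite opprD addrACA ler_normD.
rewrite RintegralD//; [|exact: rint_diff|exact: rint_diff].
by apply: lerD; near: z; [exact: fc|exact: gc].
Unshelve. all: by end_near. Qed.

Lemma tcontZ c f : tcont f -> tcont (fun x => c * f x).
Proof.
move=> [fi fc]; split; first exact: rintZ.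
move=> e e0; have e20 : 0 < e / (`|c| + 1) by rewrite divr_gt0// ltr_wpDl.
near=> z; under eq_Rintegral do rewrite -mulrBr normrM.
rewrite RintegralZl//; last exact: rint_diff.
apply: (@le_trans _ _ ((`|c| + 1) * (e / (`|c| + 1)))); last first.
  by rewrite mulrC divfK// gt_eqF// ltr_wpDl.
apply: ler_pM => //; last by near: z; exact: fc.
- exact: Rintegral_ge0.
- by rewrite lerDl.
Unshelve. all: by end_near. Qed.

Lemma tcont_sum (I : Type) (s : seq I) (F : I -> V -> R) :
  (forall i, tcont (F i)) -> tcont (fun x => \sum_(i <- s) F i x).
Proof.
move=> Fi; elim: s => [|a s ih].
  under [X in tcont X]eq_fun do rewrite big_nil.
  split; first exact: rint0.
  move=> e e0; near=> z.
  under eq_Rintegral do rewrite subrr normr0.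
  by rewrite Rintegral_cst// mul0r ltW.
by under [X in tcont X]eq_fun do rewrite big_cons; exact: tcontD.
Unshelve. all: by end_near. Qed.

(** Translation preserves the integral of [|f - g|], so a third of [e] is spent twice on the
    approximation and once on the continuity of [g]. *)
Lemma tcont_approx f : rint leb setT f ->
  (forall e, 0 < e -> exists2 g, tcont g & \int[leb]_x `|f x - g x| <= e) -> tcont f.
Proof.
move=> fi H; split => // e e0.
have e30 : 0 < e / 3 by rewrite divr_gt0.
have [g [gi gc] fg] := H _ e30.
have fgi : rint leb setT (fun x => `|f x - g x|) by apply: rint_abs; exact: rintB.
near=> z.
apply: (@le_trans _ _ (\int[leb]_x (`|f (z + x) - g (z + x)| + `|g (z + x) - g x| + `|f x - g x|))).
  apply: le_Rintegral => //; first exact: rint_diff.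
  - apply: rintD => //; apply: rintD => //; last exact: rint_diff.
    exact: (rint_affine false z fgi).
  - move=> x _; rewrite [`|f x - g x|]distrC.
    have := ler_normD (f (z + x) - g (z + x) + (g (z + x) - g x)) (g x - f x).
    have := ler_normD (f (z + x) - g (z + x)) (g (z + x) - g x).
    by rewrite !subrKA => ? ?; lra.
rewrite RintegralD//; last first.
  apply: rintD => //; last exact: rint_diff; exact: (rint_affine false z fgi).
rewrite RintegralD//; [|exact: (rint_affine false z fgi)|exact: rint_diff].
rewrite (Rintegral_affine false z (f := fun x => `|f x - g x|)); last exact: rint_meas fgi.
have : \int[leb]_x `|g (z + x) - g x| <= e / 3 by near: z; exact: gc.
by move: fg; lra.
Unshelve. all: by end_near. Qed.

(** The L^1 distance between the indicator and its translate is [2 |U|] minus twice the measure of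
    the overlap. The overlap tends to [|U|], because a point of the open set [U] stays in [U] under
    small translations. *)
Lemma tcont_open (U : set V) : open U -> (leb U < +oo)%E -> tcont (fun x => \1_U x).
Proof.
move=> oU Uoo; have mU := open_measurable_rV oU.
have Ui : rint leb setT (fun x => \1_U x : R).
  exact: rint_indic.
split => // e e0.
have m1 : measurable_fun setT (fun x : V => \1_U x : R) by exact: rint_meas Ui.
have m2 z : measurable_fun setT (fun x : V => \1_U (z + x) : R).
  exact: rint_meas (rint_affine false z Ui).
have b1 x : `|\1_U x : R| <= 1 by rewrite indicE normr_nat lern1 leq_b1.
have Pi z : rint leb setT (fun x => \1_U x * \1_U (z + x)).
  by apply: (rintM_bdd measurableT (C := 1)).
have key : \int[leb]_x (\1_U x * \1_U (z + x)) @[z --> (0 : V)] --> \int[leb]_x (\1_U x : R).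
  apply: cvg_nbhsP_seq => u u0.
  have [|| _] := Rintegral_dctT measurableT (F := fun n x => \1_U x * \1_U (u n + x))
    (f := fun x => \1_U x) (h := fun x => \1_U x) (mu := leb)
    (fun n => rint_meas (Pi (u n))) m1 Ui; last exact.
  - move=> x _; have [xU|xU] := boolP (x \in U); last first.
      rewrite indicE (negbTE xU) /=; under eq_fun do rewrite mul0r.
      exact: cvg_cst.
    rewrite indicE xU /=; under eq_fun do rewrite mul1r.
    apply: cvg_near_cst; rewrite inE in xU.
    have : u n + x @[n --> \oo] --> x by rewrite -[X in _ --> X]add0r; exact: cvgD u0 (cvg_cst _).
    move=> /(_ U); rewrite /nbhs/= => /(_ (open_nbhs_nbhs (conj oU xU))).
    by apply: filterS => n Un; rewrite indicE mem_set.
  - move=> x _ n; rewrite normrM [`|\1_U x|]ger0_norm//.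
    by rewrite ler_piMr// b1.
have E z : \int[leb]_x `|\1_U (z + x) - \1_U x : R| =
    \int[leb]_x (\1_U x : R) + \int[leb]_x (\1_U x : R) - 2 * \int[leb]_x (\1_U x * \1_U (z + x)).
  have zi := rint_affine false z Ui.
  have Es : \int[leb]_x (\1_U (z + x) : R) = \int[leb]_x (\1_U x : R) by exact: (Rintegral_affine false z m1).
  transitivity (\int[leb]_x (\1_U (z + x) + \1_U x - 2 * (\1_U x * \1_U (z + x)))).
    apply: eq_Rintegral => x _; rewrite !indicE.
    case: (z + x \in U); case: (x \in U) ; rewrite /= ?subrr ?subr0 ?sub0r ?normrN ?normr0 ?normr1; lra.
  rewrite RintegralB//; [|exact: rintD|exact: rintZ].
  by rewrite (RintegralD measurableT zi Ui) Es (RintegralZl 2 measurableT (Pi z)).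
move/cvgrPdist_le : key => /(_ _ (divr_gt0 e0 (ltr0n _ 2))).
apply: filterS => z; rewrite E ler_norml => /andP[_]; lra.
Qed.

Let B (N : nat) : set V := [set x | `|x| < N%:R].

Let oB N : open (B N).
Proof.
apply: (open_comp (f := fun x : V => `|x|) (D := [set s | s < N%:R])).
  by move=> x _; exact: norm_continuous.
exact: open_lt.
Qed.

Let Boo N : (leb (B N) < +oo)%E.
Proof.
apply: le_lt_trans (measure_ball_rV N%:R); apply: le_measure; rewrite ?inE.
- exact: open_measurable_rV.
- exact: measurable_ball_rV.
- by move=> x /= /ltW.
Qed.

(** Dynkin induction from the open sets, which are stable under intersection. Intersecting with the
    ball [B N] keeps all measures finite; the indicator of a complement is then a difference with
    that of [B N], and a disjoint union is an L^1 limit of finite sums. *)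
Lemma tcont_indic N (A : set V) : measurable A -> tcont (fun x => \1_(A `&` B N) x).
Proof.
move=> mA; have mB := open_measurable_rV (@oB N).
have oo (S : set V) : measurable S -> rint leb setT (fun x => \1_(S `&` B N) x : R).
  move=> mS; apply: rint_indic; first exact: measurableI.
  by apply: le_lt_trans (@Boo N); apply: le_measure; rewrite ?inE//; exact: measurableI.
have BT : tcont (fun x => \1_(setT `&` B N) x) by rewrite setTI; apply: tcont_open.
apply: (@dynkin_induction _ V (@open V) (fun A => tcont (fun x => \1_(A `&` B N) x))) => //.
- by move=> S T oS oT; exact: openI.
- move=> S oS; apply: tcont_open; first exact: openI.
  apply: le_lt_trans (@Boo N); apply: le_measure; rewrite ?inE//.
  by apply: measurableI => //; exact: open_measurable_rV.
- move=> S mS cS.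
  have -> : (fun x => \1_(~` S `&` B N) x : R) = (fun x => \1_(setT `&` B N) x + (-1) * \1_(S `&` B N) x).
    apply/funext => x; rewrite !indicE !in_setI in_setT in_setC.
    by case: (x \in S); case: (x \in B N) => /=; lra.
  by apply: tcontD => //; exact: tcontZ.
move=> F mF tF cF; apply: tcont_approx; first by apply: oo; exact: bigcup_measurable.
move=> e e0.
pose s n x : R := \sum_(k <- index_iota 0 n) \1_(F k `&` B N) x.
have si n : tcont (s n) by exact: tcont_sum.
have s01 x n : s n x = \1_(\bigcup_(k < n) F k `&` B N) x.
  rewrite /s; elim: n => [|n ih].
    by rewrite big_geq// bigcup_mkord big_ord0 set0I indic0.
  rewrite big_nat_recr//= ih !bigcup_mkord big_ord_recr /= setIUl !indicE in_setU.
  have [a|a] := boolP (x \in F n `&` B N); last by rewrite orbF addr0.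
  rewrite orbT (_ : (x \in _) = false) ?add0r//.
  apply/negbTE/negP; rewrite inE -bigcup_mkord => -[[k /= kn Fk] _].
  move: a; rewrite inE => -[Fn _].
  have /trivIsetP/(_ k n Logic.I Logic.I) := tF.
  rewrite (ltn_eqF kn) => /(_ isT)/seteqP[/(_ x (conj Fk Fn))].
  by [].
have Ui : rint leb setT (fun x => \1_(\bigcup_k F k `&` B N) x : R).
  by apply: oo; exact: bigcup_measurable.
have di n : rint leb setT (fun x => `|\1_(\bigcup_k F k `&` B N) x - s n x|).
  by apply: rint_abs; apply: rintB => //; case: (si n).
have sub n x : x \in \bigcup_(k < n) F k `&` B N -> x \in \bigcup_k F k `&` B N.
  by rewrite !inE => -[[k _ Fk] Bx]; split => //; exists k.
have [|| _] := Rintegral_dctT measurableT (mu := leb)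
    (F := fun n x => `|\1_(\bigcup_k F k `&` B N) x - s n x|) (f := fun=> 0)
    (h := fun x => \1_(setT `&` B N) x) (fun n => rint_meas (di n)) (measurable_cst _)
    (oo _ measurableT).
- move=> x _; apply: cvg_near_cst.
  have [|xU] := boolP (x \in \bigcup_k F k `&` B N); last first.
    apply: nearW => n; rewrite s01 !indicE (negbTE xU).
    rewrite (negbTE (contra (@sub n x) xU)) subr0 normr0//.
  rewrite inE => -[[k _ Fk] Bx]; near=> n.
  rewrite s01 !indicE !mem_set ?subrr ?normr0//; last by split => //; exists k.
  split => //; exists k => //=; near: n; exact: nbhs_infty_gt.
- move=> x _ n; rewrite s01 setTI !indicE.
  have [xU|xU] := boolP (x \in \bigcup_k F k `&` B N); last first.
    by rewrite (negbTE (contra (@sub n x) xU)) subr0 normr_id normr0.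
  have -> : x \in B N by move: xU; rewrite !inE => -[].
  by case: (_ \in _) => /=; rewrite ?subrr ?subr0 normr_id ?normr0 ?normr1.
rewrite Rintegral_cst// mul0r => /cvgr0Pnorm_le/(_ e e0)[n _ /(_ n (leqnn n))] => h.
by exists (s n) => //; apply: le_trans h; exact: ler_norm.
Unshelve. all: by end_near. Qed.

Import HBNNSimple.

(** Simple functions approximate a nonnegative [f] from below; truncating the n-th one to [B n]
    makes it a combination of indicators handled by [tcont_indic], and [f] itself dominates the
    errors. *)
Lemma rint_tcont f : rint leb setT f -> tcont f.
Proof.
wlog f0 : f / forall x, 0 <= f x.
  move=> H fi.
  have -> : f = fun x => f^\+ x + (-1) * f^\- x.
    by apply/funext => x; rewrite mulN1r -[in LHS](funrposBneg f).
  apply: tcontD; first by apply: H; [exact: funrpos_ge0|exact: integrable_funrpos].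
  by apply: tcontZ; apply: H; [exact: funrneg_ge0|exact: integrable_funrneg].
move=> fi; apply: tcont_approx => // e e0.
have mf := rint_meas fi.
have mf' : measurable_fun setT (EFin \o f) by exact/measurable_EFinP.
pose g := nnsfun_approx measurableT mf'.
pose s n x : R := g n x * \1_(B n) x.
have si n : tcont (s n).
  have -> : s n = fun x => \sum_(y <- finmap.enum_fset (fset_set (range (g n)))) y * \1_(g n @^-1` [set y] `&` B n) x.
    apply/funext => x; rewrite /s (fimfunE (g n) x) fsbig_finite//= mulr_suml.
    by apply: eq_bigr => y _; rewrite indicI/= mulrA.
  apply: tcont_sum => y; apply: tcontZ; apply: tcont_indic.
  exact: measurable_funPTI.
have gf n x : g n x <= f x.
  by have := @le_approx _ V R setT (EFin \o f) n x (fun _ _ => f0 _) Logic.I; rewrite lee_fin /g nnsfun_approxE.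
have gc x : g n x @[n --> \oo] --> f x.
  have := cvg_nnsfun_approx measurableT mf' (fun x _ => f0 x) (x := x) Logic.I.
  by move/fine_cvgP => [].
have di n : rint leb setT (fun x => `|f x - s n x|).
  by apply: rint_abs; apply: rintB => //; case: (si n).
have [|| _] := Rintegral_dctT measurableT (mu := leb)
    (F := fun n x => `|f x - s n x|) (f := fun=> 0)
    (h := f) (fun n => rint_meas (di n)) (measurable_cst _) fi.
- move=> x _; rewrite -[0 in X in _ --> X](normr0 R) -(subrr (f x)).
  apply: cvg_norm; apply: cvgB; first exact: cvg_cst.
  rewrite -[f x in X in _ --> X]mulr1; apply: cvgM; first exact: gc.
  apply: cvg_near_cst; near=> n; rewrite indicE mem_set// /B/=.
  near: n; exact: nbhs_infty_gtr.
- move=> x _ n; rewrite /s indicE; case: (_ \in _) => /=.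
    by rewrite normr_id mulr1 ger0_norm ?subr_ge0// lerBlDr lerDl//.
  by rewrite normr_id mulr0 subr0 ger0_norm.
rewrite Rintegral_cst// mul0r => /cvgr0Pnorm_le/(_ e e0)[n _ /(_ n (leqnn n))] => h.
by exists (s n) => //; apply: le_trans h; exact: ler_norm.
Unshelve. all: by end_near. Qed.

End translation_continuity.

(** * Smooth functions and convolution *)

Section is_Ck_theory.
Context {R : realType}.

Definition smooth {V : normedModType R} (f : V -> R) := forall k, is_Ck k f.

Lemma continuous_add {V : topologicalType} (f g : V -> R) :
  continuous f -> continuous g -> continuous (fun x => f x + g x).
Proof. by move=> cf cg x; exact: (cvgD (cf x) (cg x)). Qed.

Lemma continuous_mul {V : topologicalType} (f g : V -> R) :
  continuous f -> continuous g -> continuous (fun x => f x * g x).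
Proof. by move=> cf cg x; exact: (cvgM (cf x) (cg x)). Qed.

Lemma is_Ck_continuous {V : normedModType R} k (f : V -> R) : is_Ck k f -> continuous f.
Proof. by case: k => [[]|k []]. Qed.

Lemma smooth_continuous {V : normedModType R} (f : V -> R) : smooth f -> continuous f.
Proof. by move=> /(_ 0%N) /is_Ck_continuous. Qed.

Lemma smooth_derivable {V : normedModType R} (f : V -> R) x v : smooth f -> derivable f x v.
Proof. by move=> /(_ 1%N) [_ /(_ v)] []. Qed.

Lemma smooth_derive {V : normedModType R} (f : V -> R) v : smooth f -> smooth ('D_v f).
Proof. by move=> sf k; have [_ /(_ v) []] := sf k.+1. Qed.

Lemma is_Ck_le {V : normedModType R} k l (f : V -> R) : (k <= l)%N -> is_Ck l f -> is_Ck k f.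
Proof.
elim: k l f => [|k ih] [|l] f //= kl [cf df]; split=> // v.
by have [d1 d2] := df v; split => //; exact: ih d2.
Qed.

Lemma is_Ck_cst {V : normedModType R} k (c : R) : is_Ck k (fun _ : V => c).
Proof.
elim: k c => [|k ih] c /=; (split; first exact: cst_continuous) => // v.
split; first by move=> x; exact: derivable_cst.
by rewrite (_ : 'D_v _ = fun=> 0)//; apply/funext => x; rewrite derive_cst.
Qed.

Lemma is_CkD {V : normedModType R} k (f g : V -> R) :
  is_Ck k f -> is_Ck k g -> is_Ck k (fun x => f x + g x).
Proof.
elim: k f g => [|k ih] f g /= [cf df] [cg dg];
  (split; first by move=> x; apply: cvgD; [exact: cf|exact: cg]) => // v.
have [df1 df2] := df v; have [dg1 dg2] := dg v.
split; first by move=> x; exact: derivableD.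
rewrite (_ : 'D_v _ = fun x => 'D_v f x + 'D_v g x); first exact: ih.
by apply/funext => x; rewrite deriveD.
Qed.

Lemma is_CkM {V : normedModType R} k (f g : V -> R) :
  is_Ck k f -> is_Ck k g -> is_Ck k (fun x => f x * g x).
Proof.
elim: k f g => [|k ih] f g /= [cf df] [cg dg];
  (split; first by move=> x; apply: cvgM; [exact: cf|exact: cg]) => // v.
have [df1 df2] := df v; have [dg1 dg2] := dg v.
split; first by move=> x; exact: derivableM.
rewrite (_ : 'D_v _ = fun x => f x * 'D_v g x + g x * 'D_v f x); last first.
  by apply/funext => x; rewrite deriveM.
have kf : is_Ck k f by apply: (@is_Ck_le _ k k.+1); rewrite ?leqnSn.
have kg : is_Ck k g by apply: (@is_Ck_le _ k k.+1); rewrite ?leqnSn.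
by apply: is_CkD; exact: ih.
Qed.

Lemma is_CkZ {V : normedModType R} k (c : R) (f : V -> R) :
  is_Ck k f -> is_Ck k (fun x => c * f x).
Proof. by apply: is_CkM; exact: is_Ck_cst. Qed.

Lemma is_Ck_prod {V : normedModType R} (I : Type) (s : seq I) k (F : I -> V -> R) :
  (forall i, is_Ck k (F i)) -> is_Ck k (fun x => \prod_(i <- s) F i x).
Proof.
move=> Fk; elim: s => [|a s ih].
  by under [X in is_Ck k X]eq_fun do rewrite big_nil; exact: is_Ck_cst.
by under [X in is_Ck k X]eq_fun do rewrite big_cons; exact: is_CkM.
Qed.

(** [M] is the linear part of the affine map [L]: the derivative of [g \o L] along [v] is that of
    [g] along the fixed vector [M v], again composed with [L], so the induction on [k] closes. *)
Lemma is_Ck_affine {V W : normedModType R} k (g : W -> R) (L : V -> W) (M : V -> W) :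
  continuous L -> (forall x v h, L (h *: v + x) = h *: M v + L x) ->
  is_Ck k g -> is_Ck k (g \o L).
Proof.
move=> cL LM; elim: k g => [|k ih] g /= [cg dg];
  (split; first by move=> x; apply: continuous_comp; [exact: cL|exact: cg]) => // v.
have [d1 d2] := dg (M v).
have E x : (fun h => h^-1 *: (((g \o L) \o shift x) (h *: v) - (g \o L) x)) =
    (fun h => h^-1 *: ((g \o shift (L x)) (h *: M v) - g (L x))).
  by apply/funext => h; rewrite /= LM.
split; first by move=> x; rewrite /derivable E; exact: d1.
have -> : 'D_v (g \o L) = 'D_(M v) g \o L by apply/funext => x; rewrite /derive E.
exact: ih.
Qed.

Lemma derive_along {V : normedModType R} (f : V -> R) (x v : V) (s : R) :
  derivable f (s *: v + x) v ->
  is_derive s (1 : R) (fun r : R => f (r *: v + x)) ('D_v f (s *: v + x)).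
Proof.
move=> df.
have E : (fun h : R => h^-1 *: (((fun r : R => f (r *: v + x)) \o shift s) (h *: 1) - f (s *: v + x))) =
    (fun h : R => h^-1 *: ((f \o shift (s *: v + x)) (h *: v) - f (s *: v + x))).
  by apply/funext => h; rewrite /= scaler1 scalerDl addrA.
by split; [rewrite /derivable E|rewrite /derive E].
Qed.

(** A directional derivative is the derivative at 0 of the restriction to a line, which brings chain
    rules back to one real variable. *)
Lemma is_derive_alongP {V : normedModType R} (f : V -> R) (x v : V) (l : R) :
  is_derive x v f l <-> is_derive (0 : R) (1 : R) (fun r : R => f (r *: v + x)) l.
Proof.
have E : (fun h : R => h^-1 *: (((fun r : R => f (r *: v + x)) \o shift 0) (h *: 1) - f (0 *: v + x))) =
    (fun h : R => h^-1 *: ((f \o shift x) (h *: v) - f x)).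
  by apply/funext => h; rewrite /= scaler1 addr0 scale0r add0r.
split=> -[]; rewrite /derivable /derive.
  by move=> ? ?; split; rewrite /derivable /derive E.
by rewrite E => ? ?; split.
Qed.

Lemma is_derive_comp1 {V : normedModType R} (b : R -> R) (f : V -> R) (x v : V) (l df : R) :
  is_derive (f x) (1 : R) b l -> is_derive x v f df -> is_derive x v (b \o f) (l * df).
Proof.
move=> bl /is_derive_alongP fd; apply/is_derive_alongP.
have {}bl : is_derive (f (0 *: v + x)) (1 : R) b l by rewrite scale0r add0r.
exact: (is_derive1_comp bl fd).
Qed.

Lemma is_derive_comp_affine {V W : normedModType R} (g : W -> R) (L M : V -> W) (x v : V) (l : R) :
  (forall h, L (h *: v + x) = h *: M v + L x) ->
  is_derive (L x) (M v) g l -> is_derive x v (g \o L) l.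
Proof.
move=> LM /is_derive_alongP gl; apply/is_derive_alongP.
by rewrite (_ : (fun r => _) = (fun r : R => g (r *: M v + L x)))//; apply/funext => r; rewrite /= LM.
Qed.

Lemma is_derive_dirZ {V : normedModType R} (f : V -> R) (x v : V) (c l : R) :
  is_derive x v f l -> is_derive x (c *: v) f (c * l).
Proof.
move=> /is_derive_alongP fl; apply/is_derive_alongP.
rewrite (_ : (fun r => _) = (fun s : R => f (s *: v + x)) \o (fun r : R => c *: r)); last first.
  by apply/funext => r /=; rewrite scalerA mulrC.
have {}fl : is_derive (c *: (0 : R)) (1 : R) (fun s : R => f (s *: v + x)) l by rewrite scaler0.
have h2 : is_derive (0 : R) (1 : R) (fun r : R => c *: r) c.
  by apply: is_derive_eq; rewrite /GRing.scale/= mulr1.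
by apply: (is_derive_eq (is_derive1_comp fl h2)); rewrite mulrC.
Qed.

Lemma MVT_along {V : normedModType R} (f : V -> R) (v : V) (C : R) :
  (forall x, derivable f x v) -> (forall x, `|'D_v f x| <= C) ->
  forall x h, `|f (h *: v + x) - f x| <= C * `|h|.
Proof.
move=> df dC x h.
have H s := derive_along (df (s *: v + x)).
have cont a b : {within `[a, b], continuous (fun r : R => f (r *: v + x))}.
  apply: continuous_subspaceT => s; apply: differentiable_continuous.
  by apply/derivable1_diffP; have [] := H s.
have key a b : a <= b -> `|f (b *: v + x) - f (a *: v + x)| <= C * (b - a).
  rewrite le_eqVlt => /predU1P[->|ab]; first by rewrite !subrr normr0 mulr0.
  have [c _ ->] := MVT ab (fun s _ => H s) (cont a b).
  have ab0 : 0 <= b - a by rewrite subr_ge0 ltW.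
  by rewrite normrM (ger0_norm ab0) ler_wpM2r.
have [h0|h0] := leP 0 h.
  by have := key 0 h h0; rewrite scale0r add0r subr0 (ger0_norm h0).
by have := key h 0 (ltW h0); rewrite scale0r add0r sub0r distrC (ltr0_norm h0).
Qed.

Lemma derive_near0 {V : normedModType R} (f : V -> R) (x v : V) :
  (\forall y \near x, f y = 0) -> is_derive x v f 0.
Proof.
move=> fx; apply: (near_eq_is_derive (f := cst 0)).
by move: fx; apply: filterS => y ->.
Qed.

Lemma near_dist_le1 {W : normedModType R} (x : W) : \forall u \near x, `|u - x| <= 1.
Proof.
have := nbhsx_ballx x (1 : R) ltr01; rewrite -ball_normE.
by apply: filterS => u /= /ltW; rewrite distrC.
Qed.

Lemma cvg_dnbhs_seq (u : nat -> R) (a : R) :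
  (forall n, u n != a) -> u n @[n --> \oo] --> a -> u n @[n --> \oo] --> a^'.
Proof.
move=> ua cu A cA; have h : \forall x \near a, x != a -> A x := cA.
have := cu _ h; rewrite /nbhs/=; by apply: filterS => n h1; exact: (h1 (ua n)).
Qed.

(** The bound [|u n - a| <= 1] costs nothing in a limit and gives difference quotients a common
    dominating function. *)
Lemma cvg_dnbhs_seqP (q : R -> R) (a l : R) :
  (forall u : nat -> R, (forall n, u n != a) -> (forall n, `|u n - a| <= 1) ->
    u n @[n --> \oo] --> a -> q (u n) @[n --> \oo] --> l) ->
  q x @[x --> a^'] --> l.
Proof.
move=> H.
have H1 : q h @[h --> within (fun h => h != a /\ `|h - a| <= 1) (nbhs a)] --> l.
  by apply: cvg_withinP_seq => u Bu ux; apply: H => // n; have [] := Bu n.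
move=> A cA; have h : \forall u \near a, u != a /\ `|u - a| <= 1 -> A (q u) := H1 A cA.
have : \forall u \near a, u != a -> A (q u); last exact.
by apply: filterS2 h (near_dist_le1 a) => u hu u1 ua; exact: hu.
Qed.

Lemma cvg_of_dist_le (a D : nat -> R) (l : R) :
  (forall n, `|a n - l| <= D n) -> D n @[n --> \oo] --> 0 -> a n @[n --> \oo] --> l.
Proof.
move=> aD /cvgr0Pnorm_le D0; apply/cvgrPdist_le => e e0.
apply: filterS (D0 e e0) => n Dn; rewrite distrC; apply: le_trans (aD n) _.
by apply: le_trans Dn; exact: ler_norm.
Qed.

End is_Ck_theory.

Section convolution.
Context {R : realType} {d : nat}.
Local Notation V := 'rV[R]_d.
Local Notation leb := (lebesgue_rV d : {measure set V -> \bar R}).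
Implicit Types (f g k : V -> R) (x y z v : V).

Definition csupp (r : R) k := forall z, r < `|z| -> k z = 0.

Lemma csupp_bounded r k : continuous k -> csupp r k ->
  exists2 C : R, 0 <= C & forall z, `|k z| <= C.
Proof.
move=> ck sk.
have : compact (k @` [set x | `|x| <= r]).
  apply: continuous_compact; last exact: closed_ball_rV_compact.
  exact: continuous_subspaceT.
move=> /compact_bounded [M [_ HM]].
exists (`|M| + 1); first by rewrite addr_ge0.
move=> z; have [zr|zr] := leP `|z| r; last by rewrite sk// normr0 addr_ge0.
apply: (HM (`|M| + 1)); last by exists z.
by rewrite (le_lt_trans (ler_norm M))// ltrDl.
Qed.

Lemma csupp_derive r k v : csupp r k -> csupp r ('D_v k).
Proof.
move=> sk z rz; suff H : is_derive z v k 0 by exact: derive_val.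
apply: derive_near0.
have oU : open [set y : V | r < `|y|].
  apply: (open_comp (f := fun x : V => `|x|) (D := [set s | r < s])).
    by move=> x _; exact: norm_continuous.
  exact: open_gt.
by apply: filterS (open_nbhs_nbhs (conj oU rz)) => y; exact: sk.
Qed.

Lemma test_function_csupp k : test_function setT k ->
  smooth k /\ exists2 r, 0 < r & csupp r k.
Proof.
move=> [sk [K [cK _ K0]]]; split => //.
have [M [_ HM]] := compact_bounded cK.
exists (`|M| + 1); first by rewrite ltr_wpDl.
move=> z zM; apply: K0 => Kz; move: zM; rewrite ltNge => /negP; apply.
by apply: (HM (`|M| + 1)) => //; rewrite (le_lt_trans (ler_norm M))// ltrDl.
Qed.

Lemma csupp_test_function r k : smooth k -> csupp r k -> test_function setT k.
Proof.
move=> sk kr; split => //; exists [set x | `|x| <= r]; split => //.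
  exact: closed_ball_rV_compact.
by move=> x /= /negP; rewrite -ltNge; exact: kr.
Qed.

(** Local integrability is tested with indicators of balls on the whole space, so that the calculus
    of [rint] over [setT] applies. *)
Lemma L1locP f : L1loc f <-> measurable_fun setT f /\
  forall r, rint leb setT (fun y => f y * \1_[set y | `|y| <= r] y).
Proof.
have mc r : measurable_fun setT f ->
    measurable_fun setT (fun y => f y * \1_[set y : V | `|y| <= r] y).
  by move=> mf; apply: measurable_funM => //; apply: measurable_indic; exact: measurable_ball_rV.
have E r y : (`|(EFin \o f) y| * (\1_[set y : V | (`|y| <= r)%R] y)%:E)%E =
    (`|(EFin \o (fun y => f y * \1_[set y : V | `|y| <= r] y)%R) y|)%E.
  by rewrite /= normrM EFinM [`|\1__ _|]ger0_norm.
split=> [[mf H]|[mf H]]; split => //.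
  move=> r; apply/integrableP; split; first by apply/measurable_EFinP; exact: mc.
  have /integrableP[_] := H _ (@closed_ball_rV_compact R d r).
  suff <- : (\int[lebesgue_rV d]_(x in [set y : V | (`|y| <= r)%R]) `|(EFin \o f) x| =
    \int[lebesgue_rV d]_x `|(EFin \o (fun y => f y * \1_[set y : V | (`|y| <= r)%R] y)%R) x|)%E by [].
  rewrite integral_mkcond; apply: eq_integral => y _; rewrite -E patchE indicE.
  by case: ifPn => _; rewrite ?mule1 ?mule0.
move=> K cK.
have [M [_ HM]] := compact_bounded cK.
have mK : measurable K.
  by rewrite -(setCK K); apply: measurableC; apply: open_measurable_rV; rewrite openC; apply: compact_closed.
have : (lebesgue_rV d).-integrable K (EFin \o (fun y => f y * \1_[set y : V | `|y| <= `|M| + 1] y)).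
  exact: (integrableS measurableT mK (@subsetT _ _) (H (`|M| + 1))).
apply: eq_integrable => // y /set_mem Ky /=; rewrite indicE mem_set ?mulr1//=.
by apply: (HM (`|M| + 1)) => //; rewrite (le_lt_trans (ler_norm M))// ltrDl.
Qed.

Lemma rint_L1loc f : rint leb setT f -> L1loc f.
Proof.
move=> fi; apply/L1locP; split; first exact: rint_meas fi.
move=> r; apply: (rintM_bdd measurableT (C := 1)) => //.
  by apply: measurable_indic; exact: measurable_ball_rV.
by move=> y _; rewrite indicE normr_nat lern1 leq_b1.
Qed.

Lemma bounded_L1loc f (C : R) : measurable_fun setT f -> (forall y, `|f y| <= C) -> L1loc f.
Proof.
move=> mf fC; apply/L1locP; split => // r.
apply: (@rint_le _ _ _ leb _ measurableT _ (fun y => C * \1_[set y | `|y| <= r] y)).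
- by apply: measurable_funM => //; apply: measurable_indic; exact: measurable_ball_rV.
- by apply: rintZ => //; apply: rint_indic; [exact: measurable_ball_rV|exact: measure_ball_rV].
- by move=> y _; rewrite normrM [`|\1__ _|]ger0_norm// ler_wpM2r.
Qed.

Lemma L1locD f g : L1loc f -> L1loc g -> L1loc (fun y => f y + g y).
Proof.
move=> /L1locP[mf fi] /L1locP[mg gi]; apply/L1locP; split; first exact: measurable_funD.
move=> r; under [X in rint _ _ X]eq_fun do rewrite mulrDl.
exact: rintD.
Qed.

Lemma L1locZ c f : L1loc f -> L1loc (fun y => c * f y).
Proof.
move=> /L1locP[mf fi]; apply/L1locP; split; first exact: measurable_funM.
move=> r; under [X in rint _ _ X]eq_fun do rewrite -mulrA.
exact: rintZ.
Qed.

Lemma L1loc_le f g : measurable_fun setT f -> L1loc g -> (forall y, `|f y| <= g y) -> L1loc f.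
Proof.
move=> mf /L1locP[mg gi] fg; apply/L1locP; split => // r.
apply: (rint_le measurableT _ (gi r)).
  by apply: measurable_funM => //; apply: measurable_indic; exact: measurable_ball_rV.
by move=> y _; rewrite normrM [`|\1__ _|]ger0_norm// ler_wpM2r.
Qed.

Lemma rint_mul_csupp f k r : L1loc f -> continuous k -> csupp r k ->
  rint leb setT (fun y => f y * k y).
Proof.
move=> /L1locP[_ fi] ck kr.
have [C C0 kC] := csupp_bounded ck kr.
have := rintM_bdd measurableT (continuous_measurable_rV ck) (fi r) (fun x _ => kC x).
congr (rint _ _ _); apply/funext => y; rewrite indicE.
have [yr|yr] := leP `|y| r; first by rewrite mem_set ?mulr1.
by rewrite kr// !mulr0.
Qed.

Lemma csupp_reflect k r x : csupp r k -> csupp (`|x| + r) (fun y => k (x - y)).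
Proof.
move=> kr y xy; apply: kr.
have := ler_normD (x - y) (- x); rewrite addrAC subrr sub0r !normrN.
by lra.
Qed.

Lemma continuous_reflect k x : continuous k -> continuous (fun y => k (x - y)).
Proof.
move=> ck y; apply: (@continuous_comp _ _ _ (fun y => x - y) k); last exact: ck.
by apply: continuousB; [exact: cst_continuous|exact: cvg_id].
Qed.

Definition convol f k x := \int[leb]_y (f y * k (x - y)).

Lemma rint_conv f k r x : L1loc f -> continuous k -> csupp r k ->
  rint leb setT (fun y => f y * k (x - y)).
Proof.
by move=> fl ck kr; exact: (rint_mul_csupp fl (continuous_reflect (x := x) ck) (csupp_reflect (x := x) kr)).
Qed.

Lemma convC f k x : measurable_fun setT f -> measurable_fun setT k ->
  convol f k x = \int[leb]_z (f (x - z) * k z).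
Proof.
move=> mf mk; rewrite /convol -(Rintegral_affine true x).
  by apply: eq_Rintegral => z _; rewrite opprB addrCA subrr addr0.
apply: measurable_funM => //; apply: measurableT_comp => //.
exact: (measurable_affine_rV true x).
Qed.

Lemma continuous_conv f k r : L1loc f -> continuous k -> csupp r k -> continuous (convol f k).
Proof.
move=> fl ck kr x; have [C C0 kC] := csupp_bounded ck kr.
have [mf fi] := (L1locP f).1 fl.
pose B := [set u : V | `|u - x| <= 1].
have Bx : \forall u \near x, B u := near_dist_le1 x.
have : convol f k u @[u --> within B (nbhs x)] --> convol f k x; last first.
  move=> H A cA; have h : \forall u \near x, B u -> A (convol f k u) := H A cA.
  by have : \forall u \near x, A (convol f k u); [apply: filterS2 h Bx => u; exact|].
apply: cvg_withinP_seq => u Bu ux.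
have [|| _] := Rintegral_dctT measurableT (mu := leb)
  (F := fun n y => f y * k (u n - y)) (f := fun y => f y * k (x - y))
  (h := fun y => C * `|f y * \1_[set y | `|y| <= `|x| + 1 + r] y|)
  (fun n => rint_meas (rint_conv (u n) fl ck kr)) (rint_meas (rint_conv x fl ck kr))
  (rintZ measurableT C (rint_abs (fi (`|x| + 1 + r)))); last exact.
- move=> y _; apply: cvgM; first exact: cvg_cst.
  apply: (@continuous_cvg _ _ _ _ _ (fun n => u n - y) k); first exact: ck.
  by apply: cvgB => //; exact: cvg_cst.
- move=> y _ n; rewrite !normrM mulrC [`|\1__ _|]ger0_norm// indicE.
  have [yr|yr] := leP `|y| (`|x| + 1 + r).
    by rewrite mem_set//= mulr1 ler_wpM2r.
  rewrite kr ?normr0 ?mul0r ?mulr_ge0//.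
  have := ler_normB (u n) (u n - y); have := ler_normD (u n - x) x.
  rewrite subKr subrK.
  by have := Bu n; rewrite /B/=; lra.
Unshelve. all: by end_near. Qed.

(** [MVT_along] bounds the difference quotients of [k] by a bound of its derivative. For increments
    at most 1 they all vanish off a common ball, so a multiple of [|f|] on that ball dominates. *)
Lemma is_derive_conv f k r v x : L1loc f -> continuous k -> csupp r k ->
  (forall y, derivable k y v) -> continuous ('D_v k) ->
  is_derive x v (convol f k) (convol f ('D_v k) x).
Proof.
move=> fl ck kr dk cdk; have dkr := csupp_derive v kr.
have [C C0 kC] := csupp_bounded cdk dkr.
have [mf fi] := (L1locP f).1 fl.
pose q (h : R) := h^-1 *: ((convol f k \o shift x) (h *: v) - convol f k x).
suff H : q h @[h --> 0^'] --> convol f ('D_v k) x.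
  split; first by apply/cvg_ex; exists (convol f ('D_v k) x).
  exact/cvg_lim.
apply: cvg_dnbhs_seqP => u u_neq0 u1 u0.
pose F n y := f y * ((u n)^-1 * (k (u n *: v + x - y) - k (x - y))).
have Fi n : rint leb setT (F n).
  have := rintZ measurableT (u n)^-1 (rintB measurableT
    (rint_conv (u n *: v + x) fl ck kr) (rint_conv x fl ck kr)).
  by congr (rint _ _ _); apply/funext => y; rewrite /F -mulrBr mulrCA.
have qF n : q (u n) = \int[leb]_y F n y.
  rewrite /q /= /convol -RintegralB//; [|exact: rint_conv ck kr|exact: rint_conv ck kr].
  rewrite /GRing.scale/= -RintegralZl//; last first.
    by apply: rintB => //; exact: rint_conv ck kr.
  by apply: eq_Rintegral => y _; rewrite /F -mulrBr mulrCA.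
under eq_fun do rewrite qF.
have [|| _] := Rintegral_dctT measurableT (mu := leb)
  (F := F) (f := fun y => f y * 'D_v k (x - y))
  (h := fun y => C * `|f y * \1_[set y | `|y| <= `|x| + `|v| + r] y|)
  (fun n => rint_meas (Fi n)) (rint_meas (rint_conv x fl cdk dkr))
  (rintZ measurableT C (rint_abs (fi (`|x| + `|v| + r)))); last exact.
- move=> y _; apply: cvgM; first exact: cvg_cst.
  have := cvg_comp u _ (cvg_dnbhs_seq u_neq0 u0) (dk (x - y)).
  by apply: cvg_trans; apply: near_eq_cvg; near=> n; rewrite /= addrA.
- move=> y _ n; rewrite /F [X in _ <= _ * X]normrM [`|\1__ _|]ger0_norm// indicE.
  have un1 : `|u n| <= 1 by have := u1 n; rewrite subr0.
  have [yr|yr] := leP `|y| (`|x| + `|v| + r).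
    rewrite mem_set//= mulr1 normrM mulrC ler_wpM2r//.
    have := MVT_along dk kC (x - y) (u n); rewrite addrA => H.
    rewrite normrM normfV mulrC ler_pdivrMr// normr_gt0//.
  have xyv : `|y| <= `|x - y| + `|x|.
    have := ler_normD (x - y) (- x); rewrite addrAC subrr sub0r !normrN//.
  have xyu : `|y| <= `|u n *: v + x - y| + `|v| + `|x|.
    have := ler_normD (u n *: v + x - y) (- (u n *: v) - x).
    have := ler_normD (- (u n *: v)) (- x).
    have : `|u n *: v| <= `|v| by rewrite normrZ ler_piMl.
    rewrite -opprD addrAC subrr sub0r !normrN; lra.
  have v0 := normr_ge0 v.
  rewrite (kr (x - y)) ?(kr (u n *: v + x - y)) ?subrr ?mulr0 ?normr0 ?mulr_ge0//.
  + by lra.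
  + by lra.
Unshelve. all: by end_near. Qed.

Lemma derivable_conv f k r v x : L1loc f -> smooth k -> csupp r k ->
  derivable (convol f k) x v /\ 'D_v (convol f k) x = convol f ('D_v k) x.
Proof.
move=> fl sk kr.
by have [] := is_derive_conv x fl (smooth_continuous sk) kr
  (fun y => smooth_derivable (x := y) (v := v) sk) (smooth_continuous (smooth_derive v sk)).
Qed.

Lemma smooth_conv f k r : L1loc f -> smooth k -> csupp r k -> smooth (convol f k).
Proof.
move=> fl sk kr n; elim: n k sk kr => [|n ih] k sk kr /=;
  (split; first exact: continuous_conv (smooth_continuous sk) kr) => // v.
split; first by move=> x; have [] := derivable_conv v x fl sk kr.
have -> : 'D_v (convol f k) = convol f ('D_v k).
  by apply/funext => x; have [] := derivable_conv v x fl sk kr.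
by apply: ih; [exact: smooth_derive|exact: csupp_derive].
Qed.

Lemma csupp_conv f k r s : csupp r f -> csupp s k -> csupp (r + s) (convol f k).
Proof.
move=> fr ks x xrs; rewrite /convol; under eq_Rintegral => y _.
  rewrite (_ : f y * _ = 0); last first.
    have [yr|yr] := leP `|y| r; last by rewrite fr// mul0r.
    rewrite ks ?mulr0//; have := ler_normD (x - y) y; rewrite subrK; lra.
  over.
by rewrite Rintegral_cst// mul0r.
Qed.

(** Convolving the constant 1 with [k] gives the constant [int k], whose derivative is both 0 and
    the integral of the derivative of [k]. *)
Lemma csupp_Rintegral_derive k r v : continuous k -> csupp r k ->
  (forall y, derivable k y v) -> continuous ('D_v k) ->
  \int[leb]_y 'D_v k y = 0.
Proof.
move=> ck kr dk cdk.
have l1 : L1loc (fun _ : V => 1 : R) by apply: (bounded_L1loc (C := 1)) => // y; rewrite normr1.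
have E (g : V -> R) : continuous g -> convol (fun=> 1) g = fun=> \int[leb]_y g y.
  move=> cg; apply/funext => x; rewrite convC//; last exact: continuous_measurable_rV.
  by apply: eq_Rintegral => y _; rewrite mul1r.
have := is_derive_conv 0 l1 ck kr dk cdk; rewrite !E// => -[_ <-].
exact: derive_cst.
Qed.

End convolution.

(** * Mollifiers and cutoffs *)

Section smooth_bump.
Context {R : realType}.

Lemma derive1_scale (f : R -> R) (x v df : R) : is_derive x (1 : R) f df -> is_derive x v f (v * df).
Proof.
move=> [fd <-]; have dff : differentiable f x by exact/derivable1_diffP.
split; first exact: diff_derivable.
by rewrite !deriveE// -[v in LHS]mulr1 -[v * 1]/(v *: (1 : R)) linearZ.
Qed.

Lemma is_Ck_derive1 k (f g : R -> R) :
  (forall x, is_derive x (1 : R) f (g x)) -> is_Ck k g -> is_Ck k.+1 f.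
Proof.
move=> fg kg; split.
  move=> x; apply: differentiable_continuous; apply/derivable1_diffP.
  by have [] := fg x.
move=> v; have H x := derive1_scale v (fg x); split; first by move=> x; have [] := H x.
rewrite (_ : 'D_v f = fun x => v * g x); first exact: is_CkZ.
by apply/funext => x; have [] := H x.
Qed.

Lemma is_Ck_inv {V : normedModType R} k (f : V -> R) :
  (forall x, f x != 0) -> is_Ck k f -> is_Ck k (fun x => (f x)^-1).
Proof.
move=> f0; elim: k => [|k ih] /= [cf df];
  (split; first by move=> x; apply: cvgV; [exact: f0|exact: cf]) => // v.
have [df1 df2] := df v; split; first by move=> x; exact: derivableV.
rewrite (_ : 'D_v _ = fun x => (-1) * ((f x)^-1 * ((f x)^-1 * 'D_v f x))); last first.
  by apply/funext => x; rewrite deriveV// mulN1r scaleNr /GRing.scale/= expr2 invfM mulrA.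
have kf : is_Ck k f by apply: (@is_Ck_le _ _ k k.+1); rewrite ?leqnSn.
by apply: is_CkZ; apply: is_CkM; [exact: ih|apply: is_CkM; [exact: ih|]].
Qed.

Lemma is_derive_pow k (y : R) : is_derive y (1 : R) (fun y => y ^+ k) (k%:R * y ^+ k.-1).
Proof.
have H := is_deriveX k (is_derive_id y (1 : R)).
have E : id ^+ k = (fun y : R => y ^+ k) by apply/funext => z; rewrite exprfctE.
by rewrite E in H; apply: (is_derive_eq H); rewrite /GRing.scale/= mulr1.
Qed.

(** The negative powers of [x] make the family closed under differentiation, so that one induction
    proves all members smooth. *)
Definition flat k (x : R) : R := if 0 < x then x^-1 ^+ k * expR (- x^-1) else 0.

Lemma flat_ge0 k x : 0 <= flat k x.
Proof.
rewrite /flat; case: ifPn => // x0.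
by rewrite mulr_ge0 ?expR_ge0// exprn_ge0// invr_ge0 ltW.
Qed.

Lemma flat_gt0 x : 0 < x -> 0 < flat 0 x.
Proof. by rewrite /flat => ->; rewrite expr0 mul1r expR_gt0. Qed.

Lemma flat_le0 k x : x <= 0 -> flat k x = 0.
Proof. by rewrite /flat ltNge => ->. Qed.

(** This is [y^(k+2) <= (k+2)! exp y] at [y = 1 / x]. A quadratic bound makes the derivative at the
    origin vanish. *)
Lemma flat_le k x : flat k x <= k.+2`!%:R * `|x| ^+ 2.
Proof.
rewrite /flat; case: ifPn => x0; last by rewrite mulr_ge0// exprn_ge0.
have y0 : 0 < x^-1 by rewrite invr_gt0.
have := @expR_ge1Dxn R x^-1 k.+1 (ltW y0) => H.
have f0 : 0 < k.+2`!%:R :> R by rewrite ltr0n fact_gt0.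
have {}H : x^-1 ^+ k.+2 <= k.+2`!%:R * expR x^-1.
  rewrite -ler_pdivrMl//; apply: le_trans H; rewrite mulrC.
  by rewrite lerDr.
rewrite gtr0_norm// expRN ler_pdivrMr ?expR_gt0//.
rewrite -(ler_pM2l (exprn_gt0 2 y0)) -exprD addnC addn2.
apply: le_trans H _; rewrite mulrA mulrCA -mulrA.
by rewrite -exprMn mulVf ?gt_eqF// expr1n mul1r.
Qed.

Lemma is_derive_flat k x :
  is_derive x (1 : R) (flat k) (- k%:R * flat k.+1 x + flat k.+2 x).
Proof.
have [x0|x0|<-] := ltgtP 0 x.
- pose F (y : R) := y ^+ k * expR (- y).
  have dF y : is_derive y (1 : R) F (k%:R * y ^+ k.-1 * expR (- y) - y ^+ k * expR (- y)).
    have h1 := is_derive_pow k y.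
    apply: is_derive_eq; rewrite /GRing.scale/=; ring.
  have dV : is_derive x (1 : R) (fun y => y^-1) (- x ^- 2).
    have xn0 : x != 0 by rewrite gt_eqF.
    have := is_deriveV xn0 (is_derive_id x (1 : R)).
    by rewrite [X in is_derive _ _ _ X]mulr1.
  apply: (near_eq_is_derive (f := F \o (fun y => y^-1))).
    near=> y; rewrite /F /flat /= ifT//; near: y; exact: lt_nbhsr.
  apply: (is_derive_eq (is_derive1_comp (dF _) dV)).
  rewrite /flat x0; have xn0 : x != 0 by rewrite gt_eqF.
  rewrite -exprVn; move: (expR (- x^-1)) => E; move: (x^-1) => y.
  by case: k {F dF} => [|k]; rewrite /= ?mulr0n ?exprS; [ring|move: (y ^+ k) (k.+1%:R) => a c; ring].
- rewrite /flat !ifF ?mulr0 ?addr0; [|exact: lt_gtF..].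
  apply: derive_near0; near=> y; rewrite ifF//; apply: lt_gtF; near: y; exact: lt_nbhsl.
- rewrite !flat_le0// mulr0 addr0.
  have H : (fun h : R => h^-1 *: ((flat k \o shift 0) (h *: 1) - flat k 0)) @ 0^' --> 0.
    apply/cvgr0Pnorm_le => e e0.
    have f0 : 0 < k.+2`!%:R :> R by rewrite ltr0n fact_gt0.
    near=> h; rewrite /= addr0 (flat_le0 _ (lexx 0)) subr0 /GRing.scale/= mulr1.
    have h0 : h != 0 by near: h; exact: nbhs_dnbhs_neq.
    rewrite normrM normfV [`|flat _ _|]ger0_norm ?flat_ge0// ler_pdivrMl ?normr_gt0//.
    apply: le_trans (flat_le k h) _; rewrite expr2 mulrCA ler_wpM2l//.
    rewrite -ler_pdivlMl// mulrC.
    near: h; apply: dnbhs0_le; exact: divr_gt0.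
  by split; [apply/cvg_ex; exists 0|exact/cvg_lim].
Unshelve. all: by end_near. Qed.

Lemma smooth_flat k : smooth (flat k).
Proof.
move=> n; elim: n k => [|n ih] k.
  split=> // x; apply: differentiable_continuous; apply/derivable1_diffP.
  by have [] := is_derive_flat k x.
apply: (is_Ck_derive1 (is_derive_flat k)); apply: is_CkD; last exact: ih.
exact: is_CkZ.
Qed.

Lemma smooth_comp_affine {V W : normedModType R} (g : W -> R) (L : V -> W) (M : V -> W) :
  continuous L -> (forall x v h, L (h *: v + x) = h *: M v + L x) ->
  smooth g -> smooth (g \o L).
Proof. by move=> cL LM sg k; apply: is_Ck_affine => //; exact: sg. Qed.

(** The denominator is positive because [x] and [1 - x] are never both nonpositive; the quotient is
    0 left of 0 and 1 right of 1. *)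
Definition smooth_step (x : R) := flat 0 x * (flat 0 x + flat 0 (1 - x))^-1.

Let den_gt0 x : 0 < flat 0 x + flat 0 (1 - x).
Proof.
have [x0|x0] := ltP 0 x; first by rewrite ltr_pwDl ?flat_gt0 ?flat_ge0.
by rewrite ltr_wpDl ?flat_ge0// flat_gt0//; lra.
Qed.

Lemma smooth_smooth_step : smooth smooth_step.
Proof.
move=> k; apply: is_CkM; first exact: smooth_flat.
apply: is_Ck_inv; first by move=> x; rewrite gt_eqF// den_gt0.
apply: is_CkD; first exact: smooth_flat.
apply: (@smooth_comp_affine _ _ (flat 0) (fun x : R => 1 - x) (fun v : R => - v)).
- by move=> x; apply: continuousB; [exact: cst_continuous|exact: cvg_id].
- by move=> x v h; rewrite /GRing.scale/=; ring.
- exact: smooth_flat.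
Qed.

Lemma smooth_step_ge0 x : 0 <= smooth_step x.
Proof. by rewrite mulr_ge0 ?flat_ge0// invr_ge0 ltW. Qed.

Lemma smooth_step_le1 x : smooth_step x <= 1.
Proof. by rewrite ler_pdivrMr// mul1r lerDl flat_ge0. Qed.

Lemma smooth_step0 x : x <= 0 -> smooth_step x = 0.
Proof. by move=> x0; rewrite /smooth_step flat_le0// mul0r. Qed.

Lemma smooth_step1 x : 1 <= x -> smooth_step x = 1.
Proof.
move=> x1; rewrite /smooth_step [flat 0 (1 - x)]flat_le0 ?subr_le0// addr0 divff//.
by rewrite gt_eqF// flat_gt0// (lt_le_trans ltr01).
Qed.

End smooth_bump.

Section mollifier.
Context {R : realType} {d : nat}.
Local Notation V := 'rV[R]_d.
Local Notation leb := (lebesgue_rV d : {measure set V -> \bar R}).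
Implicit Types (x y z v : V).

Lemma smooth_coord_affine (g : R -> R) (a b : R) (i : 'I_d) :
  smooth g -> smooth (fun z : V => g (a + b * z 0 i)).
Proof.
move=> sg; apply: (@smooth_comp_affine R V R g (fun z : V => a + b * z 0 i) (fun z => b * z 0 i)) => //.
- move=> z; have h : y 0 i @[y --> z] --> z 0 i by exact: coord_continuous.
  exact: (cvgD (cvg_cst a) (cvgM (cvg_cst b) h)).
- by move=> x v h; rewrite !mxE /GRing.scale/=; ring.
Qed.

Lemma smoothM (W : normedModType R) (f g : W -> R) : smooth f -> smooth g -> smooth (fun x : W => f x * g x).
Proof. by move=> sf sg k; exact: is_CkM. Qed.

Lemma smooth_prod (W : normedModType R) (F : 'I_d -> W -> R) :
  (forall i, smooth (F i)) -> smooth (fun x : W => \prod_i F i x).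
Proof. by move=> sF k; apply: is_Ck_prod => i; exact: sF. Qed.

Lemma rV_norm_gt (z : V) (r : R) : 0 <= r -> r < `|z| -> exists i, r < `|z 0 i|.
Proof.
move=> r0; rewrite ltNge => /negP H; apply: contrapT => /forallNP h; apply: H.
by apply/rV_normP => // i; rewrite leNgt; apply/negP; exact: h.
Qed.

(** A product over the coordinates because the norm of row vectors is the maximum norm: the ball of
    radius [1 / (n + 1)] is a cube. *)
Definition bump (n : nat) z : R :=
  \prod_i (flat 0 (1 + n.+1%:R * z 0 i) * flat 0 (1 + - n.+1%:R * z 0 i)).

Lemma bump_ge0 n z : 0 <= bump n z.
Proof. by apply: prodr_ge0 => i _; rewrite mulr_ge0 ?flat_ge0. Qed.

Lemma bump_gt0 n z : `|z| <= 2^-1 * n.+1%:R^-1 -> 0 < bump n z.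
Proof.
move=> zn; apply: prodr_gt0 => i _.
have zi : `|z 0 i| <= 2^-1 * n.+1%:R^-1 by apply: le_trans zn; exact: rV_coord_le.
have n0 : 0 < n.+1%:R :> R by [].
have : `|n.+1%:R * z 0 i| <= 2^-1.
  by rewrite normrM gtr0_norm// mulrC -ler_pdivlMr.
rewrite ler_norml => /andP[a b].
by rewrite mulr_gt0// flat_gt0//; lra.
Qed.

Lemma bumpN n z : bump n (- z) = bump n z.
Proof. by apply: eq_bigr => i _; rewrite !mxE !mulrN !mulNr opprK mulrC. Qed.

Lemma smooth_bump n : smooth (bump n).
Proof.
by apply: smooth_prod => i; apply: smoothM; apply: smooth_coord_affine; exact: smooth_flat.
Qed.

Lemma csupp_bump n : csupp n.+1%:R^-1 (bump n).
Proof.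
move=> z zn; have n0 : 0 < n.+1%:R :> R by [].
have [i zi] : exists i, n.+1%:R^-1 < `|z 0 i| by apply: rV_norm_gt => //; rewrite invr_ge0.
rewrite /bump (bigD1 i)//=.
suff -> : flat 0 (1 + n.+1%:R * z 0 i) * flat 0 (1 + - n.+1%:R * z 0 i) = 0 by rewrite mul0r.
have : 1 <= `|n.+1%:R * z 0 i|.
  by rewrite normrM gtr0_norm// mulrC -ler_pdivrMr// mul1r ltW.
rewrite ler_normr => /orP[h|h].
  by rewrite [X in _ * X]flat_le0 ?mulr0// mulNr; lra.
by rewrite flat_le0 ?mul0r//; lra.
Qed.

Lemma measure_ball_rV_gt0 (r : R) : 0 < r -> (0 < leb [set x : V | (`|x| <= r)%R])%E.
Proof.
move=> r0.
have mA (i : 'I_d) : measurable (`[- r, r]%classic : set R) by exact: measurable_itv.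
have -> : leb [set x : V | `|x| <= r] = (\prod_(i < d) lebesgue_measure (`[(- r)%R, r]%classic : set R))%E.
  rewrite -(lebesgue_rV_box mA); congr (lebesgue_rV d _).
  apply/seteqP; split => x /=.
    by move=> /(rV_normP x (ltW r0)) h i; rewrite in_itv/= -ler_norml.
  by move=> h; apply/(rV_normP x (ltW r0)) => i; have := h i; rewrite in_itv/= -ler_norml.
elim/big_ind : _ => //.
- by move=> x y; exact: mule_gt0.
- by move=> i _; rewrite lebesgue_measure_itv/= lte_fin gtrN// -EFinB lte_fin opprK addr_gt0.
Qed.

Lemma rint_csupp (k : V -> R) r : continuous k -> csupp r k -> rint leb setT k.
Proof.
move=> ck kr.
have l1 : L1loc (fun _ : V => 1 : R) by apply: (bounded_L1loc (C := 1)) => // y; rewrite normr1.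
have := rint_mul_csupp l1 ck kr; congr (rint _ _ _).
by apply/funext => y; rewrite mul1r.
Qed.

Lemma Rintegral_bump_gt0 n : 0 < \int[leb]_z bump n z.
Proof.
have bi : rint leb setT (bump n).
  exact: rint_csupp (smooth_continuous (@smooth_bump n)) (@csupp_bump n).
rewrite lt_neqAle Rintegral_ge0 ?andbT//; last by move=> z _; exact: bump_ge0.
apply/eqP => /esym I0.
have : (\int[leb]_z `|(bump n z)%:E| = 0)%E.
  under eq_integral => z _ do rewrite gee0_abs ?lee_fin ?bump_ge0//.
  by rewrite -(rint_EFin measurableT bi) I0.
have mb : measurable_fun setT (EFin \o bump n) by apply/measurable_EFinP; exact: rint_meas bi.
move=> /(ae_eq_integral_abs _ measurableT mb).1 [N [mN N0 sN]].
(* The bump is positive on the ball of half the radius of its support, and a ball of positive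
   measure does not fit into the null set [N]. *)
pose r : R := 2^-1 * n.+1%:R^-1.
have : (leb [set x : V | (`|x| <= r)%R] <= leb N)%E.
  apply: le_measure; rewrite ?inE//; first exact: measurable_ball_rV.
  move=> x /= xr; apply: sN => /= /(_ Logic.I) [] /eqP.
  by rewrite gt_eqF// bump_gt0.
by rewrite N0 leNgt measure_ball_rV_gt0// mulr_gt0.
Qed.

Definition mollifier n z := (\int[leb]_z bump n z)^-1 * bump n z.

Lemma smooth_mollifier n : smooth (mollifier n).
Proof. by move=> k; apply: is_CkZ; exact: smooth_bump. Qed.

Lemma csupp_mollifier n : csupp n.+1%:R^-1 (mollifier n).
Proof. by move=> z zn; rewrite /mollifier csupp_bump// mulr0. Qed.

Lemma mollifier_ge0 n z : 0 <= mollifier n z.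
Proof. by rewrite mulr_ge0 ?bump_ge0// invr_ge0 ltW// Rintegral_bump_gt0. Qed.

Lemma mollifierN n z : mollifier n (- z) = mollifier n z.
Proof. by rewrite /mollifier bumpN. Qed.

Lemma Rintegral_mollifier n : \int[leb]_z mollifier n z = 1.
Proof.
rewrite RintegralZl// ?mulVf//; first by rewrite gt_eqF// Rintegral_bump_gt0.
exact: rint_csupp (smooth_continuous (@smooth_bump n)) (@csupp_bump n).
Qed.

(** Equal to 1 on the cube [|z| <= 1] and to 0 for [|z| > 2]. *)
Definition cutoff1 (z : V) : R :=
  \prod_i (smooth_step (2 + 1 * z 0 i) * smooth_step (2 + -1 * z 0 i)).

Definition cutoff (N : nat) (z : V) : R := cutoff1 (N.+1%:R^-1 *: z).

Lemma smooth_cutoff1 : smooth cutoff1.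
Proof.
by apply: smooth_prod => i; apply: smoothM; apply: smooth_coord_affine; exact: smooth_smooth_step.
Qed.

Lemma csupp_cutoff1 : csupp 2 cutoff1.
Proof.
move=> z zn.
have [i zi] : exists i, 2 < `|z 0 i| by apply: rV_norm_gt.
rewrite /cutoff1 (bigD1 i)//=.
suff -> : smooth_step (2 + 1 * z 0 i) * smooth_step (2 + -1 * z 0 i) = 0 by rewrite mul0r.
move: zi; rewrite ltNge ler_norml negb_and -!ltNge => /orP[h|h].
  by rewrite smooth_step0 ?mul0r//; lra.
by rewrite [X in _ * X]smooth_step0 ?mulr0//; lra.
Qed.

Lemma cutoff1_ge0 z : 0 <= cutoff1 z.
Proof. by apply: prodr_ge0 => i _; rewrite mulr_ge0 ?smooth_step_ge0. Qed.

Lemma cutoff1_le1 z : cutoff1 z <= 1.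
Proof.
apply: prodr_ile1 => i _; rewrite mulr_ge0 ?smooth_step_ge0//=.
by rewrite mulr_ile1 ?smooth_step_ge0 ?smooth_step_le1.
Qed.

Lemma cutoff1_1 z : `|z| <= 1 -> cutoff1 z = 1.
Proof.
move=> z1; rewrite /cutoff1 big1// => i _.
have : `|z 0 i| <= 1 by apply: le_trans z1; exact: rV_coord_le.
by rewrite ler_norml => /andP[a b]; rewrite !smooth_step1 ?mulr1//; lra.
Qed.

Lemma smooth_cutoff N : smooth (cutoff N).
Proof.
apply: (@smooth_comp_affine R V V cutoff1 ( *:%R N.+1%:R^-1) ( *:%R N.+1%:R^-1)).
- exact: scaler_continuous.
- by move=> x v h; rewrite scalerDr !scalerA mulrC.
- exact: smooth_cutoff1.
Qed.

Lemma cutoff_ge0 N z : 0 <= cutoff N z. Proof. exact: cutoff1_ge0. Qed.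
Lemma cutoff_le1 N z : cutoff N z <= 1. Proof. exact: cutoff1_le1. Qed.

Lemma normZ_cutoff N z : `|N.+1%:R^-1 *: z| = `|z| / N.+1%:R.
Proof. by rewrite normrZ ger0_norm ?invr_ge0// mulrC. Qed.

Lemma csupp_cutoff N : csupp (2 * N.+1%:R) (cutoff N).
Proof. by move=> z zn; rewrite /cutoff csupp_cutoff1// normZ_cutoff ltr_pdivlMr. Qed.

Lemma cutoff_1 N z : `|z| <= N.+1%:R -> cutoff N z = 1.
Proof. by move=> zn; rewrite /cutoff cutoff1_1// normZ_cutoff ler_pdivrMr// mul1r. Qed.

Lemma partial_cutoff N i z : partial i (cutoff N) z = N.+1%:R^-1 * partial i cutoff1 (N.+1%:R^-1 *: z).
Proof.
set c : R := N.+1%:R^-1.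
have [_ <-//] : is_derive z (delta_mx 0 i) (cutoff N) (c * partial i cutoff1 (c *: z)).
apply: (@is_derive_comp_affine _ _ _ cutoff1 ( *:%R c) ( *:%R c)).
  by move=> h; rewrite scalerDr !scalerA mulrC.
apply: is_derive_dirZ; apply/derivableP.
exact: smooth_derivable smooth_cutoff1.
Qed.

(** The scaling contributes the factor [1 / (N + 1)]; summing the bounds of the single partial
    derivatives gives one constant for all of them. *)
Lemma partial_cutoff_le : exists2 C : R, 0 <= C &
  forall N i z, `|partial i (cutoff N) z| <= C / N.+1%:R.
Proof.
have H (i : 'I_d) : exists2 C : R, 0 <= C & forall z, `|partial i cutoff1 z| <= C.
  apply: csupp_bounded (csupp_derive _ csupp_cutoff1).
  exact: smooth_continuous (smooth_derive _ smooth_cutoff1).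
have /choice[C HC] : forall i : 'I_d, exists C : R, 0 <= C /\ forall z, `|partial i cutoff1 z| <= C.
  by move=> i; have [C C0 h] := H i; exists C.
exists (\sum_i C i); first by apply: sumr_ge0 => i _; have [] := HC i.
move=> N i z; rewrite partial_cutoff normrM ger0_norm ?invr_ge0// mulrC ler_wpM2r ?invr_ge0//.
have [_ h] := HC i; apply: le_trans (h _) _.
by rewrite (bigD1 i)//= lerDl sumr_ge0// => j _; have [] := HC j.
Qed.

End mollifier.

(** * Dominated convergence controlled by L^1 distances *)

Section generalized_dct.
Context d0 (T : measurableType d0) (R : realType) (mu : {measure set T -> \bar R}).
Implicit Types (D F : nat -> T -> R) (f h : T -> R).

Local Notation mint := (rint mu setT).

(** Along [s] the integrals are at most [2^-k], so the series of the [D (s k)] has an integrable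
    sum. This sum is the dominating function, and where it is finite the terms tend to 0. *)
Lemma L1_cvg0_subseq D : (forall n, mint (D n)) -> (forall n x, 0 <= D n x) ->
  \int[mu]_x D n x @[n --> \oo] --> 0 ->
  exists s : nat -> nat, exists2 g : T -> R, mint g &
    {ae mu, forall x, (forall k, D (s k) x <= g x) /\ D (s k) x @[k --> \oo] --> 0}.
Proof.
move=> Di D0 Dc.
have e0 k : 0 < 2^-1 ^+ k :> R by exact: exprn_gt0.
have /choice[s sH] : forall k, exists n, \int[mu]_x D n x <= 2^-1 ^+ k.
  move=> k; have /cvgr0Pnorm_le/(_ _ (e0 k))[n _ /(_ n (leqnn n)) h] := Dc.
  by exists n; apply: le_trans h; exact: ler_norm.
exists s.
pose G x := (\sum_(0 <= k <oo) (D (s k) x)%:E)%E.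
have G0 x : (0 <= G x)%E by apply: nneseries_ge0 => k _ _; rewrite lee_fin.
have mG : measurable_fun setT G.
  apply: ge0_emeasurable_sum => // k; first by move=> x _ _; rewrite lee_fin.
  by move=> _; apply/measurable_EFinP; exact: rint_meas (Di _).
have Goo : (\int[mu]_x G x < +oo)%E.
  rewrite integral_nneseries//; [|by move=> k; apply/measurable_EFinP; exact: rint_meas (Di _)
    |by move=> k x _; rewrite lee_fin].
  apply: (@le_lt_trans _ _ (\sum_(0 <= k <oo) (2^-1 ^+ k : R)%:E)%E).
    apply: lee_nneseries => k _; first by move=> _; apply: integral_ge0 => x _; rewrite lee_fin.
    by rewrite -(rint_EFin measurableT (Di _)) lee_fin.
  have -> : (\sum_(0 <= k <oo) (2^-1 ^+ k : R)%:E)%E = (2%:E : \bar R); last exact: ltry.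
  apply/cvg_lim => //.
  rewrite (_ : (fun n => \sum_(0 <= k < n) (2^-1 ^+ k : R)%:E)%E = EFin \o (series (geometric 1 (2^-1 : R)))).
    apply: cvg_EFin; first exact: nearW.
    have := @cvg_geometric_series R 1 2^-1.
    rewrite ger0_norm// => /(_ ltac:(lra)).
    have -> : 1 - 2^-1 = 2^-1 :> R by lra.
    by rewrite div1r invrK.
  apply/funext => n /=; rewrite /series/= -sumEFin; apply: eq_bigr => k _.
  by rewrite mul1r.
have Gi : mu.-integrable setT G.
  by apply/integrableP; split => //; under eq_integral do rewrite gee0_abs//.
exists (fine \o G).
  apply/integrableP; split.
    by apply/measurable_EFinP; exact: measurableT_comp.
  have /integrableP[_] := Gi; apply: le_lt_trans; apply: ge0_le_integral => //.
  - by apply: measurableT_comp => //; apply/measurable_EFinP; exact: measurableT_comp.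
  - exact: measurableT_comp.
  - move=> x _ /=; rewrite (gee0_abs (G0 x)).
    case: (G x) (G0 x) => [r| |]//=; rewrite ?lee_fin => r0; first by rewrite ger0_norm.
    by rewrite normr0 leey.
have := integrable_ae measurableT Gi; apply: filterS => x /(_ Logic.I) Gfin.
have part n : \sum_(0 <= k < n) D (s k) x <= fine (G x).
  rewrite -lee_fin fineK// -sumEFin.
  apply: (@nneseries_lim_ge _ (fun k => (D (s k) x)%:E) xpredT 0 n) => k _ _.
  by rewrite lee_fin.
split=> [k|].
  apply: le_trans (part k.+1); rewrite big_nat_recr//= lerDr.
  exact: sumr_ge0.
apply: cvg_series_cvg_0.
apply: nondecreasing_is_cvgn.
  by apply/nondecreasing_seqP => n; rewrite /series/= big_nat_recr//= lerDl.
by exists (fine (G x)) => _ [n _ <-]; exact: part.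
Qed.

Lemma L1_cvg0D D1 D2 : (forall n, mint (D1 n)) -> (forall n, mint (D2 n)) ->
  \int[mu]_x D1 n x @[n --> \oo] --> 0 -> \int[mu]_x D2 n x @[n --> \oo] --> 0 ->
  (forall n, mint (fun x => D1 n x + D2 n x)) /\
  \int[mu]_x (D1 n x + D2 n x) @[n --> \oo] --> 0.
Proof.
move=> i1 i2 c1 c2; split; first by move=> n; exact: rintD.
rewrite (_ : (fun n => _) = fun n => \int[mu]_x D1 n x + \int[mu]_x D2 n x).
  by rewrite -[0 in X in _ --> X]addr0; exact: cvgD.
by apply/funext => n; rewrite (RintegralD measurableT (i1 n) (i2 n)).
Qed.

(* Dominated convergence where a.e. convergence is replaced by a sequence [D]
   of "distances" tending to 0 in L^1, which controls both the domination and
   the pointwise limit. *)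
Lemma Rintegral_dct_L1 D F f h (C : R) :
  (forall n, mint (D n)) -> (forall n x, 0 <= D n x) ->
  \int[mu]_x D n x @[n --> \oo] --> 0 ->
  (forall n, measurable_fun setT (F n)) -> measurable_fun setT f -> mint h -> 0 <= C ->
  (forall n x, `|F n x| <= h x + C * D n x) ->
  (forall x (s : nat -> nat), D (s k) x @[k --> \oo] --> 0 -> F (s k) x @[k --> \oo] --> f x) ->
  mint f /\ \int[mu]_x F n x @[n --> \oo] --> \int[mu]_x f x.
Proof.
move=> Di D0 Dc mF mf hi C0 Fh Ff.
have sub (phi : nat -> nat) : (forall n, (n <= phi n)%N) -> exists s : nat -> nat,
    mint f /\ \int[mu]_x F (phi (s k)) x @[k --> \oo] --> \int[mu]_x f x.
  move=> phin.
  have Dphi : \int[mu]_x D (phi n) x @[n --> \oo] --> 0.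
    apply: (cvg_comp phi _ _ Dc) => A [N _ NA]; exists N => // n /= Nn.
    by apply: NA => /=; exact: leq_trans (phin n).
  have [s [g gi ag]] := L1_cvg0_subseq (fun n => Di (phi n)) (fun n => D0 (phi n)) Dphi.
  exists s; apply: (@Rintegral_dct _ _ _ mu setT measurableT (fun k => F (phi (s k))) f (fun x => h x + C * g x)) => //.
  - by apply: rintD => //; exact: rintZ.
  - by move: ag; apply: filterS => x [_ Dx] _; exact: (Ff x (phi \o s)).
  - move: ag; apply: filterS => x [Dx _] _ k; apply: le_trans (Fh _ _) _.
    by rewrite lerD2l ler_wpM2l.
have [_ [fi _]] := sub id (fun n => leqnn n).
split => //; apply: contrapT => nc.
have [e e0 He] : exists2 e : R, 0 < e & forall N, exists n,
    (N <= n)%N /\ e <= `|\int[mu]_x f x - \int[mu]_x F n x|.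
  apply: contrapT => /forall2NP H; apply: nc; apply/cvgrPdist_lt => e e0.
  have [//|/existsNP[N /forallNP HN]] := H e.
  exists N => // n /= Nn; rewrite ltNge; apply/negP => en.
  by apply: (HN n).
have /choice[phi phiH] := He.
have [s [_ /cvgrPdist_lt/(_ e e0) [k _ /(_ k (leqnn k))]]] := sub phi (fun n => (phiH n).1).
by rewrite ltNge (phiH (s k)).2.
Qed.

End generalized_dct.

(** * Convergence of mollifications in L^1 *)

Section mollification.
Context {R : realType} {d : nat}.
Local Notation V := 'rV[R]_d.
Local Notation leb := (lebesgue_rV d : {measure set V -> \bar R}).
Implicit Types (f g k : V -> R) (x y z v : V).

Lemma measurable_sub_rV : measurable_fun setT (fun p : V * V => p.1 - p.2).
Proof.
apply: measurable_fun_rV => i; under eq_fun do rewrite !mxE.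
by apply: measurable_funB; [exact: (measurableT_comp (measurable_coord i) measurable_fst)|
  exact: (measurableT_comp (measurable_coord i) measurable_snd)].
Qed.

(** As [k] has integral 1, [f * k - f] is the [k]-average of the differences [f (x - z) - f x].
    Tonelli bounds its L^1 norm by the [k]-average of the translation errors, to which only
    [|z| <= delta] contributes. *)
Lemma conv_L1_le f k (delta e : R) : rint leb setT f -> continuous k -> csupp delta k ->
  (forall z, 0 <= k z) -> \int[leb]_z k z = 1 -> 
  (forall z, `|z| <= delta -> \int[leb]_x `|f (- z + x) - f x| <= e) ->
  rint leb setT (fun x => `|convol f k x - f x|) /\ \int[leb]_x `|convol f k x - f x| <= e.
Proof.
move=> fi ck kd k0 k1 H; have fl := rint_L1loc fi; have mf := rint_meas fi.
have mk : measurable_fun setT k by exact: continuous_measurable_rV.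
have ki : rint leb setT k by exact: rint_csupp ck kd.
pose W (p : V * V) : \bar R := (`|f (p.1 - p.2) - f p.1| * k p.2)%:E.
have W0 p : (0 <= W p)%E by rewrite lee_fin mulr_ge0.
have mW : measurable_fun setT W.
  apply/measurable_EFinP; apply: measurable_funM; last exact: measurableT_comp.
  apply: measurableT_comp => //; apply: measurable_funB; last exact: measurableT_comp.
  by apply: measurableT_comp => //; exact: measurable_sub_rV.
have mc : measurable_fun setT (fun x => `|convol f k x - f x|).
  apply: measurableT_comp => //; apply: measurable_funB => //.
  by apply: continuous_measurable_rV; exact: continuous_conv ck kd.
have key : (\int[leb]_x (`|convol f k x - f x|)%:E <= e%:E)%E.
  apply: (@le_trans _ _ (\int[leb]_x \int[leb]_z W (x, z))%E).
    apply: ge0_le_integral => //.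
    - exact/measurable_EFinP.
    - have := @measurable_fun_fubini_tonelli_F _ _ _ _ R (lebesgue_rV d) _ mW W0.
      exact.
    - move=> x _; rewrite convC//.
      have h1 : rint leb setT (fun z => f (x - z) * k z).
        have := rint_affine true x (rint_conv x fl ck kd).
        congr (rint _ _ _); apply/funext => z; rewrite subKr//.
      have h2 : rint leb setT (fun z => f x * k z) by exact: rintZ.
      have h3 : rint leb setT (fun z => `|f (x - z) - f x| * k z).
        have := rint_abs (rintB measurableT h1 h2).
        congr (rint _ _ _); apply/funext => z.
        by rewrite -mulrBl normrM (ger0_norm (k0 z)).
      rewrite -(rint_EFin measurableT h3) lee_fin.
      have -> : \int[leb]_z (f (x - z) * k z) - f x = \int[leb]_z (f (x - z) * k z - f x * k z).
        by rewrite RintegralB// RintegralZl// k1 mulr1.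
      apply: Rintegral_abs_le => //; first exact: rintB.
      by move=> z _; rewrite -mulrBl normrM (ger0_norm (k0 z)).
  rewrite (@fubini_tonelli _ _ _ _ R (lebesgue_rV d) (lebesgue_rV d) W mW W0).
  apply: (@le_trans _ _ (\int[leb]_z (e * k z)%:E)%E); last first.
    by rewrite -(rint_EFin measurableT (rintZ measurableT e ki)) RintegralZl// k1 mulr1.
  apply: ge0_le_integral => //.
  - by move=> z _; exact: integral_ge0.
  - have := @measurable_fun_fubini_tonelli_G _ _ _ _ R (lebesgue_rV d) _ mW W0.
    exact.
  - by apply/measurable_EFinP; exact: measurable_funM.
  move=> z _; rewrite /W/=.
  have [zd|zd] := leP `|z| delta; last first.
    under eq_integral do rewrite kd// mulr0.
    by rewrite integral0 kd// mulr0.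
  have ti : rint leb setT (fun x => `|f (x - z) - f x|).
    apply: rint_abs; apply: rintB => //.
    have := rint_affine false (- z) fi.
    by congr (rint _ _ _); apply/funext => x; rewrite addrC.
  rewrite -(rint_EFin measurableT (rintZr measurableT (k z) ti)) lee_fin RintegralZr//.
  rewrite ler_wpM2r//; apply: le_trans (H z zd).
  by rewrite le_eqVlt; apply/orP; left; apply/eqP/eq_Rintegral => x _; rewrite (addrC x).
have ii : rint leb setT (fun x => `|convol f k x - f x|).
  by apply/rint_ge0P => //; apply: le_lt_trans key _; exact: ltry.
by split => //; rewrite -lee_fin rint_EFin.
Qed.

Lemma mollify_L1 f : rint leb setT f ->
  (forall n, rint leb setT (fun x => `|convol f (mollifier n) x - f x|)) /\
  \int[leb]_x `|convol f (mollifier n) x - f x| @[n --> \oo] --> 0.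
Proof.
move=> fi; have [_ tc] := rint_tcont fi.
have ck n := smooth_continuous (@smooth_mollifier R d n).
have L n e := @conv_L1_le f (mollifier n) n.+1%:R^-1 e fi (ck n)
  (@csupp_mollifier R d n) (@mollifier_ge0 R d n) (@Rintegral_mollifier R d n).
split.
  (* Integrability at a fixed [n] follows from the crude bound of every translation error by twice
     the L^1 norm of [f]. *)
  move=> n; pose e := \int[leb]_x `|f x| + \int[leb]_x `|f x|.
  apply: (L n e _).1 => z _.
  have tz := rint_affine false (- z) fi.
  have Ez : \int[leb]_x `|f (- z + x)| = \int[leb]_x `|f x|.
    exact: (Rintegral_affine false (- z) (rint_meas (rint_abs fi))).
  apply: (@le_trans _ _ (\int[leb]_x (`|f (- z + x)| + `|f x|))); last first.
    by rewrite RintegralD// ?Ez//; [exact: (rint_abs tz)|exact: rint_abs].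
  apply: le_Rintegral => //.
  - by apply: rint_abs; exact: rintB.
  - by apply: rintD => //; [exact: (rint_abs tz)|exact: rint_abs].
  - by move=> x _; exact: ler_normB.
apply/cvgr0Pnorm_le => e e0.
have [r /= r0 rH] := (nbhs_ballP _ _).1 (tc e e0).
near=> n; rewrite ger0_norm; last exact: Rintegral_ge0.
apply: (L n e _).2 => z zn.
apply: (rH (- z)); rewrite -ball_normE /ball_/= sub0r opprK.
apply: le_lt_trans zn _; near: n; exact: (near_infty_natSinv_lt (PosNum r0)).
Unshelve. all: by end_near. Qed.

(** The mollifiers are supported in [|z| <= 1], so on the ball of radius [r] only the values of [f]
    on the ball of radius [r + 1] matter, and [mollify_L1] applies to the truncation. *)
Lemma mollify_L1loc f r : L1loc f ->
  (forall n, rint leb setT (fun x => `|convol f (mollifier n) x - f x| * \1_[set x | `|x| <= r] x)) /\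
  \int[leb]_x (`|convol f (mollifier n) x - f x| * \1_[set x | `|x| <= r] x) @[n --> \oo] --> 0.
Proof.
move=> fl; have [mf fi] := (L1locP f).1 fl.
pose f' y := f y * \1_[set y : V | `|y| <= r + 1] y.
have [i' c'] := mollify_L1 (fi (r + 1)).
have ck n := smooth_continuous (@smooth_mollifier R d n).
have E n x : `|x| <= r -> convol f (mollifier n) x - f x = convol f' (mollifier n) x - f' x.
  move=> xr; congr (_ - _); last first.
    by rewrite /f' indicE mem_set ?mulr1//=; lra.
  apply: eq_Rintegral => y _; rewrite /f' indicE.
  have [yr|yr] := leP `|y| (r + 1); first by rewrite mem_set ?mulr1.
  rewrite [mollifier _ _]csupp_mollifier ?mulr0//.
  have := ler_normB x (x - y); rewrite subKr => H.
  have n1 : n.+1%:R^-1 <= 1 :> R by rewrite invf_le1 ?ler1n.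
  by apply: (le_lt_trans n1); lra.
have m1 : measurable_fun setT (fun x : V => \1_[set x : V | `|x| <= r] x : R).
  by apply: measurable_indic; exact: measurable_ball_rV.
have le n x : `|convol f (mollifier n) x - f x| * \1_[set x | `|x| <= r] x <=
    `|convol f' (mollifier n) x - f' x|.
  rewrite indicE; have [xr|xr] := boolP (x \in _); last by rewrite mulr0.
  by rewrite mulr1 E//; move: xr; rewrite inE.
have ii n : rint leb setT (fun x => `|convol f (mollifier n) x - f x| * \1_[set x | `|x| <= r] x).
  apply: (rint_le measurableT _ (i' n)).
    apply: measurable_funM => //; apply: measurableT_comp => //; apply: measurable_funB => //.
    apply: continuous_measurable_rV; exact: (continuous_conv fl (ck n) (@csupp_mollifier R d n)).
  by move=> x _; rewrite [X in X <= _]ger0_norm ?mulr_ge0//; exact: le.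
split => //.
apply: (@squeeze_cvgr _ _ _ _ (fun=> 0) (fun n => \int[leb]_x `|convol f' (mollifier n) x - f' x|)) => //.
- apply: nearW => n; apply/andP; split; first by apply: Rintegral_ge0 => x _; rewrite mulr_ge0.
  by apply: (le_Rintegral measurableT (ii n) (i' n)) => x _; exact: le.
- exact: cvg_cst.
Qed.

End mollification.

(** * Weak gradients *)

Section weak_gradients.
Context {R : realType} {d : nat}.
Local Notation V := 'rV[R]_d.
Local Notation leb := (lebesgue_rV d : {measure set V -> \bar R}).
Implicit Types (f g : V -> R) (G : V -> V) (x y z v : V).

Lemma ae_ball (P : V -> Prop) :
  (forall n : nat, {ae leb, forall y, `|y| <= n%:R -> P y}) -> {ae leb, forall y, P y}.
Proof.
move=> H; apply: (@negligibleS _ _ _ leb _ _ _ (negligible_bigcup H)) => y /= nP.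
exists (Num.truncn `|y|).+1 => //= H1; apply: nP; apply: H1.
by rewrite ltW// Num.Theory.truncnS_gt.
Qed.

Lemma csupp_reflect_test (k : V -> R) r x : smooth k -> csupp r k ->
  test_function setT (fun y => k (x - y)).
Proof.
move=> sk kr; apply: (csupp_test_function (r := `|x| + r)); last exact: csupp_reflect.
apply: (@smooth_comp_affine R V V k (fun y => x - y) (fun v => - v)) => //.
- by move=> y; apply: continuousB; [exact: cst_continuous|exact: cvg_id].
- by move=> y v h; rewrite opprD scalerN addrCA.
Qed.

Lemma partial_reflect (k : V -> R) i x y : smooth k ->
  partial i (fun y => k (x - y)) y = - partial i k (x - y).
Proof.
move=> sk; rewrite -mulN1r.
have [_ <-//] : is_derive y (delta_mx 0 i) (k \o (fun y => x - y)) (-1 * partial i k (x - y)).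
apply: (@is_derive_comp_affine _ _ _ k (fun y => x - y) ( *:%R (-1))).
  by move=> h; rewrite scaleN1r opprD scalerN addrCA.
apply: is_derive_dirZ; apply/derivableP; exact: smooth_derivable sk.
Qed.

(** The reflected kernel [y |-> k (x - y)] is a test function; the sign from differentiating the
    reflection cancels the one in the definition of weak gradients. *)
Lemma partial_convol_weak f G i k r x : is_weak_grad f G -> smooth k -> csupp r k ->
  partial i (convol f k) x = convol (fun y => G y 0 i) k x.
Proof.
move=> [fl Gl fG] sk kr; have [_ ] := derivable_conv (delta_mx 0 i) x fl sk kr.
rewrite /partial => ->.
have := fG _ (csupp_reflect_test x sk kr) i.
have E : \int[leb]_y (f y * partial i (fun y => k (x - y)) y) = - convol f ('D_(delta_mx 0 i) k) x.
  rewrite -(RintegralN measurableT).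
    by apply: eq_Rintegral => y _; rewrite partial_reflect// mulrN.
  exact: (rint_conv x fl (smooth_continuous (smooth_derive _ sk)) (csupp_derive _ kr)).
by rewrite E => /oppr_inj.
Qed.

Lemma Rintegral_by_parts (a b : V -> R) r v :
  continuous a -> (forall y, derivable a y v) -> continuous ('D_v a) ->
  continuous b -> (forall y, derivable b y v) -> continuous ('D_v b) -> csupp r b ->
  \int[leb]_y (a y * 'D_v b y) = - \int[leb]_y ('D_v a y * b y).
Proof.
move=> ca da cda cb db cdb br.
have E : 'D_v (fun y => a y * b y) = fun y => a y * 'D_v b y + 'D_v a y * b y.
  apply/funext => y; have [_ ->] := is_deriveM (derivableP (da y)) (derivableP (db y)).
  by rewrite /GRing.scale/= [b y * _]mulrC.
have cab : continuous (fun y => a y * b y) by exact: (continuous_mul ca cb).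
have abr : csupp r (fun y => a y * b y) by move=> y /br ->; rewrite mulr0.
have c1 : continuous (fun y => a y * 'D_v b y) by exact: (continuous_mul ca cdb).
have c2 : continuous (fun y => 'D_v a y * b y) by exact: (continuous_mul cda cb).
have r1 : csupp r (fun y => a y * 'D_v b y) by move=> y /(csupp_derive v br) ->; rewrite mulr0.
have r2 : csupp r (fun y => 'D_v a y * b y) by move=> y /br ->; rewrite mulr0.
have dab y : derivable (fun y => a y * b y) y v by exact: derivableM.
have cE : continuous ('D_v (fun y => a y * b y)).
  by rewrite E; exact: continuous_add.
have := csupp_Rintegral_derive cab abr dab cE; rewrite E RintegralD//; last 2 first.
- exact: rint_csupp c1 r1.
- exact: rint_csupp c2 r2.
by move/eqP; rewrite addr_eq0 => /eqP.
Qed.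

(** Convolution with a mollifier is a pairing with a test function, hence 0; it also tends to [g] in
    L^1 on every ball. *)
Lemma fundamental_lemma g : L1loc g ->
  (forall phi, test_function setT phi -> \int[leb]_y (g y * phi y) = 0) ->
  {ae leb, forall y, g y = 0}.
Proof.
move=> gl H; apply: ae_ball => n.
have [ii ic] := mollify_L1loc n%:R gl.
have E k x : convol g (mollifier k) x = 0.
  apply: H; apply: csupp_reflect_test; [exact: smooth_mollifier|exact: csupp_mollifier].
have mB : measurable_fun setT (fun y : V => \1_[set x | `|x| <= n%:R] y : R).
  by apply: measurable_indic; exact: measurable_ball_rV.
have mg := gl.1.
have gi := ii 0%N.
have E2 : (fun x => `|convol g (mollifier 0) x - g x| * \1_[set x | `|x| <= n%:R] x) =
    (fun x => `|g x * \1_[set x | `|x| <= n%:R] x|).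
  by apply/funext => x; rewrite E sub0r normrN normrM [`|\1__ _|]ger0_norm.
rewrite E2 in gi.
have I0 : \int[leb]_x `|g x * \1_[set x | `|x| <= n%:R] x| = 0.
  have : \int[leb]_x (`|convol g (mollifier k) x - g x| * \1_[set x | `|x| <= n%:R] x) @[k --> \oo]
      --> \int[leb]_x `|g x * \1_[set x | `|x| <= n%:R] x|.
    apply: cvg_near_cst; apply: nearW => k; apply: eq_Rintegral => x _.
    by rewrite E sub0r normrN normrM [`|\1__ _|]ger0_norm.
  by move=> /(cvg_unique _ ic) <-.
have m : measurable_fun setT (EFin \o (fun x => g x * \1_[set x | `|x| <= n%:R] x)).
  by apply/measurable_EFinP; exact: measurable_funM.
have : (\int[leb]_x `|(EFin \o (fun x => g x * \1_[set x | (`|x| <= n%:R)%R] x)%R) x| = 0)%E.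
  by rewrite -[LHS](rint_EFin measurableT gi) I0.
move=> /(ae_eq_integral_abs _ measurableT m).1; apply: filterS => y /(_ Logic.I) /= [].
by move=> + yn; rewrite indicE mem_set// mulr1.
Qed.

Lemma weak_grad_unique f G G' : is_weak_grad f G -> is_weak_grad f G' ->
  forall i, {ae leb, forall y, G y 0 i = G' y 0 i}.
Proof.
move=> [fl Gl fG] [_ Gl' fG'] i.
have l : L1loc (fun y => G y 0 i + -1 * G' y 0 i) by apply: L1locD => //; exact: L1locZ.
have H : forall phi, test_function setT phi -> \int[leb]_y ((G y 0 i + -1 * G' y 0 i) * phi y) = 0.
  move=> phi tp; have [sp [r r0 pr]] := test_function_csupp tp.
  have cp := smooth_continuous sp.
  under eq_Rintegral do rewrite mulrDl mulN1r mulNr.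
  rewrite RintegralB//; [|exact: rint_mul_csupp cp pr|exact: rint_mul_csupp cp pr].
  apply/eqP; rewrite subr_eq0 -eqr_opp; apply/eqP.
  by rewrite -fG// -fG'.
by apply: filterS (fundamental_lemma l H) => y /eqP; rewrite mulN1r subr_eq0 => /eqP.
Qed.

Lemma is_weak_grad_weak_grad f : W11loc f -> is_weak_grad f (weak_grad f).
Proof. by move=> [G fG]; exact: (xgetPex (fun=> 0) (ex_intro _ G fG)). Qed.

(** The classical chain rule settles the mollified functions. The limit uses [Rintegral_dct_L1]: the
    distances of the mollified [f] and [G] to their limits control both integrands on the support of
    [phi], since [b'] is bounded and hence [b] Lipschitz. *)
Lemma weak_chain_rule f G (b b' : R -> R) (C : R) : is_weak_grad f G ->
  (forall s, is_derive s (1 : R) b (b' s)) -> continuous b' -> (forall s, `|b' s| <= C) ->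
  is_weak_grad (b \o f) (fun y => \row_i (b' (f y) * G y 0 i)).
Proof.
move=> fG bd cb' b'C; have [fl Gl fGE] := fG.
have C0 : 0 <= C by apply: le_trans (b'C 0).
have cb : continuous b.
  by move=> s; apply: differentiable_continuous; apply/derivable1_diffP; have [] := bd s.
have mb : measurable_fun setT b by exact: continuous_measurable_fun.
have mb' : measurable_fun setT b' by exact: continuous_measurable_fun.
have bLip s t : `|b s - b t| <= C * `|s - t|.
  have := @MVT_along R R b (1 : R) C (fun s => @ex_derive _ _ _ _ _ _ _ (bd s)) _ t (s - t).
  rewrite /GRing.scale/= mulr1 subrK; apply => z.
  by have [_ ->] := bd z.
have bfl : L1loc (b \o f).
  apply: (@L1loc_le _ _ _ (fun y => `|b 0| + C * `|f y|)).
  - by apply: measurableT_comp => //; exact: fl.1.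
  - apply: L1locD; first by apply: (bounded_L1loc (C := `|b 0|)) => // y; rewrite normr_id.
    apply: L1locZ; case: fl => mf fi; split; first exact: measurableT_comp.
    by move=> K cK; have := integrable_norm (fi K cK).
  - move=> y /=; have := bLip (f y) 0; rewrite subr0.
    have := ler_normD (b (f y) - b 0) (b 0); rewrite subrK; lra.
have mbf : measurable_fun setT (b' \o f) by apply: measurableT_comp => //; exact: fl.1.
split => //.
- move=> i; under [X in L1loc X]eq_fun do rewrite mxE.
  apply: (@L1loc_le _ _ _ (fun y => C * `|G y 0 i|)).
  + by apply: measurable_funM => //; exact: (Gl i).1.
  + apply: L1locZ; have [mf fi] := Gl i; split; first exact: measurableT_comp.
    by move=> K cK; have := integrable_norm (fi K cK).
  + by move=> y; rewrite normrM ler_wpM2r.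
move=> phi tp i.
have [sp [r r0 pr]] := test_function_csupp tp.
have cp := smooth_continuous sp.
have cdp : continuous (partial i phi) := smooth_continuous (smooth_derive (delta_mx 0 i) sp).
have pdr : csupp r (partial i phi) := csupp_derive (delta_mx 0 i) pr.
have [M M0 pM] := csupp_bounded cp pr.
have [M' M'0 pM'] := csupp_bounded cdp pdr.
pose k n := @mollifier R d n.
pose fn n := convol f (k n).
pose gn n := convol (fun y => G y 0 i) (k n).
have sk n : smooth (k n) by exact: smooth_mollifier.
have kr n : csupp n.+1%:R^-1 (k n) by exact: csupp_mollifier.
have cfn n : continuous (fn n) by exact: continuous_conv (smooth_continuous (sk n)) (kr n).
have cgn n : continuous (gn n) by exact: continuous_conv (smooth_continuous (sk n)) (kr n).
pose B := [set x : V | `|x| <= r].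
have [Di1 Dc1] := mollify_L1loc r fl.
have [Di2 Dc2] := mollify_L1loc r (Gl i).
pose D n y := `|fn n y - f y| * \1_B y + `|gn n y - G y 0 i| * \1_B y.
have [Di Dc] := L1_cvg0D Di1 Di2 Dc1 Dc2.
have D0 n y : 0 <= D n y by rewrite addr_ge0// mulr_ge0.
have ibp n : \int[leb]_y (b (fn n y) * partial i phi y) = - \int[leb]_y (b' (fn n y) * gn n y * phi y).
  have dbf y : is_derive y (delta_mx 0 i) (b \o fn n) (b' (fn n y) * gn n y).
    apply: is_derive_comp1 => //; have [d1 _] := derivable_conv (delta_mx 0 i) y fl (sk n) (kr n).
    rewrite /gn -(partial_convol_weak i y fG (sk n) (kr n)).
    exact: derivableP.
  have E : 'D_(delta_mx 0 i) (b \o fn n) = fun y => b' (fn n y) * gn n y.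
    by apply/funext => y; have [_ ->] := dbf y.
  have cE : continuous ('D_(delta_mx 0 i) (b \o fn n)).
    rewrite E; apply: continuous_mul => // y.
    by apply: continuous_comp; [exact: cfn|exact: cb'].
  have cbf : continuous (b \o fn n).
    by move=> y; apply: continuous_comp; [exact: cfn|exact: cb].
  have dp y : derivable phi y (delta_mx 0 i) by exact: smooth_derivable sp.
  have dbf' y : derivable (b \o fn n) y (delta_mx 0 i) by have [] := dbf y.
  have -> := Rintegral_by_parts cbf dbf' cE cp dp cdp pr.
  by congr (- _); apply: eq_Rintegral => y _; have [_ ->] := dbf y.
have dist y (s : nat -> nat) : D (s n) y @[n --> \oo] --> 0 -> `|y| <= r ->
    fn (s n) y @[n --> \oo] --> f y /\ gn (s n) y @[n --> \oo] --> G y 0 i.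
  move=> Dy yr; have yB : \1_B y = 1 :> R by rewrite indicE mem_set.
  by split; apply: cvg_of_dist_le Dy => n; rewrite /D yB !mulr1 ?lerDl ?lerDr.
have mphi : measurable_fun setT phi by exact: continuous_measurable_rV.
have mdphi : measurable_fun setT (partial i phi) by exact: continuous_measurable_rV.
have mbfn n : measurable_fun setT (b \o fn n).
  by apply: measurableT_comp => //; exact: continuous_measurable_rV.
have mb'fn n : measurable_fun setT (b' \o fn n).
  by apply: measurableT_comp => //; exact: continuous_measurable_rV.
have mbf0 : measurable_fun setT (b \o f) by case: bfl.
have BE y : `|y| <= r -> \1_B y = 1 :> R by move=> yr; rewrite indicE mem_set.
have L : \int[leb]_y (b (fn n y) * partial i phi y) @[n --> \oo] --> \int[leb]_y (b (f y) * partial i phi y).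
  apply: (@proj2 _ _ (Rintegral_dct_L1 (h := fun y => M' * `|b (f y) * \1_B y|) (C := M' * C)
    Di D0 Dc _ _ _ _ _ _)).
  - by move=> n; exact: (measurable_funM (mbfn n)).
  - exact: (measurable_funM mbf0).
  - apply: rintZ => //; apply: rint_abs; exact: ((L1locP _).1 bfl).2.
  - by rewrite mulr_ge0.
  - move=> n y; have [yr|yr] := leP `|y| r; last first.
      by rewrite pdr// mulr0 normr0 addr_ge0// mulr_ge0// mulr_ge0.
    have k1 : `|b (fn n y)| <= `|b (f y)| + C * (`|fn n y - f y| + `|gn n y - G y 0 i|).
      apply: (@le_trans _ _ (`|b (f y)| + C * `|fn n y - f y|)).
        have := bLip (fn n y) (f y); have := ler_normD (b (fn n y) - b (f y)) (b (f y)).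
        by rewrite subrK; lra.
      by rewrite lerD2l ler_wpM2l// lerDl.
    rewrite BE// !mulr1 normrM mulrC -mulrA -mulrDr.
    exact: (ler_pM (normr_ge0 _) (normr_ge0 _) (pM' y) k1).
  - move=> y s Dy; have [yr|yr] := leP `|y| r; last first.
      by rewrite pdr// mulr0; under eq_fun do rewrite mulr0; exact: cvg_cst.
    apply: cvgM; last exact: cvg_cst.
    have [fy _] := dist y s Dy yr.
    exact: (cvg_comp _ _ fy (cb (f y))).
have Rr : \int[leb]_y (b' (fn n y) * gn n y * phi y) @[n --> \oo] -->
    \int[leb]_y (b' (f y) * G y 0 i * phi y).
  apply: (@proj2 _ _ (Rintegral_dct_L1 (h := fun y => M * C * `|G y 0 i * \1_B y|) (C := M * C)
    Di D0 Dc _ _ _ _ _ _)).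
  - move=> n; apply: measurable_funM => //; apply: measurable_funM; first exact: mb'fn.
    exact: continuous_measurable_rV.
  - apply: measurable_funM => //; apply: measurable_funM => //; exact: (Gl i).1.
  - apply: rintZ => //; apply: rint_abs; exact: ((L1locP _).1 (Gl i)).2.
  - by rewrite mulr_ge0.
  - move=> n y; have [yr|yr] := leP `|y| r; last first.
      by rewrite pr// mulr0 normr0 addr_ge0// mulr_ge0// mulr_ge0.
    have k1 : `|b' (fn n y) * gn n y| <= C * (`|G y 0 i| + (`|fn n y - f y| + `|gn n y - G y 0 i|)).
      rewrite normrM; apply: ler_pM => //.
      have := ler_normD (gn n y - G y 0 i) (G y 0 i); rewrite subrK.
      have := normr_ge0 (fn n y - f y); lra.
    rewrite BE// !mulr1 normrM mulrC -!mulrA -!mulrDr.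
    exact: (ler_pM (normr_ge0 _) (normr_ge0 _) (pM y) k1).
  - move=> y s Dy; have [yr|yr] := leP `|y| r; last first.
      by rewrite pr// mulr0; under eq_fun do rewrite mulr0; exact: cvg_cst.
    have [fy gy] := dist y s Dy yr.
    apply: cvgM; last exact: cvg_cst.
    by apply: cvgM => //; exact: (cvg_comp _ _ fy (cb' (f y))).
have L2 : \int[leb]_y (b (fn n y) * partial i phi y) @[n --> \oo] -->
    - \int[leb]_y (b' (f y) * G y 0 i * phi y).
  by under eq_fun do rewrite ibp; exact: cvgN.
transitivity (- \int[leb]_y (b' (f y) * G y 0 i * phi y)); first exact: (cvg_unique _ L L2).
congr (- _).
by apply: eq_Rintegral => y _; rewrite mxE.
Qed.

(** Chain rule with [b n s = atan ((n + 1) s) / (n + 1)]: these functions tend to 0 uniformly, while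
    their derivatives tend boundedly to the indicator of [{0}]. Hence [G], restricted to the zero
    set of [f], is 0 against every test function. *)
Lemma weak_grad_zero_set f G : is_weak_grad f G ->
  forall i, {ae leb, forall y, f y = 0 -> G y 0 i = 0}.
Proof.
move=> fG i; have [fl Gl _] := fG; have mf := fl.1.
have mZ : measurable (f @^-1` [set 0]) by rewrite -[X in measurable X]setTI; exact: mf.
have m1 : measurable_fun setT (fun y => \1_(f @^-1` [set 0]) y : R) by exact: measurable_indic.
have il y : `|\1_(f @^-1` [set 0]) y : R| <= 1 by rewrite indicE normr_nat lern1 leq_b1.
have l : L1loc (fun y => G y 0 i * \1_(f @^-1` [set 0]) y).
  apply: (@L1loc_le _ _ _ (fun y => `|G y 0 i|)).
  - by apply: measurable_funM => //; exact: (Gl i).1.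
  - have [mG Gi] := Gl i; split; first exact: measurableT_comp.
    by move=> K cK; have := integrable_norm (Gi K cK).
  - by move=> y; rewrite normrM ler_piMr.
suff H : forall phi, test_function setT phi ->
    \int[leb]_y (G y 0 i * \1_(f @^-1` [set 0]) y * phi y) = 0.
  apply: filterS (fundamental_lemma l H) => y + fy0.
  by rewrite indicE mem_set// mulr1.
move=> phi tp.
have [sp [r r0 pr]] := test_function_csupp tp.
have cp := smooth_continuous sp.
have cdp : continuous (partial i phi) := smooth_continuous (smooth_derive (delta_mx 0 i) sp).
have pdr : csupp r (partial i phi) := csupp_derive (delta_mx 0 i) pr.
pose b (n : nat) (s : R) := n.+1%:R^-1 * atan (n.+1%:R * s).
pose b' (n : nat) (s : R) := (1 + (n.+1%:R * s) ^+ 2)^-1.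
have den s : 0 < 1 + s ^+ 2 :> R by rewrite ltr_pwDl// sqr_ge0.
have bd n s : is_derive s (1 : R) (b n) (b' n s).
  have h2 : is_derive s (1 : R) (fun s : R => n.+1%:R * s) (n.+1%:R).
    by apply: is_derive_eq; rewrite /GRing.scale/= mulr1.
  have h3 := is_derive1_comp (is_derive1_atan (n.+1%:R * s)) h2.
  apply: (is_derive_eq (is_deriveZ n.+1%:R^-1 h3)).
  by rewrite /GRing.scale/= mulrC mulfK.
have cb' n : continuous (b' n).
  have c1 : continuous (fun s : R => n.+1%:R * s).
    by apply: continuous_mul; [exact: cst_continuous|move=> s; exact: cvg_id].
  have c2 : continuous (fun s : R => 1 + (n.+1%:R * s) ^+ 2).
    by apply: continuous_add; [exact: cst_continuous|exact: continuous_mul].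
  by move=> s; apply: cvgV; [rewrite gt_eqF|exact: c2].
have b'1 n s : `|b' n s| <= 1.
  by rewrite /b' ger0_norm ?invf_le1// ?lerDl ?sqr_ge0// invr_ge0 ltW.
have b'f n : measurable_fun setT (b' n \o f).
  by apply: measurableT_comp => //; exact: continuous_measurable_fun.
have E n : \int[leb]_y (b n (f y) * partial i phi y) = - \int[leb]_y (b' n (f y) * G y 0 i * phi y).
  have [_ _ /(_ phi tp i) ->] := weak_chain_rule fG (bd n) (cb' n) (b'1 n).
  by congr (- _); apply: eq_Rintegral => y _; rewrite mxE.
have gi : rint leb setT (fun y => `|G y 0 i * phi y|) by apply: rint_abs; exact: rint_mul_csupp (Gl i) cp pr.
have [|||| _ L1] := Rintegral_dctT measurableT (mu := leb)
  (F := fun n y => b' n (f y) * G y 0 i * phi y) (f := fun y => G y 0 i * \1_(f @^-1` [set 0]) y * phi y)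
  (h := fun y => `|G y 0 i * phi y|) _ _ gi.
- move=> n; apply: measurable_funM; last exact: continuous_measurable_rV.
  by apply: measurable_funM; [exact: b'f|exact: (Gl i).1].
- by apply: measurable_funM; [exact: l.1|exact: continuous_measurable_rV].
- move=> y _; rewrite [G y 0 i * \1__ _]mulrC; apply: cvgM; last exact: cvg_cst.
  apply: cvgM; last exact: cvg_cst.
  rewrite indicE; have [fy|fy] := eqVneq (f y) 0.
    rewrite mem_set//; apply: cvg_near_cst; apply: nearW => n.
    by rewrite /b' fy mulr0 expr0n addr0 invr1.
  rewrite memNset; last exact/eqP.
  rewrite /= mulr0n.
  have fy2 : 0 < f y ^+ 2 by rewrite lt_neqAle eq_sym sqrf_eq0 fy sqr_ge0.
  apply: (@squeeze_cvgr _ _ _ _ (fun=> 0) (fun n => n.+1%:R^-1 * (f y ^+ 2)^-1)).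
  + apply: nearW => n; rewrite invr_ge0 ltW//= -invfM lef_pV2 ?posrE ?den ?(mulr_gt0 _ fy2)//.
    rewrite exprMn; apply: (@le_trans _ _ (n.+1%:R ^+ 2 * f y ^+ 2)); last by rewrite lerDr.
    by apply: ler_wpM2r; [exact: ltW|rewrite expr2 ler_peMr// ler1n].
  + exact: cvg_cst.
  + by rewrite -[0 in X in _ --> X](mul0r (f y ^+ 2)^-1); apply: cvgM; [exact: cvg_harmonic|exact: cvg_cst].
- by move=> y _ n; rewrite -mulrA normrM ler_piMl.
have di := rint_abs (rint_csupp cdp pdr).
have bpi n s : `|b n s| <= n.+1%:R^-1 * pi.
  rewrite normrM ger0_norm ?invr_ge0// ler_wpM2l ?invr_ge0// ler_norml.
  have := atan_ltpi2 (n.+1%:R * s); have := atan_gtNpi2 (n.+1%:R * s); have := pi_gt0 R; lra.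
have bi n : rint leb setT (fun y => b n (f y) * partial i phi y).
  have mb : measurable_fun setT (b n).
    apply: continuous_measurable_fun => s; apply: differentiable_continuous.
    by apply/derivable1_diffP; have [] := bd n s.
  have := rintM_bdd measurableT (measurableT_comp mb mf) (rint_csupp cdp pdr) (fun y _ => bpi n (f y)).
  by congr (rint _ _ _); apply/funext => y; rewrite mulrC.
have L2 : \int[leb]_y (b' n (f y) * G y 0 i * phi y) @[n --> \oo] --> 0.
  pose c := pi * \int[leb]_y `|partial i phi y|.
  have bnd n : `|\int[leb]_y (b' n (f y) * G y 0 i * phi y)| <= n.+1%:R^-1 * c.
    rewrite -normrN -E /c mulrA -RintegralZl//.
    apply: Rintegral_abs_le => //; first exact: rintZ.
    by move=> y _; rewrite normrM ler_wpM2r.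
  have c0 : n.+1%:R^-1 * c @[n --> \oo] --> 0.
    by rewrite -[0 in X in _ --> X](mul0r c); apply: cvgM; [exact: cvg_harmonic|exact: cvg_cst].
  apply: (@squeeze_cvgr _ _ _ _ (fun n => - (n.+1%:R^-1 * c)) (fun n => n.+1%:R^-1 * c)) => //.
    by apply: nearW => n; rewrite -ler_norml.
  by rewrite -[0 in X in _ --> X]oppr0; exact: cvgN.
exact: (cvg_unique _ L1 L2).
Qed.

End weak_gradients.

(** * Velocity and flux *)

Section positive_power.
Context {R : realType}.
Implicit Types (r s t : R).

(** The power extended by 0 to negative numbers: for [r > 0] continuous, for [r > 1] differentiable
    on the whole line. *)
Definition ppow r s : R := Num.max s 0 `^ r.

Lemma ppow_ge0 r s : 0 <= ppow r s.
Proof. exact: powR_ge0. Qed.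

Lemma ppowE r s : 0 <= s -> ppow r s = s `^ r.
Proof. by move=> s0; rewrite /ppow max_l. Qed.

Lemma ppow_le0 r s : 0 < r -> s <= 0 -> ppow r s = 0.
Proof. by move=> r0 s0; rewrite /ppow max_r// powR0 ?gt_eqF. Qed.

Lemma continuous_ppow r : 0 < r -> continuous (ppow r).
Proof.
move=> r0 s; have [s0|s0|->] := ltgtP s 0.
- apply: (@cvg_trans _ ((fun=> 0 : R) @ s)).
    apply: near_eq_cvg; near=> t; rewrite ppow_le0//.
    by near: t; apply: filterS (lt_nbhsl s0) => x /ltW.
  have c0 : (fun=> 0 : R) @ s --> (0 : R) by exact: cvg_cst.
  by rewrite (ppow_le0 r0 (ltW s0)).
- have cp : continuous_at s (fun x : R => x `^ r).
    apply: differentiable_continuous; apply/derivable1_diffP.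
    by have [] := is_derive1_powR r s0.
  rewrite /continuous_at ppowE ?ltW//; apply: cvg_trans cp.
  apply: near_eq_cvg; near=> t; rewrite ppowE//.
  by near: t; apply: filterS (lt_nbhsr s0) => x /ltW.
- apply/cvgrPdist_le => e e0; rewrite ppow_le0//.
  have d0 : 0 < e `^ r^-1 by exact: powR_gt0.
  have n0 : \forall t \near (0 : R), `|t| <= e `^ r^-1 by exact: nbhs0_le.
  near=> t; rewrite sub0r normrN ger0_norm ?ppow_ge0//.
  have td : Num.max t 0 <= e `^ r^-1.
    rewrite ge_max (ltW d0) andbT; apply: (le_trans (ler_norm t)).
    by near: t; exact: n0.
  apply: (@le_trans _ _ ((e `^ r^-1) `^ r)).
    apply: ge0_ler_powR => //; first exact: ltW.
    - by rewrite nnegrE le_max lexx orbT.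
    - by rewrite nnegrE ltW.
  by rewrite -powRrM mulVf ?gt_eqF// powRr1// ltW.
Unshelve. all: by end_near. Qed.

Lemma is_derive_ppow r s : 1 < r -> is_derive s (1 : R) (ppow r) (r * ppow (r - 1) s).
Proof.
move=> r1; have r0 : 0 < r by lra.
have r10 : 0 < r - 1 by lra.
have [s0|s0|->] := ltgtP s 0.
- rewrite ppow_le0 ?ltW// mulr0; apply: derive_near0; near=> t; rewrite ppow_le0//.
  by near: t; apply: filterS (lt_nbhsl s0) => x /ltW.
- have h := is_derive1_powR r s0; rewrite -(ppowE _ (ltW s0)) in h.
  apply: (near_eq_is_derive _ h).
  near=> t; rewrite ppowE//.
  by near: t; apply: filterS (lt_nbhsr s0) => x /ltW.
- rewrite (ppow_le0 r10)// mulr0.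
  have H : (fun h : R => h^-1 *: ((ppow r \o shift 0) (h *: 1) - ppow r 0)) @ 0^' --> 0.
    apply/cvgr0Pnorm_le => e e0.
    have c0 : ppow (r - 1) x @[x --> (0 : R)] --> ppow (r - 1) 0 by exact: continuous_ppow.
    have /cvgrPdist_le/(_ e e0) c := c0.
    near=> h; rewrite /= addr0 (ppow_le0 r0 (lexx 0)) subr0 /GRing.scale/= mulr1.
    have [h0|h0] := leP h 0; first by rewrite ppow_le0// mulr0 normr0 ltW.
    rewrite (ppowE _ (ltW h0)) -(mulr_powRB1 (ltW h0) r0) mulKf ?gt_eqF//.
    rewrite -(ppowE _ (ltW h0)).
    have : `|ppow (r - 1) 0 - ppow (r - 1) h| <= e by near: h; apply: cvg_within.
    by rewrite (ppow_le0 r10)// sub0r normrN.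
  by split; [apply/cvg_ex; exists 0|exact/cvg_lim].
Unshelve. all: by end_near. Qed.

End positive_power.

Section inverse_LF.
Context {R : realType}.
Variables (lam eta m : R).
Hypotheses (lam0 : 0 < lam) (eta0 : 0 < eta) (m1 : 1 < m).

Let m0 : 0 < m := lt_trans ltr01 m1.
Let m10 : 0 < m - 1. Proof. by rewrite subr_gt0. Qed.

Let L s : R := lam * s + eta * ppow m s.
(** Derivative of [L], the extension of [LF] that is linear with slope [lam] left of 0. *)
Definition dLF (s : R) : R := lam + eta * (m * ppow (m - 1) s).

Lemma dLF_ge s : lam <= dLF s.
Proof. by rewrite lerDl !mulr_ge0 ?ppow_ge0// ltW. Qed.

Let dLF_gt0 s : 0 < dLF s.
Proof. exact: lt_le_trans lam0 (dLF_ge s). Qed.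

Lemma continuous_dLF : continuous dLF.
Proof.
apply: continuous_add; first exact: cst_continuous.
apply: continuous_mul; first exact: cst_continuous.
by apply: continuous_mul; [exact: cst_continuous|exact: continuous_ppow].
Qed.

Let dL s : is_derive s (1 : R) L (dLF s).
Proof.
have h1 := is_derive_ppow s m1.
have h2 := is_deriveZ eta h1.
have h3 := is_deriveZ lam (is_derive_id s (1 : R)).
by apply: (is_derive_eq (is_deriveD h3 h2)); rewrite /GRing.scale/= mulr1.
Qed.

Let cL : continuous L.
Proof.
by move=> s; apply: differentiable_continuous; apply/derivable1_diffP; have [] := dL s.
Qed.

Let Llt s t : s < t -> L s < L t.
Proof.
move=> st; rewrite /L ltr_leD ?ltr_pM2l//.
rewrite ler_pM2l//; apply: ge0_ler_powR; first exact: ltW.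
- by rewrite nnegrE le_max lexx orbT.
- by rewrite nnegrE le_max lexx orbT.
by rewrite ge_max !le_max lexx (ltW st) orbT.
Qed.

Let Linj : injective L.
Proof.
move=> s t Lst; have [st|st|//] := ltgtP s t; have := Llt st; rewrite Lst ltxx//.
Qed.

Let Lsurj y : exists s, L s = y.
Proof.
have [y0|y0] := leP 0 y; last first.
  exists (y / lam); rewrite /L ppow_le0// ?mulr0 ?addr0.
    by rewrite mulrC divfK// gt_eqF.
  by rewrite pmulr_lle0 ?invr_gt0// ltW.
have yl : 0 <= y / lam by rewrite divr_ge0// ltW.
have L0 : L 0 = 0 by rewrite /L ppow_le0// !mulr0 addr0.
(* The term [lam s] alone reaches [y] at [s = y / lam], so the intermediate value theorem applies on
   [[0, y / lam]]. *)
have Ly : y <= L (y / lam).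
  by rewrite /L mulrCA divff ?gt_eqF// mulr1 lerDl mulr_ge0 ?ppow_ge0// ltW.
have [|s _ Ls] := @IVT R L 0 (y / lam) y yl (continuous_subspaceT cL); last by exists s.
by rewrite L0 min_l ?(le_trans y0)// max_r ?(le_trans y0)// y0 Ly.
Qed.

(** Extending [LF] to a bijection of the line with derivative at least [lam] makes the inverse
    globally C^1 with bounded derivative, as [weak_chain_rule] requires of the outer function. *)
Lemma LF_inverse : exists b : R -> R,
  [/\ forall s, 0 <= s -> b (LF lam eta m s) = s,
      forall y, is_derive y (1 : R) b (dLF (b y))^-1 &
      continuous (fun y => (dLF (b y))^-1)].
Proof.
have /choice[b bK] := Lsurj.
have Kb s : b (L s) = s by apply: Linj; rewrite bK.
have db y : is_derive y (1 : R) b (dLF (b y))^-1.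
  rewrite -{1}(bK y); apply: (@is_derive_inverse R L b).
  - have nK : \forall x \near b y, b (L x) = x by exact: (@filterE R (nbhs (b y : R)) _ _ Kb).
    exact: nK.
  - have nc : \forall x \near b y, {for x, continuous L} by exact: (@filterE R (nbhs (b y : R)) _ _ cL).
    exact: nc.
  - exact: dL.
  - by rewrite gt_eqF.
have cb : continuous b.
  by move=> s; apply: differentiable_continuous; apply/derivable1_diffP; have [] := db s.
exists b; split => //.
  by move=> s s0; rewrite -[RHS]Kb /L /LF ppowE.
move=> y; apply: cvgV; first by rewrite gt_eqF.
by apply: (cvg_comp b dLF (cb y)); exact: continuous_dLF.
Qed.

End inverse_LF.

Section velocity.
Context {R : realType} {d : nat}.
Local Notation V := 'rV[R]_d.
Local Notation leb := (lebesgue_rV d : {measure set V -> \bar R}).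
Variables (lam eta m : R) (Psi : V -> R).
Hypotheses (lam0 : 0 < lam) (eta0 : 0 < eta) (m1 : 1 < m).

Lemma is_weak_grad_lin (a b : R) (f g : V -> R) (F G : V -> V) :
  is_weak_grad f F -> is_weak_grad g G ->
  is_weak_grad (fun y => a * f y + b * g y) (fun y => a *: F y + b *: G y).
Proof.
move=> [fl Fl fF] [gl Gl gG]; split.
- by apply: L1locD; exact: L1locZ.
- move=> i; under [X in L1loc X]eq_fun do rewrite !mxE.
  by apply: L1locD; exact: L1locZ.
move=> phi tp i; have [sp [r r0 pr]] := test_function_csupp tp.
have cp := smooth_continuous sp.
have cdp : continuous (partial i phi) := smooth_continuous (smooth_derive (delta_mx 0 i) sp).
have pdr : csupp r (partial i phi) := csupp_derive (delta_mx 0 i) pr.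
have lin (u v k : V -> R) : L1loc u -> L1loc v -> continuous k -> csupp r k ->
    \int[leb]_y ((a * u y + b * v y) * k y) = a * \int[leb]_y (u y * k y) + b * \int[leb]_y (v y * k y).
  move=> ul vl ck kr.
  have iu := rint_mul_csupp ul ck kr; have iv := rint_mul_csupp vl ck kr.
  rewrite -(RintegralZl a measurableT iu) -(RintegralZl b measurableT iv).
  rewrite -(RintegralD measurableT (rintZ measurableT a iu) (rintZ measurableT b iv)).
  by apply: eq_Rintegral => y _; rewrite mulrDl !mulrA.
rewrite lin// fF// gG// !mulrN -opprD; congr (- _).
rewrite -lin//; by apply: eq_Rintegral => y _; rewrite !mxE.
Qed.

Variable rho : @density R d.
Hypothesis rhoW : W11loc (LF lam eta m \o rho).
Let w := LF lam eta m \o rho.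

Lemma weak_grad_density : is_weak_grad rho
  (fun y => \row_i ((dLF lam eta m (rho y))^-1 * weak_grad w y 0 i)).
Proof.
have [b [bK db cb']] := LF_inverse lam0 eta0 m1.
have C s : `|(dLF lam eta m (b s))^-1| <= lam^-1.
  have h := dLF_ge lam eta0 m1 (b s); have h0 := lt_le_trans lam0 h.
  by rewrite ger0_norm ?invr_ge0 ?(ltW h0)// lef_pV2.
have E : b \o w = rho :> (V -> R) by apply/funext => y; rewrite /w /= bK// density_ge0.
have := weak_chain_rule (is_weak_grad_weak_grad rhoW) db cb' C.
rewrite -/w E; congr (is_weak_grad _ _); apply/funext => y; apply/rowP => i; rewrite !mxE.
by rewrite -[in RHS](bK (rho y)) ?density_ge0.
Qed.

(** The derivative of [s^m] is unbounded, so the chain rule is bypassed: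
    [rho^m = (LF rho - lam rho) / eta] combines two functions with known weak gradients. *)
Lemma weak_grad_density_powR : is_weak_grad (fun y => rho y `^ m)
  (fun y => eta^-1 *: weak_grad w y + (- (lam / eta)) *:
    \row_i ((dLF lam eta m (rho y))^-1 * weak_grad w y 0 i)).
Proof.
have := is_weak_grad_lin eta^-1 (- (lam / eta)) (is_weak_grad_weak_grad rhoW) weak_grad_density.
congr (is_weak_grad _ _); apply/funext => y; rewrite /w /= /LF.
by field; rewrite gt_eqF.
Qed.

(** [velocity] is written with chosen weak gradients of [rho] and [rho^m]. By uniqueness they agree
    almost everywhere with the explicit ones, in which the two multiples of the gradient of [rho]
    cancel. *)
Lemma velocity_flux : {ae leb, forall y, forall i,
  rho y * velocity lam eta m Psi rho y 0 i =
  - (rho y * partial i Psi y + weak_grad w y 0 i)}.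
Proof.
have h1 := weak_grad_unique (is_weak_grad_weak_grad (ex_intro _ _ weak_grad_density)) weak_grad_density.
have h2 := weak_grad_unique (is_weak_grad_weak_grad (ex_intro _ _ weak_grad_density_powR)) weak_grad_density_powR.
have h3 := weak_grad_zero_set (is_weak_grad_weak_grad rhoW).
have m0 : 0 < m by exact: lt_trans ltr01 m1.
have H i : {ae leb, forall y, rho y * velocity lam eta m Psi rho y 0 i =
    - (rho y * partial i Psi y + weak_grad w y 0 i)}.
  have e1 := h1 i; have e2 := h2 i; have e3 := h3 i.
  move: e1 e2 e3; apply: filterS3 => y e1 e2 e3.
  rewrite !mxE e1 e2 !mxE.
  (* Where [rho] vanishes, the left side is 0 through its factor [rho], and the gradient of [LF rho]
     is 0 almost everywhere on the zero set of [LF rho]. *)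
  have [r0|r0] := eqVneq (rho y) 0.
    by rewrite r0 !mul0r e3 ?addr0 ?oppr0// /LF/= r0 mulr0 powR0 ?gt_eqF// mulr0 addr0.
  have D0 : dLF lam eta m (rho y) != 0.
    by rewrite gt_eqF// (lt_le_trans lam0)// dLF_ge.
  by field; rewrite r0 D0 gt_eqF.
by apply: filter_forall => i; exact: H.
Qed.

End velocity.

(** * Integration against the measure with a given density *)

Section density_integral.
Context {R : realType} {d : nat}.
Local Notation V := 'rV[R]_d.
Local Notation leb := (lebesgue_rV d : {measure set V -> \bar R}).
Variable rho : @density R d.
Local Notation nu := (density_measure rho : {measure set V -> \bar R}).
Local Open Scope ereal_scope.

Import HBNNSimple.

Let mrho : measurable_fun setT (EFin \o rho : V -> \bar R).
Proof. by apply/measurable_EFinP; exact: (@measurable_density _ _ rho). Qed.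

Let rho0 x : 0 <= (rho x)%:E. Proof. by rewrite lee_fin density_ge0. Qed.

Let integral_density_nnsfun (h : {nnsfun V >-> R}) :
  \int[nu]_x (h x)%:E = \int[leb]_x ((h x)%:E * (rho x)%:E).
Proof.
under [LHS]eq_integral do rewrite fimfunE -fsumEFin//.
rewrite [LHS]ge0_integral_fsum//; last 2 first.
  - by move=> r; exact/measurable_EFinP/measurableT_comp.
  - by move=> n x _; rewrite EFinM nnfun_muleindic_ge0.
under [RHS]eq_integral.
  move=> x xD; rewrite fimfunE -fsumEFin// ge0_mule_fsuml; last first.
    by move=> r; rewrite EFinM nnfun_muleindic_ge0.
  over.
rewrite [RHS]ge0_integral_fsum//; last 2 first.
  - move=> r; apply: emeasurable_funM; last exact: mrho.
    by apply/measurable_EFinP/measurableT_comp.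
  - by move=> n x _; rewrite mule_ge0// EFinM nnfun_muleindic_ge0.
apply: eq_fsbigr => r _; rewrite integralZl_indic_nnsfun//= integral_indic// setIT.
have mA : measurable (h @^-1` [set r]) by exact: measurable_sfunP.
have [r0|r0] := ltP r 0%R.
  have -> : h @^-1` [set r] = set0 by exact: preimage_nnfun0.
  by rewrite measure0 mule0 integral0_eq// => x _; rewrite indicE in_set0 mulr0 mul0e.
have -> : nu (h @^-1` [set r]) = \int[leb]_x ((fun x => (rho x)%:E) \_ (h @^-1` [set r])) x.
  by rewrite -integral_mkcond.
rewrite -ge0_integralZl//; first last.
- by move=> x _; apply: erestrict_ge0 => y _.
- apply/(measurable_restrictT _ mA); exact: measurable_funTS.
by apply: eq_integral => x _; rewrite patchE indicE; case: ifP => _;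
  rewrite ?mulr1 ?mulr0 ?mul0e ?mule0.
Qed.

Lemma ge0_integral_density_measure (f : V -> \bar R) : measurable_fun setT f ->
  (forall x, 0 <= f x) -> \int[nu]_x f x = \int[leb]_x (f x * (rho x)%:E).
Proof.
move=> mf f0; pose f_ := nnsfun_approx measurableT mf.
have nd x : {homo (fun n => (f_ n x)%:E) : m n / (m <= n)%N >-> m <= n}.
  by move=> m n mn; rewrite lee_fin; exact/lefP/nd_nnsfun_approx.
have cv x : (f_ n x)%:E @[n --> \oo] --> f x by exact: cvg_nnsfun_approx.
have -> : \int[nu]_x f x = limn (fun n => \int[nu]_x (f_ n x)%:E).
  rewrite -monotone_convergence//=.
  - by apply: eq_integral => x _; apply/esym/cvg_lim.
  - by move=> n; apply/measurable_EFinP.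
  - by move=> n x _; rewrite lee_fin.
have -> : \int[leb]_x (f x * (rho x)%:E) = limn (fun n => \int[leb]_x ((f_ n x)%:E * (rho x)%:E)).
  rewrite -monotone_convergence//=.
  - apply: eq_integral => x _; apply/esym/cvg_lim => //.
    by apply: cvgeMr.
  - by move=> n; apply: emeasurable_funM; [exact/measurable_EFinP|exact: mrho].
  - by move=> n x _; rewrite mule_ge0// lee_fin.
  - by move=> x _ m n mn; rewrite lee_wpmul2r//; exact: nd.
by congr (limn _); apply/funext => n; exact: integral_density_nnsfun.
Qed.

Lemma Rintegral_density_measure (f : V -> R) : measurable_fun setT f ->
  (\int[nu]_x f x = \int[leb]_x (f x * rho x))%R.
Proof.
move=> mf; rewrite /Rintegral; congr fine.
rewrite integralE [RHS]integralE; congr (_ - _).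
- rewrite ge0_integral_density_measure//; last exact/measurable_funepos/measurable_EFinP.
  apply: eq_integral => x _; rewrite !funeposE /= -!EFin_max -EFinM.
  by rewrite maxr_pMl ?density_ge0// mul0r.
- rewrite ge0_integral_density_measure//; last exact/measurable_funeneg/measurable_EFinP.
  apply: eq_integral => x _; rewrite !funenegE /=.
  rewrite -!EFin_max -EFinM.
  by rewrite maxr_pMl ?density_ge0// mul0r mulNr.
Qed.

End density_integral.

(** * Joint measurability *)

Section caratheodory.
Context {R : realType} {d : nat} d0 (T : measurableType d0).
Local Notation V := 'rV[R]_d.

Let grid (k : nat) (q : 'rV[int]_d) : V := \row_i ((q 0 i)%:~R / k.+1%:R).
Let cell (k : nat) (x : V) : 'rV[int]_d := \row_i Num.floor (k.+1%:R * x 0 i).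

Let grid_cell x : grid k (cell k x) @[k --> \oo] --> x.
Proof.
apply/cvgrPdist_le => e e0; near=> k.
rewrite rV_normP ?ltW// => i; rewrite !mxE.
have k0 : 0 < k.+1%:R :> R by rewrite ltr0n.
have /andP[h1 h2] := mem_rg1_floor (k.+1%:R * x 0 i).
rewrite -[X in X - _](mulfK (lt0r_neq0 k0) (x 0 i)) -mulrBl [x 0 i * _]mulrC.
rewrite normrM (gtr0_norm (_ : 0 < k.+1%:R^-1)) ?invr_gt0// ger0_norm ?subr_ge0//.
apply: (@le_trans _ _ k.+1%:R^-1).
  by rewrite ler_piMl ?invr_ge0 ?(ltW k0)// lerBlDl ltW.
rewrite -[leRHS]invrK lef_pV2 ?posrE ?invr_gt0//.
apply: (@le_trans _ _ (Num.truncn e^-1).+1%:R); first by rewrite ltW ?truncnS_gt.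
by rewrite ler_nat ltnS; near: k; exact: nbhs_infty_ge.
Unshelve. all: by end_near. Qed.

(** Replacing [x] by the lower corner of its grid cell of side [1 / (k + 1)] gives functions that
    are measurable, because there are countably many cells, and that converge by continuity in
    [x]. *)
Lemma measurable_caratheodory (F : T -> V -> R) :
  (forall x, measurable_fun setT (F ^~ x)) -> (forall t, continuous (F t)) ->
  measurable_fun setT (fun p : T * V => F p.1 p.2).
Proof.
move=> mF cF.
apply: (measurable_fun_cvg (h := fun k p => F p.1 (grid k (cell k p.2)))) => [k|[t x] _]; last first.
  have H : F t (grid k (cell k x)) @[k --> \oo] --> F t x.
    by apply: continuous_cvg; [exact: cF|exact: grid_cell].
  exact: H.
move=> _ Y mY; rewrite setTI.
have -> : (fun p : T * V => F p.1 (grid k (cell k p.2))) @^-1` Y =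
    \bigcup_(q : 'rV[int]_d) (((F ^~ (grid k q)) @^-1` Y) `*` (cell k @^-1` [set q])).
  apply/seteqP; split => [[t x] /= h|[t x] [q _ [/= h qE]]]; last by rewrite /= qE.
  by exists (cell k x).
apply: countable_bigcupT_measurable => // q; apply: measurableX.
  by rewrite -[X in measurable X]setTI; exact: mF.
have -> : cell k @^-1` [set q] =
    \bigcap_(i in [set: 'I_d]) ((fun x : V => k.+1%:R * x 0 i) @^-1` `[(q 0 i)%:~R, (q 0 i + 1)%:~R[%classic).
  apply/seteqP; split => [x /= <- i _|x h] /=.
    by rewrite in_itv/= mxE intrD; exact: mem_rg1_floor.
  apply/rowP => i; rewrite mxE; apply/eqP; have := h i I.
  by rewrite /= in_itv/= => hi; rewrite eq_sym; apply/eqP/esym/floor_def.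
apply: fin_bigcap_measurable => // i _.
rewrite -[X in measurable X]setTI.
have mc : measurable_fun setT (fun x : V => k.+1%:R * x 0 i).
  by apply: measurable_funM => //; exact: measurable_coord.
by apply: mc.
Qed.

End caratheodory.

Section fatou.
Context {R : realType}.

(** [f / (f^2 + 1 / (n + 1))] tends to the inverse of [f], also at the zeros of [f], where both are
    0 by the convention [0^-1 = 0]. The positive denominator is inverted through [expR] and [ln]. *)
Lemma measurable_inv d0 (T : measurableType d0) (D : set T) (f : T -> R) :
  measurable_fun D f -> measurable_fun D (fun x => (f x)^-1).
Proof.
move=> mf; apply: (measurable_fun_cvg (h := fun n x => f x * expR (0 - ln (f x ^+ 2 + n.+1%:R^-1)))).
  move=> n; apply: measurable_funM => //; apply: measurableT_comp => //.
  apply: measurable_funB; first exact: measurable_cst.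
  apply: measurableT_comp => //.
  apply: measurable_funD => //; exact: measurable_funX.
move=> x _; have h (n : nat) : 0 < f x ^+ 2 + n.+1%:R^-1 by rewrite ltr_wpDl ?sqr_ge0// invr_gt0.
have -> : (fun n => f x * expR (0 - ln (f x ^+ 2 + n.+1%:R^-1))) =
    (fun n => f x * (f x ^+ 2 + n.+1%:R^-1)^-1).
  by apply/funext => n; rewrite sub0r expRN lnK// posrE.
have [->|f0] := eqVneq (f x) 0.
  by rewrite invr0; under eq_fun do rewrite mul0r; exact: cvg_cst.
have -> : (f x)^-1 = f x * (f x ^+ 2 + 0)^-1 by rewrite addr0; field.
apply: cvgM; first exact: cvg_cst.
apply: cvgV; first by rewrite addr0 expf_neq0.
by apply: cvgD; [exact: cvg_cst|exact: cvg_harmonic].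
Qed.

Lemma fatou_le d0 (T : measurableType d0) (mu : {measure set T -> \bar R})
    (F : nat -> T -> R) (f : T -> R) (K : \bar R) :
  (forall n, measurable_fun setT (F n)) -> (forall n x, 0 <= F n x) ->
  measurable_fun setT f -> (forall x, 0 <= f x) ->
  {ae mu, forall x, F n x @[n --> \oo] --> f x} ->
  (forall n, \int[mu]_x (F n x)%:E <= K)%E -> (\int[mu]_x (f x)%:E <= K)%E.
Proof.
move=> mF F0 mf f0 [A [mA A0 sA]] HK.
(* Off the null set [A] the convergence holds everywhere, and multiplying by the indicator of its
   complement changes no integral. *)
pose ind (g : T -> R) x := g x * \1_(~` A) x.
have mind g : measurable_fun setT g -> measurable_fun setT (ind g).
  by move=> mg; apply: measurable_funM => //; apply: measurable_indic; exact: measurableC.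
have indE g : measurable_fun setT g -> (\int[mu]_x (ind g x)%:E = \int[mu]_x (g x)%:E)%E.
  move=> mg; apply: ae_eq_integral => //; [by apply/measurable_EFinP; exact: mind|exact/measurable_EFinP|].
  exists A; split => // x /= nx; apply: contrapT => Ax; apply: nx => _.
  by rewrite /ind indicE mem_set// mulr1.
have c x : (ind (F n) x)%:E @[n --> \oo] --> (ind f x)%:E.
  apply: cvg_EFin; first exact: nearW.
  rewrite /ind indicE; have [xA|xA] := boolP (x \in ~` A).
    rewrite mulr1; under eq_fun do rewrite mulr1.
    by move: xA; rewrite inE => xA; apply: contrapT => nc; apply: xA; exact: sA.
  by rewrite mulr0; under eq_fun do rewrite mulr0; exact: cvg_cst.
have mF' n : measurable_fun setT (fun x => (ind (F n) x)%:E) by apply/measurable_EFinP; exact: mind.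
have F'0 n x : setT x -> (0 <= (ind (F n) x)%:E)%E by rewrite lee_fin mulr_ge0.
have := fatou mu measurableT mF' F'0.
under eq_integral do rewrite (cvg_limn_einf_sup (c _)).
rewrite indE// => /le_trans; apply.
under eq_fun do rewrite indE//.
rewrite limn_einf_lim; apply: lime_le; first exact: is_cvg_einfs.
near=> n; apply: le_trans (HK n); apply: ereal_inf_lbound; exists n => //=.
Unshelve. all: by end_near. Qed.

End fatou.

Section locally_integrable.
Context {R : realType} {d : nat}.
Local Notation V := 'rV[R]_d.
Local Notation leb := (lebesgue_rV d : {measure set V -> \bar R}).

Lemma L1locM_continuous (f g : V -> R) : L1loc f -> continuous g -> L1loc (fun y => f y * g y).
Proof.
move=> fl cg; have [mf _] := (L1locP f).1 fl.
apply/L1locP; split.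
  by apply: measurable_funM => //; exact: continuous_measurable_rV.
move=> r; pose N := Num.truncn r.
have [cc cs] := (smooth_continuous (@smooth_cutoff R d N), @csupp_cutoff R d N).
have cp := continuous_mul cg cc.
have ps : csupp (2 * N.+1%:R) (fun y => g y * cutoff N y) by move=> y /cs ->; rewrite mulr0.
have h := rint_mul_csupp fl cp ps.
have mB : measurable_fun setT (\1_[set y : V | `|y| <= r] : V -> R).
  by apply: measurable_indic; exact: measurable_ball_rV.
have b1 y : setT y -> `|\1_[set y : V | `|y| <= r] y : R| <= 1.
  by move=> _; rewrite indicE; case: (_ \in _); rewrite ?normr1 ?normr0.
have := rintM_bdd measurableT mB h b1; congr (rint _ _ _); apply/funext => y.
rewrite indicE; have [yB|yB] := boolP (y \in _); last by rewrite !mulr0.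
rewrite !mulr1 cutoff_1 ?mulr1//; move: yB; rewrite inE/= => /le_trans; apply.
by rewrite ltW// truncnS_gt.
Qed.

Lemma continuous_L1loc (g : V -> R) : continuous g -> L1loc g.
Proof.
move=> cg; have h1 : L1loc (fun _ : V => 1 : R).
  by apply: (bounded_L1loc (C := 1) (measurable_cst _)) => y; rewrite normr1.
have := L1locM_continuous h1 cg; congr L1loc; apply/funext => y; exact: mul1r.
Qed.

Lemma C1_is_weak_grad (g : V -> R) : continuous g ->
  (forall i y, derivable g y (delta_mx 0 i)) -> (forall i, continuous (partial i g)) ->
  is_weak_grad g (grad g).
Proof.
move=> cg dg cdg; split; first exact: continuous_L1loc.
  by move=> i; have := continuous_L1loc (cdg i); congr L1loc; apply/funext => y; rewrite mxE.
move=> phi tp i; have [sp [r _ pr]] := test_function_csupp tp.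
rewrite (Rintegral_by_parts cg (dg i) (cdg i) (smooth_continuous sp) _ _ pr).
- by congr (- _); apply: eq_Rintegral => y _; rewrite mxE.
- by move=> y; exact: smooth_derivable.
- exact: smooth_continuous (smooth_derive (delta_mx 0 i) sp).
Qed.

End locally_integrable.

(** * Duality and Cauchy-Schwarz for convolutions *)

Section convolution_duality.
Context {R : realType} {d : nat}.
Local Notation V := 'rV[R]_d.
Local Notation leb := (lebesgue_rV d : {measure set V -> \bar R}).
Implicit Types (f g k : V -> R).

Lemma Rintegral_reflect_le k r y : continuous k -> csupp r k ->
  \int[leb]_x k (x - y) = \int[leb]_x k x.
Proof.
move=> ck kr; have mk : measurable_fun setT k by exact: continuous_measurable_rV.
rewrite -(Rintegral_affine false (- y) mk); apply: eq_Rintegral => x _.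
by rewrite addrC.
Qed.

(** Fubini for [f y * g x * k (x - y)], which is integrable because [f] is, [g] is bounded, and
    translates of [k] share one L^1 norm. *)
Lemma convol_adjoint f g k r (C : R) : rint leb setT f -> measurable_fun setT g ->
  (forall x, `|g x| <= C) -> continuous k -> csupp r k ->
  rint leb setT (fun x => convol f k x * g x) /\
  \int[leb]_x (convol f k x * g x) = \int[leb]_y (f y * \int[leb]_x (g x * k (x - y))).
Proof.
move=> fi mg gC ck kr; have fl := rint_L1loc fi; have mf := rint_meas fi.
have mk : measurable_fun setT k by exact: continuous_measurable_rV.
have ki : rint leb setT k by exact: rint_csupp ck kr.
have C0 : 0 <= C by exact: le_trans (normr_ge0 _) (gC 0).
have gl : L1loc g by exact: bounded_L1loc mg gC.
pose W (p : V * V) : R := f p.1 * g p.2 * k (p.2 - p.1).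
have msub : measurable_fun setT (fun p : V * V => p.2 - p.1).
  have e : (fun p : V * V => p.2 - p.1) = (fun p : V * V => p.1 - p.2) \o (fun p => (p.2, p.1)).
    by apply/funext => -[].
  rewrite e; apply: measurableT_comp; first exact: measurable_sub_rV.
  by apply/measurable_fun_pairP; split; [exact: measurable_snd|exact: measurable_fst].
have mW : measurable_fun setT W.
  apply: measurable_funM; last exact: measurableT_comp.
  by apply: measurable_funM; exact: measurableT_comp.
have aki y : rint leb setT (fun x => `|k (x - y)|).
  have := rint_affine false (- y) (rint_abs ki).
  by congr (rint _ _ _); apply/funext => x; rewrite addrC.
have akE y : \int[leb]_x `|k (x - y)| = \int[leb]_x `|k x|.
  have mak : measurable_fun setT (fun x => `|k x|) by exact: measurableT_comp.
  rewrite -(Rintegral_affine false (- y) mak); apply: eq_Rintegral => x _.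
  by rewrite addrC.
have gki y : rint leb setT (fun x => g x * k (x - y)).
  apply: (@rint_le _ _ _ leb setT measurableT _ (fun x => C * `|k (x - y)|)).
  - apply: measurable_funM => //; apply: measurableT_comp => //.
    by have := measurable_affine_rV false (- y); under eq_fun do rewrite addrC.
  - exact: rintZ.
  - by move=> x _; rewrite normrM ler_wpM2r.
have iW : ((lebesgue_rV d) \x (lebesgue_rV d))%E.-integrable setT (EFin \o W).
  apply/integrableP; split; first exact/measurable_EFinP.
  have maW : measurable_fun setT (fun p : V * V => `|(EFin \o W) p|%E).
    by apply: measurableT_comp => //; exact/measurable_EFinP.
  have aW0 p : (0 <= `|(EFin \o W) p|)%E by [].
  rewrite (@fubini_tonelli1 _ _ _ _ R (lebesgue_rV d) (lebesgue_rV d) _ maW aW0).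
  apply: (@le_lt_trans _ _ (\int[leb]_y (`|f y| * (C * \int[leb]_x `|k x|))%:E)%E); last first.
    have h := rintZr measurableT (C * \int[leb]_x `|k x|) (rint_abs fi).
    by rewrite -(rint_EFin measurableT h) ltry.
  apply: ge0_le_integral => //.
  - by move=> y _; exact: integral_ge0.
  - have := @measurable_fun_fubini_tonelli_F _ _ _ _ R (lebesgue_rV d) _ maW aW0.
    exact.
  - by apply/measurable_EFinP; apply: measurable_funM => //; exact: measurableT_comp.
  move=> y _; rewrite /fubini_F /=.
  have h1 : rint leb setT (fun x => `|f y| * (C * `|k (x - y)|)).
    by apply: rintZ => //; apply: rintZ.
  apply: (@le_trans _ _ (\int[leb]_x (`|f y| * (C * `|k (x - y)|))%:E)%E).
    apply: ge0_le_integral => //.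
    - apply/measurable_EFinP; apply: measurableT_comp => //.
      under eq_fun do rewrite /W/= -mulrA.
      by apply: measurable_funM => //; exact: rint_meas (gki y).
    - by apply/measurable_EFinP; exact: rint_meas h1.
    - move=> x _; rewrite lee_fin /W/= !normrM -mulrA ler_wpM2l// ler_wpM2r//.
  rewrite -(rint_EFin measurableT h1) lee_fin.
  by rewrite (RintegralZl _ measurableT (rintZ measurableT C (aki y)))
    (RintegralZl _ measurableT (aki y)) akE.
have E1 y : (\int[leb]_x (EFin \o W) (y, x) = (f y * \int[leb]_x (g x * k (x - y)))%:E)%E.
  rewrite -(RintegralZl (f y) measurableT (gki y)).
  rewrite (rint_EFin measurableT (rintZ measurableT (f y) (gki y))).
  by apply: eq_integral => x _; rewrite /W/= mulrA.
have E2 x : (\int[leb]_y (EFin \o W) (y, x) = (convol f k x * g x)%:E)%E.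
  have h := rint_conv x fl ck kr.
  rewrite -(RintegralZr (g x) measurableT h) (rint_EFin measurableT (rintZr measurableT (g x) h)).
  by apply: eq_integral => y _; rewrite /W/= mulrAC.
split.
  have mcg : measurable_fun setT (fun x => convol f k x * g x).
    apply: measurable_funM => //; apply: continuous_measurable_rV.
    exact: continuous_conv ck kr.
  have mW' : measurable_fun setT (EFin \o W) by exact/measurable_EFinP.
  have Woo := (@integrable21ltyP _ _ _ _ R (lebesgue_rV d) (lebesgue_rV d) _ mW').1 iW.
  apply/integrableP; split; first exact/measurable_EFinP.
  apply: le_lt_trans Woo; apply: ge0_le_integral => //.
  - by apply: measurableT_comp => //; exact/measurable_EFinP.
  - have maW : measurable_fun setT (fun p : V * V => `|(EFin \o W) p|%E).
      by apply: measurableT_comp => //; exact/measurable_EFinP.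
    have aW0 p : (0 <= `|(EFin \o W) p|)%E by [].
    have := @measurable_fun_fubini_tonelli_G _ _ _ _ R (lebesgue_rV d) _ maW aW0.
    exact.
  move=> x _; rewrite [X in `|X|%E]/= -E2; apply: le_abse_integral => //.
  apply: (eq_measurable_fun (fun y => (f y * k (x - y) * g x)%:E)).
    by move=> y _; rewrite /W/= mulrAC.
  apply/measurable_EFinP; apply: measurable_funM => //.
  exact: rint_meas (rint_conv x fl ck kr).
have := @Fubini _ _ _ _ R (lebesgue_rV d) (lebesgue_rV d) _ iW.
under eq_integral do rewrite E1.
under [X in _ = X -> _]eq_integral do rewrite E2.
by rewrite /Rintegral => ->.
Qed.

(** Evenness of the mollifier makes the convolution self-adjoint. *)
Lemma mollify_adjoint f g n (C : R) : rint leb setT f -> measurable_fun setT g ->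
  (forall x, `|g x| <= C) ->
  rint leb setT (fun x => convol f (mollifier n) x * g x) /\
  \int[leb]_x (convol f (mollifier n) x * g x) = \int[leb]_y (f y * convol g (mollifier n) y).
Proof.
move=> fi mg gC; have ck := smooth_continuous (@smooth_mollifier R d n).
have [h1 h2] := convol_adjoint fi mg gC ck (@csupp_mollifier R d n).
split; first exact: h1.
have E y : \int[leb]_x (g x * mollifier n (x - y)) = convol g (mollifier n) y.
  by rewrite /convol; apply: eq_Rintegral => x _; rewrite -[in LHS]mollifierN opprB.
apply: (eq_trans h2); apply: eq_Rintegral => y _.
by apply/eqP; rewrite (E y).
Qed.

Lemma mollify_rint f n : rint leb setT f ->
  rint leb setT (convol f (mollifier n)) /\
  \int[leb]_x convol f (mollifier n) x = \int[leb]_x f x.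
Proof.
move=> fi; have ck := smooth_continuous (@smooth_mollifier R d n).
have h1 : forall x : V, `|(1 : R)| <= 1 by move=> _; rewrite normr1.
have [h2 h3] := convol_adjoint (g := fun=> 1) fi (measurable_cst _) h1 ck (@csupp_mollifier R d n).
split.
  by move: h2; congr (rint _ _ _); apply/funext => x; rewrite mulr1.
transitivity (\int[leb]_x (convol f (mollifier n) x * 1)).
  by apply: eq_Rintegral => x _; rewrite mulr1.
rewrite h3; apply: eq_Rintegral => y _.
under eq_Rintegral do rewrite mul1r.
by rewrite (Rintegral_reflect_le _ ck (@csupp_mollifier R d n)) Rintegral_mollifier mulr1.
Qed.

Lemma discriminant_le (a b p : R) : 0 <= p -> (forall c, 0 <= a - 2 * c * b + c ^+ 2 * p) ->
  b ^+ 2 <= p * a.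
Proof.
move=> p0 H; have [p1|p1] := eqVneq p 0.
  have [->|b0] := eqVneq b 0; first by rewrite p1 mul0r expr0n.
  (* For [p = 0] the expression is affine in [c]; this [c] gives it the value -1. *)
  have := H ((a + 1) / (2 * b)); rewrite p1 mulr0 addr0.
  have -> : a - 2 * ((a + 1) / (2 * b)) * b = - 1 by field; rewrite b0.
  by rewrite oppr_ge0 ler10.
have pp : 0 < p by rewrite lt_def p1.
have := H (b / p).
have -> : a - 2 * (b / p) * b + (b / p) ^+ 2 * p = a - b ^+ 2 / p by field.
by rewrite subr_ge0 ler_pdivrMr// mulrC.
Qed.

(** Integrating [rho (u - c)^2 k >= 0] gives a quadratic polynomial in [c] without negative
    values. *)
Lemma convol_cauchy_schwarz (rho u k : V -> R) r x : (forall y, 0 <= rho y) ->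
  L1loc rho ->
  L1loc (fun y => rho y * u y ^+ 2) ->
  L1loc (fun y => rho y * u y) -> continuous k -> csupp r k -> (forall z, 0 <= k z) ->
  convol (fun y => rho y * u y) k x ^+ 2 <=
  convol rho k x * convol (fun y => rho y * u y ^+ 2) k x.
Proof.
move=> rho0 rl el fl ck kr k0.
have hr := rint_conv x rl ck kr; have he := rint_conv x el ck kr.
have hf := rint_conv x fl ck kr.
apply: discriminant_le => [|c].
  by apply: Rintegral_ge0 => y _; rewrite mulr_ge0.
rewrite /convol -(RintegralZl (2 * c) measurableT hf) -(RintegralZl (c ^+ 2) measurableT hr).
have hf' := rintZ measurableT (2 * c) hf; have hr' := rintZ measurableT (c ^+ 2) hr.
rewrite -(RintegralB measurableT he hf') -(RintegralD measurableT (rintB measurableT he hf') hr').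
apply: Rintegral_ge0 => y _.
have -> : rho y * u y ^+ 2 * k (x - y) - 2 * c * (rho y * u y * k (x - y)) +
   c ^+ 2 * (rho y * k (x - y)) = rho y * (u y - c) ^+ 2 * k (x - y) by ring.
by apply: mulr_ge0 => //; apply: mulr_ge0 => //; exact: sqr_ge0.
Qed.

End convolution_duality.

(** * Kinetic energy of the mollified flux *)

Section density_velocity.
Context {R : realType} {d : nat}.
Local Notation V := 'rV[R]_d.
Local Notation leb := (lebesgue_rV d : {measure set V -> \bar R}).
Variables (rho u : V -> R).
Hypotheses (rho0 : forall y, 0 <= rho y) (ri : rint leb setT rho).
Hypotheses (mu_ : measurable_fun setT u) (fl : L1loc (fun y => rho y * u y)).
Local Notation f := (fun y => rho y * u y).
Local Notation e := (fun y => rho y * u y ^+ 2).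
Local Notation ker n := (@mollifier R d n).

(** The energy density [|J|^2 / rho] of the mollified flux and density. Where the mollified density
    vanishes it is 0, by [0^-1 = 0]. *)
Definition mollified_energy n x : R := convol f (ker n) x ^+ 2 / convol rho (ker n) x.

Lemma mollified_ge0 (g : V -> R) n x : (forall y, 0 <= g y) -> 0 <= convol g (ker n) x.
Proof. by move=> g0; apply: Rintegral_ge0 => y _; rewrite mulr_ge0// mollifier_ge0. Qed.

Lemma mollified_energy_ge0 n x : 0 <= mollified_energy n x.
Proof. by rewrite mulr_ge0 ?sqr_ge0// invr_ge0 mollified_ge0. Qed.

Let me : measurable_fun setT e.
Proof.
apply: measurable_funM; first exact: rint_meas ri.
exact: measurable_funX.
Qed.

Let cmoll g n : L1loc g -> continuous (convol g (ker n)).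
Proof.
by move=> gl; exact: (continuous_conv gl (smooth_continuous (@smooth_mollifier R d n)) (@csupp_mollifier R d n)).
Qed.

Lemma measurable_mollified_energy n : measurable_fun setT (mollified_energy n).
Proof.
apply: measurable_funM.
  apply: measurable_funX; apply: continuous_measurable_rV; exact: cmoll.
apply: measurable_inv; apply: continuous_measurable_rV; apply: cmoll.
exact: rint_L1loc.
Qed.

Lemma mollified_energy_le n x : rint leb setT e ->
  convol f (ker n) x ^+ 2 <= convol rho (ker n) x * convol e (ker n) x.
Proof.
move=> ei; apply: (convol_cauchy_schwarz x rho0 (rint_L1loc ri) (rint_L1loc ei) fl
  (smooth_continuous (@smooth_mollifier R d n)) (@csupp_mollifier R d n)).
exact: mollifier_ge0.
Qed.

Lemma mollified_energy_le' n x : rint leb setT e ->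
  mollified_energy n x <= convol e (ker n) x.
Proof.
move=> ei; have := mollified_energy_le n x ei; rewrite /mollified_energy.
have e0 : 0 <= convol e (ker n) x by apply: mollified_ge0 => y; rewrite mulr_ge0// sqr_ge0.
have := mollified_ge0 n x rho0; rewrite le_eqVlt => /orP[/eqP <-|r0 h]; first by rewrite invr0 mulr0.
by rewrite ler_pdivrMr// mulrC.
Qed.

Lemma integral_mollified_energy_le n :
  (\int[leb]_x (mollified_energy n x)%:E <= \int[leb]_x (e x)%:E)%E.
Proof.
have e0 x : 0 <= e x by rewrite mulr_ge0// sqr_ge0.
have [eoo|] := ltP (\int[leb]_x (e x)%:E)%E +oo%E; last by move=> h; exact: le_trans (leey _) h.
have ei : rint leb setT e by apply/rint_ge0P.
have [h1 h2] := mollify_rint n ei.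
rewrite -(rint_EFin measurableT ei) -h2 (rint_EFin measurableT h1).
apply: ge0_le_integral => //.
- by move=> x _; rewrite lee_fin mollified_energy_ge0.
- apply/measurable_EFinP; exact: measurable_mollified_energy.
- by apply/measurable_EFinP; exact: rint_meas h1.
- by move=> x _; rewrite lee_fin mollified_energy_le'.
Qed.

(** Lower semicontinuity: along a subsequence the mollifications converge almost everywhere, and
    Fatou applies. The flux is only locally integrable, hence the balls [B N]. At zeros of [rho] the
    quotients need not converge, but the limit energy is 0 there, so the quotients are restricted to
    [Z]. *)
Lemma integral_energy_le (K : \bar R) :
  (forall n, \int[leb]_x (mollified_energy n x)%:E <= K)%E ->
  (\int[leb]_x (e x)%:E <= K)%E.
Proof.
move=> HK.
have e0 x : 0 <= e x by rewrite mulr_ge0// sqr_ge0.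
pose B (N : nat) := [set x : V | `|x| <= N%:R].
have mB N : measurable (B N) by exact: measurable_ball_rV.
pose Z := [set x : V | rho x != 0].
have mZ : measurable Z.
  have -> : Z = rho @^-1` (~` [set 0]) by apply/seteqP; split => x /= /eqP.
  rewrite -[X in measurable X]setTI; apply: (rint_meas ri) => //.
  by apply: measurableC; exact: measurable_set1.
have key N : (\int[leb]_x (e x * \1_(B N) x)%:E <= K)%E.
  have [r1 r2] := mollify_L1 ri; have [f1 f2] := mollify_L1loc N%:R fl.
  have [h1 h2] := L1_cvg0D r1 f1 r2 f2.
  have [|s [g gi ae]] := @L1_cvg0_subseq _ _ _ leb _ h1 _ h2.
    by move=> n x; rewrite addr_ge0// mulr_ge0.
  apply: (@fatou_le _ _ _ leb (fun k x => mollified_energy (s k) x * \1_(B N `&` Z) x)).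
  - move=> k; apply: measurable_funM; first exact: measurable_mollified_energy.
    by apply: measurable_indic; exact: measurableI.
  - by move=> k x; rewrite mulr_ge0// mollified_energy_ge0.
  - exact: measurable_funM.
  - by move=> x; rewrite mulr_ge0.
  - apply: filterS ae => x [_ cx].
    have [xB|xB] := boolP (x \in B N); last first.
      rewrite [\1_(B N) x]indicE (negbTE xB) mulr0; apply: cvg_near_cst; apply: nearW => k.
      by rewrite indicE in_setI (negbTE xB) mulr0.
    have [r0|r0] := eqVneq (rho x) 0.
      rewrite r0 !mul0r; apply: cvg_near_cst; apply: nearW => k.
      have /negbTE xZ : x \notin Z by rewrite notin_setE /Z/= r0 eqxx.
      by rewrite indicE in_setI xZ andbF mulr0.
    have [p0 q0 sum0] : [/\ forall k, 0 <= `|convol rho (ker (s k)) x - rho x|,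
       forall k, 0 <= `|convol f (ker (s k)) x - rho x * u x| & 
       `|convol rho (ker (s k)) x - rho x| + `|convol f (ker (s k)) x - rho x * u x| @[k --> \oo] --> 0].
      split=> //; apply: cvg_trans cx; apply: near_eq_cvg; apply: nearW => k.
      by rewrite indicE -/(B N) xB mulr1.
    have c1 : convol rho (ker (s k)) x @[k --> \oo] --> rho x.
      by apply: cvg_of_dist_le sum0 => k; rewrite lerDl.
    have c2 : convol f (ker (s k)) x @[k --> \oo] --> rho x * u x.
      by apply: cvg_of_dist_le sum0 => k; rewrite lerDr.
    have -> : rho x * u x ^+ 2 * \1_(B N) x = (rho x * u x) ^+ 2 / rho x * \1_(B N `&` Z) x.
      rewrite !indicE in_setI xB /= (_ : x \in Z) ?inE/=; first by field.
      exact: r0.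
    apply: cvgM; last exact: cvg_cst.
    by apply: cvgM; [exact: cvgM|exact: cvgV].
  move=> k; apply: le_trans (HK (s k)); apply: ge0_le_integral => //.
  - by move=> x _; rewrite lee_fin mulr_ge0// mollified_energy_ge0.
  - apply/measurable_EFinP; apply: measurable_funM; first exact: measurable_mollified_energy.
    by apply: measurable_indic; exact: measurableI.
  - by apply/measurable_EFinP; exact: measurable_mollified_energy.
  - by move=> x _; rewrite lee_fin ler_piMr ?mollified_energy_ge0// indicE; case: (_ \in _).
apply: (@fatou_le _ _ _ leb (fun N x => e x * \1_(B N) x)) => //.
- by move=> N; exact: measurable_funM.
- by move=> N x; rewrite mulr_ge0.
- apply: aeW => x; apply: cvg_near_cst; near=> N.
  rewrite indicE mem_set ?mulr1//= /B/=.
  apply: (@le_trans _ _ (Num.truncn `|x|).+1%:R); first by rewrite ltW ?truncnS_gt.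
  by rewrite ler_nat; near: N; exact: nbhs_infty_ge.
Unshelve. all: by end_near. Qed.

(* For a time-dependent density the mollified energies are jointly measurable, so this
   makes the dissipation a measurable function of time. *)
Lemma integral_energy_sup :
  (\int[leb]_x (e x)%:E = ereal_sup (range (fun n => \int[leb]_x (mollified_energy n x)%:E)))%E.
Proof.
apply/eqP; rewrite eq_le; apply/andP; split.
  by apply: integral_energy_le => n; apply: ereal_sup_ubound; exists n.
by apply: ge_ereal_sup => _ [n _ <-]; exact: integral_mollified_energy_le.
Qed.

End density_velocity.

Lemma continuous_max0 {R : realType} : continuous (fun s : R => Num.max s 0).
Proof.
have -> : (fun s : R => Num.max s 0) = (fun s => (s + `|s|) * 2^-1).
  by apply/funext => s; rewrite maxr_absE subr0 addr0.
apply: (@continuous_mul R _ (fun s : R => s + `|s|) (fun=> 2^-1)); last exact: cst_continuous.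
apply: (@continuous_add R _ (fun s : R => s) (fun s => `|s|)).
  by move=> s; exact: cvg_id.
exact: norm_continuous.
Qed.

(** * Measurability in time *)

Section flow_in_time.
Context {R : realType} {d : nat}.
Local Notation V := 'rV[R]_d.
Local Notation leb := (lebesgue_rV d : {measure set V -> \bar R}).
Variables (lam eta m : R) (Psi : V -> R).
Hypotheses (lam0 : 0 < lam) (eta0 : 0 < eta) (m1 : 1 < m) (Psi1 : is_Ck 1 Psi).
Variable rho : R -> @density R d.
Hypothesis rho_cont : forall t : R, 0 <= t ->
  weak_cvg (within `[0%R, +oo[ (nbhs t))
    (fun s => density_measure (rho s)) (density_measure (rho t)).
Hypothesis rhoW : forall t, 0 < t -> W11loc (LF lam eta m \o rho t).
Local Notation ker n := (@mollifier R d n).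
Local Notation Dpos := (`]0%R, +oo[%classic : set (measurableTypeR R)).
Local Notation vel t := (velocity lam eta m Psi (rho t)).

Let m0 : 0 < m := lt_trans ltr01 m1.

Lemma density_rint t : rint leb setT (rho t).
Proof.
apply/rint_ge0P => //; [exact: measurable_density|by move=> x _; exact: density_ge0|].
by rewrite integral_density ltry.
Qed.

Lemma Rintegral_density t : \int[leb]_y rho t y = 1.
Proof. by rewrite /Rintegral integral_density. Qed.

(** Composing with [max t 0] prolongs the curve by its initial value to negative times and turns
    continuity within [[0, +oo[] into continuity on the line. *)
Lemma continuous_mass (f : V -> R) (C : R) : continuous f -> (forall y, `|f y| <= C) ->
  continuous (fun t : R => \int[leb]_y (rho (Num.max t 0) y * f y)).
Proof.
move=> cf fC t; have t0 : 0 <= Num.max t 0 by rewrite le_max lexx orbT.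
have mf : measurable_fun setT f by exact: continuous_measurable_rV.
have E s : (\int[density_measure (rho s)]_y f y)%R = \int[leb]_y (rho s y * f y).
  rewrite (Rintegral_density_measure (rho s) mf).
  by apply: eq_Rintegral => y _; rewrite mulrC.
have h := rho_cont t0 cf (ex_intro _ C fC).
have cm : (Num.max x 0 : R) @[x --> t] --> within `[0%R, +oo[ (nbhs (Num.max t 0 : R)).
  move=> P /=; rewrite /within/= => PD.
  have : \forall x \near t, (`[0%R, +oo[%classic (Num.max x 0) -> P (Num.max x 0)) by exact: (continuous_max0 PD).
  apply: filterS => x /=; apply.
  by rewrite in_itv/= andbT le_max lexx orbT.
rewrite E in h.
have h' : \int[leb]_y (rho s y * f y) @[s --> within `[0%R, +oo[ (nbhs (Num.max t 0 : R))] -->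
   \int[leb]_y (rho (Num.max t 0) y * f y).
  by apply: cvg_trans h; apply: near_eq_cvg; apply: nearW => s; rewrite E.
exact: (cvg_comp _ _ cm h').
Qed.

Lemma continuous_mollified_density n x :
  continuous (fun t : R => convol (rho (Num.max t 0)) (ker n) x).
Proof.
have sk := @smooth_mollifier R d n.
have ck : continuous (fun y : V => ker n (x - y)) by exact: continuous_reflect (smooth_continuous sk).
have kr := csupp_reflect (x := x) (@csupp_mollifier R d n).
have [C _ kC] := csupp_bounded ck kr.
exact: continuous_mass ck kC.
Qed.

(** [LF] truncated at height [N] and extended continuously to the line; its boundedness allows
    limits under the integral. *)
Let gN (N : nat) (s : R) : R := Num.min (lam * Num.max s 0 + eta * ppow m s) N%:R.

Let cgN N : continuous (gN N).
Proof.
pose b (s : R) := lam * Num.max s 0 + eta * ppow m s.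
have cb : continuous b.
  apply: (@continuous_add R _ (fun s : R => lam * Num.max s 0) (fun s : R => eta * ppow m s)).
    by apply: (@continuous_mul R R (fun=> lam)); [exact: cst_continuous|exact: continuous_max0].
  by apply: (@continuous_mul R R (fun=> eta)); [exact: cst_continuous|exact: continuous_ppow].
have -> : gN N = (fun s => (b s + N%:R + (-1) * `|b s + (- N%:R)|) * 2^-1).
  by apply/funext => s; rewrite /gN minr_absE mulN1r.
have cc (c : R) : continuous (fun s => b s + c).
  by apply: continuous_add => //; exact: cst_continuous.
apply: (@continuous_mul R R _ (fun=> 2^-1)); last exact: cst_continuous.
apply: (@continuous_add R R (fun s => b s + N%:R)); first exact: cc.
apply: (@continuous_mul R R (fun=> -1)); first exact: cst_continuous.
move=> s; apply: (cvg_comp (fun s => b s + - N%:R) (fun x => `|x|) (cc (- N%:R) s)).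
exact: norm_continuous.
Qed.

Let gN0 N s : 0 <= gN N s.
Proof.
rewrite /gN le_min ler0n andbT addr_ge0//; rewrite mulr_ge0 ?ppow_ge0 ?(ltW lam0) ?(ltW eta0)//.
by rewrite le_max lexx orbT.
Qed.

Let gN_le N s : `|gN N s| <= N%:R.
Proof. by rewrite ger0_norm ?gN0// ge_min lexx orbT. Qed.

Let mgN N (u : V -> R) : measurable_fun setT u -> measurable_fun setT (fun x => gN N (u x)).
Proof.
by move=> mu_; apply: (@measurableT_comp _ _ _ _ _ _ (gN N)) => //; exact: continuous_measurable_fun.
Qed.

(** [LF] is nonlinear, so weak continuity of [rho] says nothing directly. With the density mollified
    and [LF] truncated, the integral is continuous in [t]. Measurability survives the limit in the
    mollification and then the one in the truncation, which is dominated since [LF (rho t)] is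
    locally integrable. *)
Lemma measurable_pressure (f : V -> R) r : continuous f -> csupp r f ->
  measurable_fun Dpos (fun t => \int[leb]_y (LF lam eta m (rho t y) * f y)).
Proof.
move=> cf fr; have mf : measurable_fun setT f by exact: continuous_measurable_rV.
have fi : rint leb setT f by exact: rint_csupp cf fr.
have mr t : measurable_fun setT (rho t) by exact: measurable_density.
have hi N : rint leb setT (fun x => N%:R * `|f x|) by apply: rintZ => //; exact: rint_abs.
have cmo t n : continuous (convol (rho t) (ker n)).
  exact: (continuous_conv (rint_L1loc (density_rint t))
    (smooth_continuous (@smooth_mollifier R d n)) (@csupp_mollifier R d n)).
have mmo t n : measurable_fun setT (convol (rho t) (ker n)).
  exact: continuous_measurable_rV.
have cN N n : continuous (fun t : R => \int[leb]_x (gN N (convol (rho (Num.max t 0)) (ker n) x) * f x)).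
  move=> t; apply: cvg_nbhsP_seq => u ut.
  apply: (Rintegral_dctT (mu := leb) (h := fun x => N%:R * `|f x|) measurableT _ _ (hi N) _ _).2.
  - by move=> k; apply: measurable_funM => //; exact: mgN.
  - by apply: measurable_funM => //; exact: mgN.
  - move=> x _; apply: cvgM; last exact: cvg_cst.
    apply: continuous_cvg; first exact: cgN.
    have H : {for t, continuous (fun s : R => convol (rho (Num.max s 0)) (ker n) x)}.
      exact: continuous_mollified_density.
    exact: (continuous_cvg _ H ut).
  - by move=> x _ k; rewrite normrM ler_wpM2r.
have mN N : measurable_fun setT (fun t : measurableTypeR R => \int[leb]_x (gN N (rho (Num.max t 0) x) * f x)).
  apply: (measurable_fun_cvg (h := fun n (t : measurableTypeR R) =>
     \int[leb]_x (gN N (convol (rho (Num.max t 0)) (ker n) x) * f x))).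
    by move=> n; exact: continuous_measurable_fun.
  move=> t _; have [r1 r2] := mollify_L1 (density_rint (Num.max t 0)).
  apply: (Rintegral_dct_L1 (mu := leb) (C := 0) r1 _ r2 _ _ (hi N) (lexx 0) _ _).2.
  - by move=> n x.
  - by move=> n; apply: measurable_funM => //; exact: mgN.
  - by apply: measurable_funM => //; exact: mgN.
  - by move=> n x; rewrite mul0r addr0 normrM ler_wpM2r.
  - move=> x s h; apply: cvgM; last exact: cvg_cst.
    by apply: continuous_cvg; [exact: cgN|apply: cvg_of_dist_le h].
apply: (measurable_fun_cvg (h := fun N (t : measurableTypeR R) => \int[leb]_x (gN N (rho (Num.max t 0) x) * f x))).
  by move=> N; apply: measurable_funTS.
move=> t /=; rewrite in_itv/= andbT => t0; rewrite max_l ?(ltW t0)//.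
have [wl _ _] := is_weak_grad_weak_grad (rhoW t0).
have wi := rint_mul_csupp wl cf fr.
have LF0 x : 0 <= LF lam eta m (rho t x).
  by rewrite /LF addr_ge0// mulr_ge0 ?powR_ge0 ?density_ge0// ltW.
have gE N x : gN N (rho t x) = Num.min (LF lam eta m (rho t x)) N%:R.
  by rewrite /gN max_l ?density_ge0// ppowE ?density_ge0.
apply: (Rintegral_dctT (mu := leb) measurableT _ _ (rint_abs wi) _ _).2.
- by move=> k; apply: measurable_funM => //; exact: mgN.
- exact: rint_meas wi.
- move=> x _; apply: cvgM; last exact: cvg_cst.
  apply: cvg_near_cst; near=> N; rewrite gE min_l//.
  apply: (@le_trans _ _ (Num.truncn (LF lam eta m (rho t x))).+1%:R); first by rewrite ltW ?truncnS_gt.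
  by rewrite ler_nat; near: N; exact: nbhs_infty_ge.
- move=> x _ N; rewrite !normrM ler_wpM2r// gE !ger0_norm ?le_min ?LF0 ?ler0n//.
  by rewrite ge_min lexx.
Unshelve. all: by end_near. Qed.

Section fixed_time.
Variable t : R.
Hypothesis t0 : 0 < t.

Let w := LF lam eta m \o rho t.

Lemma measurable_velocity i : measurable_fun setT (fun y => vel t y 0 i).
Proof.
have mr : measurable_fun setT (rho t) by exact: measurable_density.
have h1 := weak_grad_density lam0 eta0 m1 (rhoW t0).
have h2 := weak_grad_density_powR lam0 eta0 m1 (rhoW t0).
have [_ g1 _] := is_weak_grad_weak_grad (ex_intro _ _ h1).
have [_ g2 _] := is_weak_grad_weak_grad (ex_intro _ _ h2).
have cg : continuous (partial i Psi) by case: Psi1 => _ /(_ (delta_mx 0 i))[_ []].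
have -> : (fun y => vel t y 0 i) = (fun y => 0 - (partial i Psi y + lam * (rho t y)^-1 * weak_grad (rho t) y 0 i
   + eta * (rho t y)^-1 * weak_grad (fun z => rho t z `^ m) y 0 i)).
  by apply/funext => y; rewrite !mxE sub0r.
have mi : measurable_fun setT (fun y => (rho t y)^-1) by exact: measurable_inv.
apply: measurable_funB; first exact: measurable_cst.
apply: measurable_funD; [apply: measurable_funD|].
- exact: continuous_measurable_rV.
- by apply: measurable_funM; [exact: measurable_funM|have [] := g1 i].
- by apply: measurable_funM; [exact: measurable_funM|have [] := g2 i].
Qed.

Let fluxE := velocity_flux Psi lam0 eta0 m1 (rhoW t0).

Let cdPsi i : continuous (partial i Psi).
Proof. by case: Psi1 => _ /(_ (delta_mx 0 i))[_ []]. Qed.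

Let rPsi i : L1loc (fun y => rho t y * partial i Psi y).
Proof.
exact: L1locM_continuous (rint_L1loc (density_rint t)) (@cdPsi i).
Qed.

Lemma flux_L1loc i : L1loc (fun y => rho t y * vel t y 0 i).
Proof.
have [_ wl _] := is_weak_grad_weak_grad (rhoW t0).
have /L1locP[mj jl] := L1locZ (-1) (L1locD (rPsi i) (wl i)).
have mf : measurable_fun setT (fun y => rho t y * vel t y 0 i).
  by apply: measurable_funM; [exact: measurable_density|exact: measurable_velocity].
apply/L1locP; split => // r; apply: (ae_eq_rint measurableT _ (jl r)).
  apply: measurable_funM => //; apply: measurable_indic; exact: measurable_ball_rV.
by apply: filterS fluxE => y /(_ i) h _; rewrite h mulN1r.
Qed.

(** Moving the derivative from [LF (rho t)] to [phi] expresses the flux through integrals whose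
    measurability in [t] is known. *)
Lemma Rintegral_flux i (phi : V -> R) r : smooth phi -> csupp r phi ->
  \int[leb]_y (rho t y * vel t y 0 i * phi y) =
  \int[leb]_y (LF lam eta m (rho t y) * partial i phi y)
  - \int[leb]_y (rho t y * (partial i Psi y * phi y)).
Proof.
move=> sp pr; have cp := smooth_continuous sp.
have [_ wl wI] := is_weak_grad_weak_grad (rhoW t0).
rewrite (wI phi (csupp_test_function sp pr) i).
have i1 := rint_mul_csupp (wl i) cp pr.
have i2 : rint leb setT (fun y => rho t y * (partial i Psi y * phi y)).
  have := rint_mul_csupp (rPsi i) cp pr.
  by congr (rint _ _ _); apply/funext => y; rewrite mulrA.
rewrite -opprD -(RintegralD measurableT i1 i2).
rewrite -(RintegralN measurableT (rintD measurableT i1 i2)).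
apply: ae_eq_Rintegral => //.
- exact: rint_meas (rint_mul_csupp (flux_L1loc i) cp pr).
- exact: rint_meas (rintN (rintD measurableT i1 i2)).
by apply: filterS fluxE => y /(_ i) h _; rewrite h mulNr mulrDl mulrA addrC.
Qed.

End fixed_time.

Lemma measurable_flux i (phi : V -> R) r : smooth phi -> csupp r phi ->
  measurable_fun Dpos (fun t => \int[leb]_y (rho t y * vel t y 0 i * phi y)).
Proof.
move=> sp pr.
have cg : continuous (partial i Psi) by case: Psi1 => _ /(_ (delta_mx 0 i))[_ []].
have cf : continuous (fun y => partial i Psi y * phi y).
  by apply: continuous_mul => //; exact: smooth_continuous.
have fr : csupp r (fun y => partial i Psi y * phi y) by move=> y /pr ->; rewrite mulr0.
have [C _ fC] := csupp_bounded cf fr.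
apply: (eq_measurable_fun (fun t =>
  \int[leb]_y (LF lam eta m (rho t y) * partial i phi y)
  - \int[leb]_y (rho (Num.max t 0) y * (partial i Psi y * phi y)))).
  move=> t; rewrite inE/= in_itv/= andbT => t0.
  by rewrite max_l ?(ltW t0)// -(Rintegral_flux t0 i sp pr).
apply: measurable_funB.
  exact: measurable_pressure (smooth_continuous (smooth_derive (delta_mx 0 i) sp)) (csupp_derive _ pr).
by apply: measurable_funTS; apply: continuous_measurable_fun; exact: continuous_mass cf fC.
Qed.

Lemma measurable_dissipation i :
  measurable_fun Dpos (fun t => \int[leb]_y (rho t y * vel t y 0 i ^+ 2)%:E)%E.
Proof.
pose D : set R := `]0, +oo[%classic.
have mD : measurable (D : set (measurableTypeR R)) by exact: measurable_itv.
(* The indicator restricts to positive times, where the flux is locally integrable and its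
   mollification is continuous in [x]. *)
pose P n (t : measurableTypeR R) x : R :=
  \1_D t * convol (fun y => rho t y * vel t y 0 i) (ker n) x.
pose Q n (t : measurableTypeR R) x : R := convol (rho (Num.max t 0)) (ker n) x.
have sk n := @smooth_mollifier R d n; have kr n := @csupp_mollifier R d n.
have mP n : measurable_fun setT (fun p => P n p.1 p.2).
  apply: measurable_caratheodory => [x|t]; rewrite /P.
    have [sr [r _ rr]] := test_function_csupp (csupp_reflect_test x (sk n) (kr n)).
    have /(measurable_restrictT _ mD) := measurable_flux i sr rr.
    congr (measurable_fun _ _); apply/funext => t; rewrite patchE indicE.
    by case: ifP => _; rewrite ?mul1r ?mul0r.
  rewrite indicE; have [tD|tD] := boolP (t \in D); last first.
    by under eq_fun do rewrite mul0r; exact: cst_continuous.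
  have t0 : 0 < t by move: tD; rewrite inE /D/= in_itv/= andbT.
  under eq_fun do rewrite mul1r.
  exact: (continuous_conv (flux_L1loc t0 i) (smooth_continuous (sk n)) (kr n)).
have mQ n : measurable_fun setT (fun p => Q n p.1 p.2).
  apply: measurable_caratheodory => [x|t]; rewrite /Q.
    by apply: continuous_measurable_fun; exact: continuous_mollified_density.
  exact: (continuous_conv (rint_L1loc (density_rint _)) (smooth_continuous (sk n)) (kr n)).
pose A n (t : measurableTypeR R) := (\int[leb]_x (P n t x ^+ 2 / Q n t x)%:E)%E.
have mA n : measurable_fun setT (A n).
  have mW : measurable_fun setT (fun p : measurableTypeR R * V => (P n p.1 p.2 ^+ 2 / Q n p.1 p.2)%:E).
    apply/measurable_EFinP; apply: measurable_funM; first exact: measurable_funX.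
    exact: measurable_inv.
  have W0 (p : measurableTypeR R * V) : (0 <= (P n p.1 p.2 ^+ 2 / Q n p.1 p.2)%:E)%E.
    rewrite lee_fin mulr_ge0 ?sqr_ge0// invr_ge0; apply: mollified_ge0 => y; exact: density_ge0.
  have := @measurable_fun_fubini_tonelli_F _ _ _ _ R (lebesgue_rV d) _ mW W0.
  exact.
apply: (eq_measurable_fun (fun t => ereal_sup (range (A ^~ t)))).
  move=> t; rewrite inE/= in_itv/= andbT => t0.
  rewrite (integral_energy_sup (fun y => density_ge0 (rho t) y) (density_rint t)
     (measurable_velocity t0 i) (flux_L1loc t0 i)).
  apply: (congr1 (fun F => ereal_sup (range F))); apply/funext => n; apply: eq_integral => x _.
  rewrite /P /Q /mollified_energy indicE mem_set ?mul1r ?max_l ?(ltW t0)//.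
  by rewrite /D/= in_itv/= t0.
apply: measurable_funTS.
have := @measurable_fun_esups _ _ R setT A mA 0%N.
congr (measurable_fun _ _); apply/funext => t; rewrite /esups/=; congr ereal_sup.
by apply/seteqP; split => [_ [k _ <-]|_ [k _ <-]]; exists k.
Qed.

End flow_in_time.

Lemma cvg_sum_seq {R : realType} (I : Type) (r : seq I) (F : I -> nat -> R) (l : I -> R) :
  (forall i, F i n @[n --> \oo] --> l i) ->
  \sum_(i <- r) F i n @[n --> \oo] --> \sum_(i <- r) l i.
Proof.
move=> Fl; elim: r => [|i r IH].
  by rewrite big_nil; under eq_fun do rewrite big_nil; exact: cvg_cst.
by rewrite big_cons; under eq_fun do rewrite big_cons; apply: cvgD.
Qed.

(** * Smooth steps in time and their derivatives *)

Section smooth_step_derivative.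
Context {R : realType}.
Local Notation S' := ('D_(1 : R) (@smooth_step R)).

Lemma smooth_step_derive0 (x : R) : x < 0 \/ 1 < x -> S' x = 0.
Proof.
move=> [x0|x1].
  have h : is_derive x (1 : R) (@smooth_step R) 0.
    apply: derive_near0; near=> y; rewrite smooth_step0//.
    by near: y; apply: filterS (lt_nbhsl x0) => y /ltW.
  by case: h.
have h : is_derive x (1 : R) (fun y => smooth_step y - 1) 0.
  apply: derive_near0; near=> y; rewrite smooth_step1 ?subrr//.
  by near: y; apply: filterS (lt_nbhsr x1) => y /ltW.
have sd := smooth_derivable (x := x) (v := (1 : R)) (@smooth_smooth_step R).
have [_ h1] := is_deriveB (derivableP sd) (is_derive_cst (1 : R) x (1 : R)).
have [_ h2] := h.
exact: (etrans (esym (subr0 _)) (etrans (esym h1) h2)).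
Unshelve. all: by end_near. Qed.

Lemma smooth_step_derive_bounded : exists2 C : R, 0 <= C & forall x, `|S' x| <= C.
Proof.
have cS : continuous S' := smooth_continuous (smooth_derive (1 : R) (@smooth_smooth_step R)).
have cn : continuous (fun x => `|S' x|).
  by move=> x; apply: (cvg_comp S' (fun y : R => `|y|) (cS x)); exact: norm_continuous.
have [c _ hc] := @EVT_max R (fun x => `|S' x|) 0 1 ler01 (continuous_subspaceT cn).
exists `|S' c|; first exact: normr_ge0.
move=> x; have := hc x; rewrite in_itv/=.
have [x01|] := boolP (0 <= x <= 1); first by apply.
rewrite negb_and -!ltNge => h _; rewrite smooth_step_derive0 ?normr0//.
by case/orP: h => ?; [left|right].
Qed.

Let step j s r := smooth_step (j.+1%:R * (r - s)) : R.

Lemma smooth_step_scaled j s : smooth (step j s).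
Proof.
have := @smooth_comp_affine R R R (@smooth_step R) (fun r => j.+1%:R * (r - s)) (fun v => j.+1%:R * v).
apply; last exact: smooth_smooth_step.
- apply: (@continuous_mul R R (fun=> j.+1%:R)); first exact: cst_continuous.
  by move=> x; apply: cvgB; [exact: cvg_id|exact: cvg_cst].
- by move=> x v h; rewrite /GRing.scale/=; ring.
Qed.

Lemma derive_smooth_step_scaled j s r :
  'D_(1 : R) (step j s) r = j.+1%:R * S' (j.+1%:R * (r - s)).
Proof.
have sd x v := smooth_derivable (x := x) (v := v) (@smooth_smooth_step R).
have h : is_derive (j.+1%:R * (r - s)) (j.+1%:R * (1 : R)) (@smooth_step R)
    (j.+1%:R * S' (j.+1%:R * (r - s))).
  by apply: (is_derive_dirZ (v := (1 : R))); apply: DeriveDef.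
have := is_derive_comp_affine (L := fun r => j.+1%:R * (r - s)) (M := fun v => j.+1%:R * v) (x := r) (v := (1 : R)) _ h.
by case=> [x|_ <-//]; rewrite /GRing.scale/=; ring.
Qed.

End smooth_step_derivative.

Section approximate_identity.
Context {R : realType}.
Local Notation lm := (@lebesgue_measure R).
Local Notation Dpos := (`]0%R, +oo[%classic : set (measurableTypeR R)).
Local Notation step j s := (fun r : R => @smooth_step R (j.+1%:R * (r - s))).

Lemma Rintegral_derive_step j (s : R) : 
  \int[lm]_(r in `[s, s + j.+1%:R^-1]) 'D_(1 : R) (step j s) r = 1.
Proof.
have ss := smooth_step_scaled j s.
have sd x : derivable (step j s) x 1 by exact: (smooth_derivable ss).
have cd : continuous ('D_(1 : R) (step j s)) by exact: smooth_continuous (smooth_derive (1 : R) ss).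
have lt : s < s + j.+1%:R^-1 by rewrite ltrDl invr_gt0 ltr0n.
rewrite /Rintegral (@continuous_FTC2 R _ (step j s) _ _ lt).
- by rewrite /= subrr mulr0 [X in X - s]addrC addrK divff ?pnatr_eq0// smooth_step1// smooth_step0// subr0.
- exact: continuous_subspaceT.
- split => //.
  + by apply: cvg_at_right_filter; exact: (smooth_continuous ss).
  + by apply: cvg_at_left_filter; exact: (smooth_continuous ss).
- by move=> x _; rewrite derive1E.
Qed.

Lemma Rintegral_pos_itv (f : R -> R) (a b : R) : 0 < a -> (forall r, r < a -> f r = 0) ->
  (forall r, b < r -> f r = 0) -> 
  \int[lm]_(r in Dpos) f r = \int[lm]_(r in `[a, b]) f r.
Proof.
move=> a0 fa fb; rewrite /Rintegral [in LHS]integral_mkcond [in RHS]integral_mkcond.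
congr fine; apply: eq_integral => r _; rewrite !patchE.
have [rD|rD] := boolP (r \in Dpos); have [rI|rI] := boolP (r \in `[a, b]%classic) => //.
- move: rI; rewrite notin_setE/= in_itv/= => /negP; rewrite negb_and -!ltNge.
  by case/orP => h; [rewrite fa|rewrite fb].
- move: rD rI; rewrite notin_setE inE/= !in_itv/= andbT => /negP; rewrite -leNgt => r0 /andP[ar _].
  by have := lt_le_trans a0 (le_trans ar r0); rewrite ltxx.
Qed.

Lemma rint_itv (f : R -> R) (a b : R) : continuous f -> rint lm `[a, b] f.
Proof.
move=> cf; apply: continuous_compact_integrable; first exact: segment_compact.
exact: continuous_subspaceT.
Qed.

Lemma derive_step_out j s r : r < s \/ s + j.+1%:R^-1 < r -> 'D_(1 : R) (step j s) r = 0.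
Proof.
have j0 : 0 < j.+1%:R :> R by rewrite ltr0n.
move=> h; rewrite derive_smooth_step_scaled smooth_step_derive0 ?mulr0//.
case: h => h; [left|right]; first by rewrite pmulr_rlt0// subr_lt0.
by rewrite -[ltLHS](divff (lt0r_neq0 j0)) ltr_pM2l// ltrBrDl.
Qed.

Lemma rint_pos_itv (f : R -> R) (a b : R) : continuous f -> 0 < a ->
  (forall r, r < a -> f r = 0) -> (forall r, b < r -> f r = 0) -> rint lm Dpos f.
Proof.
move=> cf a0 fa fb; have mI : measurable (`[a, b]%classic : set (measurableTypeR R)) by exact: measurable_itv.
have mD : measurable Dpos by exact: measurable_itv.
apply/(integrable_mkcond _ mD).
suff -> : (EFin \o f) \_ Dpos = (EFin \o f) \_ `[a, b].
  by apply/(integrable_mkcond _ mI); exact: rint_itv.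
apply/funext => r; rewrite !patchE /=.
have [rD|rD] := boolP (r \in Dpos); have [rI|rI] := boolP (r \in `[a, b]%classic) => //.
- move: rI; rewrite notin_setE/= in_itv/= => /negP; rewrite negb_and -!ltNge.
  by case/orP => h; [rewrite fa|rewrite fb].
- move: rD rI; rewrite notin_setE inE/= !in_itv/= andbT => /negP; rewrite -leNgt => r0 /andP[ar _].
  by have := lt_le_trans a0 (le_trans ar r0); rewrite ltxx.
Qed.

(** The derivative of the steep step has integral 1, is bounded by [C (j + 1)] and vanishes off an
    interval of length [1 / (j + 1)] to the right of [s]. Its L^1 norm is thus at most [C], whence
    the tolerance [e / (C + 1)] for [g]. *)
Lemma cvg_Rintegral_derive_step (g : R -> R) (s : R) : 0 < s -> continuous g ->
  \int[lm]_(r in Dpos) ('D_(1 : R) (step j s) r * g r) @[j --> \oo] --> g s.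
Proof.
move=> s0 cg; have [C C0 SC] := @smooth_step_derive_bounded R.
have out j := @derive_step_out j s.
have cd j : continuous ('D_(1 : R) (step j s)).
  exact: smooth_continuous (smooth_derive (1 : R) (smooth_step_scaled j s)).
apply/cvgrPdist_le => e e0.
have e1 : 0 < e / (C + 1) by rewrite divr_gt0// ltr_wpDl.
have [dl /= dl0 gd] : exists2 dl : R, 0 < dl & forall r, `|s - r| < dl -> `|g s - g r| <= e / (C + 1).
  have /cvgrPdist_le/(_ _ e1) /nbhs_ballP[dl /= dl0 h] := cg s.
  by exists dl => // r rd; apply: h; rewrite -ball_normE.
near=> j.
have j0 : 0 < j.+1%:R :> R by rewrite ltr0n.
have jd : j.+1%:R^-1 < dl.
  rewrite -[ltRHS]invrK ltf_pV2 ?posrE ?invr_gt0//.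
  apply: (lt_le_trans (truncnS_gt _)); rewrite ler_nat ltnS.
  by near: j; exact: nbhs_infty_ge.
rewrite (@Rintegral_pos_itv _ s (s + j.+1%:R^-1)) //; last 2 first.
  by move=> r rs; rewrite out ?mul0r//; left.
  by move=> r rs; rewrite out ?mul0r//; right.
have mI : measurable (`[s, s + j.+1%:R^-1] : set (measurableTypeR R)) by exact: measurable_itv.
have i1 := rint_itv s (s + j.+1%:R^-1) (cd j).
have i2 : rint lm `[s, s + j.+1%:R^-1] (fun r => 'D_(1 : R) (step j s) r * g r).
  by apply: rint_itv; exact: continuous_mul.
have E : g s - \int[lm]_(r in `[s, s + j.+1%:R^-1]) ('D_(1 : R) (step j s) r * g r) =
    \int[lm]_(r in `[s, s + j.+1%:R^-1]) ('D_(1 : R) (step j s) r * g s - 'D_(1 : R) (step j s) r * g r).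
  rewrite (RintegralB mI (rintZr mI (g s) i1) i2) (RintegralZr (g s) mI i1).
  by rewrite Rintegral_derive_step mul1r.
rewrite E.
have i3 : rint lm `[s, s + j.+1%:R^-1] (fun=> (j.+1%:R * C) * (e / (C + 1))).
  by apply: rint_itv; exact: cst_continuous.
apply: (@le_trans _ _ (\int[lm]_(r in `[s, s + j.+1%:R^-1]) ((j.+1%:R * C) * (e / (C + 1))))).
  apply: Rintegral_abs_le => //; first by apply: rintB => //; exact: rintZr.
  move=> r /=; rewrite in_itv/= => /andP[sr rs].
  rewrite -mulrBr normrM derive_smooth_step_scaled normrM (gtr0_norm j0).
  apply: ler_pM => //; first by rewrite ler_wpM2l// ltW.
  apply: gd; rewrite ler0_norm ?subr_le0// opprB (le_lt_trans _ jd)//.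
  by rewrite lerBlDl.
have hm : lm `[s, s + j.+1%:R^-1]%classic = (j.+1%:R^-1)%:E.
  by rewrite lebesgue_measure_itv/= lte_fin ltrDl invr_gt0 j0 -EFinB addrAC subrr add0r.
have := @Rintegral_cst _ _ R lm _ mI ((j.+1%:R * C) * (e / (C + 1))).
rewrite [X in fine X]hm /= => ->; rewrite -mulrA mulrC -!mulrA.
have -> : (C + 1)^-1 * (j.+1%:R^-1 * (j.+1%:R * C)) = C / (C + 1).
  by rewrite mulKf ?gt_eqF// mulrC.
by rewrite ler_piMr ?(ltW e0)// ler_pdivrMr ?mul1r ?lerDl// ltr_wpDl.
Unshelve. all: by end_near. Qed.

End approximate_identity.

(** * The continuity equation *)

Section transport.
Context {R : realType} {d : nat}.
Local Notation V := 'rV[R]_d.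
Local Notation leb := (lebesgue_rV d : {measure set V -> \bar R}).
Local Notation lm := (@lebesgue_measure R).
Local Notation Rm := (measurableTypeR R).
Local Notation Dpos := (`]0%R, +oo[%classic : set Rm).
Variables (rho : R -> @density R d) (v : R -> 'I_d -> V -> R).
Hypothesis mass_cont : forall (f : V -> R) (C : R), continuous f -> (forall y, `|f y| <= C) ->
  continuous (fun t : R => \int[leb]_y (rho (Num.max t 0) y * f y)).
Hypothesis mv : forall t i, 0 < t -> measurable_fun setT (v t i).
Hypothesis mflux : forall i (phi : V -> R) r, smooth phi -> csupp r phi ->
  measurable_fun Dpos (fun t => \int[leb]_y (rho t y * v t i y * phi y)).
Hypothesis mdis : forall i,
  measurable_fun Dpos (fun t => \int[leb]_y (rho t y * v t i y ^+ 2)%:E)%E.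

(** By the continuity equation this is the time derivative of [mass psi], in the integrated form of
    [mass_flow]. *)
Definition flow (psi : V -> R) t := \sum_i \int[leb]_y (rho t y * v t i y * partial i psi y).
Definition mass (psi : V -> R) t := \int[leb]_y (rho (Num.max t 0) y * psi y).
Definition dissipation t : \bar R := (\sum_i \int[leb]_y (rho t y * v t i y ^+ 2)%:E)%E.
(** Times of finite dissipation, at which the flux is integrable over the whole space. *)
Definition good : set Rm := [set t : R | 0 < t /\ (dissipation t < +oo)%E].
Definition diss (t : R) : R := fine (dissipation t).

Hypothesis dis_fin : forall T : R, 0 < T -> (\int[lm]_(t in `]0%R, T]) dissipation t < +oo)%E.
Hypothesis weak_eq : forall (chi : R -> R) (a b : R), smooth chi -> 0 < a ->
  (forall r, r < a -> chi r = 0) -> (forall r, b < r -> chi r = 0) ->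
  forall (psi : V -> R) c, smooth psi -> csupp c psi ->
  (\int[lm]_(r in Dpos) ('D_(1 : R) chi r * mass psi r + chi r * flow psi r)%:E = 0)%E.

Let rho0 t y : 0 <= rho t y. Proof. exact: density_ge0. Qed.

Lemma dissipation_ge0 t : (0 <= dissipation t)%E.
Proof.
apply: sume_ge0 => i _; apply: integral_ge0 => y _.
by rewrite lee_fin mulr_ge0// sqr_ge0.
Qed.

Lemma diss_ge0 t : 0 <= diss t.
Proof. by rewrite fine_ge0// dissipation_ge0. Qed.

Lemma measurable_dissipation_sum : measurable_fun Dpos dissipation.
Proof. by apply: emeasurable_sum => i; exact: mdis. Qed.

Let mDpos : measurable Dpos. Proof. exact: measurable_itv. Qed.

Lemma measurable_good : measurable good.
Proof.
have := emeasurable_fun_infty_o mDpos measurable_dissipation_sum +oo%E.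
congr measurable; apply/seteqP; split => t /=; rewrite in_itv/= andbT => -[? ?]; split=> //.
Qed.

Lemma measurable_diss : measurable_fun good diss.
Proof.
apply: (measurable_funS mDpos) => [t [t0 _]|]; first by rewrite /= in_itv/= t0.
exact: (measurableT_comp _ measurable_dissipation_sum).
Qed.

(** Only a null set of the interval is lost, and estimates valid at good times hold everywhere on
    this domain of integration. *)
Definition window (s t : R) : set Rm := `]s, t]%classic `&` good.

Lemma measurable_window s t : measurable (window s t).
Proof. by apply: measurableI; [exact: measurable_itv|exact: measurable_good]. Qed.

Lemma window_good s t r : window s t r -> [/\ 0 < r, s < r <= t & good r].
Proof. by move=> [/=]; rewrite in_itv/= => ? [? ?]. Qed.

Lemma window_null T : {ae lm, forall t : Rm, `]0, T]%classic t -> good t}.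
Proof.
have [T0|T0] := leP T 0.
  by apply: aeW => t /=; rewrite in_itv/= => /andP[t0 /le_trans/(_ T0)/(lt_le_trans t0)]; rewrite ltxx.
have mI : measurable (`]0, T]%classic : set Rm) by exact: measurable_itv.
have : lm.-integrable `]0, T] dissipation.
  apply/integrableP; split.
    apply: (measurable_funS mDpos) measurable_dissipation_sum => t /=.
    by rewrite !in_itv/= andbT => /andP[].
  under eq_integral do rewrite gee0_abs ?dissipation_ge0//.
  exact: dis_fin.
move=> /(integrable_ae mI); apply: filterS => t h tI; split.
  by move: tI; rewrite /= in_itv/= => /andP[].
by have := h tI; rewrite ge0_fin_numE// dissipation_ge0.
Qed.

Lemma dissipationE t : good t -> dissipation t = (diss t)%:E.
Proof. by move=> [_ h]; rewrite /diss fineK// ge0_fin_numE// dissipation_ge0. Qed.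

Lemma diss_rint T : rint lm (window 0 T) diss.
Proof.
have [T0|T0] := leP T 0.
  have -> : window 0 T = set0.
    apply/seteqP; split => t// /window_good[t0 /andP[_ tT] _].
    by have := lt_le_trans t0 (le_trans tT T0); rewrite ltxx.
  exact: integrable_set0.
have mW := measurable_window 0 T.
have mD : measurable_fun (window 0 T) diss.
  by apply: (measurable_funS measurable_good) measurable_diss => t [].
have D0 t : window 0 T t -> 0 <= diss t by move=> _; exact: diss_ge0.
suff H : (\int[lm]_(t in window 0 T) (diss t)%:E < +oo)%E.
  exact: ((rint_ge0P lm mD D0).2 H).
apply: le_lt_trans (dis_fin T0).
have -> : (\int[lm]_(t in window 0 T) (diss t)%:E = \int[lm]_(t in window 0 T) dissipation t)%E.
  by apply: eq_integral => t; rewrite inE => /window_good[_ _ gt]; rewrite dissipationE.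
apply: ge0_subset_integral => //.
- apply: (measurable_funS mDpos) measurable_dissipation_sum => t /=.
  by rewrite !in_itv/= andbT => /andP[].
- by move=> t _; exact: dissipation_ge0.
- by move=> t [].
Qed.

Section good_time.
Variable t : R.
Hypothesis gt : good t.
Let t0 : 0 < t. Proof. by case: gt. Qed.

Let mr : measurable_fun setT (rho t). Proof. exact: measurable_density. Qed.

Let me i : measurable_fun setT (fun y => rho t y * v t i y ^+ 2).
Proof. by apply: measurable_funM => //; apply: measurable_funX; exact: mv. Qed.

Lemma energy_rint i : rint leb setT (fun y => rho t y * v t i y ^+ 2).
Proof.
have e0 y : 0 <= rho t y * v t i y ^+ 2 by rewrite mulr_ge0// sqr_ge0.
apply/rint_ge0P => //; case: gt => _; apply: le_lt_trans; rewrite /dissipation.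
rewrite (bigD1 i)//= leeDl// sume_ge0// => j _; apply: integral_ge0 => y _.
by rewrite lee_fin mulr_ge0// sqr_ge0.
Qed.

Lemma dissE : diss t = \sum_i \int[leb]_y (rho t y * v t i y ^+ 2).
Proof.
apply: EFin_inj; rewrite -dissipationE// -sumEFin; apply: eq_bigr => i _.
by rewrite (rint_EFin measurableT (energy_rint i)).
Qed.

Let flux_le i y : `|rho t y * v t i y| <= rho t y + rho t y * v t i y ^+ 2.
Proof.
rewrite normrM ger0_norm// -{2}[rho t y]mulr1 -mulrDr ler_wpM2l//.
have [v1|v1] := leP `|v t i y| 1; first by rewrite (le_trans v1)// lerDl sqr_ge0.
rewrite -real_normK ?num_real//; have := ltW v1; nra.
Qed.

Let mf i : measurable_fun setT (fun y => rho t y * v t i y).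
Proof. by apply: measurable_funM => //; exact: mv. Qed.

Lemma flux_rint i : rint leb setT (fun y => rho t y * v t i y).
Proof.
apply: (@rint_le _ _ _ leb setT measurableT _ (fun y => rho t y + rho t y * v t i y ^+ 2)) => //.
by apply: rintD => //; [exact: density_rint|exact: energy_rint].
Qed.

(** [|rho v| <= rho + rho v^2] in each of the [d] components, and [rho] has mass 1. *)
Lemma flux_norm_le : \sum_i \int[leb]_y `|rho t y * v t i y| <= d%:R + diss t.
Proof.
have -> : d%:R = \sum_(i < d) 1 :> R by rewrite sumr_const card_ord.
rewrite dissE -big_split/=; apply: ler_sum => i _.
rewrite -(Rintegral_density rho t) -(RintegralD measurableT (density_rint rho t) (energy_rint i)).
apply: le_Rintegral => //.
- exact: rint_abs (flux_rint i).
- by apply: rintD => //; [exact: density_rint|exact: energy_rint].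
Qed.

Lemma flux_test_le (g : 'I_d -> V -> R) (C : R) : 0 <= C -> 
  (forall i, measurable_fun setT (g i)) -> (forall i y, `|g i y| <= C) ->
  (forall i, rint leb setT (fun y => rho t y * v t i y * g i y)) /\
  `|\sum_i \int[leb]_y (rho t y * v t i y * g i y)| <= C * (d%:R + diss t).
Proof.
move=> C0 mg gC.
have h i : rint leb setT (fun y => rho t y * v t i y * g i y).
  by apply: (rintM_bdd measurableT (mg i) (flux_rint i)) => y _; exact: gC.
split => //; apply: (le_trans (ler_norm_sum _ _ _)).
apply: (@le_trans _ _ (\sum_i C * \int[leb]_y `|rho t y * v t i y|)); last first.
  by rewrite -mulr_sumr ler_wpM2l// flux_norm_le.
apply: ler_sum => i _; have ai := rint_abs (flux_rint i).
rewrite -(RintegralZl C measurableT ai); apply: Rintegral_abs_le => //.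
  exact: rintZ.
by move=> y _; rewrite normrM mulrC ler_wpM2r.
Qed.

End good_time.

Lemma measurable_flow (psi : V -> R) c : smooth psi -> csupp c psi ->
  measurable_fun Dpos (flow psi).
Proof.
move=> sp pc; apply: measurable_sum => i.
by apply: (mflux i (smooth_derive (delta_mx 0 i) sp)); exact: csupp_derive pc.
Qed.

Lemma flow_rint (psi : V -> R) c T : smooth psi -> csupp c psi -> rint lm (window 0 T) (flow psi).
Proof.
move=> sp pc.
have /choice[C HC] : forall i, exists C : R, 0 <= C /\ forall z, `|partial i psi z| <= C.
  move=> i; have [C C0 h] := csupp_bounded (smooth_continuous (smooth_derive (delta_mx 0 i) sp)) (csupp_derive _ pc).
  by exists C.
pose K := \sum_i C i.
have K0 : 0 <= K by apply: sumr_ge0 => i _; case: (HC i).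
have CK i z : `|partial i psi z| <= K.
  case: (HC i) => _ h; apply: le_trans (h z) _.
  by rewrite /K (bigD1 i)//= lerDl; apply: sumr_ge0 => j _; case: (HC j).
have mW := measurable_window 0 T.
apply: (@rint_le _ _ _ lm (window 0 T) mW _ (fun t => K * (d%:R + diss t))).
- apply: (measurable_funS mDpos) (measurable_flow sp pc) => t /window_good[t0 _ _].
  by rewrite /= in_itv/= t0.
- apply: rintZ => //; apply: rintD => //; last exact: diss_rint.
  apply: rint_cst => //; apply: (@le_lt_trans _ _ (lm `]0, T]%classic)).
    by apply: le_measure; rewrite ?inE; [exact: mW|exact: measurable_itv|move=> t []].
  by rewrite lebesgue_measure_itv/=; case: ifP => _; rewrite ltry.
- move=> t /window_good[_ _ gt]; apply: (flux_test_le gt K0 _ CK).2 => i.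
  exact: continuous_measurable_rV (smooth_continuous (smooth_derive (delta_mx 0 i) sp)).
Qed.

Lemma Rintegral_window (g : R -> R) (T : R) : measurable_fun Dpos g ->
  (forall r, T < r -> g r = 0) -> rint lm (window 0 T) g ->
  rint lm Dpos g /\ \int[lm]_(r in Dpos) g r = \int[lm]_(r in window 0 T) g r.
Proof.
move=> mg gT gi; have mW := measurable_window 0 T.
pose h (r : Rm) := g r * \1_(window 0 T) r.
have mh : measurable_fun Dpos h.
  by apply: measurable_funM => //; apply: measurable_funTS; exact: measurable_indic.
have ae : {ae lm, forall r : Rm, Dpos r -> h r = g r}.
  apply: filterS (window_null T) => r hr rD; rewrite /h indicE.
  have [rT|rT] := leP r T; last by rewrite gT// mul0r.
  have rI : (`]0, T]%classic : set R) r.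
    by move: rD; rewrite /= !in_itv/= andbT rT andbT.
  by rewrite mem_set ?mulr1//; split => //; exact: hr.
have E : (EFin \o h) \_ Dpos = (EFin \o g) \_ (window 0 T).
  apply/funext => r; rewrite !patchE /h /= indicE.
  have [rW|rW] := boolP (r \in window 0 T).
    by move: rW; rewrite inE => /window_good[r0 _ _]; rewrite mem_set ?mulr1//= in_itv/= r0.
  by rewrite mulr0; case: ifP.
have hi : rint lm Dpos h.
  by apply/(integrable_mkcond _ mDpos); rewrite E; apply/(integrable_mkcond _ mW).
split; first exact: (ae_eq_rint mDpos mg hi ae).
rewrite -(ae_eq_Rintegral mDpos mh mg ae) /Rintegral integral_mkcond [in RHS]integral_mkcond.
by congr fine; apply: eq_integral => r _; rewrite -[in RHS]E.
Qed.

Lemma Rintegral_window_indic (g : R -> R) s t T : 0 <= s -> t <= T ->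
  \int[lm]_(r in window 0 T) (\1_(`]s, t]%classic : set R) r * g r) = \int[lm]_(r in window s t) g r.
Proof.
move=> s0 tT; rewrite /Rintegral [in LHS]integral_mkcond [in RHS]integral_mkcond.
congr fine; apply: eq_integral => r _; rewrite !patchE indicE /=.
have [rW|rW] := boolP (r \in window s t).
  move: rW; rewrite inE => /window_good[r0 /andP[sr rt] gr].
  rewrite mem_set; last by split => //; rewrite /= in_itv/= r0 (le_trans rt).
  by rewrite mem_set ?mul1r//= in_itv/= sr rt.
case: ifPn => // rT; have [rI|_] := boolP (r \in _); last by rewrite mul0r.
move: rW; rewrite notin_setE => -[]; move: rT rI; rewrite !inE => -[_ gr] rI.
by split.
Qed.

(** The equation is tested in time with a difference [chi j] of two steep steps. It tends to the
    indicator of []s, t]], while its derivative, paired with the continuous [mass psi], produces the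
    values at [s] and [t]. *)
Lemma mass_flow (psi : V -> R) c s t : smooth psi -> csupp c psi -> 0 < s -> s <= t ->
  mass psi t - mass psi s = \int[lm]_(r in window s t) flow psi r.
Proof.
move=> sp pc s0 st; have t0 := lt_le_trans s0 st.
pose chi j (r : R) := smooth_step (j.+1%:R * (r - s)) - smooth_step (j.+1%:R * (r - t)) : R.
have sS j u : smooth (fun r : R => smooth_step (j.+1%:R * (r - u))) := smooth_step_scaled j u.
have schi j : smooth (chi j).
  have -> : chi j = (fun r => smooth_step (j.+1%:R * (r - s)) + (-1) * smooth_step (j.+1%:R * (r - t))).
    by apply/funext => r; rewrite mulN1r.
  by move=> k; apply: is_CkD; [exact: sS|apply: is_CkZ; exact: sS].
have j0 j : 0 < j.+1%:R :> R by rewrite ltr0n.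
have chi0 j r : r <= s -> chi j r = 0.
  move=> rs; rewrite /chi !smooth_step0 ?subrr//.
    by rewrite pmulr_rle0// subr_le0 (le_trans rs).
  by rewrite pmulr_rle0// subr_le0.
have chi1 j r : t + j.+1%:R^-1 <= r -> chi j r = 0.
  move=> rt; have h u : u <= t -> 1 <= j.+1%:R * (r - u).
    move=> ut; rewrite -[leLHS](divff (lt0r_neq0 (j0 j))) ler_pM2l// lerBrDr.
    by rewrite (le_trans _ rt)// addrC lerD2r.
  by rewrite /chi !smooth_step1 ?subrr ?h.
have chi_le j r : `|chi j r| <= 1.
  rewrite /chi ler_distl; have := @smooth_step_ge0 R; have := @smooth_step_le1 R.
  by move=> h1 h2; have := h1 (j.+1%:R * (r - s)); have := h1 (j.+1%:R * (r - t));
    have := h2 (j.+1%:R * (r - s)); have := h2 (j.+1%:R * (r - t)); lra.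
have chi_lim r : chi j r @[j --> \oo] --> (\1_(`]s, t]%classic : set R) r : R).
  have lim1 u : u < r -> smooth_step (j.+1%:R * (r - u)) @[j --> \oo] --> (1 : R).
    move=> ur; apply: cvg_near_cst; near=> j; apply: smooth_step1.
    have ru : 0 < r - u by rewrite subr_gt0.
    rewrite -ler_pdivrMr// (le_trans (ltW (truncnS_gt _)))// ler_nat ltnS.
    by near: j; exact: nbhs_infty_ge.
  have lim0 u : r <= u -> smooth_step (j.+1%:R * (r - u)) @[j --> \oo] --> (0 : R).
    move=> ru; apply: cvg_near_cst; apply: nearW => j; apply: smooth_step0.
    by rewrite pmulr_rle0// subr_le0.
  rewrite indicE; have [rI|] := boolP (r \in _).
    move: rI; rewrite inE/= in_itv/= => /andP[sr rt].
    by rewrite -[X in _ --> X](subr0 1); apply: cvgB; [exact: lim1|exact: lim0].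
  rewrite notin_setE/= in_itv/= => /negP; rewrite negb_and -leNgt -ltNge => /orP[rs|tr].
    by rewrite -[X in _ --> X](subr0 0); apply: cvgB; [exact: lim0|apply: lim0; exact: le_trans rs st].
  rewrite -[X in _ --> X](subrr (1 : R)); apply: cvgB; apply: lim1 => //.
  exact: le_lt_trans tr.
pose fl r := \1_good r * flow psi r.
(* Every [chi j] vanishes beyond [t + 1 / (j + 1)], which is at most [T]. *)
pose T := t + 1.
have mW := measurable_window 0 T; have mWs := measurable_window s t.
have fi := flow_rint T sp pc.
have cm : continuous (mass psi).
  have [C _ pC] := csupp_bounded (smooth_continuous sp) pc.
  exact: mass_cont (smooth_continuous sp) pC.
have Deq j : 'D_(1 : R) (chi j) = (fun r => 'D_(1 : R) (fun r : R => smooth_step (j.+1%:R * (r - s))) r -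
     'D_(1 : R) (fun r : R => smooth_step (j.+1%:R * (r - t))) r).
  apply/funext => r; rewrite /chi -deriveB//; exact: (smooth_derivable (sS j _)).
have eqj j : \int[lm]_(r in window 0 T) (chi j r * flow psi r) =
    \int[lm]_(r in Dpos) ('D_(1 : R) (fun r : R => smooth_step (j.+1%:R * (r - t))) r * mass psi r)
    - \int[lm]_(r in Dpos) ('D_(1 : R) (fun r : R => smooth_step (j.+1%:R * (r - s))) r * mass psi r).
  pose p u r := 'D_(1 : R) (fun r : R => smooth_step (j.+1%:R * (r - u))) r * mass psi r.
  have ip u : 0 < u -> rint lm Dpos (p u).
    move=> u0; apply: (rint_pos_itv (a := u) (b := u + j.+1%:R^-1)) => //.
    - by apply: continuous_mul => //; exact: smooth_continuous (smooth_derive (1 : R) (sS j u)).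
    - by move=> r ru; rewrite /p derive_step_out ?mul0r//; left.
    - by move=> r ru; rewrite /p derive_step_out ?mul0r//; right.
  have tT : t + j.+1%:R^-1 <= T by rewrite lerD2l invf_le1// ler1n.
  have mcf : measurable_fun Dpos (fun r => chi j r * flow psi r).
    apply: measurable_funM; last exact: measurable_flow sp pc.
    apply: measurable_funTS; apply: continuous_measurable_fun; exact: smooth_continuous (schi j).
  have [||i3 E3] := @Rintegral_window (fun r => chi j r * flow psi r) T mcf.
  - by move=> r Tr; rewrite chi1 ?mul0r// (le_trans tT)// ltW.
  - have := rintM_bdd mW (g := chi j) (C := 1) _ fi _.
    rewrite /rint => h; have := h _ (fun r _ => chi_le j r).
    by rewrite (_ : (fun r => flow psi r * chi j r) = (fun r => chi j r * flow psi r));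
      [apply; apply: measurable_funTS; apply: continuous_measurable_fun; exact: smooth_continuous (schi j)
      |apply/funext => r; rewrite mulrC].
  have := weak_eq (schi j) s0 (fun r rs => chi0 j r (ltW rs)) (fun r rs => chi1 j r (ltW rs)) sp pc.
  have i12 := rintB mDpos (ip s s0) (ip t t0).
  have -> : (fun r => ('D_(1 : R) (chi j) r * mass psi r + chi j r * flow psi r)%:E) =
     (fun r => (p s r - p t r + chi j r * flow psi r)%:E).
    apply/funext => r; rewrite /p -mulrBl; congr ((_ * _ + _)%:E).
    exact: (congr1 (fun f => f r) (Deq j)).
  rewrite -(rint_EFin mDpos (rintD mDpos i12 i3)) => -[].
  rewrite (RintegralD mDpos i12 i3) (RintegralB mDpos (ip s s0) (ip t t0)) E3.
  have aux (x y z : R) : x - y + z = 0 -> z = y - x by move=> h; lra.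
  exact: aux.
have L1 : \int[lm]_(r in window 0 T) (chi j r * flow psi r) @[j --> \oo] --> mass psi t - mass psi s.
  under eq_fun do rewrite eqj.
  by apply: cvgB; apply: cvg_Rintegral_derive_step.
have L2 : \int[lm]_(r in window 0 T) (chi j r * flow psi r) @[j --> \oo] -->
    \int[lm]_(r in window 0 T) (\1_(`]s, t]%classic : set R) r * flow psi r).
  have mfl := rint_meas fi.
  have mitv : measurable (`]s, t]%classic : set Rm) by exact: measurable_itv.
  apply: (Rintegral_dctT (mu := lm) mW _ _ (rint_abs fi) _ _).2.
  - move=> j; apply: measurable_funM => //; apply: measurable_funTS.
    by apply: continuous_measurable_fun; exact: smooth_continuous (schi j).
  - by apply: measurable_funM => //; apply: measurable_funTS; exact: measurable_indic.
  - by move=> r _; apply: cvgM; [exact: chi_lim|exact: cvg_cst].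
  - by move=> r _ j; rewrite normrM ler_piMl.
rewrite (Rintegral_window_indic _ (ltW s0)) ?lerDl// in L2.
exact: (cvg_unique _ L1 L2).
Unshelve. all: by end_near. Qed.

(** Test functions live at positive times; the initial time is reached through the continuity of
    [mass psi]. *)
Lemma mass_flow0 (psi : V -> R) c s t : smooth psi -> csupp c psi -> 0 <= s -> s <= t ->
  mass psi t - mass psi s = \int[lm]_(r in window s t) flow psi r.
Proof.
move=> sp pc; rewrite le_eqVlt => /orP[/eqP <-{s} t0|s0]; last exact: mass_flow sp pc s0.
move: t0; rewrite le_eqVlt => /orP[/eqP <-{t}|t0].
  have -> : window 0 0 = set0.
    apply/seteqP; split => r// /window_good[r0 /andP[_ r0'] _].
    by have := lt_le_trans r0 r0'; rewrite ltxx.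
  by rewrite subrr Rintegral_set0.
pose u (n : nat) := t * n.+1%:R^-1.
have u0 n : 0 < u n by rewrite mulr_gt0 ?invr_gt0.
have ut n : u n <= t by rewrite ler_piMr ?(ltW t0)// invf_le1// ler1n.
have ulim : u n @[n --> \oo] --> (0 : R).
  by rewrite -(mulr0 t); apply: cvgM; [exact: cvg_cst|exact: cvg_harmonic].
have [C _ pC] := csupp_bounded (smooth_continuous sp) pc.
have cm := mass_cont (smooth_continuous sp) pC.
have fi := flow_rint t sp pc.
have mW := measurable_window 0 t.
have L1 : \int[lm]_(r in window 0 t) (\1_(`]u n, t]%classic : set R) r * flow psi r) @[n --> \oo]
    --> mass psi t - mass psi 0.
  have -> : (fun n => \int[lm]_(r in window 0 t) (\1_(`]u n, t]%classic : set R) r * flow psi r)) =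
     (fun n => mass psi t - mass psi (u n)).
    by apply/funext => n; rewrite (Rintegral_window_indic _ (ltW (u0 n)))// -(mass_flow sp pc).
  apply: cvgB; first exact: cvg_cst.
  have c0 : {for 0, continuous (mass psi)} by exact: cm.
  exact: (continuous_cvg _ c0 ulim).
have L2 : \int[lm]_(r in window 0 t) (\1_(`]u n, t]%classic : set R) r * flow psi r) @[n --> \oo]
    --> \int[lm]_(r in window 0 t) flow psi r.
  apply: (Rintegral_dctT (mu := lm) mW _ _ (rint_abs fi) _ _).2.
  - move=> n; apply: measurable_funM; last exact: rint_meas fi.
    by apply: measurable_funTS; apply: measurable_indic; exact: measurable_itv.
  - exact: rint_meas fi.
  - move=> r /window_good[r0 /andP[_ rt] _]; apply: cvg_near_cst; near=> n.
    rewrite indicE mem_set ?mul1r//= in_itv/= rt andbT.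
    near: n; exact: (cvgr_lt _ ulim).
  - by move=> r _ n; rewrite normrM ler_piMl// indicE; case: (_ \in _); rewrite ?normr1 ?normr0.
exact: (cvg_unique _ L1 L2).
Unshelve. all: by end_near. Qed.


End transport.

(** * Dissipation of the entropy of the mollified density *)

Section entropy_step.
Context {R : realType} {d : nat}.
Local Notation V := 'rV[R]_d.
Local Notation leb := (lebesgue_rV d : {measure set V -> \bar R}).
Local Notation lm := (@lebesgue_measure R).
Local Notation Rm := (measurableTypeR R).
Local Notation Dpos := (`]0%R, +oo[%classic : set Rm).
Local Notation ker n := (@mollifier R d n).
Variables (rho : R -> @density R d) (v : R -> 'I_d -> V -> R).
Hypothesis mass_cont : forall (f : V -> R) (C : R), continuous f -> (forall y, `|f y| <= C) ->
  continuous (fun t : R => \int[leb]_y (rho (Num.max t 0) y * f y)).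
Hypothesis mv : forall t i, 0 < t -> measurable_fun setT (v t i).
Local Notation window := (window rho v).
Local Notation flow := (flow rho v).
Local Notation mass := (mass rho).
Local Notation diss := (diss rho v).
Hypothesis mW : forall s t, measurable (window s t).
Hypothesis dissi : forall T, rint lm (window 0 T) diss.
Hypothesis flowi : forall (psi : V -> R) c T, smooth psi -> csupp c psi ->
  rint lm (window 0 T) (flow psi).
Hypothesis mass_flow : forall (psi : V -> R) c s t, smooth psi -> csupp c psi -> 0 <= s -> s <= t ->
  mass psi t - mass psi s = \int[lm]_(r in window s t) flow psi r.

Variables (n N : nat) (q G : R -> R) (Cq : R).
Hypothesis qc : forall s, 0 <= s -> {for s, continuous q}.
Hypothesis q_le : forall s, 0 <= s -> `|q s| <= Cq.
Hypothesis G_convex : forall a b, 0 <= a -> 0 <= b -> G a - G b <= q a * (a - b).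
Hypothesis Gc : forall s, 0 <= s -> {for s, continuous G}.

Let zeta := @cutoff R d N.
Definition moll t : V -> R := convol (rho t) (ker n).
(** The outer convolution transfers the mollifier from the density to the test function: pairing
    [rho] with it amounts to pairing the mollified density with [zeta q], where [q] plays the role
    of [G']. *)
Definition test_fun t : V -> R := convol (fun x => zeta x * q (moll t x)) (ker n).
Definition entropy t := \int[leb]_x (zeta x * G (moll t x)).

Let cker : continuous (ker n) := smooth_continuous (@smooth_mollifier R d n).

Lemma moll_ge0 t x : 0 <= moll t x.
Proof. by apply: mollified_ge0 => y; exact: density_ge0. Qed.

Lemma continuous_moll t : continuous (moll t).
Proof.
exact: (continuous_conv (rint_L1loc (density_rint rho t)) cker (@csupp_mollifier R d n)).
Qed.

Let Cq0 : 0 <= Cq. Proof. exact: le_trans (normr_ge0 _) (q_le (lexx 0)). Qed.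

Let g t x := zeta x * q (moll t x).

Let cg t : continuous (g t).
Proof.
apply: continuous_mul; first exact: smooth_continuous (@smooth_cutoff R d N).
move=> x; apply: (cvg_comp (moll t) q (@continuous_moll t x)).
exact: qc (moll_ge0 t x).
Qed.

Let g_le t x : `|g t x| <= Cq.
Proof.
rewrite normrM ger0_norm ?cutoff_ge0// (le_trans _ (q_le (moll_ge0 t x)))//.
by rewrite ler_piMl// cutoff_le1.
Qed.

Let gs t : csupp (2 * N.+1%:R) (g t).
Proof. by move=> x /(@csupp_cutoff R d N) h; rewrite /g /zeta h mul0r. Qed.

Let gl t : L1loc (g t).
Proof. exact: bounded_L1loc (continuous_measurable_rV (@cg t)) (g_le t). Qed.

Lemma smooth_test_fun t : smooth (test_fun t).
Proof. exact: smooth_conv (gl t) (@smooth_mollifier R d n) (@csupp_mollifier R d n). Qed.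

Lemma csupp_test_fun t : csupp (2 * N.+1%:R + n.+1%:R^-1) (test_fun t).
Proof. by apply: csupp_conv; [exact: gs|exact: csupp_mollifier]. Qed.

Let dk i := partial i (ker n).

Let cdk i : continuous (dk i).
Proof. exact: smooth_continuous (smooth_derive _ (@smooth_mollifier R d n)). Qed.

Let sdk i : csupp n.+1%:R^-1 (dk i).
Proof. exact: csupp_derive (@csupp_mollifier R d n). Qed.

Let dki i y : rint leb setT (fun x => `|dk i (y - x)|).
Proof.
have := rint_affine true y (rint_abs (rint_csupp (@cdk i) (@sdk i))).
exact.
Qed.

(** The derivative falls on the kernel, so a bound on [q] alone controls it. *)
Lemma partial_test_fun t i y : partial i (test_fun t) y = \int[leb]_x (g t x * dk i (y - x)).
Proof.
have := derivable_conv (delta_mx 0 i) y (gl t) (@smooth_mollifier R d n) (@csupp_mollifier R d n).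
by case.
Qed.

Let K := \sum_i \int[leb]_x `|dk i x|.

Let intdk i y : \int[leb]_x `|dk i (y - x)| = \int[leb]_x `|dk i x|.
Proof.
have mk : measurable_fun setT (fun x => `|dk i x|).
  by apply: measurableT_comp => //; exact: continuous_measurable_rV.
by have := Rintegral_affine true y mk; exact.
Qed.

Let K0 : 0 <= K.
Proof. by apply: sumr_ge0 => i _; apply: Rintegral_ge0. Qed.

Let partial_test_fun_le t i y : `|partial i (test_fun t) y| <= Cq * K.
Proof.
rewrite partial_test_fun.
apply: (@le_trans _ _ (\int[leb]_x (Cq * `|dk i (y - x)|))).
  apply: Rintegral_abs_le => //.
  - exact: (rint_conv y (gl t) (@cdk i) (@sdk i)).
  - exact: rintZ.
  - by move=> x _; rewrite normrM ler_wpM2r.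
rewrite (RintegralZl Cq measurableT (dki i y)) intdk ler_wpM2l// /K (bigD1 i)//= lerDl.
by apply: sumr_ge0 => j _; apply: Rintegral_ge0.
Qed.

(* Convexity bounds the increment by that of the mass tested against [test_fun t],
   which the continuity equation turns into a time integral of the flux. *)
Lemma entropy_step s t : 0 <= s -> 0 <= t ->
  entropy t - entropy s <= mass (test_fun t) t - mass (test_fun t) s.
Proof.
move=> s0 t0.
have cz := smooth_continuous (@smooth_cutoff R d N).
have iG u : rint leb setT (fun x => zeta x * G (moll u x)).
  apply: (@rint_csupp _ _ _ (2 * N.+1%:R)).
    apply: continuous_mul => // x; apply: (cvg_comp (moll u) G (@continuous_moll u x)).
    exact: Gc (moll_ge0 u x).
  by move=> x /(@csupp_cutoff R d N) h; rewrite /zeta h mul0r.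
have mg := continuous_measurable_rV (@cg t).
have massE u : 0 <= u -> mass (test_fun t) u = \int[leb]_x (moll u x * g t x) /\
    rint leb setT (fun x => moll u x * g t x).
  move=> u0; have [h1 h2] := mollify_adjoint n (density_rint rho u) mg (g_le t).
  by split => //; rewrite /mass max_l// h2.
have [-> i1] := massE t t0; have [-> i2] := massE s s0.
rewrite /entropy -(RintegralB measurableT (iG t) (iG s)) -(RintegralB measurableT i1 i2).
apply: le_Rintegral => //; [exact: rintB|exact: rintB|].
move=> x _; rewrite -mulrBr -mulrBl /g mulrCA ler_wpM2l ?cutoff_ge0//.
by rewrite [leRHS]mulrC G_convex// moll_ge0.
Qed.

Lemma flow_test_le t r : good rho v r -> `|flow (test_fun t) r| <= Cq * K * (d%:R + diss r).
Proof.
move=> gr; apply: (flux_test_le mv gr _ _ _).2 => //.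
- by rewrite mulr_ge0.
- by move=> i; apply: continuous_measurable_rV; exact: smooth_continuous (smooth_derive _ (smooth_test_fun t)).
Qed.

Lemma cvg_moll (u : nat -> R) (r : R) x : (forall j, 0 <= u j) -> 0 <= r -> u j @[j --> \oo] --> r ->
  moll (u j) x @[j --> \oo] --> moll r x.
Proof.
move=> u0 r0 ur.
have c : {for r, continuous (fun t : R => convol (rho (Num.max t 0)) (ker n) x)}.
  have kr := csupp_reflect (x := x) (@csupp_mollifier R d n).
  have ck : continuous (fun y : V => ker n (x - y)) by exact: continuous_reflect cker.
  have [C _ kC] := csupp_bounded ck kr.
  exact: (mass_cont ck kC).
have h : convol (rho (Num.max (u j) 0)) (ker n) x @[j --> \oo] --> convol (rho (Num.max r 0)) (ker n) x.
  exact: (continuous_cvg _ c ur).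
move: h; rewrite max_l//; apply: cvg_trans; apply: near_eq_cvg; apply: nearW => j.
by rewrite max_l.
Qed.

Lemma cvg_flow_test (u : nat -> R) r : (forall j, 0 <= u j) -> good rho v r ->
  u j @[j --> \oo] --> r -> flow (test_fun (u j)) r @[j --> \oo] --> flow (test_fun r) r.
Proof.
move=> u0 gr ur; have r0 : 0 < r by case: gr.
have cp t i : measurable_fun setT (partial i (test_fun t)).
  by apply: continuous_measurable_rV; exact: smooth_continuous (smooth_derive _ (smooth_test_fun t)).
have lim i y : partial i (test_fun (u j)) y @[j --> \oo] --> partial i (test_fun r) y.
  under eq_fun do rewrite partial_test_fun.
  rewrite partial_test_fun.
  apply: (Rintegral_dctT (mu := leb) (h := fun x => Cq * `|dk i (y - x)|) measurableT _ _ _ _ _).2.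
  - by move=> j; exact: rint_meas (rint_conv y (gl (u j)) (@cdk i) (@sdk i)).
  - exact: rint_meas (rint_conv y (gl r) (@cdk i) (@sdk i)).
  - exact: rintZ.
  - move=> x _; apply: cvgM; last exact: cvg_cst.
    apply: cvgM; first exact: cvg_cst.
    by apply: continuous_cvg; [exact: qc (moll_ge0 r x)|apply: cvg_moll => //; exact: ltW].
  - by move=> x _ j; rewrite normrM ler_wpM2r.
apply: cvg_sum_seq => i; have fi := flux_rint mv gr i.
apply: (Rintegral_dctT (mu := leb) (h := fun y => Cq * K * `|rho r y * v r i y|) measurableT _ _ _ _ _).2.
- by move=> j; apply: measurable_funM => //; exact: rint_meas fi.
- by apply: measurable_funM => //; exact: rint_meas fi.
- by apply: rintZ => //; exact: rint_abs.
- by move=> y _; apply: cvgM; [exact: cvg_cst|exact: lim].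
- by move=> y _ j; rewrite normrM mulrC ler_wpM2r.
Qed.

(** [entropy_step] and [mass_flow] are summed over a partition, with the test function frozen at the
    right end of each interval. The sum is the integral of [B M], which is dominated by a multiple
    of [d + diss] and tends to the flow whose test function is taken at the running time. *)
Lemma entropy_dissipation T : 0 < T -> rint lm (window 0 T) (fun r => flow (test_fun r) r) /\
  entropy T - entropy 0 <= \int[lm]_(r in window 0 T) flow (test_fun r) r.
Proof.
move=> T0.
pose tt M j : R := T * j%:R / M.+1%:R.
have M0 M : 0 < M.+1%:R :> R by rewrite ltr0n.
have ttlt M j : tt M j < tt M j.+1.
  by rewrite /tt ltr_pM2r ?invr_gt0// ltr_pM2l// ltr_nat.
have ttle M i j : (i <= j)%N -> tt M i <= tt M j.
  by move=> ij; rewrite /tt ler_pM2r ?invr_gt0// ler_pM2l// ler_nat.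
have tt0 M j : 0 <= tt M j by rewrite /tt !mulr_ge0// ?invr_ge0// ltW.
have ttM M : tt M M.+1 = T by rewrite /tt mulfK// gt_eqF.
have tt00 M : tt M 0%N = 0 by rewrite /tt mulr0 mul0r.
pose I M j : set R := `]tt M j, tt M j.+1]%classic.
pose B M r := \sum_(j < M.+1) (\1_(I M j) r * flow (test_fun (tt M j.+1)) r).
pose bound r := Cq * K * (d%:R + diss r).
have ib : rint lm (window 0 T) bound.
  apply: rintZ => //; apply: rintD => //; apply: rint_cst => //.
  apply: (@le_lt_trans _ _ (lm `]0, T]%classic)).
    by apply: le_measure; rewrite ?inE; [exact: mW|exact: measurable_itv|move=> t []].
  by rewrite lebesgue_measure_itv/=; case: ifP => _; rewrite ltry.
have iterm M j : (j < M.+1)%N -> rint lm (window 0 T)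
    (fun r => \1_(I M j) r * flow (test_fun (tt M j.+1)) r).
  move=> jM; apply: (@rint_le _ _ _ lm (window 0 T) (mW 0 T) _ bound) => //.
    apply: measurable_funM.
      by apply: measurable_funTS; apply: measurable_indic; exact: measurable_itv.
    exact: rint_meas (flowi T (smooth_test_fun _) (@csupp_test_fun _)).
  move=> r [_ gr]; rewrite normrM (le_trans _ (flow_test_le (tt M j.+1) gr))//.
  by rewrite ler_piMl// indicE; case: (_ \in _); rewrite ?normr1 ?normr0.
(* The interval containing [r] is the one that ends at the first node not before [r]. *)
have ex M r : 0 < r -> r <= T -> exists j, [/\ (j < M.+1)%N, tt M j < r <= tt M j.+1 &
    B M r = flow (test_fun (tt M j.+1)) r].
  move=> r0 rT.
  have exk : exists k, r <= tt M k by exists M.+1; rewrite ttM.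
  case: (ex_minnP exk) => -[|k] rk kmin.
    by move: rk; rewrite tt00 leNgt r0.
  have kr : tt M k < r by rewrite ltNge; apply/negP => /kmin; rewrite ltnn.
  have kM : (k < M.+1)%N by apply: kmin; rewrite ttM.
  exists k; split => //; first by rewrite kr.
  rewrite /B (bigD1 (Ordinal kM))//= indicE mem_set ?mul1r; last by rewrite /I/= in_itv/= kr.
  rewrite big1 ?addr0// => j /eqP jk; rewrite indicE memNset ?mul0r// /I/= in_itv/= => /andP[h1 h2].
  have [jk'|jk'|jk'] := ltngtP j k.
  - by have := le_lt_trans (le_trans h2 (ttle M _ _ jk')) kr; rewrite ltxx.
  - by have := le_lt_trans (le_trans rk (ttle M _ _ jk')) h1; rewrite ltxx.
  - by apply: jk; apply: val_inj.
have B_le M r : window 0 T r -> `|B M r| <= bound r.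
  move=> /window_good[r0 /andP[_ rT] gr]; have [j [_ _ ->]] := ex M r r0 rT.
  exact: flow_test_le.
have mB M : measurable_fun (window 0 T) (B M).
  by apply: measurable_sum => j; exact: rint_meas (iterm M j (ltn_ord j)).
have Blim r : window 0 T r -> B M r @[M --> \oo] --> flow (test_fun r) r.
  move=> /window_good[r0 /andP[_ rT] gr].
  have /choice[j Hj] := fun M => ex M r r0 rT.
  have -> : B ^~ r = (fun M => flow (test_fun (tt M (j M).+1)) r).
    by apply/funext => M; have [_ _ ->] := Hj M.
  apply: (@cvg_flow_test (fun M => tt M (j M).+1)) => //.
  apply: (@cvg_of_dist_le _ _ (fun M => T * M.+1%:R^-1)).
    move=> M; have [_ /andP[h1 h2] _] := Hj M.
    rewrite ger0_norm ?subr_ge0// lerBlDr.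
    have -> : tt M (j M).+1 = T * M.+1%:R^-1 + tt M (j M).
      by rewrite /tt -natr1; ring.
    by rewrite lerD2l ltW.
  by rewrite -(mulr0 T); apply: cvgM; [exact: cvg_cst|exact: cvg_harmonic].
have mlim : measurable_fun (window 0 T) (fun r => flow (test_fun r) r).
  exact: (measurable_fun_cvg mB Blim).
have [ilim L] := Rintegral_dctT (mu := lm) (mW 0 T) mB mlim ib Blim (fun r wr M => B_le M r wr).
split => //.
have step M : entropy T - entropy 0 <= \int[lm]_(r in window 0 T) B M r.
  have -> : entropy T - entropy 0 = \sum_(j < M.+1) (entropy (tt M j.+1) - entropy (tt M j)).
    transitivity (\sum_(0 <= j < M.+1) (entropy (tt M j.+1) - entropy (tt M j))).
      apply: esym; apply: (@etrans _ _ (entropy (tt M M.+1) - entropy (tt M 0%N))).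
        exact: (telescope_sumr (fun j => entropy (tt M j))).
      by rewrite ttM tt00.
    exact: big_mkord.
  rewrite /B Rintegral_sum//; last by move=> j; exact: iterm.
  apply: ler_sum => j _; apply: (le_trans (entropy_step (tt0 M j) (tt0 M j.+1))).
  rewrite (mass_flow (smooth_test_fun _) (@csupp_test_fun _) (tt0 M j) (ltW (ttlt M j))).
  by rewrite Rintegral_window_indic// -[leRHS](ttM M) ttle.
rewrite -(cvg_lim _ L)//; apply: limr_ge; first by apply/cvg_ex; eexists; exact: L.
exact: nearW.
Qed.

End entropy_step.

(** * Removing the mollification *)

Section nonneg_composition.
Context {R : realType}.

(** [b] is controlled on the half-line only; composing it with [max s 0] makes it continuous
    everywhere without changing [b (f x)]. *)
Lemma measurable_comp_ge0 d0 (T : measurableType d0) (b : R -> R) (f : T -> R) :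
  (forall s, 0 <= s -> {for s, continuous b}) -> measurable_fun setT f ->
  (forall x, 0 <= f x) -> measurable_fun setT (fun x => b (f x)).
Proof.
move=> bc mf f0; pose b' s := b (Num.max s 0).
have cb : continuous b'.
  move=> s; have h : {for Num.max s 0, continuous b} by apply: bc; rewrite le_max lexx orbT.
  apply: (cvg_comp (fun s => Num.max s 0) b); last exact: h.
  exact: continuous_max0.
have -> : (fun x => b (f x)) = b' \o f by apply/funext => x; rewrite /b' /= max_l.
by apply: measurableT_comp => //; exact: continuous_measurable_fun.
Qed.

Lemma continuous_comp_ge0 (V : topologicalType) (b : R -> R) (f : V -> R) :
  (forall s, 0 <= s -> {for s, continuous b}) -> continuous f ->
  (forall x, 0 <= f x) -> continuous (fun x => b (f x)).
Proof.
move=> bc cf f0 x; apply: (cvg_comp f b (cf x)); exact: bc.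
Qed.

End nonneg_composition.

Section mollify_sequences.
Context {R : realType} {d : nat}.
Local Notation V := 'rV[R]_d.
Local Notation leb := (lebesgue_rV d : {measure set V -> \bar R}).
Local Notation ker n := (@mollifier R d n).

(** [Rintegral_dct_L1] works with a single distance; this one controls the mollification errors of
    finitely many functions. *)
Definition moll_dist (s : seq (V -> R)) n x : R :=
  \sum_(f <- s) `|convol f (ker n) x - f x|.

Lemma moll_dist_ge0 s n x : 0 <= moll_dist s n x.
Proof. by apply: sumr_ge0. Qed.

Lemma moll_dist_le s f n x : List.In f s -> `|convol f (ker n) x - f x| <= moll_dist s n x.
Proof.
elim: s => // g s IH /= [<-|fs]; rewrite /moll_dist big_cons.
  by rewrite lerDl; apply: sumr_ge0.
by rewrite (le_trans (IH fs))// /moll_dist lerDr.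
Qed.

Lemma moll_dist_cvg s f x (k : nat -> nat) : List.In f s ->
  moll_dist s (k j) x @[j --> \oo] --> 0 -> convol f (ker (k j)) x @[j --> \oo] --> f x.
Proof. by move=> fs; apply: cvg_of_dist_le => j; exact: moll_dist_le. Qed.

Lemma moll_dist_L1 s : (forall f, List.In f s -> rint leb setT f) ->
  (forall n, rint leb setT (moll_dist s n)) /\
  \int[leb]_x moll_dist s n x @[n --> \oo] --> 0.
Proof.
elim: s => [_|f s IH H].
  have -> : moll_dist [::] = (fun n x => 0).
    by apply/funext => n; apply/funext => x; rewrite /moll_dist big_nil.
  split=> [n|]; first exact: rint0.
  by apply: cvg_near_cst; apply: nearW => n; rewrite Rintegral_cst// mul0r.
have [h1 h2] := IH (fun g gs => H g (or_intror gs)).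
have [g1 g2] := mollify_L1 (H f (or_introl erefl)).
have := L1_cvg0D g1 h1 g2 h2.
have -> // : moll_dist (f :: s) = (fun n x => `|convol f (ker n) x - f x| + moll_dist s n x).
by apply/funext => n; apply/funext => x; rewrite /moll_dist big_cons.
Qed.

Lemma continuous_mollify (f : V -> R) n : L1loc f -> continuous (convol f (ker n)).
Proof.
by move=> fl; exact: (continuous_conv fl (smooth_continuous (@smooth_mollifier R d n)) (@csupp_mollifier R d n)).
Qed.

Lemma Rintegral_mollify_abs (f : V -> R) n : rint leb setT f ->
  rint leb setT (fun x => `|convol f (ker n) x|) /\
  \int[leb]_x `|convol f (ker n) x| <= \int[leb]_x `|f x|.
Proof.
move=> fi; have [h1 _] := mollify_rint n fi.
have [h2 <-] := mollify_rint n (rint_abs fi).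
have ck := smooth_continuous (@smooth_mollifier R d n).
split; first exact: rint_abs.
apply: le_Rintegral => //; first exact: rint_abs.
move=> x _; apply: Rintegral_abs_le => //.
- exact: (rint_conv x (rint_L1loc fi) ck (@csupp_mollifier R d n)).
- exact: (rint_conv x (rint_L1loc (rint_abs fi)) ck (@csupp_mollifier R d n)).
- by move=> y _; rewrite normrM (ger0_norm (mollifier_ge0 _ _)).
Qed.

End mollify_sequences.

(** * The limit at a fixed time, where [q] is [G'], [dq] is [G''] and [P s] is [s G' s - G s] *)

Section fixed_time_limit.
Context {R : realType} {d : nat}.
Local Notation V := 'rV[R]_d.
Local Notation leb := (lebesgue_rV d : {measure set V -> \bar R}).
Local Notation ker n := (@mollifier R d n).
Variables (rho : @density R d) (v W : 'I_d -> V -> R) (Dl Psi : V -> R) (lam : R) (N : nat).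
Variables (q dq P : R -> R) (Cq C2 CP Cz K0 : R).
Hypothesis mv : forall i, measurable_fun setT (v i).
Hypothesis ei : forall i, rint leb setT (fun y => rho y * v i y ^+ 2).
Hypothesis WG : is_weak_grad rho (fun y => \row_i W i y).
Hypothesis mDl : measurable_fun setT Dl.
Hypothesis lam0 : 0 < lam.
Hypothesis Dl_ge : forall y, lam <= Dl y.
Hypothesis fluxE : {ae leb, forall y, forall i,
  rho y * v i y = - (rho y * partial i Psi y + Dl y * W i y)}.
Hypothesis Psi2 : is_Ck 2 Psi.
Let zeta := @cutoff R d N.
Let r0 : R := 2 * N.+1%:R.
Hypothesis Cz_le : forall i z, `|partial i zeta z| <= Cz.
Hypothesis K0_le : forall i y, `|y| <= r0 + 1 -> `|partial i Psi y| <= K0.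
Hypothesis dq_der : forall s : R, 0 <= s -> is_derive s (1 : R) q (dq s).
Hypothesis dq_cont : forall s : R, 0 <= s -> {for s, continuous dq}.
Hypothesis q_le : forall s, 0 <= s -> `|q s| <= Cq.
Hypothesis dq_ge0 : forall s, 0 <= s -> 0 <= dq s.
Hypothesis dq_le : forall s, 0 <= s -> s * dq s <= C2.
Hypothesis P_der : forall s : R, 0 <= s -> is_derive s (1 : R) P (s * dq s).
Hypothesis P_ge0 : forall s, 0 <= s -> 0 <= P s.
Hypothesis P_le : forall s, 0 <= s -> P s <= CP * s.

Let q_cont (s : R) : 0 <= s -> {for s, continuous q}.
Proof.
by move=> s0; apply: differentiable_continuous; apply/derivable1_diffP; have [] := dq_der s0.
Qed.

Let P_cont (s : R) : 0 <= s -> {for s, continuous P}.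
Proof.
by move=> s0; apply: differentiable_continuous; apply/derivable1_diffP; have [] := P_der s0.
Qed.

Let Cq0 : 0 <= Cq. Proof. exact: le_trans (normr_ge0 _) (q_le (lexx 0)). Qed.
Let C20 : 0 <= C2. Proof. by have := dq_le (lexx 0); rewrite mul0r. Qed.
Let rho_ge0 y : 0 <= rho y. Proof. exact: density_ge0. Qed.
Let ri : rint leb setT rho. Proof. exact: (density_rint (fun _ : R => rho) 0). Qed.
Let mr : measurable_fun setT rho. Proof. exact: measurable_density. Qed.
Let e i y := rho y * v i y ^+ 2.
Let J i y := rho y * v i y.
Let B : set V := [set y | `|y| <= r0 + 1].
Let ind y : R := \1_B y.
(** Solving the flux identity for the gradient gives [W = rho u] almost everywhere on [B]. The
    indicator keeps [grad Psi] bounded, so that [rho u^2] is integrable over the whole space. *)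
Let u i y := - ((v i y + partial i Psi y) / Dl y) * ind y.
Let Wt i y := rho y * u i y.
Let U i y := rho y * u i y ^+ 2.
Let rn n : V -> R := convol rho (ker n).

Let cPsi i : continuous (partial i Psi).
Proof. by case: Psi2 => _ /(_ (delta_mx 0 i))[_ []]. Qed.

Let ddPsi i j : (forall y, derivable (partial i Psi) y (delta_mx 0 j)) /\
  continuous (partial j (partial i Psi)).
Proof. by case: Psi2 => _ /(_ (delta_mx 0 i))[_ [_ /(_ (delta_mx 0 j)) [? []]]]. Qed.

Let mind : measurable_fun setT ind.
Proof. by apply: measurable_indic; exact: measurable_ball_rV. Qed.

Let mu_ i : measurable_fun setT (u i).
Proof.
apply: measurable_funM => //; apply: (eq_measurable_fun (fun y => 0 - (v i y + partial i Psi y) * (Dl y)^-1)).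
  by move=> y _; rewrite sub0r.
apply: measurable_funB; first exact: measurable_cst.
apply: measurable_funM; last exact: measurable_inv.
by apply: measurable_funD => //; exact: continuous_measurable_rV.
Qed.

Let K00 : 'I_d -> 0 <= K0.
Proof. by move=> i; apply: le_trans (normr_ge0 _) (@K0_le i 0 _); rewrite normr0 addr_ge0// mulr_ge0. Qed.

(** The constant comes from [(a + b)^2 <= 2 (a^2 + b^2)] and [Dl >= lam]. *)
Let U_le i y : U i y <= 2 / lam ^+ 2 * (e i y + K0 ^+ 2 * rho y).
Proof.
rewrite /U /e /u /ind indicE; have [yB|yB] := boolP (y \in B); last first.
  rewrite mulr0 expr0n mulr0 mulr_ge0// ?divr_ge0// ?sqr_ge0//.
  by rewrite addr_ge0// mulr_ge0// sqr_ge0.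
have K1 : partial i Psi y ^+ 2 <= K0 ^+ 2.
  rewrite -[X in X <= _]real_normK ?num_real// lerXn2r ?nnegrE ?(K00 i)//.
  by apply: K0_le; move: yB; rewrite inE.
have -> : rho y * (- ((v i y + partial i Psi y) / Dl y) * true%:R) ^+ 2 =
    rho y * ((v i y + partial i Psi y) ^+ 2 / Dl y ^+ 2).
  by rewrite mulr1 sqrrN expr_div_n.
have -> : 2 / lam ^+ 2 * (rho y * v i y ^+ 2 + K0 ^+ 2 * rho y) =
    rho y * (2 / lam ^+ 2 * (v i y ^+ 2 + K0 ^+ 2)) by ring.
rewrite ler_wpM2l//.
have D0 : 0 < Dl y by exact: lt_le_trans lam0 (Dl_ge y).
rewrite ler_pdivrMr ?exprn_gt0//.
have h1 : (v i y + partial i Psi y) ^+ 2 <= 2 * (v i y ^+ 2 + K0 ^+ 2).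
  by have := sqr_ge0 (v i y - partial i Psi y); nra.
have h2 : 1 <= Dl y ^+ 2 / lam ^+ 2.
  rewrite ler_pdivlMr ?exprn_gt0// mul1r.
  by apply: lerXn2r; [rewrite nnegrE ltW|rewrite nnegrE ltW|exact: Dl_ge].
have h3 : 0 <= 2 * (v i y ^+ 2 + K0 ^+ 2) by rewrite mulr_ge0// addr_ge0// sqr_ge0.
apply: (le_trans h1); rewrite -[leLHS]mulr1.
have -> : 2 / lam ^+ 2 * (v i y ^+ 2 + K0 ^+ 2) * Dl y ^+ 2 =
  2 * (v i y ^+ 2 + K0 ^+ 2) * (Dl y ^+ 2 / lam ^+ 2) by ring.
exact: ler_wpM2l.
Qed.

Let Ui i : rint leb setT (U i).
Proof.
apply: (@rint_le _ _ _ leb setT measurableT _ (fun y => 2 / lam ^+ 2 * (e i y + K0 ^+ 2 * rho y))).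
- by apply: measurable_funM => //; exact: measurable_funX.
- exact: (rintZ measurableT _ (rintD measurableT (ei i) (rintZ measurableT _ ri))).
- by move=> y _; rewrite ger0_norm ?U_le// mulr_ge0// sqr_ge0.
Qed.

Let norm_flux_le (w : V -> R) y : `|rho y * w y| <= rho y + rho y * w y ^+ 2.
Proof.
rewrite normrM ger0_norm// -{2}[rho y]mulr1 -mulrDr ler_wpM2l//.
have [v1|v1] := leP `|w y| 1; first by rewrite (le_trans v1)// lerDl sqr_ge0.
rewrite -[w y ^+ 2]real_normK ?num_real//; have := ltW v1; nra.
Qed.

Let Wti i : rint leb setT (Wt i).
Proof.
apply: (@rint_le _ _ _ leb setT measurableT _ (fun y => rho y + U i y)).
- exact: measurable_funM.
- exact: (rintD measurableT ri (Ui i)).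
- by move=> y _; exact: norm_flux_le.
Qed.

Let Ji i : rint leb setT (J i).
Proof.
apply: (@rint_le _ _ _ leb setT measurableT _ (fun y => rho y + e i y)).
- exact: measurable_funM.
- exact: (rintD measurableT ri (ei i)).
- by move=> y _; exact: norm_flux_le.
Qed.

Let WtE : {ae leb, forall y, forall i, B y -> W i y = Wt i y}.
Proof.
apply: filterS fluxE => y H i yB; have h := H i.
have D0 : 0 < Dl y by exact: lt_le_trans lam0 (Dl_ge y).
rewrite /Wt /u /ind indicE mem_set// mulr1.
apply: (mulfI (lt0r_neq0 D0)).
have -> : Dl y * (rho y * - ((v i y + partial i Psi y) / Dl y)) = - (rho y * v i y + rho y * partial i Psi y).
  by field; rewrite gt_eqF.
by rewrite h; ring.
Qed.

Let Wl i : L1loc (W i).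
Proof. by case: WG => _ /(_ i) + _; congr L1loc; apply/funext => y; rewrite mxE. Qed.

(** Mollifiers reach at most distance 1, so within radius [r0] the convolutions see only [B], where
    [W] and [Wt] agree almost everywhere. *)
Let Wn_eq n i x : `|x| <= r0 -> convol (W i) (ker n) x = convol (Wt i) (ker n) x.
Proof.
move=> xr; have ck := smooth_continuous (@smooth_mollifier R d n).
apply: ae_eq_Rintegral => //.
- exact: rint_meas (rint_conv x (Wl i) ck (@csupp_mollifier R d n)).
- exact: rint_meas (rint_conv x (rint_L1loc (Wti i)) ck (@csupp_mollifier R d n)).
apply: filterS WtE => y H _; have [yB|yB] := leP `|y| (r0 + 1); first by rewrite H.
rewrite csupp_mollifier ?mulr0//.
have h1 : n.+1%:R^-1 <= 1 :> R by rewrite invf_le1// ler1n.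
have h3 : `|y| <= `|x - y| + `|x| by rewrite addrC -{1}[y](subKr x); exact: ler_normB.
apply: (le_lt_trans h1); rewrite -(ltrD2r `|x|); apply: lt_le_trans h3.
by apply: le_lt_trans yB; rewrite addrC lerD2r.
Qed.

Let s0 i : seq (V -> R) := [:: (rho : V -> R); J i; e i; U i; Wt i].
Let Dist i n x := moll_dist (s0 i) n x.

Let Distall i : (forall n, rint leb setT (Dist i n)) /\
  \int[leb]_x Dist i n x @[n --> \oo] --> 0.
Proof.
apply: moll_dist_L1 => f /= [<-|[<-|[<-|[<-|[<-|//]]]]].
- exact: ri.
- exact: Ji.
- exact: ei.
- exact: Ui.
- exact: Wti.
Qed.

Let rn_ge0 n x : 0 <= rn n x. Proof. exact: mollified_ge0. Qed.

Let crn n : continuous (rn n). Proof. exact: continuous_mollify (rint_L1loc ri). Qed.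

Let cqrn n : continuous (fun x => q (rn n x)).
Proof. by apply: continuous_comp_ge0 => //; exact: crn. Qed.

Let cdqrn n : continuous (fun x => dq (rn n x)).
Proof. by apply: continuous_comp_ge0 => //; exact: crn. Qed.

Let partial_rn n i x : partial i (rn n) x = convol (W i) (ker n) x.
Proof.
rewrite (partial_convol_weak i x WG (@smooth_mollifier R d n) (@csupp_mollifier R d n)).
by congr convol; apply/funext => y; rewrite mxE.
Qed.

Let rn_derivable n i x : is_derive x (delta_mx 0 i) (rn n) (convol (W i) (ker n) x).
Proof.
have [h1 _] := derivable_conv (delta_mx 0 i) x (rint_L1loc ri) (@smooth_mollifier R d n) (@csupp_mollifier R d n).
by rewrite -partial_rn; exact: DeriveDef.
Qed.

Let sz : smooth zeta := @smooth_cutoff R d N.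
Let cz : continuous zeta := smooth_continuous sz.
Let zs : csupp r0 zeta := @csupp_cutoff R d N.
Let z0 x : 0 <= zeta x := cutoff_ge0 N x.
Let z1 x : zeta x <= 1 := cutoff_le1 N x.

Let g n x := zeta x * q (rn n x).
Definition flow_test n := convol (fun x => zeta x * q (convol rho (ker n) x)) (ker n).

Let dg n i x : is_derive x (delta_mx 0 i) (g n)
  (partial i zeta x * q (rn n x) + zeta x * (dq (rn n x) * convol (W i) (ker n) x)).
Proof.
have h1 := is_derive_comp1 (dq_der (rn_ge0 n x)) (rn_derivable n i x).
have h2 : is_derive x (delta_mx 0 i) zeta (partial i zeta x).
  by apply: DeriveDef => //; exact: smooth_derivable.
have h := is_deriveM h2 h1.
by apply: (is_derive_eq h); rewrite /GRing.scale/=; ring.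
Qed.

Let pg n i x : partial i (g n) x =
  partial i zeta x * q (rn n x) + zeta x * (dq (rn n x) * convol (W i) (ker n) x).
Proof. by have [] := dg n i x. Qed.

Let cpz i : continuous (partial i zeta) := smooth_continuous (smooth_derive (delta_mx 0 i) sz).

Let cWn n i : continuous (convol (W i) (ker n)). Proof. exact: continuous_mollify. Qed.

Let cpg n i : continuous (partial i (g n)).
Proof.
have -> : partial i (g n) = (fun x => partial i zeta x * q (rn n x) +
    zeta x * (dq (rn n x) * convol (W i) (ker n) x)) by apply/funext => x; exact: pg.
apply: continuous_add; first exact: continuous_mul (@cpz i) (@cqrn n).
by apply: continuous_mul => //; exact: continuous_mul (@cdqrn n) (@cWn n i).
Qed.

Let cg n : continuous (g n). Proof. exact: continuous_mul (@cqrn n). Qed.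

Let gs n : csupp r0 (g n). Proof. by move=> x xr; rewrite /g zs// mul0r. Qed.

Let partial_flow_test n i y : partial i (flow_test n) y = convol (partial i (g n)) (ker n) y.
Proof.
have h : is_weak_grad (g n) (grad (g n)).
  by apply: C1_is_weak_grad; [exact: cg|move=> j x; have [] := dg n j x|move=> j; exact: cpg].
rewrite (partial_convol_weak i y h (@smooth_mollifier R d n) (@csupp_mollifier R d n)).
by congr convol; apply/funext => x; rewrite mxE.
Qed.

(** The two terms of the product rule for [zeta q (rho_n)], multiplied by the mollified flux; in the
    second one [W] is replaced by [Wt]. *)
Let F1 n i x := convol (J i) (ker n) x * (partial i zeta x * q (rn n x)).
Let F2 n i x := convol (J i) (ker n) x * (zeta x * (dq (rn n x) * convol (Wt i) (ker n) x)).

Let zW n i x : zeta x * (dq (rn n x) * convol (W i) (ker n) x) =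
  zeta x * (dq (rn n x) * convol (Wt i) (ker n) x).
Proof.
have [xr|xr] := leP `|x| r0; first by rewrite Wn_eq.
by rewrite zs// !mul0r.
Qed.

Let mconv (f : V -> R) n : rint leb setT f -> measurable_fun setT (convol f (ker n)).
Proof. by move=> fi; apply: continuous_measurable_rV; apply: continuous_mollify; exact: rint_L1loc. Qed.

Let mF1 n i : measurable_fun setT (F1 n i).
Proof.
apply: measurable_funM; first exact: mconv.
by apply: continuous_measurable_rV; exact: continuous_mul (@cpz i) (@cqrn n).
Qed.

Let mF2 n i : measurable_fun setT (F2 n i).
Proof.
apply: measurable_funM; first exact: mconv.
apply: measurable_funM; first exact: continuous_measurable_rV.
by apply: measurable_funM; [exact: continuous_measurable_rV|exact: mconv].
Qed.

Let Cz0 : 'I_d -> 0 <= Cz.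
Proof. by move=> i; exact: le_trans (normr_ge0 _) (Cz_le i 0). Qed.

Let F1_le n i x : `|F1 n i x| <= Cz * Cq * `|convol (J i) (ker n) x|.
Proof.
rewrite normrM mulrC ler_wpM2r// normrM ler_pM//; exact: q_le.
Qed.

(** By Cauchy-Schwarz the squares of the mollified flux and of the mollified [Wt] are each at most
    [rho_n] times a mollified energy. Their product thus carries a factor [rho_n], which
    [s * dq s <= C2] absorbs. *)
Let F2_le n i x : `|F2 n i x| <= C2 * (convol (e i) (ker n) x + convol (U i) (ker n) x).
Proof.
have h1 := mollified_energy_le rho_ge0 ri (rint_L1loc (Ji i)) n x (ei i).
have h2 := mollified_energy_le rho_ge0 ri (rint_L1loc (Wti i)) n x (Ui i).
have E0 : 0 <= convol (e i) (ker n) x by apply: mollified_ge0 => y; rewrite mulr_ge0// sqr_ge0.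
have U0 : 0 <= convol (U i) (ker n) x by apply: mollified_ge0 => y; rewrite mulr_ge0// sqr_ge0.
have d0 := dq_ge0 (rn_ge0 n x).
set a := convol (J i) (ker n) x; set b := convol (Wt i) (ker n) x.
set E := convol (e i) (ker n) x; set Un := convol (U i) (ker n) x.
have ab : `|a * b| <= rn n x * (E + Un).
  have : `|a * b| <= a ^+ 2 + b ^+ 2.
    rewrite normrM -[a ^+ 2]real_normK ?num_real// -[b ^+ 2]real_normK ?num_real//.
    have := sqr_ge0 (`|a| - `|b|); have := normr_ge0 a; have := normr_ge0 b; nra.
  by move/le_trans; apply; rewrite mulrDr lerD.
have -> : F2 n i x = zeta x * (dq (rn n x) * (a * b)) by rewrite /F2 -/a -/b; ring.
rewrite normrM (ger0_norm (z0 x)) normrM (ger0_norm d0).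
apply: (@le_trans _ _ (1 * (dq (rn n x) * (rn n x * (E + Un))))).
  by rewrite ler_pM ?z1 ?mulr_ge0// ler_wpM2l.
by rewrite mul1r mulrA ler_wpM2r ?addr_ge0// mulrC dq_le.
Qed.

Let rintE f n : rint leb setT f -> rint leb setT (convol f (ker n)).
Proof. by move=> fi; have [] := mollify_rint n fi. Qed.

Let iF1 n i : rint leb setT (F1 n i).
Proof.
apply: (@rint_le _ _ _ leb setT measurableT _ (fun x => Cz * Cq * `|convol (J i) (ker n) x|)) => //.
by apply: rintZ => //; apply: rint_abs; exact: rintE.
Qed.

Let iF2 n i : rint leb setT (F2 n i).
Proof.
apply: (@rint_le _ _ _ leb setT measurableT _
  (fun x => C2 * (convol (e i) (ker n) x + convol (U i) (ker n) x))) => //.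
exact: (rintZ measurableT _ (rintD measurableT (rintE n (ei i)) (rintE n (Ui i)))).
Qed.

Lemma flow_testE n : \sum_i \int[leb]_y (rho y * v i y * partial i (flow_test n) y) =
  \sum_i (\int[leb]_x F1 n i x + \int[leb]_x F2 n i x).
Proof.
apply: eq_bigr => i _; have mpg : measurable_fun setT (partial i (g n)).
  by apply: continuous_measurable_rV; exact: cpg.
have pgs : csupp r0 (partial i (g n)) by exact: csupp_derive (@gs n).
have [C _ HC] := csupp_bounded (@cpg n i) pgs.
have [_ h] := mollify_adjoint n (Ji i) mpg HC.
transitivity (\int[leb]_y (J i y * convol (partial i (g n)) (ker n) y)).
  by apply: eq_Rintegral => y _; rewrite partial_flow_test.
rewrite -h -(RintegralD measurableT (iF1 n i) (iF2 n i)).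
by apply: eq_Rintegral => x _; rewrite pg zW -mulrDr.
Qed.

Let S := \sum_i \int[leb]_y (rho y * v i y ^+ 2).

Let intrho : \int[leb]_y rho y = 1. Proof. exact: (Rintegral_density (fun _ : R => rho) 0). Qed.

Let int_e_ge0 i : 0 <= \int[leb]_y e i y.
Proof. by apply: Rintegral_ge0 => y _; rewrite mulr_ge0// sqr_ge0. Qed.

(** Being uniform in [n], this bound dominates the flows in the time integral. [F1] contributes the
    first constant, the two energies in [F2] the others, that of [Wt] through [U_le]. *)
Lemma flow_test_bound n : 
  `|\sum_i \int[leb]_y (rho y * v i y * partial i (flow_test n) y)| <=
  (Cz * Cq + C2 + C2 * (2 / lam ^+ 2) * (1 + K0 ^+ 2)) * (d%:R + S).
Proof.
rewrite flow_testE; apply: (le_trans (ler_norm_sum _ _ _)).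
have -> : d%:R = \sum_(i < d) 1 :> R by rewrite sumr_const card_ord.
rewrite /S -big_split/= mulr_sumr; apply: ler_sum => i _.
apply: (le_trans (ler_normD _ _)).
have h1 : `|\int[leb]_x F1 n i x| <= Cz * Cq * (1 + \int[leb]_y e i y).
  have [a1 a2] := Rintegral_mollify_abs n (Ji i).
  apply: (@le_trans _ _ (\int[leb]_x (Cz * Cq * `|convol (J i) (ker n) x|))).
    by apply: Rintegral_abs_le => //; exact: rintZ.
  rewrite RintegralZl// ler_wpM2l ?mulr_ge0 ?(Cz0 i)//; apply: (le_trans a2).
  rewrite -intrho -(RintegralD measurableT ri (ei i)); apply: le_Rintegral => //.
  - by apply: rint_abs; exact: Ji.
  - exact: rintD.
  - by move=> y _; exact: norm_flux_le.
have h2 : `|\int[leb]_x F2 n i x| <= C2 * (\int[leb]_y e i y + 2 / lam ^+ 2 * (\int[leb]_y e i y + K0 ^+ 2)).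
  have [a1 a2] := mollify_rint n (ei i); have [b1 b2] := mollify_rint n (Ui i).
  have i1 := rintD measurableT a1 b1.
  have i2 := rintZ measurableT (K0 ^+ 2) ri.
  apply: (@le_trans _ _ (\int[leb]_x (C2 * (convol (e i) (ker n) x + convol (U i) (ker n) x)))).
    by apply: Rintegral_abs_le => //; exact: (rintZ measurableT C2 i1).
  rewrite (RintegralZl C2 measurableT i1) ler_wpM2l// (RintegralD measurableT a1 b1) a2 b2 lerD2l.
  apply: (@le_trans _ _ (\int[leb]_y (2 / lam ^+ 2 * (e i y + K0 ^+ 2 * rho y)))).
    apply: le_Rintegral => //; first exact: Ui.
    exact: (rintZ measurableT _ (rintD measurableT (ei i) i2)).
  rewrite (RintegralZl _ measurableT (rintD measurableT (ei i) i2)).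
  by rewrite (RintegralD measurableT (ei i) i2) (RintegralZl _ measurableT ri) intrho mulr1.
apply: (le_trans (lerD h1 h2)); have e0 := int_e_ge0 i.
set x := \int[leb]_y e i y; rewrite -/x in e0.
have L0 : 0 <= 2 / lam ^+ 2 by rewrite divr_ge0// sqr_ge0.
have CL := mulr_ge0 C20 L0; have K2 := sqr_ge0 K0.
have := mulr_ge0 CL e0; have := mulr_ge0 (mulr_ge0 CL K2) e0.
move=> x1 x2; rewrite -/(e i) -/x -subr_ge0.
set L := 2 / lam ^+ 2 in L0 CL x1 x2 *.
have -> : (Cz * Cq + C2 + C2 * L * (1 + K0 ^+ 2)) * (1 + x)
    - (Cz * Cq * (1 + x) + C2 * (x + L * (x + K0 ^+ 2))) = C2 + C2 * L + C2 * L * K0 ^+ 2 * x by ring.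
by rewrite !addr_ge0.
Qed.

Let F1l i y := J i y * (partial i zeta y * q (rho y)).
Let F2l i y := J i y * (zeta y * (dq (rho y) * Wt i y)).

Let mqr : measurable_fun setT (fun y => q (rho y)). Proof. exact: measurable_comp_ge0. Qed.
Let mdqr : measurable_fun setT (fun y => dq (rho y)). Proof. exact: measurable_comp_ge0. Qed.
Let mJ i : measurable_fun setT (J i). Proof. exact: rint_meas (Ji i). Qed.
Let mWt i : measurable_fun setT (Wt i). Proof. exact: rint_meas (Wti i). Qed.
Let mz : measurable_fun setT zeta. Proof. exact: continuous_measurable_rV. Qed.

Let in_rho i : List.In (rho : V -> R) (s0 i). Proof. by left. Qed.
Let in_J i : List.In (J i) (s0 i). Proof. by right; left. Qed.
Let in_e i : List.In (e i) (s0 i). Proof. by do 2 right; left. Qed.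
Let in_U i : List.In (U i) (s0 i). Proof. by do 3 right; left. Qed.
Let in_Wt i : List.In (Wt i) (s0 i). Proof. by do 4 right; left. Qed.

Let conv_le (f : V -> R) i n x : List.In f (s0 i) ->
  `|convol f (ker n) x| <= `|f x| + Dist i n x.
Proof.
move=> fs; rewrite -{1}[convol f (ker n) x](subrK (f x)) addrC.
apply: (le_trans (ler_normD _ _)); rewrite lerD2l; exact: moll_dist_le.
Qed.

Let F1_cvg i : rint leb setT (F1l i) /\
  \int[leb]_x F1 n i x @[n --> \oo] --> \int[leb]_x F1l i x.
Proof.
have [d1 d2] := Distall i.
have C0 : 0 <= Cz * Cq by rewrite mulr_ge0 ?(Cz0 i).
apply: (@Rintegral_dct_L1 _ _ _ leb (Dist i) (fun n => F1 n i) (F1l i)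
  (fun x => Cz * Cq * `|J i x|) (Cz * Cq)) => //.
- by move=> n x; exact: moll_dist_ge0.
- by apply: measurable_funM => //; apply: measurable_funM => //; exact: continuous_measurable_rV.
- exact: (rintZ measurableT _ (rint_abs (Ji i))).
- move=> n x; apply: (le_trans (F1_le n i x)).
  by rewrite -mulrDr ler_wpM2l// conv_le.
move=> x s h; have hr := moll_dist_cvg (in_rho i) h; have hJ := moll_dist_cvg (in_J i) h.
apply: cvgM; first exact: hJ.
apply: cvgM; first exact: cvg_cst.
exact: (continuous_cvg _ (q_cont (rho_ge0 x)) hr).
Qed.

Let F2_cvg i : rint leb setT (F2l i) /\
  \int[leb]_x F2 n i x @[n --> \oo] --> \int[leb]_x F2l i x.
Proof.
have [d1 d2] := Distall i.
apply: (@Rintegral_dct_L1 _ _ _ leb (Dist i) (fun n => F2 n i) (F2l i)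
  (fun x => C2 * (e i x + U i x)) (C2 * 2)) => //.
- by move=> n x; exact: moll_dist_ge0.
- by apply: measurable_funM => //; apply: measurable_funM => //; exact: measurable_funM.
- exact: (rintZ measurableT _ (rintD measurableT (ei i) (Ui i))).
- by rewrite mulr_ge0.
- move=> n x; apply: (le_trans (F2_le n i x)).
  rewrite -mulrA -mulrDr ler_wpM2l//.
  have h1 := conv_le n x (in_e i); have h2 := conv_le n x (in_U i).
  have e0 : 0 <= e i x by rewrite mulr_ge0// sqr_ge0.
  have U0 : 0 <= U i x by rewrite mulr_ge0// sqr_ge0.
  rewrite (ger0_norm e0) in h1; rewrite (ger0_norm U0) in h2.
  have := lerD (le_trans (ler_norm _) h1) (le_trans (ler_norm _) h2).
  by move/le_trans; apply; rewrite addrACA -mulr2n mulr_natl.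
move=> x s h; have hr := moll_dist_cvg (in_rho i) h; have hJ := moll_dist_cvg (in_J i) h.
have hW := moll_dist_cvg (in_Wt i) h.
apply: cvgM; first exact: hJ.
apply: cvgM; first exact: cvg_cst.
apply: cvgM; last exact: hW.
exact: (continuous_cvg _ (dq_cont (rho_ge0 x)) hr).
Qed.

Definition flow_limit := \sum_i (\int[leb]_x F1l i x + \int[leb]_x F2l i x).

Lemma flow_test_cvg :
  \sum_i \int[leb]_y (rho y * v i y * partial i (flow_test n) y) @[n --> \oo] --> flow_limit.
Proof.
under eq_fun do rewrite flow_testE.
by apply: cvg_sum_seq => i; apply: cvgD; [exact: (F1_cvg i).2|exact: (F2_cvg i).2].
Qed.

Let b i y := zeta y * partial i Psi y.
Let db i y := partial i zeta y * partial i Psi y + zeta y * partial i (partial i Psi) y.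

Let b_der i y : is_derive y (delta_mx 0 i) (b i) (db i y).
Proof.
have [dP _] := ddPsi i i.
have h1 : is_derive y (delta_mx 0 i) zeta (partial i zeta y).
  by apply: DeriveDef => //; exact: smooth_derivable.
have h2 : is_derive y (delta_mx 0 i) (partial i Psi) (partial i (partial i Psi) y).
  exact: DeriveDef.
have h := is_deriveM h1 h2.
by apply: (is_derive_eq h); rewrite /db /GRing.scale/=; ring.
Qed.

Let cb i : continuous (b i). Proof. exact: continuous_mul (@cPsi i). Qed.

Let cdb i : continuous (db i).
Proof.
have [_ cP] := ddPsi i i.
apply: continuous_add; first exact: continuous_mul (@cpz i) (@cPsi i).
exact: continuous_mul cz cP.
Qed.

Let bs i : csupp r0 (b i). Proof. by move=> y yr; rewrite /b zs// mul0r. Qed.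

Let dbs i : csupp r0 (db i).
Proof.
move=> y yr; have pz : partial i zeta y = 0 by exact: (csupp_derive (delta_mx 0 i) zs yr).
by rewrite /db zs// pz !mul0r addr0.
Qed.

Let mPr : measurable_fun setT (fun y => P (rho y)). Proof. exact: measurable_comp_ge0. Qed.

Let Pabs s : 0 <= s -> `|P s| <= CP * s.
Proof. by move=> h; rewrite ger0_norm ?P_ge0// P_le. Qed.

Let CP0 : 0 <= CP.
Proof. by have := le_trans (P_ge0 ler01) (P_le ler01); rewrite mulr1. Qed.

Let iPdb i : rint leb setT (fun y => P (rho y) * db i y).
Proof.
have [C C0 hC] := csupp_bounded (@cdb i) (@dbs i).
apply: (@rint_le _ _ _ leb setT measurableT _ (fun y => CP * C * rho y)).
- by apply: measurable_funM => //; exact: continuous_measurable_rV.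
- exact: rintZ.
- move=> y _; rewrite normrM mulrAC ler_pM ?Pabs//.
Qed.

Let Y i y := rho y * dq (rho y) * Wt i y * b i y.

Let dqabs s : 0 <= s -> `|s * dq s| <= C2.
Proof. by move=> h; rewrite ger0_norm ?dq_le// mulr_ge0// dq_ge0. Qed.

Let mY i : measurable_fun setT (Y i).
Proof.
apply: measurable_funM; last exact: continuous_measurable_rV.
by apply: measurable_funM => //; exact: measurable_funM.
Qed.

Let iY i : rint leb setT (Y i).
Proof.
have [C C0 hC] := csupp_bounded (@cb i) (@bs i).
apply: (@rint_le _ _ _ leb setT measurableT _ (fun y => C2 * C * `|Wt i y|)) => //.
  by apply: rintZ => //; apply: rint_abs; exact: Wti.
by move=> y _; rewrite normrM [leRHS]mulrAC ler_pM// normrM ler_wpM2r// dqabs.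
Qed.

(** As [s * dq s] is the derivative of [P], formally [Y] is the derivative of [P (rho)] times [b].
    The integration by parts is carried out for the mollified density and then passed to the
    limit. *)
Let Y_by_parts i : \int[leb]_y Y i y = - \int[leb]_y (P (rho y) * db i y).
Proof.
have [C C0 hC] := csupp_bounded (@cb i) (@bs i).
have [C' C'0 hC'] := csupp_bounded (@cdb i) (@dbs i).
have [d1 d2] := Distall i.
pose Yn n y := rn n y * dq (rn n y) * convol (Wt i) (ker n) y * b i y.
have cPrn n : continuous (fun x => P (rn n x)) by apply: continuous_comp_ge0 => //; exact: crn.
have Ynd n : \int[leb]_y Yn n y = - \int[leb]_y (P (rn n y) * db i y).
  have dP y : is_derive y (delta_mx 0 i) (P \o rn n)
      (rn n y * dq (rn n y) * convol (W i) (ker n) y).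
    exact: is_derive_comp1 (P_der (rn_ge0 n y)) (rn_derivable n i y).
  have dPE y : 'D_(delta_mx 0 i) (P \o rn n) y = rn n y * dq (rn n y) * convol (W i) (ker n) y.
    by have [] := dP y.
  have dbE : 'D_(delta_mx 0 i) (b i) = db i by apply/funext => y; have [] := b_der i y.
  have := @Rintegral_by_parts _ _ (P \o rn n) (b i) r0 (delta_mx 0 i) (@cPrn n).
  move=> /(_ (fun y => @ex_derive _ _ _ _ _ _ _ (dP y))) => H.
  have cdP : continuous ('D_(delta_mx 0 i) (P \o rn n)).
    have -> : 'D_(delta_mx 0 i) (P \o rn n) = (fun y => rn n y * dq (rn n y) * convol (W i) (ker n) y).
      by apply/funext.
    by apply: continuous_mul => //; exact: continuous_mul (@crn n) (@cdqrn n).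
  have cdb' : continuous ('D_(delta_mx 0 i) (b i)) by rewrite dbE; exact: cdb.
  have H' := H cdP (@cb i) (fun y => @ex_derive _ _ _ _ _ _ _ (b_der i y)) cdb' (@bs i).
  have eA : \int[leb]_y Yn n y = \int[leb]_y ('D_(delta_mx 0 i) (P \o rn n) y * b i y).
    apply: eq_Rintegral => y _; rewrite dPE /Yn /b.
    have [yr|yr] := leP `|y| r0; first by rewrite Wn_eq.
    by rewrite zs// !(mul0r,mulr0).
  have eB : \int[leb]_y (P (rn n y) * db i y) = \int[leb]_y ((P \o rn n) y * 'D_(delta_mx 0 i) (b i) y).
    by apply: eq_Rintegral => y _; have [_ ->] := b_der i y.
  apply: (etrans eA); apply/eqP; rewrite -eqr_oppLR; apply/eqP.
  exact: (esym (etrans eB H')).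
have mYn n : measurable_fun setT (Yn n).
  apply: measurable_funM; last exact: continuous_measurable_rV.
  apply: measurable_funM; last exact: mconv.
  by apply: continuous_measurable_rV; exact: continuous_mul (@crn n) (@cdqrn n).
have L1 : \int[leb]_y Yn n y @[n --> \oo] --> \int[leb]_y Y i y.
  apply: (@Rintegral_dct_L1 _ _ _ leb (Dist i) Yn (Y i) (fun x => C2 * C * `|Wt i x|) (C2 * C) _ _ _ _ _ _ _ _ _).2 => //.
  - by move=> n x; exact: moll_dist_ge0.
  - by apply: rintZ => //; apply: rint_abs; exact: Wti.
  - by rewrite mulr_ge0.
  - move=> n x; rewrite -mulrDr; apply: (@le_trans _ _ (C2 * C * `|convol (Wt i) (ker n) x|)).
      by rewrite normrM [leRHS]mulrAC ler_pM// normrM ler_wpM2r// dqabs.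
    by rewrite ler_wpM2l ?mulr_ge0// conv_le.
  - move=> x s h; have hr := moll_dist_cvg (in_rho i) h; have hW := moll_dist_cvg (in_Wt i) h.
    apply: cvgM; last exact: cvg_cst.
    apply: cvgM; last exact: hW.
    apply: cvgM; first exact: hr.
    exact: (continuous_cvg _ (dq_cont (rho_ge0 x)) hr).
have L2 : \int[leb]_y (P (rn n y) * db i y) @[n --> \oo] --> \int[leb]_y (P (rho y) * db i y).
  apply: (@Rintegral_dct_L1 _ _ _ leb (Dist i) (fun n y => P (rn n y) * db i y) (fun y => P (rho y) * db i y)
    (fun x => CP * C' * rho x) (CP * C') _ _ _ _ _ _ _ _ _).2 => //.
  - by move=> n x; exact: moll_dist_ge0.
  - by move=> n; apply: continuous_measurable_rV; exact: continuous_mul (@cPrn n) (@cdb i).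
  - by apply: measurable_funM => //; exact: continuous_measurable_rV.
  - exact: rintZ.
  - by rewrite mulr_ge0.
  - move=> n x; rewrite -mulrDr; apply: (@le_trans _ _ (CP * C' * rn n x)).
      by rewrite normrM mulrAC ler_pM// Pabs.
    have := conv_le n x (in_rho i); rewrite (ger0_norm (rho_ge0 x)) (ger0_norm (rn_ge0 n x)) => h.
    by rewrite ler_wpM2l ?mulr_ge0.
  - move=> x s h; have hr := moll_dist_cvg (in_rho i) h.
    apply: cvgM; last exact: cvg_cst.
    exact: (continuous_cvg _ (P_cont (rho_ge0 x)) hr).
have L3 : \int[leb]_y Yn n y @[n --> \oo] --> - \int[leb]_y (P (rho y) * db i y).
  by under eq_fun do rewrite Ynd; exact: cvgN.
exact: (cvg_unique _ L1 L3).
Qed.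

(** Inserting the flux identity in [F2l] leaves the diffusion term [- zeta * dq (rho) * Dl * Wt^2],
    which is nonpositive and dropped, and a drift term that [Y_by_parts] turns into [P (rho)]
    against the divergence of [zeta grad Psi]. *)
Lemma flow_limit_le : flow_limit <=
  \sum_i \int[leb]_y (rho y * v i y * (partial i zeta y * q (rho y))) +
  \int[leb]_y (P (rho y) * (\sum_i partial i zeta y * partial i Psi y + zeta y * laplacian Psi y)).
Proof.
have -> : \int[leb]_y (P (rho y) * (\sum_i partial i zeta y * partial i Psi y + zeta y * laplacian Psi y)) =
    \sum_i \int[leb]_y (P (rho y) * db i y).
  rewrite -(Rintegral_sum measurableT _ iPdb); apply: eq_Rintegral => y _.
  by rewrite /laplacian mulr_sumr -big_split/= mulr_sumr.
rewrite /flow_limit -big_split/=; apply: ler_sum => i _; rewrite lerD2l.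
rewrite -[leRHS]opprK -Y_by_parts -(RintegralN measurableT (iY i)).
have [iF _] := F2_cvg i.
apply: (ae_le_Rintegral measurableT iF (rintN (iY i))).
move: fluxE WtE; apply: filterS2 => y H1 H2 _.
have [yr|yr] := leP `|y| r0; last by rewrite /F2l /Y /b zs// !(mul0r,mulr0) oppr0.
have yB : B y by rewrite /B/= (le_trans yr)// lerDl.
have h1 := H1 i; have h2 := H2 i yB.
have -> : F2l i y = zeta y * dq (rho y) * (- (rho y * partial i Psi y) * Wt i y - Dl y * Wt i y ^+ 2).
  by rewrite /F2l /J h1 h2; ring.
have -> : - Y i y = zeta y * dq (rho y) * (- (rho y * partial i Psi y) * Wt i y).
  by rewrite /Y /b; ring.
rewrite ler_wpM2l ?mulr_ge0 ?dq_ge0// lerBlDr lerDl mulr_ge0 ?sqr_ge0//.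
by rewrite (le_trans (ltW lam0)).
Qed.

End fixed_time_limit.

(** * The entropy inequality *)

Section gronwall.
Context {R : realType}.

(** The increment is bounded by the value at the later time, so on [n + 1] equal steps this is an
    implicit Euler scheme: each step multiplies [g] by at most [1 / (1 - x n)], and [1 / (1 - x) = 1
    + x / (1 - x) <= exp (x / (1 - x))] once [x < 1]. *)
Lemma gronwall_increment (g : R -> R) (alpha T : R) : 0 <= alpha -> 0 <= T ->
  (forall t : R, 0 <= t <= T -> 0 <= g t) ->
  (forall s t : R, 0 <= s -> s <= t -> t <= T -> g t - g s <= alpha * (t - s) * g t) ->
  g T <= g 0 * expR (alpha * T).
Proof.
move=> a0 T0 g0 H.
pose x (n : nat) := alpha * T / n.+1%:R.
have n0 (n : nat) : 0 < n.+1%:R :> R by rewrite ltr0n.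
have x0 n : 0 <= x n by rewrite /x !mulr_ge0// invr_ge0 ltW.
have xlim : x n @[n --> \oo] --> (0 : R).
  by rewrite -(mulr0 (alpha * T)); apply: cvgM; [exact: cvg_cst|exact: cvg_harmonic].
have step n j : x n < 1 -> (j <= n.+1)%N -> g (T * j%:R / n.+1%:R) <= g 0 * expR (j%:R * (x n / (1 - x n))).
  move=> x1; have x1' : 0 < 1 - x n by rewrite subr_gt0.
  elim: j => [_|j IH jn]; first by rewrite mulr0 !mul0r expR0 mulr1.
  have {}IH := IH (ltnW jn).
  have tle (i : nat) : (i <= n.+1)%N -> T * i%:R / n.+1%:R <= T.
    by move=> i_n; rewrite ler_pdivrMr// ler_wpM2l// ler_nat.
  have t0 (i : nat) : 0 <= T * i%:R / n.+1%:R by rewrite !mulr_ge0// invr_ge0 ltW.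
  have tt : T * j%:R / n.+1%:R <= T * j.+1%:R / n.+1%:R.
    by rewrite ler_pM2r ?invr_gt0// ler_wpM2l// ler_nat.
  have := H _ _ (t0 j) tt (tle _ jn).
  have -> : alpha * (T * j.+1%:R / n.+1%:R - T * j%:R / n.+1%:R) = x n by rewrite /x -natr1; ring.
  set g1 := g (T * j.+1%:R / n.+1%:R) => h.
  have g10 : 0 <= g1 by apply: g0; rewrite t0 tle.
  have h1 : g1 <= g (T * j%:R / n.+1%:R) / (1 - x n).
    by rewrite ler_pdivlMr// mulrBr mulr1 mulrC; move: h; rewrite lerBlDr lerBlDl addrC.
  apply: (le_trans h1).
  have -> : j.+1%:R * (x n / (1 - x n)) = j%:R * (x n / (1 - x n)) + x n / (1 - x n).
    by rewrite -natr1 mulrDl mul1r.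
  rewrite expRD mulrA.
  apply: ler_pM => //; first by apply: g0; rewrite t0 tle// ltnW.
    by rewrite invr_ge0 ltW.
  rewrite [leLHS](_ : _ = 1 + x n / (1 - x n)); first exact: expR_ge1Dx.
  by field; rewrite gt_eqF.
have L : g 0 * expR (n.+1%:R * (x n / (1 - x n))) @[n --> \oo] --> g 0 * expR (alpha * T).
  apply: cvgM; first exact: cvg_cst.
  apply: continuous_cvg; first exact: continuous_expR.
  have -> : (fun n => n.+1%:R * (x n / (1 - x n))) = (fun n => alpha * T / (1 - x n)).
    by apply/funext => n; rewrite mulrA /x mulrCA [n.+1%:R * _]mulrC mulVf ?gt_eqF// mulr1.
  rewrite -[X in _ --> X]divr1; apply: cvgM; first exact: cvg_cst.
  apply: cvgV; first by rewrite oner_eq0.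
  by rewrite -[X in _ --> X]subr0; apply: cvgB; [exact: cvg_cst|exact: xlim].
rewrite -(cvg_lim _ L)//; apply: limr_ge; first by apply/cvg_ex; eexists; exact: L.
have x1 : \forall n \near \oo, x n < 1 by exact: (cvgr_lt _ xlim).
near=> n.
have := step n n.+1 _ (leqnn _); rewrite mulfK ?gt_eqF//; apply.
by near: n.
Unshelve. all: by end_near. Qed.

End gronwall.

Section energy_inequality.
Context {R : realType} {d : nat}.
Local Notation V := 'rV[R]_d.
Local Notation leb := (lebesgue_rV d : {measure set V -> \bar R}).
Local Notation lm := (@lebesgue_measure R).
Local Notation Rm := (measurableTypeR R).
Local Notation ker n := (@mollifier R d n).
Variables (rho : R -> @density R d) (v W : R -> 'I_d -> V -> R) (Dl : R -> V -> R).
Variables (Psi : V -> R) (lam : R).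
Hypothesis mass_cont : forall (f : V -> R) (C : R), continuous f -> (forall y, `|f y| <= C) ->
  continuous (fun t : R => \int[leb]_y (rho (Num.max t 0) y * f y)).
Hypothesis mv : forall (t : R) i, 0 < t -> measurable_fun setT (v t i).
Local Notation window := (window rho v).
Local Notation flow := (flow rho v).
Local Notation mass := (mass rho).
Local Notation diss := (diss rho v).
Local Notation good := (good rho v).
Hypothesis mW : forall s t : R, measurable (window s t).
Hypothesis dissi : forall T : R, rint lm (window 0 T) diss.
Hypothesis flowi : forall (psi : V -> R) (c T : R), smooth psi -> csupp c psi ->
  rint lm (window 0 T) (flow psi).
Hypothesis mass_flow : forall (psi : V -> R) (c s t : R), smooth psi -> csupp c psi -> 0 <= s -> s <= t ->
  mass psi t - mass psi s = \int[lm]_(r in window s t) flow psi r.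
Hypothesis lam0 : 0 < lam.
Hypothesis WG : forall t : R, 0 < t -> is_weak_grad (rho t) (fun y => \row_i W t i y).
Hypothesis mDl : forall t : R, 0 < t -> measurable_fun setT (Dl t).
Hypothesis Dl_ge : forall t y, lam <= Dl t y.
Hypothesis fluxE : forall t : R, 0 < t -> {ae leb, forall y, forall i,
  rho t y * v t i y = - (rho t y * partial i Psi y + Dl t y * W t i y)}.
Hypothesis Psi2 : is_Ck 2 Psi.
Variables (Kg A : R).
Hypothesis Kg0 : 0 <= Kg.
Hypothesis grow : forall i y, `|partial i Psi y| <= Kg * (1 + `|y|).
Hypothesis A0 : 0 <= A.
Hypothesis lap_le : {ae leb, forall y, laplacian Psi y <= A}.

Variables (q dq G : R -> R) (Cq C2 CG a eps : R).
Hypothesis dq_der : forall s : R, 0 <= s -> is_derive s (1 : R) q (dq s).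
Hypothesis G_der : forall s : R, 0 <= s -> is_derive s (1 : R) G (q s).
Hypothesis dq_cont : forall s : R, 0 <= s -> {for s, continuous dq}.
Hypothesis q_le : forall s : R, 0 <= s -> `|q s| <= Cq.
Hypothesis dq_ge0 : forall s : R, 0 <= s -> 0 <= dq s.
Hypothesis dq_le : forall s : R, 0 <= s -> s * dq s <= C2.
Hypothesis G_convex : forall x y : R, 0 <= x -> 0 <= y -> G x - G y <= q x * (x - y).
Hypothesis G_ge0 : forall s : R, 0 <= s -> 0 <= G s.
Hypothesis G_le : forall s : R, 0 <= s -> G s <= CG * s.
Let P s := s * q s - G s.
Hypothesis P_ge0 : forall s : R, 0 <= s -> 0 <= P s.
Hypothesis a0 : 0 <= a.
Hypothesis P_le : forall s : R, 0 <= s -> P s <= a * G s + eps * s.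
Hypothesis eps0 : 0 <= eps.
Variable Cc : R.
Hypothesis Cc0 : 0 <= Cc.
Hypothesis Cc_le : forall N i (z : V), `|partial i (cutoff N) z| <= Cc / N.+1%:R.

Let q_cont (s : R) : 0 <= s -> {for s, continuous q}.
Proof.
by move=> s0; apply: differentiable_continuous; apply/derivable1_diffP; have [] := dq_der s0.
Qed.

Let G_cont (s : R) : 0 <= s -> {for s, continuous G}.
Proof.
by move=> s0; apply: differentiable_continuous; apply/derivable1_diffP; have [] := G_der s0.
Qed.

Let CG0 : 0 <= CG.
Proof. by have := le_trans (G_ge0 ler01) (G_le ler01); rewrite mulr1. Qed.

Let Gabs (s : R) : 0 <= s -> `|G s| <= CG * s.
Proof. by move=> s0; rewrite ger0_norm ?G_ge0// G_le. Qed.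

Let CP := a * CG + eps.
Let P_le' (s : R) : 0 <= s -> P s <= CP * s.
Proof.
move=> s0; apply: (le_trans (P_le s0)); rewrite mulrDl lerD2r -mulrA ler_wpM2l//.
exact: G_le.
Qed.

Let P_der (s : R) : 0 <= s -> is_derive s (1 : R) P (s * dq s).
Proof.
move=> s0; have h1 := is_deriveM (is_derive_id s (1 : R)) (dq_der s0).
have h := is_deriveB h1 (G_der s0).
by apply: (is_derive_eq h); rewrite /GRing.scale/=; ring.
Qed.

Let ri t : rint leb setT (rho t). Proof. exact: density_rint. Qed.
Let rge t y : 0 <= rho t y. Proof. exact: density_ge0. Qed.
Let mr t : measurable_fun setT (rho t). Proof. exact: measurable_density. Qed.

Let mGr t : measurable_fun setT (fun y => G (rho t y)).
Proof. exact: measurable_comp_ge0. Qed.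

Lemma entropy_rint t : rint leb setT (fun y => G (rho t y)).
Proof.
apply: (@rint_le _ _ _ leb setT measurableT _ (fun y => CG * rho t y)) => //.
  exact: rintZ.
by move=> y _; exact: Gabs.
Qed.

Definition Phi t := \int[leb]_y G (rho t y).

Let Phi_ge0 t : 0 <= Phi t.
Proof. by apply: Rintegral_ge0 => y _; exact: G_ge0. Qed.

Let Phi_le t : Phi t <= CG.
Proof.
rewrite -[leRHS]mulr1 -(Rintegral_density rho t) -(RintegralZl CG measurableT (ri t)).
apply: le_Rintegral => //; [exact: entropy_rint|exact: rintZ|].
by move=> y _; exact: G_le.
Qed.

Let cz N : continuous (@cutoff R d N). Proof. exact: smooth_continuous (@smooth_cutoff R d N). Qed.
Let mz N : measurable_fun setT (@cutoff R d N). Proof. exact: continuous_measurable_rV. Qed.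

Let PhiN N t := \int[leb]_y (cutoff N y * G (rho t y)).

Let entropy_cvg N t : entropy rho n N G t @[n --> \oo] --> PhiN N t.
Proof.
have [r1 r2] := mollify_L1 (ri t).
apply: (@Rintegral_dct_L1 _ _ _ leb (fun n x => `|convol (rho t) (ker n) x - rho t x|)
  (fun n x => cutoff N x * G (moll rho n t x)) (fun x => cutoff N x * G (rho t x))
  (fun x => CG * rho t x) CG r1 _ r2 _ _ _ _ _ _).2 => //.
- move=> n; apply: continuous_measurable_rV; apply: continuous_mul => //.
  by apply: continuous_comp_ge0; [exact: G_cont|exact: continuous_moll|exact: moll_ge0].
- exact: measurable_funM.
- exact: rintZ.
- move=> n x; rewrite -mulrDr normrM ger0_norm ?cutoff_ge0//.
  apply: (@le_trans _ _ (1 * (CG * moll rho n t x))).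
    by apply: ler_pM => //; [exact: cutoff_ge0|exact: cutoff_le1|apply: Gabs; exact: moll_ge0].
  rewrite mul1r ler_wpM2l// -lerBlDl; exact: ler_norm.
- move=> x s h; apply: cvgM; first exact: cvg_cst.
  have h' : moll rho (s k) t x @[k --> \oo] --> rho t x by apply: cvg_of_dist_le h.
  exact: (continuous_cvg _ (G_cont (rge t x)) h').
Qed.

Let PhiN_cvg t : PhiN N t @[N --> \oo] --> Phi t.
Proof.
apply: (Rintegral_dctT (mu := leb) measurableT _ (mGr t) (entropy_rint t) _ _).2.
- by move=> N; exact: measurable_funM.
- move=> x _; apply: cvg_near_cst; near=> N; rewrite cutoff_1 ?mul1r//.
  apply: (le_trans (ltW (truncnS_gt _))); rewrite ler_nat ltnS.
  by near: N; exact: nbhs_infty_ge.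
- move=> x _ N; rewrite normrM ger0_norm ?cutoff_ge0// (ger0_norm (G_ge0 _))//.
  by rewrite ler_piMl ?G_ge0// cutoff_le1.
Unshelve. all: by end_near. Qed.

Let moll_bound n : exists C : R, forall t x, moll rho n t x <= C.
Proof.
have ck := smooth_continuous (@smooth_mollifier R d n).
have [C C0 hC] := csupp_bounded ck (@csupp_mollifier R d n).
exists C => t x; rewrite -[leRHS]mulr1 -(Rintegral_density rho t) -(RintegralZl C measurableT (ri t)).
apply: le_Rintegral => //.
- exact: (rint_conv x (rint_L1loc (ri t)) ck (@csupp_mollifier R d n)).
- exact: rintZ.
- by move=> y _; rewrite mulrC ler_wpM2r// (le_trans (ler_norm _)).
Qed.

Let entropy_measurable n N (D : set Rm) : D `<=` [set r : R | 0 <= r] -> measurable_fun D (entropy rho n N G).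
Proof.
move=> D0; apply: (eq_measurable_fun (fun t : R => entropy rho n N G (Num.max t 0))).
  by move=> t; rewrite inE => /D0 /= t0; rewrite max_l.
apply: measurable_funTS; apply: continuous_measurable_fun => t.
apply: cvg_nbhsP_seq => u ut; have [C hC] := moll_bound n.
have zi : rint leb setT (@cutoff R d N) by exact: rint_csupp (@cz N) (@csupp_cutoff R d N).
have cG r : continuous (fun x => G (moll rho n r x)).
  by apply: continuous_comp_ge0; [exact: G_cont|exact: continuous_moll|exact: moll_ge0].
have ut' : (Num.max (u k) 0 : R) @[k --> \oo] --> (Num.max t 0 : R).
  have h : {for t, continuous (fun s : R => Num.max s 0)} by exact: continuous_max0.
  exact: (continuous_cvg _ h ut).
apply: (Rintegral_dctT (mu := leb) (h := fun x => CG * C * cutoff N x) measurableT _ _ _ _ _).2.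
- by move=> k; apply: measurable_funM => //; exact: continuous_measurable_rV.
- by apply: measurable_funM => //; exact: continuous_measurable_rV.
- exact: rintZ.
- move=> x _; apply: cvgM; first exact: cvg_cst.
  have hm : moll rho n (Num.max (u k) 0) x @[k --> \oo] --> moll rho n (Num.max t 0) x.
    apply: (cvg_moll mass_cont (u := fun k => Num.max (u k) 0)) => //.
    - by move=> k; rewrite le_max lexx orbT.
    - by rewrite le_max lexx orbT.
  exact: (continuous_cvg _ (G_cont (moll_ge0 rho n (Num.max t 0) x)) hm).
- move=> x _ k; rewrite normrM ger0_norm ?cutoff_ge0// mulrC ler_wpM2r ?cutoff_ge0//.
  apply: (le_trans (Gabs (moll_ge0 rho n _ x))); rewrite ler_wpM2l//.
Qed.

Let Phi_measurable s t : 0 <= s -> measurable_fun (window s t) Phi.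
Proof.
move=> s0; apply: (measurable_fun_cvg (h := PhiN)); last by move=> r _; exact: PhiN_cvg.
move=> N; apply: (measurable_fun_cvg (h := fun n => entropy rho n N G)); last by move=> r _; exact: entropy_cvg.
by move=> n; apply: entropy_measurable => r /window_good[r0 _ _]; exact: ltW.
Qed.

(** The constant of [flow_test_bound] for the cutoff of index [N], with [grad Psi] estimated on the
    ball of radius [2 (N + 1) + 1]. It grows with [N], which does no harm since the mollification is
    removed at fixed [N]. *)
Let KK N := Cc / N.+1%:R * Cq + C2 + C2 * (2 / lam ^+ 2) * (1 + (Kg * (1 + (2 * N.+1%:R + 1))) ^+ 2).
Let LN N r := flow_limit (rho r) (v r) (Dl r) Psi N q dq.

Let grow' N i (y : V) : `|y| <= 2 * N.+1%:R + 1 -> `|partial i Psi y| <= Kg * (1 + (2 * N.+1%:R + 1)).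
Proof. by move=> yr; apply: (le_trans (grow i y)); rewrite ler_wpM2l// lerD2l. Qed.

Let flow_lim N r : good r -> flow (test_fun rho n N q r) r @[n --> \oo] --> LN N r.
Proof.
move=> gr; have r0 : 0 < r by case: gr.
exact: (flow_test_cvg (fun i => mv i r0) (energy_rint mv gr) (WG r0) (mDl r0) lam0 (Dl_ge r)
  (fluxE r0) Psi2 (Cc_le N) (@grow' N) dq_der dq_cont q_le dq_ge0 dq_le).
Qed.

Let flow_bound n N r : good r -> `|flow (test_fun rho n N q r) r| <= KK N * (d%:R + diss r).
Proof.
move=> gr; have r0 : 0 < r by case: gr.
rewrite (dissE mv gr).
exact: (flow_test_bound (fun i => mv i r0) (energy_rint mv gr) (WG r0) (mDl r0) lam0 (Dl_ge r)
  (fluxE r0) Psi2 (Cc_le N) (@grow' N) dq_der dq_cont q_le dq_ge0 dq_le n).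
Qed.

Let window_fin s t : (lm (window s t) < +oo)%E.
Proof.
apply: (@le_lt_trans _ _ (lm `]s, t]%classic)).
  by apply: le_measure; rewrite ?inE; [exact: mW|exact: measurable_itv|move=> r []].
by rewrite lebesgue_measure_itv/=; case: ifP => _; rewrite -?EFinB ltry.
Qed.

Let window_cst s t c : rint lm (window s t) (fun=> c).
Proof. exact: (rint_cst (mW s t) c (window_fin s t)). Qed.

Let diss_bound T c : rint lm (window 0 T) (fun r => c * (d%:R + diss r)).
Proof. exact: (rintZ (mW 0 T) _ (rintD (mW 0 T) (window_cst 0 T d%:R) (dissi T))). Qed.

Let PhiN_le N T : 0 < T -> rint lm (window 0 T) (LN N) /\
  PhiN N T - PhiN N 0 <= \int[lm]_(r in window 0 T) LN N r.
Proof.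
move=> T0.
have key n := entropy_dissipation mass_cont mv mW dissi flowi mass_flow n N q_cont q_le G_convex G_cont T0.
have mL : measurable_fun (window 0 T) (LN N).
  apply: (measurable_fun_cvg (h := fun n r => flow (test_fun rho n N q r) r)).
    by move=> n; exact: rint_meas (key n).1.
  by move=> r [_ gr]; exact: flow_lim.
have [h1 h2] := Rintegral_dctT (mu := lm) (mW 0 T) (fun n => rint_meas (key n).1) mL (diss_bound T (KK N))
  (fun r wr => @flow_lim N r wr.2) (fun r wr n => @flow_bound n N r wr.2).
split => //.
have h3 : entropy rho n N G T - entropy rho n N G 0 @[n --> \oo] --> PhiN N T - PhiN N 0.
  by apply: cvgB; exact: entropy_cvg.
rewrite -(cvg_lim _ h2)// -(cvg_lim _ h3)//; apply: ler_lim.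
- by apply/cvg_ex; eexists; exact: h3.
- by apply/cvg_ex; eexists; exact: h2.
- by apply: nearW => n; exact: (key n).2.
Qed.

Let tail M t := \int[leb]_y (rho t y * (1 - cutoff M y)).

Let tail_rint M t : rint leb setT (fun y => rho t y * (1 - cutoff M y)).
Proof.
apply: (rintM_bdd measurableT (g := fun y => 1 - cutoff M y) (C := 1) _ (ri t)) => [|y _].
  exact: measurable_funB.
by rewrite ger0_norm ?subr_ge0 ?cutoff_le1// lerBlDr lerDl cutoff_ge0.
Qed.

Let tail01 M t : 0 <= tail M t <= 1.
Proof.
have h0 y : 0 <= 1 - @cutoff R d M y by rewrite subr_ge0 cutoff_le1.
rewrite /tail Rintegral_ge0 => [/=|y _]; last by rewrite mulr_ge0.
rewrite -[leRHS](Rintegral_density rho t); apply: le_Rintegral => //; [exact: tail_rint|exact: ri|].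
by move=> y _; rewrite ler_piMr// lerBlDr lerDl cutoff_ge0.
Qed.

Let tail_cvg t : tail M t @[M --> \oo] --> 0.
Proof.
have <- : \int[leb]_y (fun _ : V => 0 : R) y = 0 by rewrite Rintegral_cst// mul0r.
apply: (Rintegral_dctT (mu := leb) measurableT _ (measurable_cst _) (ri t) _ _).2.
- by move=> M; exact: rint_meas (tail_rint M t).
- move=> x _; apply: cvg_near_cst; near=> N; rewrite cutoff_1 ?subrr ?mulr0//.
  apply: (le_trans (ltW (truncnS_gt _))); rewrite ler_nat ltnS.
  by near: N; exact: nbhs_infty_ge.
- move=> x _ N; rewrite normrM ger0_norm// ler_piMr// ger0_norm ?subr_ge0 ?cutoff_le1//.
  by rewrite lerBlDr lerDl cutoff_ge0.
Unshelve. all: by end_near. Qed.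

Let tail_measurable M s t : 0 <= s -> measurable_fun (window s t) (tail M).
Proof.
move=> s0; apply: (eq_measurable_fun (fun t : R => \int[leb]_y (rho (Num.max t 0) y * (1 - cutoff M y)))).
  by move=> r; rewrite inE => /window_good[r0 _ _]; rewrite max_l// ltW.
apply: measurable_funTS; apply: continuous_measurable_fun.
apply: (@mass_cont (fun y => 1 - cutoff M y) 1).
  have -> : (fun y => 1 - @cutoff R d M y) = (fun y => 1 + (-1) * cutoff M y).
    by apply/funext => y; rewrite mulN1r.
  apply: (@continuous_add R V (fun=> 1)); first exact: cst_continuous.
  by apply: (@continuous_mul R V (fun=> -1)) => //; exact: cst_continuous.
by move=> y; rewrite ger0_norm ?subr_ge0 ?cutoff_le1// lerBlDr lerDl cutoff_ge0.
Qed.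

(** [NM M + 1 = 2 M + 3] exceeds [2 (M + 1)]: where the cutoff of index [NM M] begins to vary, the
    one of index [M] is already 0. *)
Let NM M := (2 * M).+2.
Let Ct := Cc * (Kg * 4) *+ d.

(** With [N = NM M], on the region [|y| <= 2 (N + 1)] the gradient of the cutoff is of size
    [1 / (N + 1)] and that of [Psi] at most [4 Kg (N + 1)]. Their product is bounded, not small; the
    factor [1 - cutoff M] places it in the tail. *)
Let cross_le M y : `|\sum_i partial i (cutoff (NM M)) y * partial i Psi y| <= Ct * (1 - cutoff M y).
Proof.
have N0 : 0 < (NM M).+1%:R :> R by rewrite ltr0n.
have [yN|yN] := ltP `|y| (NM M).+1%:R.
  have h0 i : partial i (@cutoff R d (NM M)) y = 0.
    have h : is_derive y (delta_mx 0 i) (@cutoff R d (NM M)) 0.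
      have h0 : is_derive y (delta_mx 0 i) (fun _ : V => 1 : R) 0 by exact: is_derive_cst.
      apply: (near_eq_is_derive _ h0).
      have nb : \forall z \near y, `|z| < (NM M).+1%:R.
        exact: (cvgr_lt _ (@norm_continuous _ _ y) _ yN).
      by apply: filterS nb => z /ltW zN; rewrite cutoff_1.
    by case: h.
  rewrite big1 => [|i _]; last by rewrite h0 mul0r.
  by rewrite normr0 mulr_ge0 ?subr_ge0 ?cutoff_le1// mulrn_wge0// !mulr_ge0.
have -> : @cutoff R d M y = 0.
  apply: csupp_cutoff; apply: lt_le_trans yN.
  by rewrite -natrM ltr_nat /NM mulnS.
rewrite subr0 mulr1 /Ct; apply: (le_trans (ler_norm_sum _ _ _)).
have -> : Cc * (Kg * 4) *+ d = \sum_(i < d) Cc * (Kg * 4) by rewrite sumr_const card_ord.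
apply: ler_sum => i _; rewrite normrM.
have [y2|y2] := leP `|y| (2 * (NM M).+1%:R); last first.
  have -> : partial i (@cutoff R d (NM M)) y = 0 by exact: (csupp_derive (delta_mx 0 i) (@csupp_cutoff R d (NM M)) y2).
  by rewrite normr0 mul0r !mulr_ge0.
apply: (@le_trans _ _ (Cc / (NM M).+1%:R * (Kg * (4 * (NM M).+1%:R)))).
  apply: ler_pM => //; apply: (le_trans (grow i y)); rewrite ler_wpM2l//.
  have N1 : 1 <= (NM M).+1%:R :> R by rewrite ler1n.
  by move: y2 N1; set x := (NM M).+1%:R; set z := `|y|; lra.
rewrite [leLHS](_ : _ = Cc * (Kg * 4)) //; field.
by rewrite gt_eqF.
Qed.

(** The first two summands are the cutoff errors, one from the flux against the small gradient of
    the cutoff, the other from the mass in the tail; both vanish as [M] grows. *)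
Let LN_le M r : good r -> LN (NM M) r <=
  Cc / (NM M).+1%:R * Cq * (d%:R + diss r) + CP * Ct * tail M r + A * (a * Phi r + eps).
Proof.
move=> gr; have r0 : 0 < r by case: gr.
have := flow_limit_le q (fun i => mv i r0) (energy_rint mv gr) (WG r0) (mDl r0) lam0 (Dl_ge r)
  (fluxE r0) Psi2 (@grow' (NM M)) dq_cont dq_ge0 dq_le P_der P_ge0 P_le'.
move=> /le_trans; apply; rewrite -addrA; apply: lerD.
  apply: (le_trans (ler_norm _)).
  have Cz0 : 0 <= Cc / (NM M).+1%:R by rewrite divr_ge0.
  apply: (flux_test_le mv gr (C := Cc / (NM M).+1%:R * Cq) _ _ _).2.
  - by rewrite mulr_ge0//; exact: le_trans (normr_ge0 _) (q_le (lexx 0)).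
  - move=> i; apply: measurable_funM; last exact: measurable_comp_ge0.
    by apply: continuous_measurable_rV; exact: smooth_continuous (smooth_derive _ (@smooth_cutoff R d _)).
  - by move=> i y; rewrite normrM ler_pM// q_le.
have clap : continuous (laplacian Psi).
  apply: continuous_big => [|i _]; last by case: Psi2 => _ /(_ (delta_mx 0 i))[_ [_ /(_ (delta_mx 0 i)) [_ []]]].
  exact: add_continuous.
pose h y := \sum_i partial i (cutoff (NM M)) y * partial i Psi y + cutoff (NM M) y * laplacian Psi y.
have mh : measurable_fun setT h.
  apply: measurable_funD; last by apply: measurable_funM => //; exact: continuous_measurable_rV.
  apply: measurable_sum => i; apply: measurable_funM; apply: continuous_measurable_rV.
    exact: smooth_continuous (smooth_derive _ (@smooth_cutoff R d _)).
  by case: Psi2 => _ /(_ (delta_mx 0 i))[_ []].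
have mP : measurable_fun setT (fun y => P (rho r y)).
  by apply: measurable_funB => //; apply: measurable_funM => //; exact: measurable_comp_ge0.
have [C C0 hC] : exists2 C, 0 <= C & forall y, `|cutoff (NM M) y * laplacian Psi y| <= C.
  apply: (@csupp_bounded _ _ (2 * (NM M).+1%:R)); first exact: continuous_mul.
  by move=> y /(@csupp_cutoff R d (NM M)) hy; rewrite hy mul0r.
have CP0 : 0 <= CP by rewrite addr_ge0// mulr_ge0.
have Ct0 : 0 <= Ct by rewrite mulrn_wge0// !mulr_ge0.
have c01 y : 0 <= 1 - @cutoff R d M y <= 1.
  by rewrite subr_ge0 cutoff_le1 lerBlDr lerDl cutoff_ge0.
have ih : rint leb setT (fun y => P (rho r y) * h y).
  apply: (@rint_le _ _ _ leb setT measurableT _ (fun y => CP * (Ct + C) * rho r y)) => //.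
  - exact: measurable_funM.
  - exact: rintZ.
  - move=> y _; rewrite normrM mulrAC ler_pM//.
      by rewrite ger0_norm ?P_ge0// P_le'.
    apply: (le_trans (ler_normD _ _)); rewrite lerD//.
    apply: (le_trans (cross_le M y)); rewrite ler_piMr//.
    by have /andP[] := c01 y.
have i1 : rint leb setT (fun y => CP * Ct * (rho r y * (1 - cutoff M y))).
  exact: (rintZ measurableT _ (tail_rint M r)).
have i2 := rintZ measurableT a (entropy_rint r).
have i3 := rintZ measurableT eps (ri r).
have i4 := rintZ measurableT A (rintD measurableT i2 i3).
have -> : CP * Ct * tail M r + A * (a * Phi r + eps) =
    \int[leb]_y (CP * Ct * (rho r y * (1 - cutoff M y)) + A * (a * G (rho r y) + eps * rho r y)).
  rewrite (RintegralD measurableT i1 i4) (RintegralZl _ measurableT (tail_rint M r)).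
  rewrite (RintegralZl A measurableT (rintD measurableT i2 i3)) (RintegralD measurableT i2 i3).
  rewrite (RintegralZl a measurableT (entropy_rint r)) (RintegralZl eps measurableT (ri r)).
  by rewrite (Rintegral_density rho r) mulr1.
apply: (ae_le_Rintegral measurableT ih (rintD measurableT i1 i4)).
apply: filterS lap_le => y ly _.
have /andP[d0 d1] := c01 y; have Py := P_ge0 (rge r y).
rewrite /h mulrDr; apply: lerD.
  apply: (@le_trans _ _ (P (rho r y) * (Ct * (1 - cutoff M y)))).
    by rewrite ler_wpM2l// (le_trans (ler_norm _))// cross_le.
  have -> : CP * Ct * (rho r y * (1 - cutoff M y)) = CP * rho r y * (Ct * (1 - cutoff M y)) by ring.
  by rewrite ler_wpM2r ?mulr_ge0// P_le'.
apply: (@le_trans _ _ (P (rho r y) * A)).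
  rewrite ler_wpM2l//; apply: (@le_trans _ _ (cutoff (NM M) y * A)).
    by rewrite ler_wpM2l// cutoff_ge0.
  by rewrite ler_piMl// cutoff_le1.
by rewrite mulrC ler_wpM2l// P_le.
Qed.

Let rhs_rint s t : 0 <= s -> rint lm (window s t) (fun r => A * (a * Phi r + eps)).
Proof.
move=> s0; apply: (@rint_le _ _ _ lm (window s t) (mW s t) _ (fun=> A * (a * CG + eps))).
- apply: measurable_funM => //; apply: measurable_funD => //; apply: measurable_funM => //.
  exact: Phi_measurable.
- exact: window_cst.
- move=> r _; rewrite ger0_norm ?mulr_ge0 ?addr_ge0 ?mulr_ge0//.
  by rewrite ler_wpM2l// lerD2r ler_wpM2l.
Qed.

Lemma Phi_increment T : 0 < T ->
  Phi T - Phi 0 <= \int[lm]_(r in window 0 T) (A * (a * Phi r + eps)).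
Proof.
move=> T0; have Cq0 : 0 <= Cq := le_trans (normr_ge0 _) (q_le (lexx 0)).
have CP0 : 0 <= CP by rewrite addr_ge0// mulr_ge0.
have Ct0 : 0 <= Ct by rewrite mulrn_wge0// !mulr_ge0.
have sub t : PhiN (NM M) t @[M --> \oo] --> Phi t.
  have h : NM M @[M --> \oo] --> \oo.
    apply/cvgnyPge => N; near=> M; rewrite /NM.
    apply: (@leq_trans M); first by near: M; exact: nbhs_infty_ge.
    by rewrite mul2n -addnn -!addnS leq_addr.
  exact: (cvg_comp NM (fun N => PhiN N t) h (@PhiN_cvg t)).
pose bnd M r := Cc / (NM M).+1%:R * Cq * (d%:R + diss r) + CP * Ct * tail M r + A * (a * Phi r + eps).
have itail M : rint lm (window 0 T) (fun r => CP * Ct * tail M r).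
  apply: rintZ => //; apply: (@rint_le _ _ _ lm (window 0 T) (mW 0 T) _ (fun=> 1)) => //.
    exact: tail_measurable.
  by move=> r _; have /andP[h1 h2] := tail01 M r; rewrite ger0_norm.
have ibnd M : rint lm (window 0 T) (bnd M).
  exact: (rintD (mW 0 T) (rintD (mW 0 T) (diss_bound T _) (itail M)) (rhs_rint T (lexx 0))).
have L : \int[lm]_(r in window 0 T) bnd M r @[M --> \oo] -->
    \int[lm]_(r in window 0 T) (A * (a * Phi r + eps)).
  have ih := rintD (mW 0 T) (rintD (mW 0 T) (diss_bound T (Cc * Cq)) (window_cst 0 T (CP * Ct)))
    (rhs_rint T (lexx 0)).
  apply: (Rintegral_dctT (mu := lm) (mW 0 T) _ _ ih _ _).2.
  - by move=> M; exact: rint_meas (ibnd M).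
  - exact: rint_meas (rhs_rint T (lexx 0)).
  - move=> r _; rewrite -[X in _ --> X]add0r; apply: cvgD; last exact: cvg_cst.
    rewrite -[X in _ --> X]add0r; apply: cvgD.
      rewrite -(mul0r (d%:R + diss r)); apply: cvgM; last exact: cvg_cst.
      rewrite -(mul0r Cq); apply: cvgM; last exact: cvg_cst.
      rewrite -(mulr0 Cc); apply: cvgM; first exact: cvg_cst.
      have h : NM M @[M --> \oo] --> \oo.
        apply/cvgnyPge => N; near=> M; rewrite /NM.
        apply: (@leq_trans M); first by near: M; exact: nbhs_infty_ge.
        by rewrite mul2n -addnn -!addnS leq_addr.
      exact: (cvg_comp NM (fun N => N.+1%:R^-1) h (@cvg_harmonic R)).
    by rewrite -(mulr0 (CP * Ct)); apply: cvgM; [exact: cvg_cst|exact: tail_cvg].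
  - move=> r _ M; have /andP[h1 h2] := tail01 M r.
    have dr : 0 <= d%:R + diss r by rewrite addr_ge0// diss_ge0.
    have e0 : 0 <= Cc / (NM M).+1%:R * Cq * (d%:R + diss r) by rewrite !mulr_ge0// invr_ge0.
    have e1 : 0 <= A * (a * Phi r + eps) by rewrite mulr_ge0// addr_ge0// mulr_ge0.
    have e2 : 0 <= CP * Ct * tail M r by rewrite !mulr_ge0.
    rewrite ger0_norm; last by rewrite !addr_ge0.
    rewrite lerD2r lerD//; last by rewrite ler_piMr// mulr_ge0.
    rewrite ler_wpM2r// ler_wpM2r// ler_piMr// invf_le1// ler1n//.
have L' : PhiN (NM M) T - PhiN (NM M) 0 @[M --> \oo] --> Phi T - Phi 0 by apply: cvgB.
rewrite -(cvg_lim _ L)// -(cvg_lim _ L')//; apply: ler_lim.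
- by apply/cvg_ex; eexists; exact: L'.
- by apply/cvg_ex; eexists; exact: L.
apply: nearW => M; have [h1 h2] := PhiN_le (NM M) T0; apply: (le_trans h2).
by apply: le_Rintegral => //; [exact: ibnd|move=> r [_ gr]; exact: LN_le].
Unshelve. all: by end_near. Qed.

Lemma window_integral_le (f : R -> R) (s t c : R) : s <= t -> rint lm (window s t) f ->
  0 <= c -> (forall r, window s t r -> f r <= c) -> \int[lm]_(r in window s t) f r <= c * (t - s).
Proof.
move=> st fi c0 fc; apply: (@le_trans _ _ (\int[lm]_(r in window s t) c)).
  by apply: le_Rintegral => //; exact: window_cst.
rewrite Rintegral_cst// ler_wpM2l//.
have h : (lm (window s t) <= (t - s)%:E)%E.
  apply: (@le_trans _ _ (lm `]s, t]%classic)).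
    by apply: le_measure; rewrite ?inE; [exact: mW|exact: measurable_itv|move=> r []].
  rewrite lebesgue_measure_itv/= lte_fin; case: ifP => _; first by rewrite -EFinB.
  by rewrite lee_fin subr_ge0.
by rewrite -lee_fin fineK// (ge0_fin_numE (measure_ge0 _ _)); exact: window_fin.
Qed.

(** [Phi_increment] starts at time 0 only, so Gronwall is applied to the nondecreasing majorant [g]
    of [Phi], whose increment over []s, t]] is at most [A a (t - s) g t]. *)
Lemma energy_inequality T : 0 <= T -> Phi T <= (Phi 0 + A * eps * T) * expR (A * a * T).
Proof.
rewrite le_eqVlt => /orP[/eqP <-|T0].
  by rewrite !mulr0 addr0 expR0 mulr1.
pose g t := Phi 0 + A * eps * T + \int[lm]_(r in window 0 t) (A * a * Phi r).
have iPhi s t : 0 <= s -> rint lm (window s t) (fun r => A * a * Phi r).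
  move=> s0; apply: (@rint_le _ _ _ lm (window s t) (mW s t) _ (fun=> A * a * CG)).
  - by apply: measurable_funM => //; exact: Phi_measurable.
  - exact: window_cst.
  - by move=> r _; rewrite ger0_norm ?mulr_ge0// ler_wpM2l// mulr_ge0.
have Phig t : 0 <= t -> t <= T -> Phi t <= g t.
  rewrite le_eqVlt => /orP[/eqP <- _|t0 tT].
    rewrite /g -addrA lerDl addr_ge0// ?mulr_ge0// ?(ltW T0)//.
    by apply: Rintegral_ge0 => r _; rewrite !mulr_ge0.
  have := Phi_increment t0; rewrite lerBlDl => /le_trans; apply.
  rewrite /g -addrA lerD2l.
  have ie : rint lm (window 0 t) (fun=> A * eps) by exact: window_cst.
  have -> : \int[lm]_(r in window 0 t) (A * (a * Phi r + eps)) =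
      \int[lm]_(r in window 0 t) (A * eps) + \int[lm]_(r in window 0 t) (A * a * Phi r).
    rewrite -(RintegralD (mW 0 t) ie (iPhi 0 t (lexx 0))); apply: eq_Rintegral => r _; ring.
  rewrite lerD2r; apply: (@le_trans _ _ (A * eps * (t - 0))).
    by apply: window_integral_le => //; [exact: ltW|exact: mulr_ge0].
  by rewrite subr0 ler_wpM2l// mulr_ge0.
have g_split s t : 0 <= s -> s <= t -> g t - g s = \int[lm]_(r in window s t) (A * a * Phi r).
  move=> s0 st; rewrite /g opprD addrACA subrr add0r; pose f r := A * a * Phi r.
  have iI u w : rint lm (window 0 t) (fun r => \1_(`]u, w]%classic : set R) r * f r).
    apply: (@rint_le _ _ _ lm (window 0 t) (mW 0 t) _ f) => //.
    - apply: measurable_funM; last exact: rint_meas (iPhi 0 t (lexx 0)).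
      by apply: measurable_funTS; apply: measurable_indic; exact: measurable_itv.
    - exact: iPhi.
    - move=> r _; rewrite normrM [X in _ * X]ger0_norm /f ?mulr_ge0// ler_piMl ?mulr_ge0//.
      by rewrite indicE; case: (_ \in _); rewrite ?normr1 ?normr0.
  rewrite -(Rintegral_window_indic rho v f s0 (lexx t)) -(Rintegral_window_indic rho v f (lexx 0) st).
  apply/eqP; rewrite subr_eq -(RintegralD (mW 0 t) (iI s t) (iI 0 s)); apply/eqP.
  apply: eq_Rintegral => r; rewrite inE => /window_good[r0 /andP[_ rt] _].
  rewrite -mulrDl !indicE !mem_setE !in_itv/= r0 rt andbT/=.
  by case: ltP => _; rewrite ?addr0 ?add0r mul1r.
have g_nd s t : 0 <= s -> s <= t -> g s <= g t.
  move=> s0 st; rewrite -subr_ge0 g_split//.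
  by apply: Rintegral_ge0 => r _; rewrite !mulr_ge0.
have g0 : g 0 = Phi 0 + A * eps * T.
  have W0 : window 0 0 = set0.
    apply/seteqP; split => r// /window_good[r0 /andP[_ r0'] _].
    by have := lt_le_trans r0 r0'; rewrite ltxx.
  by rewrite /g W0 Rintegral_set0 addr0.
apply: (le_trans (Phig T (ltW T0) (lexx T))); rewrite -g0.
have g0_ge : 0 <= g 0 by rewrite g0 addr_ge0// !mulr_ge0// ltW.
apply: gronwall_increment; rewrite ?mulr_ge0 ?(ltW T0)//.
  by move=> t /andP[t0 tT]; exact: le_trans g0_ge (g_nd _ _ (lexx 0) t0).
move=> s t s0 st tT; rewrite g_split// mulrAC.
have t0 := le_trans s0 st.
apply: window_integral_le => //; first exact: iPhi.
  by rewrite !mulr_ge0//; exact: le_trans g0_ge (g_nd _ _ (lexx 0) t0).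
move=> r /window_good[r0 /andP[_ rt] _]; rewrite ler_wpM2l ?mulr_ge0//.
apply: (le_trans (Phig r (ltW r0) (le_trans rt tT))); exact: g_nd (ltW r0) rt.
Qed.

End energy_inequality.

(** * Regularized powers *)

Section regularized_power.
Context {R : realType}.
Variables (m e : R).
Hypotheses (m1 : 1 < m) (e0 : 0 < e).

Let m0 : 0 < m := lt_trans ltr01 m1.
Let mm1 : 0 < m - 1. Proof. by rewrite subr_gt0. Qed.

(* With [u = s / (1 + e s)] and [f u = (u + e)^m - e^m - m e^(m-1) u], the
   perspective [G s = (1 + e s) f u] is convex, has at most linear growth, and
   satisfies [s G' s - G s = u f' u - f u]; it tends to [s^m] as [e] tends to 0. *)
Definition reg_u (s : R) : R := s / (1 + e * s).
(** The shift by [e] keeps the second derivative finite at 0 when [m < 2]; subtracting the tangent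
    at 0 gives [f 0 = 0] and [f1 0 = 0]. *)
Let f (u : R) : R := (u + e) `^ m - e `^ m - m * e `^ (m - 1) * u.
Let f1 (u : R) : R := m * (u + e) `^ (m - 1) - m * e `^ (m - 1).
Let f2 (u : R) : R := m * ((m - 1) * (u + e) `^ (m - 2)).
Definition reg_G (s : R) : R := (1 + e * s) * f (reg_u s).
Definition reg_q (s : R) : R := f1 (reg_u s) + e * (f (reg_u s) - reg_u s * f1 (reg_u s)).
Definition reg_dq (s : R) : R := (1 + e * s)^-1 ^+ 3 * f2 (reg_u s).

Let den (s : R) : 0 <= s -> 0 < 1 + e * s.
Proof. by move=> s0; rewrite ltr_pwDl// mulr_ge0// ltW. Qed.

Let u_ge0 (s : R) : 0 <= s -> 0 <= reg_u s.
Proof. by move=> s0; rewrite divr_ge0// ltW// den. Qed.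

Let ue_gt0 (s : R) : 0 <= s -> 0 < reg_u s + e.
Proof. by move=> s0; rewrite ltr_wpDl// u_ge0. Qed.

Let u_le (s : R) : 0 <= s -> reg_u s <= s.
Proof.
by move=> s0; rewrite ler_pdivrMr ?den// mulrDr mulr1 lerDl !mulr_ge0// ltW.
Qed.

Let u_bound (s : R) : 0 <= s -> reg_u s <= e^-1.
Proof.
move=> s0; rewrite ler_pdivrMr ?den// mulrDr mulr1 mulrA mulVf ?gt_eqF// mul1r.
by rewrite lerDr invr_ge0 ltW.
Qed.

Let der_u (s : R) : 0 <= s -> is_derive s (1 : R) reg_u ((1 + e * s)^-1 ^+ 2).
Proof.
move=> s0; have d0 := lt0r_neq0 (den s0).
have h1 : is_derive s (1 : R) (fun s : R => 1 + e * s) e.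
  have h := is_deriveD (is_derive_cst (1 : R) s (1 : R)) (is_deriveZ e (is_derive_id s (1 : R))).
  by apply: (is_derive_eq h); rewrite add0r /GRing.scale/= mulr1.
have h2 : is_derive s (1 : R) (fun s : R => (1 + e * s)^-1) (- (1 + e * s) ^- 2 *: e).
  exact: is_deriveV.
have h := is_deriveM (is_derive_id s (1 : R)) h2.
by apply: (is_derive_eq h); rewrite /GRing.scale/=; field.
Qed.

Let der_pow (r u : R) : 0 < u + e -> is_derive u (1 : R) (fun u => (u + e) `^ r) (r * (u + e) `^ (r - 1)).
Proof.
move=> ue; have h1 : is_derive u (1 : R) (fun u : R => u + e) 1.
  have h := is_deriveD (is_derive_id u (1 : R)) (is_derive_cst e u (1 : R)).
  by apply: (is_derive_eq h); rewrite addr0.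
have h := is_derive_comp1 (f := fun u : R => u + e) (is_derive1_powR r ue) h1.
by apply: (is_derive_eq h); rewrite mulr1.
Qed.

Let der_f (u : R) : 0 < u + e -> is_derive u (1 : R) f (f1 u).
Proof.
move=> ue; have h1 := is_deriveB (der_pow m ue) (is_derive_cst (e `^ m) u (1 : R)).
have h := is_deriveB h1 (is_deriveZ (m * e `^ (m - 1)) (is_derive_id u (1 : R))).
by apply: (is_derive_eq h); rewrite /f1 /GRing.scale/= subr0 mulr1.
Qed.

Let der_f1 (u : R) : 0 < u + e -> is_derive u (1 : R) f1 (f2 u).
Proof.
move=> ue; have h1 := is_deriveZ m (der_pow (m - 1) ue).
have h := is_deriveB h1 (is_derive_cst (m * e `^ (m - 1)) u (1 : R)).
apply: (is_derive_eq h); rewrite /f2 /GRing.scale/= subr0.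
by rewrite -addrA -opprD.
Qed.

Lemma reg_G_der (s : R) : 0 <= s -> is_derive s (1 : R) reg_G (reg_q s).
Proof.
move=> s0; have d0 := lt0r_neq0 (den s0).
have h1 : is_derive s (1 : R) (fun s : R => 1 + e * s) e.
  have h := is_deriveD (is_derive_cst (1 : R) s (1 : R)) (is_deriveZ e (is_derive_id s (1 : R))).
  by apply: (is_derive_eq h); rewrite add0r /GRing.scale/= mulr1.
have h2 := is_derive_comp1 (der_f (ue_gt0 s0)) (der_u s0).
have h := is_deriveM h1 h2.
apply: (is_derive_eq h); rewrite /reg_q /GRing.scale/= /reg_u.
set F1 := f1 _; set F := f _; by field.
Qed.

Lemma reg_q_der (s : R) : 0 <= s -> is_derive s (1 : R) reg_q (reg_dq s).
Proof.
move=> s0; have d0 := lt0r_neq0 (den s0).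
have hu := der_u s0; have h1 := is_derive_comp1 (der_f1 (ue_gt0 s0)) hu.
have h0 := is_derive_comp1 (der_f (ue_gt0 s0)) hu.
have h := is_deriveD h1 (is_deriveZ e (is_deriveB h0 (is_deriveM hu h1))).
apply: (is_derive_eq h); rewrite /reg_dq /GRing.scale/= /reg_u.
set F2 := f2 _; set F1 := f1 _; by field.
Qed.

Let cu (s : R) : 0 <= s -> {for s, continuous reg_u}.
Proof.
by move=> s0; apply: differentiable_continuous; apply/derivable1_diffP; have [] := der_u s0.
Qed.

Lemma reg_dq_cont (s : R) : 0 <= s -> {for s, continuous reg_dq}.
Proof.
move=> s0; have d0 := lt0r_neq0 (den s0).
have c1 : {for s, continuous (fun s : R => 1 + e * s)}.
  by apply: cvgD; [exact: cvg_cst|apply: cvgM; [exact: cvg_cst|exact: cvg_id]].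
have c2 : {for s, continuous (fun s : R => (1 + e * s)^-1)} by apply: cvgV.
have c3 : {for reg_u s, continuous (fun u : R => (u + e) `^ (m - 2))}.
  by apply: differentiable_continuous; apply/derivable1_diffP; have [] := der_pow (m - 2) (ue_gt0 s0).
apply: cvgM.
  have -> : (fun s : R => (1 + e * s)^-1 ^+ 3) = (fun s : R => (1 + e * s)^-1 * ((1 + e * s)^-1 * (1 + e * s)^-1)).
    by apply/funext => x; rewrite !exprS expr0 mulr1.
  by rewrite !exprS expr0 mulr1; apply: cvgM => //; apply: cvgM.
apply: cvgM; first exact: cvg_cst.
apply: cvgM; first exact: cvg_cst.
exact: (cvg_comp reg_u (fun u : R => (u + e) `^ (m - 2)) (@cu s s0) c3).
Qed.

Let pow_mono (r x y : R) : 0 <= r -> 0 <= x -> x <= y -> x `^ r <= y `^ r.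
Proof. by move=> r0 x0 xy; apply: ge0_ler_powR => //; rewrite nnegrE// (le_trans x0). Qed.

Let f1_ge0 (u : R) : 0 <= u -> 0 <= f1 u.
Proof.
move=> u0; rewrite subr_ge0 ler_wpM2l ?(ltW m0)//.
by apply: pow_mono; [exact: ltW|exact: ltW|rewrite lerDr].
Qed.

Let f1_mono (u w : R) : 0 <= u -> u <= w -> f1 u <= f1 w.
Proof.
move=> u0 uw; rewrite lerD2r ler_wpM2l ?(ltW m0)//.
by apply: pow_mono; [exact: ltW|exact: (addr_ge0 _ (ltW e0))|rewrite lerD2r].
Qed.

Let f0 : f 0 = 0. Proof. by rewrite /f add0r subrr mulr0 subr0. Qed.

Let f_mvt (u : R) : 0 <= u -> exists2 c, 0 <= c <= u & f u = f1 c * u.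
Proof.
rewrite le_eqVlt => /orP[/eqP <-|u0]; first by exists 0; rewrite ?lexx// mulr0 f0.
have dd x : x \in `]0, u[ -> is_derive x (1 : R) f (f1 x).
  by rewrite in_itv/= => /andP[x0 _]; apply: der_f; rewrite addr_gt0.
have cf : {within `[0, u], continuous f}.
  apply: derivable_within_continuous => x; rewrite in_itv/= => /andP[x0 _].
  by have [] := @der_f x (ltr_wpDl x0 e0).
have [c] := MVT u0 dd cf; rewrite in_itv/= f0 !subr0 => /andP[c0 cu'] ->.
by exists c => //; rewrite !ltW.
Qed.

Let f_ge0 (u : R) : 0 <= u -> 0 <= f u.
Proof.
by move=> u0; have [c /andP[c0 _] ->] := f_mvt u0; rewrite mulr_ge0// f1_ge0.
Qed.

Let f_le (u : R) : 0 <= u -> f u <= u * f1 u.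
Proof.
by move=> u0; have [c /andP[c0 cu'] ->] := f_mvt u0; rewrite mulrC ler_wpM2l// f1_mono.
Qed.

(** Bounds [f1] on [[0, 1 / e]], an interval containing all values of [reg_u] on the half-line. *)
Let B := m * (e^-1 + e) `^ (m - 1).

Let f1_le (u : R) : 0 <= u -> u <= e^-1 -> f1 u <= B.
Proof.
move=> u0 ue; rewrite lerBlDr; apply: (@le_trans _ _ B).
  rewrite ler_wpM2l ?(ltW m0)//.
  by apply: pow_mono; [exact: ltW|exact: (addr_ge0 _ (ltW e0))|rewrite lerD2r].
by rewrite lerDl mulr_ge0 ?powR_ge0// ltW.
Qed.

Lemma reg_G_ge0 (s : R) : 0 <= s -> 0 <= reg_G s.
Proof. by move=> s0; rewrite mulr_ge0 ?f_ge0 ?u_ge0// ltW// den. Qed.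

Let G_le_f1 (s : R) : 0 <= s -> reg_G s <= s * f1 (reg_u s).
Proof.
move=> s0; have d0 := lt0r_neq0 (den s0).
apply: (@le_trans _ _ ((1 + e * s) * (reg_u s * f1 (reg_u s)))).
  by rewrite ler_wpM2l ?(ltW (den s0))// f_le// u_ge0.
by rewrite mulrA /reg_u mulrCA divff// mulr1.
Qed.

Lemma reg_G_le (s : R) : 0 <= s -> reg_G s <= B * s.
Proof.
move=> s0; apply: (le_trans (G_le_f1 s0)); rewrite mulrC ler_wpM2r//.
by rewrite f1_le ?u_ge0 ?u_bound.
Qed.

(** Writing [q = (1 - e u) f1 u + e f u] with [e u <= 1] shows that [q] is nonnegative, and
    [f u <= u f1 u] that it is at most [f1 u]. *)
Lemma reg_q_le (s : R) : 0 <= s -> `|reg_q s| <= B.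
Proof.
move=> s0; have u0 := u_ge0 s0; have F1 := f1_ge0 u0; have F0 := f_ge0 u0; have Fl := f_le u0.
have eu : e * reg_u s <= 1.
  by rewrite mulrC -ler_pdivlMr// div1r u_bound.
have q0 : 0 <= reg_q s.
  have -> : reg_q s = (1 - e * reg_u s) * f1 (reg_u s) + e * f (reg_u s) by rewrite /reg_q; ring.
  by rewrite addr_ge0// mulr_ge0// ?subr_ge0// ltW.
rewrite ger0_norm//; apply: (le_trans _ (f1_le u0 (u_bound s0))).
by rewrite /reg_q gerDl pmulr_rle0// subr_le0.
Qed.

Lemma reg_dq_ge0 (s : R) : 0 <= s -> 0 <= reg_dq s.
Proof.
move=> s0; have d0 := ltW (den s0).
by rewrite mulr_ge0 ?exprn_ge0 ?invr_ge0// mulr_ge0 ?(ltW m0)// mulr_ge0 ?powR_ge0// ltW.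
Qed.

(** Up to a factor at most 1 the left side is [u f2 u], and [u (u + e)^(m-2) <= (u + e)^(m-1)]
    removes the power that is negative for [m < 2]. *)
Lemma reg_dq_le (s : R) : 0 <= s -> s * reg_dq s <= (m - 1) * B.
Proof.
move=> s0; have d0 := den s0; have u0 := u_ge0 s0.
have i0 : 0 <= (1 + e * s)^-1 <= 1.
  by rewrite invr_ge0 ltW//= invf_le1// lerDl mulr_ge0// ltW.
have f20 : 0 <= f2 (reg_u s) by rewrite !mulr_ge0 ?powR_ge0// ltW.
apply: (@le_trans _ _ (reg_u s * f2 (reg_u s))).
  have -> : s * reg_dq s = (1 + e * s)^-1 ^+ 2 * (reg_u s * f2 (reg_u s)) by rewrite /reg_dq /reg_u; ring.
  case/andP: i0 => i0 i1; apply: ler_piMl; first exact: (mulr_ge0 u0 f20).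
  exact: exprn_ile1.
have -> : reg_u s * f2 (reg_u s) = (m - 1) * (m * (reg_u s * (reg_u s + e) `^ (m - 2))) by rewrite /f2; ring.
rewrite ler_wpM2l ?(ltW mm1)// ler_wpM2l ?(ltW m0)//.
apply: (@le_trans _ _ ((reg_u s + e) * (reg_u s + e) `^ (m - 2))).
  by rewrite ler_wpM2r ?powR_ge0// lerDl ltW.
have -> : (reg_u s + e) * (reg_u s + e) `^ (m - 2) = (reg_u s + e) `^ (m - 1).
  have -> : m - 2 = m - 1 - 1 by ring.
  by rewrite mulr_powRB1 ?(ltW (ue_gt0 s0)).
by apply: pow_mono; [exact: ltW|exact: (ltW (ue_gt0 s0))|rewrite lerD2r u_bound].
Qed.

Lemma reg_PE (s : R) : 0 <= s -> s * reg_q s - reg_G s = reg_u s * f1 (reg_u s) - f (reg_u s).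
Proof.
move=> s0; have d0 := lt0r_neq0 (den s0); rewrite /reg_q /reg_G /reg_u.
by set F1 := f1 _; set F := f _; field.
Qed.

Lemma reg_P_ge0 (s : R) : 0 <= s -> 0 <= s * reg_q s - reg_G s.
Proof. by move=> s0; rewrite reg_PE// subr_ge0 f_le// u_ge0. Qed.

(** The defect due to the linear term of [f]: it contributes 0 to [u f' u - f u] but
    [- m (m - 1) e^(m-1) u] to [(m - 1) f u]. *)
Definition reg_eps : R := m * (m - 1) * e `^ (m - 1).

Lemma reg_eps_ge0 : 0 <= reg_eps.
Proof. by rewrite !mulr_ge0 ?powR_ge0// ltW. Qed.

(** In terms of [u] the difference of the two sides is [m e ((u + e)^(m-1) - e^(m-1)) >= 0]; then
    [u <= s] and [f u <= G s] are used. *)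
Lemma reg_P_le (s : R) : 0 <= s -> s * reg_q s - reg_G s <= (m - 1) * reg_G s + reg_eps * s.
Proof.
move=> s0; have u0 := u_ge0 s0; have ue := ue_gt0 s0; rewrite reg_PE//.
apply: (@le_trans _ _ ((m - 1) * f (reg_u s) + reg_eps * reg_u s)); last first.
  apply: lerD; last by rewrite ler_wpM2l ?reg_eps_ge0// u_le.
  rewrite ler_wpM2l ?(ltW mm1)// /reg_G ler_peMl ?f_ge0//.
  by rewrite lerDl mulr_ge0// ltW.
set u := reg_u s in u0 ue *.
have p1 : (u + e) `^ m = (u + e) * (u + e) `^ (m - 1).
  by rewrite mulr_powRB1 ?(ltW ue).
have p2 : e `^ m = e * e `^ (m - 1).
  by rewrite mulr_powRB1 ?(ltW e0).
have mono : e `^ (m - 1) <= (u + e) `^ (m - 1) by apply: pow_mono; [exact: ltW|exact: ltW|rewrite lerDr].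
rewrite -subr_ge0 /f /f1 /reg_eps p1 p2.
set x := (u + e) `^ (m - 1) in mono *; set y := e `^ (m - 1) in mono *.
have -> : (m - 1) * ((u + e) * x - e * y - m * y * u) + m * (m - 1) * y * u
   - (u * (m * x - m * y) - ((u + e) * x - e * y - m * y * u)) = m * e * (x - y) by ring.
by rewrite !mulr_ge0 ?subr_ge0// ltW.
Qed.

Lemma reg_q_mono (x y : R) : 0 <= x -> x <= y -> reg_q x <= reg_q y.
Proof.
move=> x0; rewrite le_eqVlt => /orP[/eqP <-//|xy].
have dd z : z \in `]x, y[ -> is_derive z (1 : R) reg_q (reg_dq z).
  by rewrite in_itv/= => /andP[xz _]; apply: reg_q_der; rewrite ltW// (le_lt_trans x0).
have cq : {within `[x, y], continuous reg_q}.
  apply: derivable_within_continuous => z; rewrite in_itv/= => /andP[xz _].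
  by have [] := reg_q_der (le_trans x0 xz).
have [c] := MVT xy dd cq; rewrite in_itv/= => /andP[xc _] h.
rewrite -subr_ge0 h mulr_ge0 ?subr_ge0 ?(ltW xy)// reg_dq_ge0//.
by rewrite ltW// (le_lt_trans x0).
Qed.

Lemma reg_G_convex (x y : R) : 0 <= x -> 0 <= y -> reg_G x - reg_G y <= reg_q x * (x - y).
Proof.
have mvt (a b : R) : 0 <= a -> a < b -> exists2 c, a < c < b & reg_G b - reg_G a = reg_q c * (b - a).
  move=> a0 ab.
  have dd z : z \in `]a, b[ -> is_derive z (1 : R) reg_G (reg_q z).
    by rewrite in_itv/= => /andP[xz _]; apply: reg_G_der; rewrite ltW// (le_lt_trans a0).
  have cq : {within `[a, b], continuous reg_G}.
    apply: derivable_within_continuous => z; rewrite in_itv/= => /andP[xz _].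
    by have [] := reg_G_der (le_trans a0 xz).
  by have [c] := MVT ab dd cq; rewrite in_itv/= => h1 h2; exists c.
move=> x0 y0; have [xy|xy|->] := ltgtP x y; last by rewrite !subrr mulr0.
- have [c /andP[xc cy] h] := mvt x y x0 xy.
  rewrite -opprB h -mulrN opprB -[leRHS]opprK -mulrN opprB -lerN2 opprK -mulrN opprB.
  by rewrite ler_wpM2r ?subr_ge0 ?(ltW xy)// reg_q_mono// ltW.
- have [c /andP[yc cx] ->] := mvt y x y0 xy.
  rewrite ler_wpM2r ?subr_ge0 ?(ltW xy)// reg_q_mono// ?ltW//.
  exact: le_lt_trans y0 yc.
Qed.

(** Uniform in [e <= 1], so this dominates the regularized integrals at time 0. The factor 2 bounds
    [s + 1] by 2 if [s <= 1] and by [2 s] otherwise. *)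
Lemma reg_G_le_pow (s : R) : e <= 1 -> 0 <= s ->
  reg_G s <= m * 2 `^ (m - 1) * (s + s `^ m).
Proof.
move=> e1 s0; apply: (le_trans (G_le_f1 s0)).
have h1 : f1 (reg_u s) <= m * (s + 1) `^ (m - 1).
  rewrite lerBlDr; apply: (@le_trans _ _ (m * (s + 1) `^ (m - 1))).
    rewrite ler_wpM2l ?(ltW m0)//; apply: pow_mono; rewrite ?(ltW mm1) ?(ltW (ue_gt0 s0))//.
    by rewrite lerD// u_le.
  by rewrite lerDl mulr_ge0 ?powR_ge0// ltW.
apply: (le_trans (ler_wpM2l s0 h1)); rewrite mulrCA -mulrA ler_wpM2l ?(ltW m0)//.
have [s1|s1] := leP s 1.
  apply: (@le_trans _ _ (s * 2 `^ (m - 1))).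
    rewrite ler_wpM2l//; apply: pow_mono; rewrite ?(ltW mm1) ?addr_ge0//.
    by rewrite -natr1 lerD2r.
  by rewrite mulrC ler_wpM2l ?powR_ge0// lerDl powR_ge0.
apply: (@le_trans _ _ (s * (2 * s) `^ (m - 1))).
  rewrite ler_wpM2l//; apply: pow_mono; rewrite ?(ltW mm1) ?addr_ge0//.
  by rewrite mulr_natl mulr2n lerD2l ltW.
rewrite powRM// mulrCA ler_wpM2l ?powR_ge0//.
by rewrite mulr_powRB1// lerDr.
Qed.

End regularized_power.

Lemma reg_G_cvg {R : realType} (m : R) (s : R) : 1 < m -> 0 <= s ->
  reg_G m (n.+1%:R^-1 : R) s @[n --> \oo] --> s `^ m.
Proof.
move=> m1 s0; have m0 := lt_trans ltr01 m1; have mm1 : 0 < m - 1 by rewrite subr_gt0.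
pose e (n : nat) : R := n.+1%:R^-1.
have e0 n : 0 < e n by rewrite invr_gt0.
have elim : e n @[n --> \oo] --> (0 : R) by exact: cvg_harmonic.
have d1 : 1 + e n * s @[n --> \oo] --> (1 : R).
  by rewrite -[X in _ --> X]addr0 -[X in 1 + X](mul0r s); apply: cvgD; [exact: cvg_cst|apply: cvgM; [|exact: cvg_cst]].
have d2 : reg_u (e n) s @[n --> \oo] --> s.
  rewrite -[X in _ --> X]divr1; apply: cvgM; first exact: cvg_cst.
  by apply: cvgV => //; rewrite oner_eq0.
have d3 : reg_u (e n) s + e n @[n --> \oo] --> s.
  by rewrite -[X in _ --> X]addr0; apply: cvgD.
have pE n r : 0 <= n -> n `^ r = ppow r n :> R by move=> n0; rewrite ppowE.
have cp (r : R) (u : nat -> R) (l : R) : 0 < r -> (forall n, 0 <= u n) -> 0 <= l -> u n @[n --> \oo] --> l ->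
    u n `^ r @[n --> \oo] --> l `^ r.
  move=> r0 u0 l0 ul; have c : {for l, continuous (ppow r)} by exact: continuous_ppow.
  have h : ppow r (u n) @[n --> \oo] --> ppow r l by exact: (continuous_cvg _ c ul).
  rewrite pE//; apply: cvg_trans h; apply: near_eq_cvg; apply: nearW => n.
  by rewrite pE.
have u0 n : 0 <= reg_u (e n) s + e n.
  by rewrite addr_ge0 ?(ltW (e0 n))// divr_ge0// addr_ge0// mulr_ge0// ltW.
have L1 := cp m _ _ m0 u0 s0 d3.
have L2 := cp m _ _ m0 (fun n => ltW (e0 n)) (lexx 0) elim.
have L3 := cp (m - 1) _ _ mm1 (fun n => ltW (e0 n)) (lexx 0) elim.
rewrite powR0 ?gt_eqF// in L2; rewrite powR0 ?gt_eqF// in L3.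
rewrite -[X in _ --> X]mul1r -[X in 1 * X]subr0 -[X in 1 * X]subr0 /reg_G.
apply: cvgM; first exact: d1.
apply: cvgB; first by apply: cvgB.
by rewrite -(mul0r s); apply: cvgM => //; rewrite -(mulr0 m); apply: cvgM => //; exact: cvg_cst.
Qed.

Lemma reg_eps_cvg {R : realType} (m : R) : 1 < m ->
  reg_eps m (n.+1%:R^-1 : R) @[n --> \oo] --> (0 : R).
Proof.
move=> m1; have mm1 : 0 < m - 1 by rewrite subr_gt0.
have e0 n : 0 <= n.+1%:R^-1 :> R by rewrite invr_ge0.
have c : {for (0 : R), continuous (ppow (m - 1))} by exact: continuous_ppow.
have h : ppow (m - 1) (n.+1%:R^-1 : R) @[n --> \oo] --> ppow (m - 1) (0 : R).
  exact: (continuous_cvg _ c (@cvg_harmonic R)).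
rewrite ppow_le0// in h; rewrite -(mulr0 (m * (m - 1))).
apply: cvgM; first exact: cvg_cst.
by apply: cvg_trans h; apply: near_eq_cvg; apply: nearW => n; rewrite ppowE.
Qed.

(** * The Gaussian integral on R^d *)

Lemma enorm_sqr {R : realType} {d : nat} (y : 'rV[R]_d) : enorm y ^+ 2 = dot y y.
Proof. by rewrite sqr_sqrtr// sumr_ge0// => i _; rewrite -expr2 sqr_ge0. Qed.

Lemma measurable_dot_self {R : realType} {d : nat} : measurable_fun setT (fun y : 'rV[R]_d => dot y y).
Proof.
by apply: measurable_sum => i; apply: measurable_funM; exact: measurable_coord.
Qed.

Lemma integral_gauss_rV_lty {R : realType} d :
  (\int[lebesgue_rV d]_y (expR (- dot (y : 'rV[R]_d) y))%:E < +oo)%E.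
Proof.
have mg k : measurable_fun setT (fun y : 'rV[R]_k => (expR (- dot y y))%:E).
  apply/measurable_EFinP; apply: measurableT_comp => //.
  by apply: measurableT_comp => //; exact: measurable_dot_self.
elim: d => [|d IH].
  have -> : (\int[lebesgue_rV 0]_(y in setT) (expR (- dot (y : 'rV[R]_0) y))%:E)%E = (\d_((0%R : 'rV[R]_0)) setT * (expR (- dot (0%R : 'rV[R]_0) 0%R))%:E)%E by exact: (integral_dirac _ measurableT (mg 0%N)).
  by rewrite diracE mem_set// mul1e ltry.
rewrite integral_lebesgue_rVS//.
have E (a : R) (x : 'rV[R]_d) : expR (- dot (rVcons (a, x)) (rVcons (a, x))) = gauss_fun a * expR (- dot x x).
  rewrite /gauss_fun -expRD; congr expR; rewrite /dot big_ord_recl opprD !mxE unlift_none -expr2; congr (_ - _).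
  by apply: eq_bigr => i _; rewrite !mxE liftK.
set I := (\int[lebesgue_rV d]_x _)%E in IH.
have I0 : (0 <= I)%E by apply: integral_ge0 => x _; rewrite lee_fin expR_ge0.
have -> : (\int[lebesgue_measure]_a \int[lebesgue_rV d]_x (expR (- dot (rVcons (a, x)) (rVcons (a, x))))%:E
   = \int[lebesgue_measure]_a ((gauss_fun a)%:E * I))%E.
  apply: eq_integral => a _; rewrite -(ge0_integralZl (lebesgue_rV d) measurableT (mg d)).
  - by apply: eq_integral => x _; rewrite E EFinM.
  - by move=> x _; rewrite lee_fin expR_ge0.
  - by rewrite lee_fin gauss_fun_ge0.
have /integrableP[mG] := @integrableT_gauss R.
under eq_integral do rewrite gee0_abs ?lee_fin ?gauss_fun_ge0//.
move=> fG; rewrite ge0_integralZr//; last by move=> x _; rewrite lee_fin gauss_fun_ge0.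
rewrite lte_mul_pinfty//.
  by apply: integral_ge0 => x _; rewrite lee_fin gauss_fun_ge0.
by rewrite ge0_fin_numE//; apply: integral_ge0 => x _; rewrite lee_fin gauss_fun_ge0.
Qed.

(** * Energy and L^m norm *)

Section energy_bound.
Context {R : realType} {d : nat}.
Local Notation V := 'rV[R]_d.
Local Notation leb := (lebesgue_rV d : {measure set V -> \bar R}).

(* For [s > 0], [- s ln s - s a = s z] with [z = - (ln s + a)], and [z <= exp z]. *)
Lemma neg_entropy_le (s a : R) : 0 <= s -> - (s * ln s) <= s * a + expR (- a).
Proof.
rewrite le_eqVlt => /orP[/eqP <-|s0].
  by rewrite !mul0r oppr0 add0r expR_ge0.
rewrite -lerBlDl -mulrN -mulrBr -opprD.
have h : - (ln s + a) <= expR (- (ln s + a)).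
  by apply: le_trans (expR_ge1Dx _); rewrite lerDr.
apply: (le_trans (ler_wpM2l (ltW s0) h)).
by rewrite opprD expRD mulrA -{1}(lnK s0) -expRD subrr expR0 mul1r.
Qed.

Lemma energy_integral_powR_lty (lam eta m : R) (Psi : V -> R) (rho : @density R d) :
  0 < lam -> 0 < eta -> 1 < m -> (forall y, 0 <= Psi y) -> D2 rho ->
  (energy lam eta m Psi rho < +oo)%E -> (\int[leb]_y (rho y `^ m)%:E < +oo)%E.
Proof.
move=> lam0 eta0 m1 Psi0 rho2; rewrite /energy.
have mr := measurable_density rho; have r0 := density_ge0 rho.
have mH : measurable_fun setT (H lam \o rho).
  apply: measurable_funM; first exact: measurable_funM.
  exact: (measurableT_comp (@measurable_ln R)).
set E1 := (\int[leb]_y (Psi y * rho y)%:E)%E.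
have E10 : (0 <= E1)%E by apply: integral_ge0 => y _; rewrite lee_fin mulr_ge0.
set E2 := (\int[leb]_y ((H lam \o rho)^\+ y)%:E)%E.
have E20 : (0 <= E2)%E by apply: integral_ge0 => y _; rewrite lee_fin le_max lexx orbT.
set E3 := (\int[leb]_y ((H lam \o rho)^\- y)%:E)%E.
have E30 : (0 <= E3)%E by apply: integral_ge0 => y _; rewrite lee_fin le_max lexx orbT.
have E3oo : (E3 < +oo)%E.
  have mg : measurable_fun setT (fun y : V => (expR (- dot y y))).
    by apply: measurableT_comp => //; apply: measurableT_comp => //; exact: measurable_dot_self.
  have m2 : measurable_fun setT (fun y : V => enorm y ^+ 2 * rho y).
    apply: measurable_funM => //; under eq_fun do rewrite enorm_sqr.
    exact: measurable_dot_self.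
  apply: (@le_lt_trans _ _ (\int[leb]_y (lam%:E * ((enorm y ^+ 2 * rho y)%:E + (expR (- dot y y))%:E)))%E).
    apply: ge0_le_integral => //.
    - by move=> y _; rewrite lee_fin le_max lexx orbT.
    - by apply/measurable_EFinP; exact: measurable_funrneg.
    - by apply/measurable_EFinP; apply: measurable_funM => //; apply: measurable_funD.
    move=> y _; rewrite -EFinD -EFinM lee_fin ge_max; apply/andP; split.
      rewrite /= /H -mulrA -mulrN ler_wpM2l ?(ltW lam0)//.
      by rewrite enorm_sqr [X in _ <= X + _]mulrC neg_entropy_le.
    by rewrite mulr_ge0 ?(ltW lam0)// addr_ge0 ?expR_ge0// mulr_ge0// sqr_ge0.
  rewrite ge0_integralZl//; last 3 first.
  - by apply/measurable_EFinP; apply: measurable_funD.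
  - by move=> y _; rewrite adde_ge0// lee_fin ?expR_ge0// mulr_ge0// sqr_ge0.
  - by rewrite lee_fin ltW.
  have e0 (y : V) : [set: V] y -> (0 <= (enorm y ^+ 2 * rho y)%:E)%E.
    by rewrite lee_fin mulr_ge0// sqr_ge0.
  have g0 (y : V) : [set: V] y -> (0 <= (expR (- dot y y))%:E)%E by rewrite lee_fin expR_ge0.
  rewrite ge0_integralD//; [|exact/measurable_EFinP|exact/measurable_EFinP].
  rewrite lte_mul_pinfty ?lee_fin ?(ltW lam0)// lte_add_pinfty//.
  exact: integral_gauss_rV_lty.
have c0 : 0 < eta / (m - 1) by rewrite divr_gt0// subr_gt0.
have mp : measurable_fun setT (fun y => rho y `^ m).
  exact: (measurableT_comp (measurable_powR m)).
have -> : (\int[leb]_y (eta / (m - 1) * rho y `^ m)%:E = (eta / (m - 1))%:E * \int[leb]_y (rho y `^ m)%:E)%E.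
  rewrite -ge0_integralZl//; first exact/measurable_EFinP.
  - by move=> y _; rewrite lee_fin powR_ge0.
  - by rewrite lee_fin ltW.
set I := (\int[leb]_y (rho y `^ m)%:E)%E => Efin.
(* [E1] and [E2] are nonnegative and the subtracted [E3] is finite, so an infinite [I] would make
   the energy infinite. *)
rewrite ltey; apply/eqP => Ioo; move: Efin; rewrite Ioo gt0_muley ?lte_fin//.
rewrite addey ?ltxx// -ltNye.
have f3 : E3 \is a fin_num by rewrite ge0_fin_numE.
by rewrite -(fineK f3) -EFinN; apply: lt_le_trans (leeDr _ (adde_ge0 E10 E20)); rewrite ltNyr.
Qed.

End energy_bound.

(** * From the regularized powers to [rho^m] *)

Section power_inequality.
Context {R : realType} {d : nat}.
Local Notation V := 'rV[R]_d.
Local Notation leb := (lebesgue_rV d : {measure set V -> \bar R}).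
Local Notation lm := (@lebesgue_measure R).
Variables (rho : R -> @density R d) (v W : R -> 'I_d -> V -> R) (Dl : R -> V -> R).
Variables (Psi : V -> R) (lam : R).
Hypothesis mass_cont : forall (f : V -> R) (C : R), continuous f -> (forall y, `|f y| <= C) ->
  continuous (fun t : R => \int[leb]_y (rho (Num.max t 0) y * f y)).
Hypothesis mv : forall (t : R) i, 0 < t -> measurable_fun setT (v t i).
Local Notation window := (window rho v).
Local Notation flow := (flow rho v).
Local Notation mass := (mass rho).
Local Notation diss := (diss rho v).
Hypothesis mW : forall s t : R, measurable (window s t).
Hypothesis dissi : forall T : R, rint lm (window 0 T) diss.
Hypothesis flowi : forall (psi : V -> R) (c T : R), smooth psi -> csupp c psi ->
  rint lm (window 0 T) (flow psi).
Hypothesis mass_flow : forall (psi : V -> R) (c s t : R), smooth psi -> csupp c psi -> 0 <= s -> s <= t ->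
  mass psi t - mass psi s = \int[lm]_(r in window s t) flow psi r.
Hypothesis lam0 : 0 < lam.
Hypothesis WG : forall t : R, 0 < t -> is_weak_grad (rho t) (fun y => \row_i W t i y).
Hypothesis mDl : forall t : R, 0 < t -> measurable_fun setT (Dl t).
Hypothesis Dl_ge : forall t y, lam <= Dl t y.
Hypothesis fluxE : forall t : R, 0 < t -> {ae leb, forall y, forall i,
  rho t y * v t i y = - (rho t y * partial i Psi y + Dl t y * W t i y)}.
Hypothesis Psi2 : is_Ck 2 Psi.
Variables (Kg A m : R).
Hypothesis Kg0 : 0 <= Kg.
Hypothesis grow : forall i y, `|partial i Psi y| <= Kg * (1 + `|y|).
Hypothesis A0 : 0 <= A.
Hypothesis lap_le : {ae leb, forall y, laplacian Psi y <= A}.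
Hypothesis m1 : 1 < m.

Let mrho t : measurable_fun setT (fun y => rho t y `^ m).
Proof. exact: (measurableT_comp (measurable_powR m) (measurable_density (rho t))). Qed.

(** At time 0 the regularized integrals converge by domination, as [rho 0 ^ m] is integrable. At
    time [T] that integrability is part of the claim, and Fatou's lemma is used. *)
Lemma integral_powR_le (T : R) : 0 <= T -> rint leb setT (fun y => rho 0 y `^ m) ->
  (\int[leb]_y (rho T y `^ m)%:E <=
   ((\int[leb]_y (rho 0 y `^ m)) * expR (A * (m - 1) * T))%R%:E)%E.
Proof.
move=> T0 r0m; have mm1 : 0 <= m - 1 by rewrite subr_ge0 ltW.
pose e (n : nat) : R := n.+1%:R^-1.
have e0 n : 0 < e n by rewrite invr_gt0 ltr0n.
have e1 n : e n <= 1 by rewrite invf_le1 ?ltr0n// ler1n.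
have elim : e n @[n --> \oo] --> (0 : R) by exact: cvg_harmonic.
have [Cc Cc0 Cc_le] := @partial_cutoff_le R d.
have ineq n : Phi rho (reg_G m (e n)) T <=
    (Phi rho (reg_G m (e n)) 0 + A * reg_eps m (e n) * T) * expR (A * (m - 1) * T).
  exact: (energy_inequality mass_cont mv mW dissi flowi mass_flow lam0 WG mDl Dl_ge fluxE Psi2
    Kg0 grow A0 lap_le (reg_q_der m (e0 n)) (reg_G_der m (e0 n)) (fun s s0 => @reg_dq_cont _ m _ (e0 n) s s0)
    (reg_q_le m1 (e0 n)) (reg_dq_ge0 m1 (e0 n)) (reg_dq_le m1 (e0 n)) (reg_G_convex m1 (e0 n))
    (reg_G_ge0 m1 (e0 n)) (reg_G_le m1 (e0 n)) (reg_P_ge0 m1 (e0 n)) mm1 (reg_P_le m1 (e0 n))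
    (reg_eps_ge0 (e n) m1) Cc0 Cc_le T0).
have cG n (s : R) : 0 <= s -> {for s, continuous (reg_G m (e n))}.
  move=> s0; apply: differentiable_continuous; apply/derivable1_diffP.
  by have [] := reg_G_der m (e0 n) s0.
have mG t n : measurable_fun setT (fun y => reg_G m (e n) (rho t y)).
  apply: measurable_comp_ge0; [exact: cG|exact: measurable_density|exact: density_ge0].
have rG t y n : 0 <= reg_G m (e n) (rho t y) by rewrite reg_G_ge0// density_ge0.
have Glim t y : reg_G m (e n) (rho t y) @[n --> \oo] --> rho t y `^ m.
  exact: (reg_G_cvg m1 (density_ge0 (rho t) y)).
have Phi0lim : Phi rho (reg_G m (e n)) 0 @[n --> \oo] --> \int[leb]_y (rho 0 y `^ m).
  have hi : rint leb setT (fun y => m * 2 `^ (m - 1) * (rho 0 y + rho 0 y `^ m)).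
    by apply: rintZ => //; apply: rintD => //; exact: density_rint.
  have bd y : [set: V] y -> forall n, `|reg_G m (e n) (rho 0 y)| <= m * 2 `^ (m - 1) * (rho 0 y + rho 0 y `^ m).
    by move=> _ n; rewrite ger0_norm// reg_G_le_pow// density_ge0.
  have [_] := @Rintegral_dctT _ _ _ leb setT measurableT (fun n y => reg_G m (e n) (rho 0 y))
    (fun y => rho 0 y `^ m) _ (mG 0) (mrho 0) hi (fun y _ => Glim 0 y)
    bd; apply.
have Klim : (Phi rho (reg_G m (e n)) 0 + A * reg_eps m (e n) * T) * expR (A * (m - 1) * T)
    @[n --> \oo] --> (\int[leb]_y (rho 0 y `^ m)) * expR (A * (m - 1) * T).
  apply: cvgM; last exact: cvg_cst.
  rewrite -[X in _ --> X]addr0; apply: cvgD; first exact: Phi0lim.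
  have -> : (0 : R) = A * 0 * T by rewrite mulr0 mul0r.
  apply: cvgM; last exact: cvg_cst.
  by apply: cvgM; [exact: cvg_cst|exact: reg_eps_cvg].
apply/lee_addgt0Pr => z z0.
(* From the index [N] on the bound exceeds its limit by less than [z]; Fatou's lemma is applied to
   that tail of the sequence. *)
have [N _ HN] : \forall n \near \oo, (Phi rho (reg_G m (e n)) 0 + A * reg_eps m (e n) * T) * expR (A * (m - 1) * T)
    < (\int[leb]_y (rho 0 y `^ m)) * expR (A * (m - 1) * T) + z.
  by apply: (cvgr_lt _ Klim); rewrite ltrDl.
rewrite -EFinD; apply: (@fatou_le _ _ _ leb (fun n y => reg_G m (e (n + N)%N) (rho T y))) => //.
- by move=> y; exact: powR_ge0.
- apply: nearW => y.
  exact: (cvg_comp (fun n => (n + N)%N) (fun n => reg_G m (e n) (rho T y)) (@cvg_addnr N) (Glim T y)).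
- move=> n; rewrite -(rint_EFin measurableT (entropy_rint rho (reg_G_der m (e0 (n + N)%N)) (reg_G_ge0 m1 (e0 (n + N)%N)) (reg_G_le m1 (e0 (n + N)%N)) T)).
  by rewrite lee_fin; apply: (le_trans (ineq (n + N)%N)); apply/ltW/HN; rewrite /= leq_addl.
Qed.

End power_inequality.

(** * The equation tested with tensor products *)

Section fokker_planck_solution.
Context {R : realType} {d : nat}.
Local Notation V := 'rV[R]_d.
Local Notation leb := (lebesgue_rV d : {measure set V -> \bar R}).
Local Notation lm := (@lebesgue_measure R).
Local Notation Dpos := (`]0%R, +oo[%classic : set (measurableTypeR R)).
Variables (lam eta m : R) (Psi : V -> R).
Hypotheses (lam0 : 0 < lam) (eta0 : 0 < eta) (m1 : 1 < m) (Psi1 : is_Ck 1 Psi).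
Variables (rho0 : @density R d) (rho : R -> @density R d).
Hypothesis sol : FP_solution lam eta m Psi rho0 rho.
Let v (t : R) i y := velocity lam eta m Psi (rho t) y 0 i.

Lemma test_function_tensor (chi : R -> R) (psi : V -> R) (a b c : R) : smooth chi -> 0 < a ->
  (forall r, r < a -> chi r = 0) -> (forall r, b < r -> chi r = 0) ->
  smooth psi -> csupp c psi ->
  test_function [set p : R * V | 0 < p.1] (fun p : R * V => chi p.1 * psi p.2).
Proof.
move=> sc a0 ca cb sp cp; split.
  move=> k; apply: is_CkM.
  - by apply: (is_Ck_affine (g := chi) (L := fst) (M := fst)) => // x; exact: cvg_fst.
  - by apply: (is_Ck_affine (g := psi) (L := snd) (M := snd)) => // x; exact: cvg_snd.
exists (`[a, b]%classic `*` [set y : V | `|y| <= c]); split.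
- by apply: compact_setX; [exact: segment_compact|exact: closed_ball_rV_compact].
- by move=> [t y] [/=]; rewrite in_itv/= => /andP[ta _] _; exact: lt_le_trans a0 ta.
move=> [t y] nK /=; have [ta|ta] := ltP t a; first by rewrite ca// mul0r.
have [tb|tb] := ltP b t; first by rewrite cb// mul0r.
have [cy|cy] := ltP c `|y|; first by rewrite cp// mulr0.
by exfalso; apply: nK; split => //=; rewrite in_itv/= ta tb.
Qed.

(** The definition of solution writes the flux as [rho grad Psi] plus the gradient of [LF (rho)]; at
    every positive time [velocity_flux] identifies it with [- rho v] almost everywhere in space. *)
Lemma weak_equation_tensor (chi : R -> R) (a b : R) : smooth chi -> 0 < a ->
  (forall r, r < a -> chi r = 0) -> (forall r, b < r -> chi r = 0) ->
  forall (psi : V -> R) c, smooth psi -> csupp c psi ->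
  (\int[lm]_(r in Dpos) ('D_(1 : R) chi r * mass rho psi r + chi r * flow rho v psi r)%:E = 0)%E.
Proof.
move=> sc a0 ca cb psi c sp cp; have [_ _ rhoW weq] := sol.
rewrite -[RHS](weq _ (test_function_tensor sc a0 ca cb sp cp)).
apply: eq_integral => t; rewrite inE/= in_itv/= andbT => t0.
have dt y : (fun s : R => chi s * psi y)^`()%classic t = 'D_(1 : R) chi t * psi y.
  rewrite derive1E.
  have [_ ->] : is_derive t (1 : R) (fun s : R => chi s * psi y) ('D_(1 : R) chi t * psi y) => //.
  have h := is_deriveM (derivableP (smooth_derivable (x := t : R) (v := (1 : R)) sc)) (is_derive_cst (psi y) t (1 : R)).
  by apply: (is_derive_eq h); rewrite /GRing.scale/= mulr0 add0r mulrC.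
have dy y i : partial i (fun z => chi t * psi z) y = chi t * partial i psi y.
  have h := is_deriveZ (chi t) (derivableP (smooth_derivable (x := y) (v := delta_mx 0 i) sp)).
  by have [_ hE] := h; exact: hE.
pose w := weak_grad (LF lam eta m \o rho t).
pose O y := rho t y * ('D_(1 : R) chi t * psi y)
  - \sum_i (rho t y * partial i Psi y + w y 0 i) * (chi t * partial i psi y).
have -> : (fun y => (rho t y * (fun s : R => chi s * psi y)^`()%classic t
    - dot (rho t y *: grad Psi y + weak_grad (LF lam eta m \o rho t) y)
      (grad (fun z => chi t * psi z) y))%:E) = (fun y => (O y)%:E).
  apply/funext => y; rewrite dt /O; congr (_ - _)%:E; apply: eq_bigr => i _.
  by rewrite !mxE dy.
pose f i y := rho t y * v t i y * partial i psi y.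
have csp := smooth_continuous sp.
have csd i : continuous (partial i psi) by exact: (smooth_continuous (smooth_derive (delta_mx 0 i) sp)).
have r1 : rint leb setT (fun y => rho t y * psi y).
  exact: (rint_mul_csupp (rint_L1loc (density_rint rho t)) csp cp).
have r2 i : rint leb setT (f i).
  exact: (rint_mul_csupp (flux_L1loc lam0 eta0 m1 Psi1 rhoW t0 i) (@csd i) (csupp_derive _ cp)).
pose F y := 'D_(1 : R) chi t * (rho t y * psi y) + chi t * \sum_i f i y.
have r2s : rint leb setT (fun y => \sum_i f i y) by exact: rint_sum.
have rz1 := rintZ measurableT ('D_(1 : R) chi t) r1.
have rz2 := rintZ measurableT (chi t) r2s.
have rF : rint leb setT F by exact: (rintD measurableT rz1 rz2).
transitivity (\int[leb]_y (F y)%:E)%E.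
  rewrite -(rint_EFin measurableT rF) /F (RintegralD measurableT rz1 rz2).
  rewrite (RintegralZl _ measurableT r1) (RintegralZl _ measurableT r2s) (Rintegral_sum measurableT)//.
  by rewrite /mass max_l ?(ltW t0).
have mrho : measurable_fun setT (rho t) by exact: measurable_density.
have [_ mw _] := is_weak_grad_weak_grad (rhoW t t0).
have cP i : continuous (partial i Psi) by have [_ /(_ (delta_mx 0 i))[_ []]] := Psi1.
apply: ae_eq_integral => //.
- by apply/measurable_EFinP; exact: rint_meas rF.
- apply/measurable_EFinP; apply: measurable_funB.
    apply: measurable_funM => //; apply: measurable_funM => //; exact: continuous_measurable_rV.
  apply: measurable_sum => i; apply: measurable_funM.
    apply: measurable_funD; last by case: (mw i).
    by apply: measurable_funM => //; exact: continuous_measurable_rV.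
  by apply: measurable_funM => //; exact: continuous_measurable_rV.
have := velocity_flux Psi lam0 eta0 m1 (rhoW t t0); apply: filterS => y vE _.
rewrite /F /O -sumrN mulr_sumr; congr (_ + _)%:E; first by rewrite mulrCA.
by apply: eq_bigr => i _; rewrite /f /v vE mulNr mulrN mulrCA.
Qed.

Lemma dissipationE_enorm (t : R) : 0 < t ->
  dissipation rho v t = (\int[leb]_y (enorm (velocity lam eta m Psi (rho t) y) ^+ 2 * rho t y)%:E)%E.
Proof.
move=> t0; have [_ _ rhoW _] := sol.
have mv i : measurable_fun setT (v t i) by exact: (measurable_velocity lam0 eta0 m1 Psi1 rhoW t0 i).
have mrho : measurable_fun setT (rho t) by exact: measurable_density.
rewrite /dissipation -ge0_integral_sum//.
- apply: eq_integral => y _; rewrite sumEFin enorm_sqr /dot mulr_suml; congr _%:E.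
  by apply: eq_bigr => i _; rewrite mulrC expr2.
- move=> i; apply/measurable_EFinP; apply: measurable_funM => //; exact: measurable_funX.
- by move=> i y _; rewrite lee_fin mulr_ge0 ?sqr_ge0// density_ge0.
Qed.

End fokker_planck_solution.

Lemma ae_le_Lnorm_pinfty {d0} {T : measurableType d0} {R : realType}
    (mu : {measure set T -> \bar R}) (f : T -> R) : f \in Lfun mu +oo%E ->
  {ae mu, forall y, f y <= fine 'N[mu]_+oo%E[EFin \o f]}.
Proof.
move=> /sub_Lfun_finLfun/set_mem; rewrite /finite_norm => fin.
have fn : ('N[mu]_+oo[EFin \o f] \is a fin_num)%E by rewrite ge0_fin_numE ?Lnorm_ge0.
have : {ae mu, forall y, (`|(f y)%:E| <= 'N[mu]_+oo[EFin \o f])%E}.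
  rewrite unlock; case: ifPn => [_|mu0]; first exact: (ess_sup_inf.ess_sup_ge mu (abse \o (EFin \o f))).
  (* The remaining case is that of a null space, on which everything holds almost everywhere. *)
  exists setT; split => //.
  by apply/eqP; rewrite -measure_le0 leNgt.
apply: filterS => y; rewrite -{1}(fineK fn) lee_fin; apply: le_trans; exact: ler_norm.
Qed.

Lemma coord_le_enorm {R : realType} {d : nat} (y : 'rV[R]_d) i : `|y 0 i| <= enorm y.
Proof.
rewrite -sqrtr_sqr ler_sqrt; last by apply: sumr_ge0 => j _; rewrite -expr2 sqr_ge0.
rewrite /dot (bigD1 i)//= expr2 lerDl; apply: sumr_ge0 => j _; rewrite -expr2 sqr_ge0//.
Qed.

Lemma enorm_le_norm {R : realType} {d : nat} (y : 'rV[R]_d) : enorm y <= d%:R * `|y|.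
Proof.
have h0 : 0 <= d%:R * `|y| by rewrite mulr_ge0.
rewrite -[leRHS](ger0_norm h0) -sqrtr_sqr ler_sqrt ?sqr_ge0//.
apply: (@le_trans _ _ (\sum_(i < d) `|y| ^+ 2)).
  apply: ler_sum => i _; rewrite -expr2 -[leLHS]real_normK ?num_real//.
  by rewrite lerXn2r ?nnegrE// rV_coord_le.
rewrite sumr_const card_ord exprMn -[leLHS]mulr_natl ler_wpM2r ?sqr_ge0//.
by rewrite -natrX ler_nat; case: (d) => // n; rewrite expnS leq_pmulr// expn1.
Qed.

Section Lnorm_density.
Context {R : realType} {d : nat}.
Variables (rho : @density R d) (m : R).

Lemma Lnorm_density : ('N[lebesgue_rV d]_m%:E [EFin \o rho] =
  (\int[lebesgue_rV d]_y (rho y `^ m)%:E) `^ m^-1)%E.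
Proof.
rewrite unlock; apply: (congr1 (fun x => x `^ m^-1)%E); apply: eq_integral => y _.
by rewrite -[in RHS](ger0_norm (density_ge0 rho y)).
Qed.

Lemma density_in_Lfun : (\int[lebesgue_rV d]_y (rho y `^ m)%:E < +oo)%E ->
  (rho : 'rV[R]_d -> R) \in Lfun (lebesgue_rV d) m%:E.
Proof.
move=> fin; rewrite inE; apply/andP; split; first by rewrite inE; exact: measurable_density.
by rewrite inE /= /finite_norm Lnorm_density poweR_lty.
Qed.

End Lnorm_density.

Theorem proposition5p1 (R : realType) (d : nat) (hd : (0 < d)%N)
    (lam eta m : R) (hlam : 0 < lam < expR 1 / 2) (heta : 0 < eta) (hm : 1 < m)
    (Psi : 'rV[R]_d -> R) (hPsi0 : forall y, 0 <= Psi y) (hPsi2 : is_Ck 2 Psi)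
    (hlap : (laplacian Psi)^\+ \in Lfun (lebesgue_rV d) +oo%E)
    (hgrad : exists2 K : R, 0 < K &
      forall y, enorm (grad Psi y) <= K * (1 + enorm y))
    (hmono : exists2 r : R, 0 < r &
      forall k y, 1 <= k -> r <= enorm y -> Psi y <= Psi (k *: y))
    (rho0 : density d) (hrho0 : D2 rho0)
    (hJ : (energy lam eta m Psi rho0 < +oo)%E)
    (rho : R -> density d) (hrho : MM_solution lam eta m Psi rho0 rho) :
  let A := fine 'N[lebesgue_rV d]_+oo%E [EFin \o (laplacian Psi)^\+] in
  (forall t : R, 0 <= t -> (rho t : 'rV[R]_d -> R) \in Lfun (lebesgue_rV d) m%:E) /\
  (forall t : R, 0 <= t ->
    ('N[lebesgue_rV d]_m%:E [EFin \o rho t] <=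
     (expR ((m - 1) / m * A * t))%:E * 'N[lebesgue_rV d]_m%:E [EFin \o rho0])%E).
Proof.
move=> A; have /andP[lam0 _] := hlam; have [K K0 hK] := hgrad.
have Psi1 : is_Ck 1 Psi by exact: (is_Ck_le _ hPsi2).
have [sol _ _ _ velfin] := hrho; have [rho_cont rho00 rhoW _] := sol.
pose v (t : R) i y := velocity lam eta m Psi (rho t) y 0 i.
pose W (t : R) i y := (dLF lam eta m (rho t y))^-1 * weak_grad (LF lam eta m \o rho t) y 0 i.
pose Dl (t : R) y := dLF lam eta m (rho t y).
have mass_cont (f : 'rV[R]_d -> R) C : continuous f -> (forall y, `|f y| <= C) ->
    continuous (fun t : R => \int[lebesgue_rV d]_y (rho (Num.max t 0) y * f y)).
  by move=> cf bf; exact: (@continuous_mass _ _ _ rho_cont f C cf bf).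
have mv (t : R) i : 0 < t -> measurable_fun setT (v t i).
  by move=> t0; exact: (measurable_velocity lam0 heta hm Psi1 rhoW t0 i).
have mflux i (phi : 'rV[R]_d -> R) r : smooth phi -> csupp r phi -> _ :=
  @measurable_flux _ _ _ _ _ _ lam0 heta hm Psi1 _ rho_cont rhoW i phi r.
have mdis i := @measurable_dissipation _ _ _ _ _ _ lam0 heta hm Psi1 _ rho_cont rhoW i.
have dis_fin (T : R) : 0 < T ->
    (\int[lebesgue_measure]_(t in `]0%R, T]) dissipation rho v t < +oo)%E.
  move=> T0; rewrite (le_lt_trans _ (velfin T T0))// le_eqVlt; apply/orP; left; apply/eqP.
  apply: eq_integral => t; rewrite inE/= in_itv/= => /andP[t0 _].
  exact: (dissipationE_enorm lam0 heta hm Psi1 sol).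
have weq := weak_equation_tensor lam0 heta hm Psi1 sol.
have A0 : 0 <= A by rewrite fine_ge0// Lnorm_ge0.
have lap_le : {ae lebesgue_rV d, forall y, laplacian Psi y <= A}.
  by have := ae_le_Lnorm_pinfty hlap; apply: filterS => y; apply: le_trans; rewrite le_max lexx.
(* Growth is assumed in the Euclidean norm and used in the maximum norm; [enorm y <= d |y|] accounts
   for the factor [1 + d]. *)
have Kg0 : 0 <= K * (1 + d%:R) by rewrite mulr_ge0 ?(ltW K0).
have grow i (y : 'rV[R]_d) : `|partial i Psi y| <= K * (1 + d%:R) * (1 + `|y|).
  have := coord_le_enorm (grad Psi y) i; rewrite mxE => /le_trans; apply.
  apply: (le_trans (hK y)); rewrite -mulrA ler_wpM2l ?(ltW K0)// mulrDl mul1r mulrDr mulr1.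
  rewrite -addrA lerD2l (le_trans (enorm_le_norm y))//.
  by rewrite addrA lerDr addr_ge0.
have Dl_ge t y : lam <= Dl t y := dLF_ge lam heta hm (rho t y).
have mDl (t : R) : 0 < t -> measurable_fun setT (Dl t).
  move=> _; apply: (measurableT_comp (f := dLF lam eta m)); last exact: measurable_density.
  by apply: continuous_measurable_fun; exact: continuous_dLF.
have WG (t : R) : 0 < t -> is_weak_grad (rho t) (fun y => \row_i W t i y).
  by move=> t0; exact: (weak_grad_density lam0 heta hm (rhoW t t0)).
have fluxE (t : R) : 0 < t -> {ae lebesgue_rV d, forall y, forall i,
    rho t y * v t i y = - (rho t y * partial i Psi y + Dl t y * W t i y)}.
  move=> t0; have := velocity_flux Psi lam0 heta hm (rhoW t t0); apply: filterS => y h i.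
  by rewrite h /W mulVKf// gt_eqF// (lt_le_trans lam0 (Dl_ge t y)).
have mpow (r : density d) : measurable_fun setT (fun y : 'rV[R]_d => (r y `^ m)%:E).
  apply/measurable_EFinP.
  exact: (measurableT_comp (measurable_powR m) (measurable_density r)).
have I0 := energy_integral_powR_lty lam0 heta hm hPsi0 hrho0 hJ.
(* [rho 0] and [rho0] agree only almost everywhere, which the integral does not see. *)
have IE : (\int[lebesgue_rV d]_y (rho 0 y `^ m)%:E = \int[lebesgue_rV d]_y (rho0 y `^ m)%:E)%E.
  apply: ae_eq_integral => //; move: rho00; apply: filterS => y h yT.
  by rewrite h.
have r0m : rint (lebesgue_rV d) setT (fun y => rho 0 y `^ m).
  have mr : measurable_fun setT (fun y : 'rV[R]_d => rho 0 y `^ m).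
    by apply/measurable_EFinP; exact: mpow.
  have p0 (y : 'rV[R]_d) : setT y -> 0 <= rho 0 y `^ m by move=> _; exact: powR_ge0.
  by apply/(rint_ge0P (lebesgue_rV d) mr p0); rewrite IE.
have key (t : R) : 0 <= t -> (\int[lebesgue_rV d]_y (rho t y `^ m)%:E <=
    (\int[lebesgue_rV d]_y (rho 0 y `^ m) * expR (A * (m - 1) * t))%:E)%E.
  move=> t0.
  exact: (integral_powR_le mass_cont mv (fun s t => measurable_window mdis s t)
    (diss_rint mdis dis_fin) (fun psi c T => @flow_rint _ _ _ _ mv mflux mdis dis_fin psi c T)
    (mass_flow0 mass_cont mv mflux mdis dis_fin weq) lam0 WG mDl Dl_ge fluxE hPsi2 Kg0 grow
    A0 lap_le hm t0 r0m).
have m0 : 0 < m := lt_trans ltr01 hm.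
split => t t0.
  exact: (density_in_Lfun (le_lt_trans (key t t0) (ltry _))).
rewrite !Lnorm_density -IE -(rint_EFin measurableT r0m).
have i0 : 0 <= \int[lebesgue_rV d]_y (rho 0 y `^ m) by apply: Rintegral_ge0 => y _; exact: powR_ge0.
have hle := key t t0.
(* Taking the m-th root of the integral estimate divides the exponent [A (m - 1) t] by [m]. *)
apply: (le_trans (gt0_ler_poweR _ _ _ hle)).
- by rewrite invr_ge0 ltW.
- by rewrite in_itv/= leey andbT; apply: integral_ge0 => y _; rewrite lee_fin powR_ge0.
- by rewrite in_itv/= leey andbT lee_fin mulr_ge0// expR_ge0.
rewrite !poweR_EFin -EFinM lee_fin powRM ?expR_ge0// -expRM mulrC.
suff -> : A * (m - 1) * t / m = (m - 1) / m * A * t by [].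
by field; rewrite gt_eqF.
Qed.
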